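(* Let $g\in H^{\frac12-}(\mathbb T)$, $\mathbb T=\mathbb R/(2\pi\mathbb Z)$, let $P=\frac1\pi\|g\|_{L^2(\mathbb T)}^2$, and let $u$ be the solution of the Wick ordered cubic NLS equation $$iu_t+u_{xx}\pm|u|^2u\mp Pu=0,\quad t\in\mathbb R,\ x\in\mathbb T,\qquad u(0,\cdot)=g$$ (either choice of sign). Then, locally in time, $$u-e^{it\partial_{xx}}g\in C^{\frac12-}_{t,x},$$ i.e. for each $\alpha<\frac12$ the $C^\alpha_{t,x}$ norm of $u-e^{it\partial_{xx}}g$ is finite on each compact subset of $\mathbb R\times\mathbb T$.
   Context: $H^{\frac12-}(\mathbb T)=\bigcap_{s<1/2}H^s(\mathbb T)$. $e^{it\partial_{xx}}g=\sum_n\widehat g(n)e^{-itn^2+inx}$. The signs $\pm$ and $\mp$ are opposite to each other. $u$ is the unique global solution given by the $L^2(\mathbb T)$ well-posedness theory (Bourgain). $C^{\alpha}_{t,x}$ denotes joint Hölder continuity of exponent $\alpha$ in $(t,x)$. *)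

(* Defs.v *)
From mathcomp Require Import all_boot all_order all_algebra.
From mathcomp Require Import all_classical all_reals all_analysis.
From mathcomp Require Import complex.

Set Implicit Arguments.
Unset Strict Implicit.
Unset Printing Implicit Defensive.

Import Order.TTheory GRing.Theory Num.Theory.
Import numFieldNormedType.Exports.

Local Open Scope classical_set_scope.
Local Open Scope ring_scope.
Local Open Scope complex_scope.

(* Functions on the torus R / 2 pi Z are 2 pi-periodic functions on R, and
   Lebesgue classes are given by Borel representatives.  The measure on the
   torus is dx on [0, 2 pi] (total mass 2 pi), and the Fourier normalization is
   f^(n) = (1 / 2 pi) \int f(x) e^{-inx} dx, so that f = \sum_n f^(n) e^{inx}. *)

Section Torus.
Context {R : realType}.
Implicit Types (f g : R -> R[i]) (u v : R -> R -> R[i]).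

Local Notation mu := (@lebesgue_measure R).

(* The library absolute value `|z| on R[i] takes values in R[i]; this is the
   same modulus with values in R. *)
Definition cabs (z : R[i]) : R := ComplexField.Normc.normc z.

Definition expi (theta : R) : R[i] := cos theta +i* sin theta.

Definition cmeasurable d (T : measurableType d) (f : T -> R[i]) : Prop :=
  measurable_fun setT (fun x => complex.Re (f x)) /\
  measurable_fun setT (fun x => complex.Im (f x)).

Definition cintegral (D : set R) (f : R -> R[i]) : R[i] :=
  (\int[mu]_(x in D) complex.Re (f x)) +i* (\int[mu]_(x in D) complex.Im (f x)).

(* \int_a^b f, for a <= b as well as for b <= a: one of the two sets below is
   always negligible. *)
Definition oriented_cintegral (a b : R) (f : R -> R[i]) : R[i] :=
  cintegral `[a, b] f - cintegral `[b, a] f.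

Definition circle : set R := `[0, pi *+ 2].

Definition L2norm_sq f : \bar R :=
  (\int[mu]_(x in circle) (cabs (f x) ^+ 2)%:E)%E.

Definition inL2 f : Prop :=
  [/\ periodic f (pi *+ 2), @cmeasurable _ (measurableTypeR R) f & (L2norm_sq f < +oo)%E].

Definition fourier f (n : int) : R[i] :=
  (pi *+ 2)^-1%:C * cintegral circle (fun x => f x * expi (- (n%:~R * x))).

(* For s >= 0 this is H^s; for s < 0 it is only L^2, which is the part of H^s
   relevant for the intersection below. *)
Definition inHs (s : R) f : Prop :=
  inL2 f /\
  (\esum_(n in [set: int])
     (((1 + n%:~R ^+ 2) `^ s) * cabs (fourier f n) ^+ 2)%:E < +oo)%E.

(* The intersection of the spaces H^s over all s < 1/2. *)
Definition inHhalf_minus f : Prop := forall s : R, s < 2^-1 -> inHs s f.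

Definition free_partial_sum g (N : nat) (t x : R) : R[i] :=
  \sum_(k < N.*2.+1)
    let n : int := (k : nat)%:Z - N%:Z in
    fourier g n * expi (- (t * n%:~R ^+ 2) + n%:~R * x).

(* v(t) = e^{it d_xx} g, i.e. v(t) is the sum in L^2 of
   \sum_n g^(n) e^{-itn^2 + inx}; this determines v(t) almost everywhere. *)
Definition is_free_evolution g v : Prop :=
  forall t : R, inL2 (v t) /\
    L2norm_sq (fun x => v t x - free_partial_sum g N t x) @[N --> \oo] --> 0%E.

(* The constant P = ||g||^2 / pi. *)
Definition wick_constant g : R := pi^-1 * fine (L2norm_sq g).

Definition wick_nonlinearity (P : R) (z : R[i]) : R[i] :=
  (cabs z ^+ 2 - P)%:C * z.

(* The class C(R; L^2) intersected with L^4_loc(R; L^4), in which Bourgain's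
   L^2 solution is constructed and unique. *)
Definition in_solution_class u : Prop :=
  [/\ forall t, inL2 (u t),
      forall t0 : R,
        L2norm_sq (fun x => u t x - u t0 x) @[t --> t0] --> 0%E,
      @cmeasurable _ (measurableTypeR R * measurableTypeR R)%type
        (fun z => u z.1 z.2) &
      forall M : R,
        (\int[mu \x mu]_(z in `[(- M)%R, M] `*` circle)
           (cabs (u z.1 z.2) ^+ 4)%:E < +oo)%E].

(* The solution of i u_t + u_xx + sgn (|u|^2 u - P u) = 0, u(0) = g
   (sgn = 1 or -1), in the sense of the Duhamel formula
     u(t) = e^{it d_xx} g
            + i sgn \int_0^t e^{i(t-s) d_xx} (|u|^2 u - P u)(s) ds,
   written for each Fourier coefficient. *)
Definition is_wick_NLS_solution (sgn : R) g u : Prop :=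
  [/\ in_solution_class u,
      {ae mu, forall x, u 0 x = g x} &
      forall (t : R) (n : int),
        fourier (u t) n =
          expi (- (t * n%:~R ^+ 2)) * fourier g n +
          'i * sgn%:C *
          oriented_cintegral 0 t (fun s =>
            expi (- ((t - s) * n%:~R ^+ 2)) *
            fourier (fun x => wick_nonlinearity (wick_constant g) (u s x)) n)].

Definition torus_dist (x y : R) : R :=
  inf [set `|x - y + (pi *+ 2) * k%:~R| | k in [set: int]].

(* The C^alpha_{t,x} norm of w on K is finite.  Points of R x T are given by
   lifts to R * R: the compact subsets of R x T are exactly the projections of
   the compact subsets of R * R. *)
Definition finite_holder_norm (alpha : R) (K : set (R * R)) (w : R -> R -> R[i])
    : Prop :=
  exists C : R,
    (forall z, K z -> cabs (w z.1 z.2) <= C) /\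
    (forall z z', K z -> K z' ->
       cabs (w z.1 z.2 - w z'.1 z'.2) <=
         C * (`|z.1 - z'.1| + torus_dist z.2 z'.2) `^ alpha).

End Torus.

(* Main.v *)
(* Write a_n(t) = e^{itn^2} u^(t)(n).  The solution class only gives L^4
   integrability, so regularity has to be propagated first.  The difference of u
   and a spatial translate of u solves a linear equation with potential in
   L^2_{t,x}; the L^4 Strichartz inequality and its dual bound the L^2 norm of the
   difference at time t by K_T times its value at time 0, with K_T independent of
   the translation, and dyadic translations turn this into a bound for u in H^s,
   s < 1/2, uniform on [-T, T].  Each a_n is then continuously differentiable and
   the mass is conserved, so the resonant part of the cubic term cancels against
   the Wick term up to |a_n|^2 a_n.  The remaining frequencies oscillate with
   phase 2 (n1 - n2)(n3 - n2) t; one integration by parts gains this factor.  With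
   the majorants A_n = |g^(n)| + \int_{-T}^T |d_t a_n|, which lie in the same
   weighted l^2 spaces as g^, this bounds sum_n |a_n(t) - a_n(t')| by
   C |t - t'|^alpha and sum_n (1 + |n|)^{2 alpha} |a_n(t) - g^(n)| by C.  The
   Fourier series of u - e^{it d_xx} g then converges absolutely, and its sum is
   Hölder continuous term by term. *)

(* The L^4 inequality needs a modulation weight of exponent above 3/4, while the Duhamel operator,
   which gains one full power of the modulation, closes only below 1; the exponent 7/8 lies between.
   Time is confined to windows inside one period [0, 2 pi] with sharp cut-offs: a forcing dominated
   by the product of an L^2 and an L^4 function stays so dominated under any restriction in time, so
   no smooth localization occurs. On a window where the potential is small in L^2, the L^4 norm of
   the translate difference is absorbed, and the number of windows depends only on u and T. A
   translate difference, unlike a derivative of fractional order, solves an exact linear equation,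
   so persistence becomes an L^2 statement about the given u itself. Infinite sums appear as bounds
   on finite subsums, and nonlinear identities are proved for frequencies in [-M, M] with an error
   that is a negative power of M. The strict inequality s < 1/2 pays for each small loss. At a fixed
   time u and its free evolution are determined only up to null sets, so the regular function is
   defined by its own series and identified with the difference almost everywhere. *)
Require Import Defs.
From mathcomp Require Import all_boot all_order all_algebra.
From mathcomp Require Import all_classical all_reals all_analysis.
From mathcomp Require Import measurable_realfun complex ring lra zify.
Import Order.TTheory GRing.Theory Num.Theory.
Import numFieldNormedType.Exports.
Local Open Scope classical_set_scope.
Local Open Scope ring_scope.
Local Open Scope complex_scope.

Set Implicit Arguments.
Unset Strict Implicit.
Unset Printing Implicit Defensive.
Local Notation "z ^cj" := (conjc z) (at level 1, format "z ^cj") : ring_scope.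

(** * Complex modulus and weighted sums *)

Section ComplexModulus.
Context {R : realType}.
Implicit Types z w : R[i].

Lemma cabsE z : cabs z = Num.sqrt (complex.Re z ^+ 2 + complex.Im z ^+ 2).
Proof. by case: z. Qed.

Lemma cabs_ge0 z : 0 <= cabs z.
Proof. by rewrite cabsE sqrtr_ge0. Qed.

Lemma cabs_sqr z : cabs z ^+ 2 = complex.Re z ^+ 2 + complex.Im z ^+ 2.
Proof. by rewrite cabsE sqr_sqrtr// addr_ge0// sqr_ge0. Qed.

Lemma cabsM z w : cabs (z * w) = cabs z * cabs w.
Proof. exact: ComplexField.Normc.normcM. Qed.

Lemma cabsD z w : cabs (z + w) <= cabs z + cabs w.
Proof. exact: le_normcD. Qed.

Lemma cabsN z : cabs (- z) = cabs z.
Proof. exact: normcN. Qed.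

Lemma cabsB z w : cabs (z - w) <= cabs z + cabs w.
Proof. by rewrite -(cabsN w) cabsD. Qed.

Lemma cabsC z w : cabs (z - w) = cabs (w - z).
Proof. by rewrite -cabsN opprB. Qed.

Lemma cabs0 : cabs (0 : R[i]) = 0.
Proof. exact: ComplexField.Normc.normc0. Qed.

Lemma cabs1 : cabs (1 : R[i]) = 1.
Proof. exact: ComplexField.Normc.normc1. Qed.

Lemma cabs0_eq0 z : cabs z = 0 -> z = 0.
Proof. exact: ComplexField.Normc.eq0_normc. Qed.

Lemma cabsX z n : cabs (z ^+ n) = cabs z ^+ n.
Proof. by elim: n => [|n IH]; rewrite ?expr0 ?cabs1// !exprS cabsM IH. Qed.

Lemma cabsV z : cabs z^-1 = (cabs z)^-1.
Proof. exact: ComplexField.Normc.normcV. Qed.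

Lemma cabs_conj z : cabs z^cj = cabs z.
Proof. by case: z => a b; rewrite !cabsE/= sqrrN. Qed.

Lemma cabs_real (x : R) : cabs x%:C = `|x|.
Proof. by rewrite cabsE/= expr0n/= addr0 sqrtr_sqr. Qed.

Lemma cabs_i : cabs ('i : R[i]) = 1.
Proof. by rewrite cabsE/= expr0n/= add0r expr1n sqrtr1. Qed.

Lemma Re_le_cabs z : `|complex.Re z| <= cabs z.
Proof. by rewrite cabsE -sqrtr_sqr ler_wsqrtr// lerDl sqr_ge0. Qed.

Lemma Im_le_cabs z : `|complex.Im z| <= cabs z.
Proof. by rewrite cabsE -sqrtr_sqr ler_wsqrtr// lerDr sqr_ge0. Qed.

Lemma cabs_le_ReIm z : cabs z <= `|complex.Re z| + `|complex.Im z|.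
Proof.
rewrite -(@ler_pXn2r _ 2) ?nnegrE ?cabs_ge0 ?addr_ge0//.
rewrite cabs_sqr sqrrD !real_normK ?num_real// lerD2r lerDl.
by rewrite mulrn_wge0// mulr_ge0.
Qed.

Lemma cabs_sqrC z : (cabs z ^+ 2)%:C = z * z^cj.
Proof.
by rewrite cabs_sqr; case: z => a b; simpc => /=; congr (_ +i* _); ring.
Qed.

Lemma cabs_triangle z w v : cabs (z - v) <= cabs (z - w) + cabs (w - v).
Proof. by rewrite (le_trans _ (cabsD _ _))// addrA subrK. Qed.

Lemma cabs_sum (I : Type) (s : seq I) (P : pred I) (F : I -> R[i]) :
  cabs (\sum_(i <- s | P i) F i) <= \sum_(i <- s | P i) cabs (F i).
Proof.
elim/big_ind2 : _ => //; first by rewrite cabs0.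
by move=> a b c d h1 h2; rewrite (le_trans (cabsD _ _))// lerD.
Qed.

Lemma cReD z w : complex.Re (z + w) = complex.Re z + complex.Re w.
Proof. by case: z; case: w. Qed.
Lemma cImD z w : complex.Im (z + w) = complex.Im z + complex.Im w.
Proof. by case: z; case: w. Qed.
Lemma cRe_sum (I : Type) (s : seq I) (P : pred I) (F : I -> R[i]) :
  complex.Re (\sum_(i <- s | P i) F i) = \sum_(i <- s | P i) complex.Re (F i).
Proof. exact: (big_morph _ cReD erefl). Qed.

Lemma cIm_sum (I : Type) (s : seq I) (P : pred I) (F : I -> R[i]) :
  complex.Im (\sum_(i <- s | P i) F i) = \sum_(i <- s | P i) complex.Im (F i).
Proof. exact: (big_morph _ cImD erefl). Qed.

Lemma cReN z : complex.Re (- z) = - complex.Re z.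
Proof. by case: z. Qed.
Lemma cImN z : complex.Im (- z) = - complex.Im z.
Proof. by case: z. Qed.
Lemma cReM z w : complex.Re (z * w) =
  complex.Re z * complex.Re w - complex.Im z * complex.Im w.
Proof. by case: z; case: w. Qed.
Lemma cImM z w : complex.Im (z * w) =
  complex.Re z * complex.Im w + complex.Im z * complex.Re w.
Proof. by case: z; case: w. Qed.
Lemma cRe_conj z : complex.Re z^cj = complex.Re z.
Proof. by case: z. Qed.
Lemma cIm_conj z : complex.Im z^cj = - complex.Im z.
Proof. by case: z. Qed.

Lemma complex_eq z w : complex.Re z = complex.Re w ->
  complex.Im z = complex.Im w -> z = w.
Proof. by case: z; case: w => a b c d /= -> ->. Qed.

Lemma cconjB z w : (z - w)^cj = z^cj - w^cj.
Proof. exact: rmorphB. Qed.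
Lemma cconjM z w : (z * w)^cj = z^cj * w^cj.
Proof. exact: rmorphM. Qed.
Lemma cconj_sum (I : Type) (s : seq I) (P : pred I) (F : I -> R[i]) :
  (\sum_(i <- s | P i) F i)^cj = \sum_(i <- s | P i) (F i)^cj.
Proof. exact: rmorph_sum. Qed.

Lemma cconj_real (x : R) : (x%:C)^cj = x%:C.
Proof. by rewrite /conjc /= oppr0. Qed.

Lemma rcD (x y : R) : (x + y)%:C = x%:C + y%:C :> R[i].
Proof. exact: rmorphD. Qed.
Lemma rcB (x y : R) : (x - y)%:C = x%:C - y%:C :> R[i].
Proof. exact: rmorphB. Qed.
Lemma rcM (x y : R) : (x * y)%:C = x%:C * y%:C :> R[i].
Proof. exact: rmorphM. Qed.
Lemma rc_sum (I : Type) (s : seq I) (P : pred I) (F : I -> R) :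
  (\sum_(i <- s | P i) F i)%:C = \sum_(i <- s | P i) (F i)%:C :> R[i].
Proof. exact: rmorph_sum. Qed.

Lemma conj_realM (x : R) z : (x%:C * z)^cj = x%:C * z^cj.
Proof. by rewrite cconjM cconj_real. Qed.

Implicit Types x y : R.

Lemma expiD x y : expi (x + y) = expi x * expi y.
Proof.
rewrite /expi cosD sinD; apply: complex_eq; rewrite ?cReM ?cImM//=; ring.
Qed.

Lemma expi0 : expi (0 : R) = 1.
Proof. by rewrite /expi cos0 sin0. Qed.

Lemma expiN x : expi (- x) = (expi x)^cj.
Proof. by rewrite /expi cosN sinN. Qed.

Lemma cabs_expi x : cabs (expi x) = 1.
Proof. by rewrite cabsE/= cos2Dsin2 sqrtr1. Qed.

Lemma expiK x : expi x * expi (- x) = 1.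
Proof. by rewrite -expiD subrr expi0. Qed.

Lemma expi2pi : expi (pi *+ 2 : R) = 1.
Proof. by rewrite /expi cos2pi sin2pi. Qed.

Lemma expi2piMn (n : nat) : expi (n%:R * (pi *+ 2) : R) = 1.
Proof.
elim: n => [|n IH]; first by rewrite mul0r expi0.
by rewrite -natr1 mulrDl mul1r expiD IH expi2pi mulr1.
Qed.

Lemma expi2piM (n : int) : expi (n%:~R * (pi *+ 2) : R) = 1.
Proof.
case: n => n; first exact: expi2piMn.
rewrite NegzE rmorphN/= mulNr expiN.
by rewrite (expi2piMn n.+1) conjc1.
Qed.

Lemma expi_periodic (n : int) x :
  expi (n%:~R * (x + pi *+ 2) : R) = expi (n%:~R * x).
Proof. by rewrite mulrDr expiD expi2piM mulr1. Qed.

Lemma abs_sin_le x : `|sin x| <= `|x|.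
Proof.
have H y : 0 <= y -> sin y <= y.
  rewrite le_eqVlt => /orP[/eqP <-|y0]; first by rewrite sin0.
  have [c _] := @MVT R sin cos 0 y y0
    (fun x _ => is_derive_sin x) (continuous_subspaceT (@continuous_sin R)).
  rewrite sin0 !subr0 => ->.
  by rewrite -[leRHS]mul1r ler_wpM2r ?cos_le1// ltW.
wlog x0 : x / 0 <= x.
  move=> W; have [/W//|/ltW x0] := leP 0 x.
  by rewrite -normrN -sinN -(normrN x) W// oppr_ge0.
rewrite (ger0_norm x0).
have [h|h] := leP x 1; last by rewrite (le_trans (sin_max x))// ltW.
rewrite ger0_norm ?H// sin_ge0_pi// x0/= (le_trans h)//.
by rewrite (le_trans _ (pi_ge2 R))// ler1n.
Qed.

Lemma cabs_expiB1 x : cabs (expi x - 1) ^+ 2 = 4 * sin (x / 2) ^+ 2.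
Proof.
rewrite cabs_sqr /expi /= subr0.
have e : x = (x / 2) *+ 2 by rewrite mulr2n -splitr.
have h := cos2Dsin2 (x / 2).
rewrite {1 2}e cos_mulr2n sin_mulr2n.
move: h; set c := cos _; set s := sin _ => h.
have e2 : c ^+ 2 = 1 - s ^+ 2 by rewrite -h addrK.
rewrite (_ : (_ + _) = 4 * (c ^+ 2 - 1) ^+ 2 + 4 * c ^+ 2 * s ^+ 2); last by ring.
by rewrite e2; ring.
Qed.

Lemma cabs_expiB1_le x : cabs (expi x - 1) <= `|x|.
Proof.
rewrite -(@ler_pXn2r _ 2) ?nnegrE ?cabs_ge0// cabs_expiB1.
have : `|sin (x / 2)| ^+ 2 <= `|x / 2| ^+ 2.
  by rewrite ler_pXn2r ?nnegrE// abs_sin_le.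
rewrite !real_normK ?num_real//; nra.
Qed.

Lemma cabs_expiB_le x y : cabs (expi x - expi y) <= `|x - y|.
Proof.
rewrite (_ : expi x - expi y = expi y * (expi (x - y) - 1)).
  by rewrite cabsM cabs_expi mul1r cabs_expiB1_le.
by rewrite mulrBr -expiD subrKC mulr1.
Qed.

Lemma cabs_expiB_le2 x y : cabs (expi x - expi y) <= 2.
Proof. by rewrite (le_trans (cabsB _ _))// !cabs_expi. Qed.

End ComplexModulus.

Section FiniteSums.
Context {R : realType}.

Lemma ler_sum_sub (T : eqType) (s t : seq T) (f : T -> R) :
  uniq s -> {subset s <= t} -> (forall x, 0 <= f x) ->
  \sum_(x <- s) f x <= \sum_(x <- t) f x.
Proof.
elim: s t => [|a s IH] t; first by rewrite big_nil => _ _ f0; apply: sumr_ge0.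
move=> /= /andP[as_ us] st f0.
have at_ : a \in t by apply: st; rewrite mem_head.
rewrite big_cons (perm_big _ (perm_to_rem at_)) big_cons lerD2l.
apply: IH => // x xs.
have /st : x \in a :: s by rewrite inE xs orbT.
rewrite (perm_mem (perm_to_rem at_)) inE => /orP[/eqP xa|//].
by move: as_; rewrite -xa xs.
Qed.

(** Lagrange's identity: twice the difference of the two sides is the double sum of the squares (a_i
    b_j - a_j b_i)^2. *)
Lemma sum_cauchy_schwarz (T : Type) (s : seq T) (a b : T -> R) :
  (\sum_(i <- s) a i * b i) ^+ 2 <=
  (\sum_(i <- s) a i ^+ 2) * (\sum_(i <- s) b i ^+ 2).
Proof.
rewrite -subr_ge0 -(pmulr_rge0 _ (ltr0n R 2)).
rewrite [X in 0 <= X](_ : _ = \sum_(i <- s) \sum_(j <- s) (a i * b j - a j * b i) ^+ 2).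
  by apply: sumr_ge0 => i _; apply: sumr_ge0 => j _; exact: sqr_ge0.
transitivity (\sum_(i <- s) \sum_(j <- s) (a i ^+ 2 * b j ^+ 2 +
    (- 2 * (a i * b i)) * (a j * b j) + b i ^+ 2 * a j ^+ 2)); last first.
  by apply: eq_bigr => i _; apply: eq_bigr => j _; ring.
transitivity (\sum_(i <- s) (a i ^+ 2 * (\sum_(j <- s) b j ^+ 2) +
    (- 2 * (a i * b i)) * (\sum_(j <- s) a j * b j) +
    b i ^+ 2 * (\sum_(j <- s) a j ^+ 2))); last first.
  by apply: eq_bigr => i _; rewrite 2!big_split/= !mulr_sumr.
rewrite 2!big_split/= -!mulr_suml -mulr_sumr; ring.
Qed.

Lemma sum_sqr_le (T : Type) (s : seq T) (a b : T -> R) (A B : R) :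
  \sum_(i <- s) a i ^+ 2 <= A -> \sum_(i <- s) b i ^+ 2 <= B ->
  (\sum_(i <- s) a i * b i) ^+ 2 <= A * B.
Proof.
move=> hA hB; apply: (le_trans (sum_cauchy_schwarz _ _ _)).
by apply: ler_pM => //; apply: sumr_ge0 => i _; exact: sqr_ge0.
Qed.

(** The Japanese bracket in the form 1 + |n| instead of a square root, so that it is
    submultiplicative and subadditive with constant 1. *)
Definition brk (n : int) : R := 1 + `|n%:~R|.

Lemma brk_ge1 n : 1 <= brk n.
Proof. by rewrite /brk lerDl. Qed.

Lemma brk_gt0 n : 0 < brk n.
Proof. exact: (lt_le_trans ltr01 (brk_ge1 n)). Qed.

Lemma brk_ge0 n : 0 <= brk n.
Proof. exact/ltW/brk_gt0. Qed.

Hint Resolve brk_ge0 brk_gt0 : core.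

Lemma brkN n : brk (- n) = brk n.
Proof. by rewrite /brk rmorphN normrN. Qed.

Lemma brk0 : brk 0 = 1.
Proof. by rewrite /brk normr0 addr0. Qed.

Lemma brkD (m n : int) : brk (m + n) <= brk m * brk n.
Proof.
rewrite /brk intrD mulrDl mul1r mulrDr mulr1.
have := ler_normD (m%:~R : R) n%:~R.
have : 0 <= `|m%:~R| * `|n%:~R| :> R by rewrite mulr_ge0.
lra.
Qed.

Lemma brkDs (m n : int) : brk (m + n) <= brk m + brk n.
Proof.
rewrite /brk intrD.
have := ler_normD (m%:~R : R) n%:~R; lra.
Qed.

Lemma brkB m n : brk (m - n) <= brk m * brk n.
Proof. by rewrite -(brkN n) brkD. Qed.

Lemma brkpow_ge0 n (a : R) : 0 <= brk n `^ a.
Proof. exact: powR_ge0. Qed.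

Lemma brkpow_gt0 n (a : R) : 0 < brk n `^ a.
Proof. by rewrite powR_gt0. Qed.

Hint Resolve brkpow_ge0 brkpow_gt0 : core.

Lemma brkpow_le n (a b : R) : a <= b -> brk n `^ a <= brk n `^ b.
Proof. by move=> ab; rewrite ler_powR// brk_ge1. Qed.

Lemma brkpowD n (a b : R) : brk n `^ (a + b) = brk n `^ a * brk n `^ b.
Proof. by rewrite powRD// implybE (gt_eqF (brk_gt0 n)) orbT. Qed.

Lemma brkpowK n (a : R) : brk n `^ a * brk n `^ (- a) = 1.
Proof. by rewrite -brkpowD subrr powRr0. Qed.

Lemma brkpow_ge1 n (a : R) : 0 <= a -> 1 <= brk n `^ a.
Proof. by move=> a0; rewrite -(powRr0 (brk n)) brkpow_le. Qed.

Lemma brkpow_sqr n (a : R) : (brk n `^ a) ^+ 2 = brk n `^ (a *+ 2).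
Proof. by rewrite expr2 -brkpowD mulr2n. Qed.

Lemma brkpowM m n (a : R) : 0 <= a ->
  brk (m + n) `^ a <= brk m `^ a * brk n `^ a.
Proof.
by move=> a0; rewrite -powRM// ge0_ler_powR// ?nnegrE ?mulr_ge0//; exact: brkD.
Qed.

Lemma le_powRN (x y a : R) : 0 < x -> x <= y -> 0 <= a -> y `^ (- a) <= x `^ (- a).
Proof.
move=> x0 xy a0; rewrite !powRN lef_pV2 ?posrE ?powR_gt0//.
  by rewrite ge0_ler_powR// nnegrE ltW// (lt_le_trans x0).
by rewrite (lt_le_trans x0).
Qed.

(** For nonnegative f this says that the series over the integers converges with sum at most B,
    without an order of summation or a limit; bounds pass directly between series and finite
    truncations. *)
Definition bsum (f : int -> R) (B : R) : Prop :=
  forall s : seq int, uniq s -> \sum_(n <- s) f n <= B.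

Lemma bsum_ge0 f B : bsum f B -> 0 <= B.
Proof. by move=> /(_ [::] isT); rewrite big_nil. Qed.

Lemma bsum_inj f B (phi : int -> int) : injective phi -> bsum f B ->
  bsum (fun n => f (phi n)) B.
Proof.
move=> ip fB s us; rewrite -(big_map phi xpredT f).
by apply: fB; rewrite map_inj_uniq.
Qed.

Lemma bsum_le f g B : (forall n, f n <= g n) -> bsum g B -> bsum f B.
Proof. by move=> fg gB s us; apply: (le_trans _ (gB s us)); apply: ler_sum. Qed.

Lemma bsumD f g A B : bsum f A -> bsum g B -> bsum (fun n => f n + g n) (A + B).
Proof. by move=> fA gB s us; rewrite big_split/= lerD ?fA ?gB. Qed.

Lemma bsumZ f A (c : R) : 0 <= c -> bsum f A -> bsum (fun n => c * f n) (c * A).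
Proof. by move=> c0 fA s us; rewrite -mulr_sumr ler_wpM2l// fA. Qed.

Lemma bsum_pt f B n : bsum f B -> f n <= B.
Proof. by move=> /(_ [:: n] isT); rewrite big_seq1. Qed.

(** A discrete integral test. With x = 1/(n+2) and rho = 1 - x, division by (n+2)^(-q) leaves
    rho^(-q) - 1 >= q x, which follows from exp(y) >= 1 + y and -ln(1 - x) >= x. *)
Lemma powR_telescope (q : R) (n : nat) : 0 < q ->
  q * (n.+2%:R) `^ (- (1 + q)) <= (n.+1%:R) `^ (- q) - (n.+2%:R) `^ (- q).
Proof.
move=> q0.
have a0 : 0 < n.+1%:R :> R by [].
have b0 : 0 < n.+2%:R :> R by [].
rewrite opprD powRD; last by rewrite implybE orbC (gt_eqF b0).
rewrite powR_inv1//.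
rewrite (_ : n.+1%:R = (n.+1%:R / n.+2%:R) * n.+2%:R :> R); last first.
  by rewrite -mulrA mulVf ?mulr1// gt_eqF.
rewrite powRM ?divr_ge0// -{3}(mul1r (n.+2%:R `^ (- q))) -mulrBl mulrA.
rewrite ler_wpM2r ?powR_ge0//.
rewrite lerBrDr {1}/powR gt_eqF ?divr_gt0//.
apply: le_trans (expR_ge1Dx _); rewrite addrC lerD2l mulNr -mulrN.
rewrite (ler_wpM2l (ltW q0))//.
rewrite -lnV ?posrE ?divr_gt0// invf_div.
have : 0 < n.+2%:R^-1 :> R by rewrite invr_gt0.
set x := _^-1 => x0.
have -> : n.+2%:R / n.+1%:R = (1 - x)^-1 :> R.
  have -> : 1 - x = n.+1%:R / n.+2%:R.
    apply: (@mulIf _ n.+2%:R); first by rewrite gt_eqF.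
    by rewrite divfK ?gt_eqF// mulrBl mul1r mulVf ?gt_eqF// -[n.+2%:R]natr1 addrK.
  by rewrite invf_div.
have x1 : x < 1 by rewrite invf_lt1// ltr1n.
rewrite lnV ?posrE ?subr_gt0// lerNr.
by apply: le_ln1Dx; rewrite ltrN2.
Qed.

Lemma sum_powR_nat (q : R) (N : nat) : 0 < q ->
  \sum_(k <- iota 0 N) (k.+1%:R) `^ (- (1 + q)) <= 1 + q^-1.
Proof.
move=> q0.
(* Keeping the telescoped remainder makes the bound inductive; it is dropped only at the end. *)
suff H n : q * \sum_(k <- iota 0 n.+1) (k.+1%:R) `^ (- (1 + q)) <=
    q + 1 - n.+1%:R `^ (- q).
  case: N => [|n]; first by rewrite big_nil addr_ge0// invr_ge0 ltW.
  rewrite -(ler_pM2l q0) mulrDr mulr1 divff ?gt_eqF//.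
  by apply: (le_trans (H n)); rewrite gerBl powR_ge0.
elim: n => [|n IH]; first by rewrite big_seq1 !mulr1n !powR1 mulr1 addrK.
rewrite -[n.+2]addn1 iotaD big_cat/= big_seq1 add0n addn1 mulrDr.
have := powR_telescope n q0; lra.
Qed.

Lemma bsum_brk (p : R) : 1 < p -> exists2 B, 0 < B & bsum (fun n => brk n `^ (- p)) B.
Proof.
move=> p1; exists ((1 + (p - 1)^-1) *+ 2).
  by rewrite mulrn_wgt0// addr_gt0// invr_gt0 subr_gt0.
have H (s : seq int) : uniq [seq absz n | n <- s] ->
    \sum_(n <- s) brk n `^ (- p) <= 1 + (p - 1)^-1.
  move=> us.
  have := @sum_powR_nat (p - 1) (foldr maxn 0%N [seq absz n | n <- s]).+1.
  rewrite subr_gt0 subrKC => /(_ p1); apply: le_trans.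
  rewrite (eq_bigr (fun n : int => (absz n).+1%:R `^ (- p))); last first.
    by move=> n _; rewrite /brk -intr_norm -natr1 addrC -abszE -pmulrn.
  rewrite -(big_map absz xpredT (fun k => k.+1%:R `^ (- p))).
  apply: ler_sum_sub => // k.
  rewrite mem_iota add0n ltnS /=.
  elim: {us}(map _ _) => //= a t IH; rewrite inE => /orP[/eqP ->|/IH h].
    exact: leq_maxl.
  by rewrite (leq_trans h)// leq_maxr.
(* [absz] is injective on the nonnegative and on the negative integers separately, whence the factor
   2 in the witness. *)
move=> s us; rewrite mulr2n (bigID (fun n : int => 0 <= n))/= -!(big_filter s).
by apply: lerD; apply: H; rewrite map_inj_in_uniq ?filter_uniq//;
   move=> x y; rewrite !mem_filter => /andP[hx _] /andP[hy _]; lia.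
Qed.

(** The symmetric range [-M, M], listed in the order of [free_partial_sum]. *)
Definition zr (M : nat) : seq int := [seq k%:Z - M%:Z | k <- iota 0 M.*2.+1].

Lemma zr_uniq M : uniq (zr M).
Proof. by rewrite map_inj_uniq ?iota_uniq// => x y; lia. Qed.

Lemma mem_zr M n : (n \in zr M) = (absz n <= M)%N.
Proof.
apply/mapP/idP => [[k]|h]; first by rewrite mem_iota => h ->; lia.
by exists (absz (n + M%:Z)); rewrite ?mem_iota; lia.
Qed.

Lemma zr_exists (s : seq int) : exists M, {subset s <= zr M}.
Proof.
elim: s => [|a s [M h]]; first by exists 0%N.
exists (maxn (absz a) M) => x; rewrite inE => /orP[/eqP ->|/h]; rewrite !mem_zr; lia.
Qed.

Lemma zr_sub M M' : (M <= M')%N -> {subset zr M <= zr M'}.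
Proof. by move=> h x; rewrite !mem_zr; lia. Qed.

Lemma sum_zr (V : nmodType) M (f : int -> V) :
  \sum_(n <- zr M) f n = \sum_(k < M.*2.+1) f ((k : nat)%:Z - M%:Z).
Proof. by rewrite big_map -[in LHS](subn0 M.*2.+1) -/(index_iota _ _) big_mkord. Qed.

End FiniteSums.

(** * Counting sums behind the L^4 Strichartz inequality *)

Section StrichartzSums.
Context {R : realType}.
Hint Resolve brk_ge0 brk_gt0 brkpow_ge0 brkpow_gt0 : core.
Local Notation brk := (@brk R).

(** The larger of the two brackets is at least half of [brk q]: 5/8 of its exponent is spent on the
    decay in q, and the remaining 1/4 is transferred to the smaller bracket, whose exponent 9/8 is
    then summable. The power 5/8 is kept because [quadratic_sum] needs more than 1/2. *)
Lemma modulation_sum : exists2 C : R, 0 < C & forall (q : int) (s : seq int), uniq s ->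
  \sum_(l <- s) brk l `^ (- (7 / 8)) * brk (q - l) `^ (- (7 / 8)) <=
  C * brk q `^ (- (5 / 8)).
Proof.
have [|B B0 hB] := @bsum_brk R (9 / 8); first lra.
have K0 : 0 < 2 `^ (5 / 8) :> R by rewrite powR_gt0.
exists (2 `^ (5 / 8) * (B + B)); first by rewrite mulr_gt0// addr_gt0.
move=> q s us.
have pt (x y z : R) : 0 < x -> 0 < z -> x <= y -> z <= x + y ->
    x `^ (- (7 / 8)) * y `^ (- (7 / 8)) <=
    2 `^ (5 / 8) * z `^ (- (5 / 8)) * x `^ (- (9 / 8)).
  move=> x0 z0 xy zxy.
  have y0 : 0 < y by exact: lt_le_trans xy.
  have xD (a b : R) : x `^ (a + b) = x `^ a * x `^ b.
    by rewrite powRD// implybE (gt_eqF x0) orbT.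
  have -> : - (9 / 8) = - (7 / 8) + - (1 / 4) :> R by lra.
  rewrite xD mulrCA ler_wpM2l ?powR_ge0//.
  have -> : - (7 / 8) = - (5 / 8) + - (1 / 4) :> R by lra.
  rewrite powRD; last by rewrite implybE (gt_eqF y0) orbT.
  apply: ler_pM; rewrite ?powR_ge0//; last by apply: le_powRN => //; lra.
  have -> : 2 `^ (5 / 8) * z `^ (- (5 / 8)) = (z / 2) `^ (- (5 / 8)).
    rewrite powRM ?invr_ge0 ?ltW// mulrC; congr (_ * _).
    by rewrite -[2^-1](@powR_inv1 _ 2)// -powRrM; congr (_ `^ _); lra.
  by apply: le_powRN; lra.
apply: (@le_trans _ _ (\sum_(l <- s) 2 `^ (5 / 8) * brk q `^ (- (5 / 8)) *
    (brk l `^ (- (9 / 8)) + brk (q - l) `^ (- (9 / 8))))).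
  apply: ler_sum => l _.
  have hq : brk q <= brk l + brk (q - l) by rewrite (le_trans _ (brkDs _ _))// subrKC.
  rewrite mulrDr.
  have [h|/ltW h] := leP (brk l) (brk (q - l)).
    rewrite ler_wpDr ?mulr_ge0// ?powR_ge0//.
    by apply: pt.
  rewrite ler_wpDl ?mulr_ge0// ?powR_ge0// mulrC.
  by apply: pt => //; rewrite addrC.
rewrite -mulr_sumr [leRHS]mulrAC ler_wpM2l ?mulr_ge0 ?powR_ge0//.
rewrite big_split/= lerD ?hB//.
by apply: (bsum_inj _ hB) => // x y; lia.
Qed.

Lemma int_sqrt (Y : nat) : exists r : nat, (r ^ 2 <= Y < r.+1 ^ 2)%N.
Proof.
elim: Y => [|Y [r /andP[h1 h2]]]; first by exists 0%N.
have [h|h] := ltnP Y.+1 (r.+1 ^ 2); first by exists r; rewrite h andbT; lia.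
by exists r.+1; rewrite h/=; lia.
Qed.

(** With r the integer square root of -X, or 0 if X is nonnegative, the factorization of m^2 - r^2
    shows growth at least quadratic in the distance d from |m| to r; the shift d - 1 absorbs the
    rounding of the root. *)
Lemma quadratic_gap (X : int) : exists r : nat, forall m : int,
  let d := `| `|m| - r%:Z | in
  (d - 1) ^+ 2 <= `|m ^+ 2 + X| \/ d = 0.
Proof.
have [X0|X0] := leP 0 X.
  exists 0%N => m /=; rewrite subr0 normr_id; have [->|m0] := eqVneq m 0; first by right.
  left; rewrite [`|_ + X|]ger0_norm ?addr_ge0 ?sqr_ge0//.
  have h1 : 1 <= `|m| by lia.
  have : `|m| ^+ 2 = m ^+ 2 by rewrite real_normK// num_real.
  nia.
have [r /andP[h1 h2]] := int_sqrt (absz X).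
exists r => m /=.
have e : m ^+ 2 = `|m| ^+ 2 by rewrite real_normK// num_real.
rewrite e; have : 0 <= `|m| by [].
move: (`|m|) => a a0; have {h1} h1 : (r%:Z ^+ 2 <= - X) by lia.
have {h2} h2 : (- X < (r%:Z + 1) ^+ 2) by lia.
have [h|h] := leP a r%:Z.
  have [->|n0] := eqVneq a r%:Z; [right; lia|left].
  rewrite ler0_norm ?subr_le0// ler0_norm; last by nia.
  nia.
left; rewrite ger0_norm ?subr_ge0 ?ltW// ger0_norm; last by nia.
nia.
Qed.

Fact gap_sqr (x y : R) : (x - 1) ^+ 2 <= y *+ 2 -> (1 + x) ^+ 2 / 8 <= 1 + y.
Proof.
(* Indeed 8 + 4 (x - 1)^2 - (1 + x)^2 = ((3 x - 5)^2 + 8) / 3. *)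
move=> h; have h5 : 0 <= (3 * x - 5) ^+ 2 by exact: sqr_ge0.
rewrite ler_pdivrMr//.
rewrite sqrrB expr1n mulr1 mulr2n in h.
rewrite sqrrB exprMn mulr2n in h5.
rewrite sqrrD expr1n mul1r.
lra.
Qed.

(** Completing the square, twice the bracketed integer is (2 n - N)^2 + (N^2 + 2 K). By
    [quadratic_gap] it dominates the squared distance of 2 n - N to r or to -r, so the exponent 5/8
    becomes 5/4 > 1 around two centres, uniformly in K and N. *)
Lemma quadratic_sum : exists2 C : R, 0 < C & forall (K N : int) (s : seq int), uniq s ->
  \sum_(n <- s) brk (K + n ^+ 2 + (N - n) ^+ 2) `^ (- (5 / 8)) <= C.
Proof.
have [|B B0 hB] := @bsum_brk R (5 / 4); first lra.
have K0 : 0 < 8 `^ (5 / 8) :> R by rewrite powR_gt0.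
exists (8 `^ (5 / 8) * (B + B)); first by rewrite mulr_gt0// addr_gt0.
move=> K N s us.
have [r hr] := quadratic_gap (N ^+ 2 + K *+ 2).
apply: (@le_trans _ _ (\sum_(n <- s) 8 `^ (5 / 8) *
   (brk (n *+ 2 - N - r%:Z) `^ (- (5 / 4)) + brk (N - n *+ 2 - r%:Z) `^ (- (5 / 4))))).
  apply: ler_sum => n _.
  set q := K + _ + _; set m := n *+ 2 - N.
  have e2 : q *+ 2 = m ^+ 2 + (N ^+ 2 + K *+ 2) by rewrite /q /m; ring.
  set d : int := `|m| - r%:Z.
  have hd : brk d ^+ 2 / 8 <= brk q.
    have eq2 : `|q%:~R| *+ 2 = `|m ^+ 2 + (N ^+ 2 + K *+ 2)|%:~R :> R.
      by rewrite -e2 intr_norm rmorphMn normrMn.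
    rewrite /brk.
    have -> : `|d%:~R| = `|d|%:~R :> R by rewrite intr_norm.
    have [h|->] := hr m; last by move: (normr_ge0 (q%:~R : R)); lra.
    by move: h; rewrite -/d -(ler_int R) -eq2 rmorphXn rmorphB; exact: gap_sqr.
  have hp : brk q `^ (- (5 / 8)) <= 8 `^ (5 / 8) * brk d `^ (- (5 / 4)).
    apply: (@le_trans _ _ ((brk d ^+ 2 / 8) `^ (- (5 / 8)))).
      apply: le_powRN; [by apply: divr_gt0 => //; apply: exprn_gt0; exact: brk_gt0|exact: hd|lra].
    have d0 : 0 <= brk d by exact: brk_ge0.
    rewrite powRM; [|exact: exprn_ge0|by rewrite invr_ge0].
    have -> : (brk d ^+ 2) `^ (- (5 / 8)) = brk d `^ (- (5 / 4)).
      by rewrite -powR_mulrn// -powRrM; congr (_ `^ _); lra.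
    have -> // : 8^-1 `^ (- (5 / 8)) = 8 `^ (5 / 8) :> R.
      transitivity ((8 `^ (-1)) `^ (- (5 / 8)) : R); first by rewrite powR_inv1.
      by rewrite -powRrM; congr (_ `^ _); lra.
    by rewrite mulrC.
  apply: (le_trans hp); rewrite ler_wpM2l ?powR_ge0// /d.
  have [m0|m0] := leP 0 m; first by rewrite ger0_norm// ler_wpDr ?powR_ge0.
  by rewrite ltr0_norm// ler_wpDl ?powR_ge0// /m opprB.
rewrite -mulr_sumr ler_wpM2l ?powR_ge0// big_split/= lerD//.
  by apply: (bsum_inj _ hB) => // x y; lia.
by apply: (bsum_inj _ hB) => // x y; lia.
Qed.

(** The two modulations add up to K + n^2 + (N - n)^2, which does not depend on k; hence the sum
    over k is done first and leaves exactly the quadratic sum over n. *)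
Lemma strichartz_sum : exists2 C : R, 0 < C & forall (K N : int) (s1 s2 : seq int),
  uniq s1 -> uniq s2 ->
  \sum_(n <- s1) \sum_(k <- s2)
    brk (k + n ^+ 2) `^ (- (7 / 8)) * brk (K - k + (N - n) ^+ 2) `^ (- (7 / 8)) <= C.
Proof.
have [C1 C10 h1] := modulation_sum; have [C2 C20 h2] := quadratic_sum.
exists (C1 * C2); first by rewrite mulr_gt0.
move=> K N s1 s2 u1 u2.
apply: (@le_trans _ _ (\sum_(n <- s1) C1 * brk (K + n ^+ 2 + (N - n) ^+ 2) `^ (- (5 / 8)))).
  apply: ler_sum => n _; set q := K + n ^+ 2 + _.
  rewrite (eq_bigr (fun k => brk (k + n ^+ 2) `^ (- (7 / 8)) *
      brk (q - (k + n ^+ 2)) `^ (- (7 / 8)))); last first.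
    by move=> k _; congr (_ * brk _ `^ _); rewrite /q; ring.
  rewrite -(big_map (fun k => k + n ^+ 2) xpredT (fun l => brk l `^ (- (7 / 8)) *
      brk (q - l) `^ (- (7 / 8)))).
  by apply: h1; rewrite map_inj_uniq// => x y; lia.
by rewrite -mulr_sumr ler_pM2l// h2.
Qed.

End StrichartzSums.

Fact frac_le (R : realFieldType) (x c : R) : 0 <= x -> 0 <= c -> x / (x + 1) * c <= c.
Proof.
move=> x0 c0; have x1 : 0 < x + 1 by rewrite ltr_wpDl.
by rewrite ler_piMl// ler_pdivrMr// mul1r lerDl.
Qed.

(** * Integration *)

Section NonnegIntegrals.
Context d (T : measurableType d) (R : realType).
Context (mu : {measure set T -> \bar R}).
Context (D : set T) (mD : measurable D).
Implicit Types f g : T -> R.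

Local Notation I f := (\int[mu]_(x in D) (f x)%:E)%E.

Lemma nnint_ge0 f : (forall x, 0 <= f x) -> (0 <= I f)%E.
Proof. by move=> f0; apply: integral_ge0 => x _; rewrite lee_fin. Qed.

Lemma nnint_le f g : measurable_fun setT f -> measurable_fun setT g ->
  (forall x, D x -> 0 <= f x) -> (forall x, D x -> f x <= g x) -> (I f <= I g)%E.
Proof.
move=> mf mg f0 fg; apply: ge0_le_integral => //.
- by apply/measurable_EFinP; exact: measurable_funTS.
- by apply/measurable_EFinP; exact: measurable_funTS.
Qed.

Lemma nnintD f g : measurable_fun setT f -> measurable_fun setT g ->
  (forall x, 0 <= f x) -> (forall x, 0 <= g x) ->
  (I (fun x => f x + g x)%R = I f + I g)%E.
Proof.
move=> mf mg f0 g0; rewrite -ge0_integralD//.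
- by move=> x _; rewrite lee_fin.
- by apply/measurable_EFinP; exact: measurable_funTS.
- by move=> x _; rewrite lee_fin.
- by apply/measurable_EFinP; exact: measurable_funTS.
Qed.

Lemma nnintZ f (k : R) : measurable_fun setT f ->
  (forall x, 0 <= f x) -> 0 <= k -> (I (fun x => k * f x)%R = k%:E * I f)%E.
Proof.
move=> mf f0 k0; rewrite -ge0_integralZl_EFin//.
- by move=> x _; rewrite lee_fin.
- by apply/measurable_EFinP; exact: measurable_funTS.
Qed.

Lemma nnint_sum (J : Type) (s : seq J) (F : J -> T -> R) :
  (forall j, measurable_fun setT (F j)) -> (forall j x, 0 <= F j x) ->
  (I (fun x => \sum_(j <- s) F j x)%R = \sum_(j <- s) I (F j))%E.
Proof.
move=> mF F0; rewrite -ge0_integral_sum//.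
- by apply: eq_integral => x _; rewrite sumEFin.
- by move=> j; apply/measurable_EFinP; exact: measurable_funTS.
- by move=> j x _; rewrite lee_fin.
Qed.

Lemma ae_nnint_lty (h : T -> \bar R) : measurable_fun setT h ->
  (forall x, 0 <= h x)%E -> (\int[mu]_(x in D) h x < +oo)%E ->
  {ae mu, forall x, D x -> (h x < +oo)%E}.
Proof.
move=> mh h0 hy.
have /integrable_ae : mu.-integrable D h.
  apply/integrableP; split; first exact: measurable_funTS.
  by under eq_integral => x _ do rewrite gee0_abs//.
move=> /(_ mD); apply: filterS => x hx Dx.
by have := hx Dx; rewrite ge0_fin_numE.
Qed.

(** Weighted arithmetic-geometric inequality f g <= (B/2A) f^2 + (A/2B) g^2, the weights making both
    terms contribute AB/2. *)
Let cs_pos f g (A B : R) : measurable_fun setT f -> measurable_fun setT g ->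
  (forall x, 0 <= f x) -> (forall x, 0 <= g x) -> 0 < A -> 0 < B ->
  (I (fun x => f x ^+ 2)%R <= (A ^+ 2)%:E)%E -> (I (fun x => g x ^+ 2)%R <= (B ^+ 2)%:E)%E ->
  (I (fun x => f x * g x)%R <= (A * B)%:E)%E.
Proof.
move=> mf mg f0 g0 A0 B0 hf hg.
have mf2 : measurable_fun setT (fun x => f x ^+ 2) by exact: measurable_funX.
have mg2 : measurable_fun setT (fun x => g x ^+ 2) by exact: measurable_funX.
apply: (@le_trans _ _ (I (fun x => (B / A / 2) * f x ^+ 2 + (A / B / 2) * g x ^+ 2))).
  apply: nnint_le.
  - exact: measurable_funM.
  - by apply: measurable_funD; apply: measurable_funM.
  - by move=> x _; rewrite mulr_ge0.
  - move=> x _; rewrite -subr_ge0.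
    rewrite (_ : _ - _ = (B * f x - A * g x) ^+ 2 / (2 * A * B)); last first.
      by field; rewrite !gt_eqF.
    by rewrite divr_ge0 ?sqr_ge0// !mulr_ge0// ltW.
have hA : 0 <= B / A / 2 by rewrite !divr_ge0 ?ltW.
have hB : 0 <= A / B / 2 by rewrite !divr_ge0 ?ltW.
rewrite nnintD; first last.
- by move=> x; rewrite mulr_ge0 ?sqr_ge0.
- by move=> x; rewrite mulr_ge0 ?sqr_ge0.
- exact: measurable_funM.
- exact: measurable_funM.
rewrite !nnintZ//; try by move=> x; exact: sqr_ge0.
have -> : (A * B)%:E = ((B / A / 2)%:E * (A ^+ 2)%:E + (A / B / 2)%:E * (B ^+ 2)%:E)%E.
  by rewrite -!EFinM -EFinD; congr (_%:E); field; rewrite !gt_eqF.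
by apply: leeD; apply: lee_wpmul2l.
Qed.

Lemma integral_cauchy_schwarz f g (A B : R) :
  measurable_fun setT f -> measurable_fun setT g ->
  (forall x, 0 <= f x) -> (forall x, 0 <= g x) -> 0 <= A -> 0 <= B ->
  (I (fun x => f x ^+ 2)%R <= (A ^+ 2)%:E)%E -> (I (fun x => g x ^+ 2)%R <= (B ^+ 2)%:E)%E ->
  (I (fun x => f x * g x)%R <= (A * B)%:E)%E.
Proof.
move=> mf mg f0 g0 A0 B0 hf hg.
have H (e : R) : 0 < e -> (I (fun x => f x * g x)%R <= ((A + e) * (B + e))%:E)%E.
  move=> e0; apply: cs_pos => //; try by rewrite ltr_wpDl.
    by apply: (le_trans hf); rewrite lee_fin; nra.
  by apply: (le_trans hg); rewrite lee_fin; nra.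
apply/lee_addgt0Pr => e e0.
have c0 : 0 < A + B + 1 by rewrite ltr_wpDl ?addr_ge0.
(* Then (A + u) (B + u) <= AB + u (A + B + 1) <= AB + e; positive bounds are restored this way when
   A or B vanishes. *)
pose u := Num.min 1 (e / (A + B + 1)).
have u0 : 0 < u by rewrite lt_min ltr01 divr_gt0.
apply: (le_trans (H _ u0)); rewrite -EFinD lee_fin.
have h1 : u <= 1 by rewrite ge_min lexx.
have h2 : u * (A + B + 1) <= e by rewrite -ler_pdivlMr// ge_min lexx orbT.
nra.
Qed.

(** The powers of the truncations increase to the power of f, so monotone convergence applies. *)
Lemma truncation_le (f : T -> R) (c : \bar R) (p : nat) : (0 < p)%N ->
  measurable_fun setT f ->
  (forall x, 0 <= f x) ->
  (forall n : nat, (I (fun x => (Num.min (f x) n%:R) ^+ p)%R <= c)%E) ->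
  (I (fun x => f x ^+ p)%R <= c)%E.
Proof.
move=> p0 mf f0 h.
have mmin (n : nat) : measurable_fun setT (fun x => (Num.min (f x) n%:R) ^+ p).
  by apply: measurable_funX; apply: measurable_minr.
have -> : I (fun x => f x ^+ p)%R =
    (\int[mu]_(x in D) limn (fun n : nat => ((Num.min (f x) n%:R) ^+ p)%:E))%E.
  apply: eq_integral => x _; apply/esym/lim_near_cst => //.
  near=> n; rewrite min_l//.
  near: n; exists (Num.bound (f x)) => // n /= hn.
  by rewrite (le_trans (ltW (archi_boundP (f0 x))))// ler_nat.
rewrite monotone_convergence//.
- by apply: lime_le; [|exact: nearW]; apply: ereal_nondecreasing_is_cvgn => m n mn;
    apply: nnint_le => // x _;
    rewrite ?exprn_ge0// ?ler_pXn2r ?nnegrE ?le_min ?f0 ?ler0n// ?ge_min ?lexx//= ?ler_nat ?mn ?orbT.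
- by move=> n; apply/measurable_EFinP; exact: measurable_funTS.
- by move=> n x _; rewrite lee_fin exprn_ge0// le_min f0 ler0n.
- move=> x _ m n mn; rewrite lee_fin ler_pXn2r ?nnegrE ?le_min ?f0 ?ler0n//.
  by rewrite ge_min lexx/= ge_min ler_nat mn orbT.
Unshelve. all: by end_near. Qed.

(** A form of Fatou's lemma that avoids subsequences: it carries an L^4 bound through approximation
    in L^2. For a truncation p of f, p^4 <= p^3 fe + p^3 de; Young's inequality gives 3/4 p^4 + 1/4
    fe^4 for the first product, and the first of these terms is absorbed because p is bounded on a
    set of finite measure. The second product is small since p <= n and de is small in L^2. *)
Lemma L4_lower_semicontinuity (f : T -> R) (B : R) : (mu D < +oo)%E ->
  measurable_fun setT f -> (forall x, 0 <= f x) -> 0 <= B ->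
  (forall e : R, 0 < e -> exists fe de : T -> R,
    [/\ measurable_fun setT fe /\ (forall x, 0 <= fe x),
        measurable_fun setT de /\ (forall x, 0 <= de x),
        forall x, D x -> f x <= fe x + de x,
        (I (fun x => fe x ^+ 4)%R <= B%:E)%E &
        (I (fun x => de x ^+ 2)%R <= e%:E)%E]) ->
  (I (fun x => f x ^+ 4)%R <= B%:E)%E.
Proof.
move=> Dy mf f0 B0 H; apply: truncation_le => // n.
set m := fine (mu D).
have mE : mu D = m%:E by rewrite fineK// ge0_fin_numE.
have m0 : 0 <= m by rewrite fine_ge0.
pose p x := Num.min (f x) n%:R.
have p0 x : 0 <= p x by rewrite le_min f0 ler0n.
have mp : measurable_fun setT p by exact: measurable_minr.
have mp4 : measurable_fun setT (fun x => p x ^+ 4) by exact: measurable_funX.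
have fin : (I (fun x => p x ^+ 4)%R <= (n%:R ^+ 4 * m)%:E)%E.
  rewrite EFinM -mE -integral_cst//; apply: nnint_le => // x _; rewrite ?exprn_ge0//.
  by rewrite ler_pXn2r ?nnegrE// ge_min lexx orbT.
set J : \bar R := I (fun x => p x ^+ 4)%R.
have JE : J = (fine J)%:E.
  rewrite fineK// ge0_fin_numE ?(le_lt_trans fin) ?ltry//.
  by apply: nnint_ge0 => x; rewrite exprn_ge0.
apply/lee_addgt0Pr => e e0.
(* With this choice the constant term costs at most e/8 and the L^2 error at most e/16; together
   they are below e/4, and dividing by the 1/4 left after absorption gives at most e. *)
pose del := e / (8 * (m + 1)).
have d0 : 0 < del by rewrite divr_gt0// mulr_gt0// ltr_wpDl.
have K0 : 0 < (n%:R : R) ^+ 6 + 1 by rewrite ltr_wpDl// exprn_ge0.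
have [|fe [de [[mfe fe0] [mde de0] hle hfe hde]]] := H (del * e / 4 / (n%:R ^+ 6 + 1)).
  by rewrite !divr_gt0// mulr_gt0.
have c0 : 0 <= n%:R ^+ 6 / (4 * del).
  by rewrite divr_ge0 ?exprn_ge0// mulr_ge0// ltW.
have key : (J <= (3 / 4)%:E * J + (4^-1)%:E * B%:E + (del%:E * mu D + (n%:R ^+ 6 / (4 * del))%:E * I (fun x => de x ^+ 2)))%E.
  apply: (@le_trans _ _ (I (fun x => ((3 / 4) * p x ^+ 4 + 4^-1 * fe x ^+ 4) +
      (del * cst 1 x + (n%:R ^+ 6 / (4 * del)) * de x ^+ 2)))).
    apply: nnint_le => //.
    - apply: measurable_funD; apply: measurable_funD; apply: measurable_funM => //; exact: measurable_funX.
    - by move=> x _; rewrite exprn_ge0.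
    - move=> x Dx.
      have pf : p x <= fe x + de x by rewrite (le_trans _ (hle _ Dx))// ge_min lexx.
      have pn : p x <= n%:R by rewrite ge_min lexx orbT.
      move: (p x) (fe x) (de x) (n%:R : R) (p0 x) (fe0 x) (de0 x) pf pn => P F E N P0 F0 E0 PF PN.
      have y1 : P ^+ 3 * F <= 3 / 4 * P ^+ 4 + 4^-1 * F ^+ 4.
        rewrite -subr_ge0 (_ : _ - _ = (P - F) ^+ 2 * (3 * P ^+ 2 + 2 * P * F + F ^+ 2) / 4); last by field.
        by rewrite divr_ge0// mulr_ge0 ?sqr_ge0// !addr_ge0// ?mulr_ge0// sqr_ge0.
      have y2 : P ^+ 3 * E <= del + N ^+ 6 / (4 * del) * E ^+ 2.
        apply: (@le_trans _ _ (N ^+ 3 * E)).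
          by rewrite ler_wpM2r// ler_pXn2r ?nnegrE// (le_trans P0).
        rewrite -subr_ge0 (_ : _ - _ = (2 * del - N ^+ 3 * E) ^+ 2 / (4 * del)).
          by rewrite divr_ge0 ?sqr_ge0// mulr_ge0// ltW.
        by field; rewrite gt_eqF.
      rewrite /cst mulr1 (le_trans _ (lerD y1 y2))// -mulrDr exprSr ler_wpM2l// exprn_ge0//.
  rewrite nnintD; first last.
  - by move=> x; apply: addr_ge0; apply: mulr_ge0; rewrite ?sqr_ge0 ?(ltW d0).
  - by move=> x; apply: addr_ge0; apply: mulr_ge0; rewrite ?exprn_ge0.
  - by apply: measurable_funD; apply: measurable_funM => //; exact: measurable_funX.
  - by apply: measurable_funD; apply: measurable_funM => //; exact: measurable_funX.
  rewrite (nnintD (f := fun x => 3 / 4 * p x ^+ 4)); first last.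
  - by move=> x; rewrite mulr_ge0 ?exprn_ge0.
  - by move=> x; rewrite mulr_ge0 ?exprn_ge0.
  - by apply: measurable_funM => //; exact: measurable_funX.
  - by apply: measurable_funM.
  rewrite (nnintD (f := fun x => del * cst 1 x)); first last.
  - by move=> x; apply: mulr_ge0; rewrite ?sqr_ge0.
  - by move=> x; apply: mulr_ge0; rewrite ?(ltW d0).
  - by apply: measurable_funM => //; exact: measurable_funX.
  - by apply: measurable_funM.
  have hc : I (@cst T R 1) = mu D by rewrite -[RHS]mul1e -integral_cst.
  rewrite !nnintZ//; try (by move=> x; rewrite ?sqr_ge0 ?exprn_ge0); try exact: measurable_funX;
    try exact: (ltW d0).
  rewrite hc; apply: leeD => //; apply: leeD => //.
  by apply: lee_wpmul2l.
have key2 : (J <= (3 / 4)%:E * J + (4^-1)%:E * B%:E + (del%:E * mu D + (n%:R ^+ 6 / (4 * del))%:E * (del * e / 4 / (n%:R ^+ 6 + 1))%:E))%E.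
  apply: (le_trans key); apply: leeD => //; apply: leeD => //; exact: lee_wpmul2l.
move: key2; rewrite -/J JE mE -!EFinM -!EFinD !lee_fin; set j := fine J => key2.
have t1 : n%:R ^+ 6 / (4 * del) * (del * e / 4 / (n%:R ^+ 6 + 1)) <= e / 16.
  rewrite (_ : _ * _ = (n%:R ^+ 6 / (n%:R ^+ 6 + 1)) * (e / 16)); last first.
    by field; rewrite !gt_eqF.
  by apply: frac_le; rewrite ?exprn_ge0// divr_ge0// ltW.
have t2 : del * m <= e / 8.
  rewrite /del (_ : _ * m = (m / (m + 1)) * (e / 8)); last first.
    by field; rewrite gt_eqF// ltr_wpDl.
  by apply: frac_le; rewrite // divr_ge0// ltW.
lra.
Qed.

(** If every truncation lost more than e, [truncation_le] with exponent 1 would bound the integral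
    of f by itself minus e. *)
Lemma truncation_tail (f : T -> R) (e : R) : measurable_fun setT f ->
  (forall x, 0 <= f x) -> (I f < +oo)%E -> 0 < e ->
  exists n : nat, (I (fun x => f x - Num.min (f x) n%:R)%R <= e%:E)%E.
Proof.
move=> mf f0 fy e0.
pose p n x := Num.min (f x) n%:R.
have p0 n x : 0 <= p n x by rewrite le_min f0 ler0n.
have mp n : measurable_fun setT (p n) by exact: measurable_minr.
have IfE : I f = (fine (I f))%:E by rewrite fineK// ge0_fin_numE// nnint_ge0.
have [n hn] : exists n, (I f <= I (p n) + e%:E)%E.
  apply/not_existsP => H.
  have : (I (fun x => f x ^+ 1)%R <= (fine (I f) - e)%:E)%E.
    apply: truncation_le => // n; have /negP := H n; rewrite -ltNge => /ltW h.
    by rewrite EFinB -IfE leeBrDr.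
  rewrite -[X in (X <= _)%E]/(I f) IfE lee_fin.
  by rewrite lerBrDr; move: e0; lra.
exists n.
have q0 x : 0 <= f x - p n x by rewrite subr_ge0 ge_min lexx.
have mq : measurable_fun setT (fun x => f x - p n x) by exact: measurable_funB.
have fE : I f = (I (p n) + I (fun x => f x - p n x)%R)%E.
  by rewrite -nnintD//; apply: eq_integral => x _; rewrite subrKC.
have pfin : I (p n) \is a fin_num.
  rewrite ge0_fin_numE; last exact: nnint_ge0.
  apply: le_lt_trans fy; apply: nnint_le => // x _; rewrite ge_min lexx//.
by move: hn; rewrite fE leeD2lE.
Qed.

(** Splitting f into a bounded truncation and a tail of small integral makes the absolute continuity
    of the integral explicit and linear in the measure of A, so one n serves all short windows. *)
Lemma uniform_integrability (f : T -> R) (e : R) : measurable_fun setT f ->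
  (forall x, 0 <= f x) -> (I f < +oo)%E -> 0 < e ->
  exists n : nat, forall A, measurable A -> A `<=` D ->
    (\int[mu]_(x in A) (f x)%:E <= e%:E + n%:R%:E * mu A)%E.
Proof.
move=> mf f0 fy e0.
pose p n x := Num.min (f x) n%:R.
have p0 n x : 0 <= p n x by rewrite le_min f0 ler0n.
have mp n : measurable_fun setT (p n) by exact: measurable_minr.
have [n hq] := truncation_tail mf f0 fy e0.
exists n => A mA AD.
have q0 x : 0 <= f x - p n x by rewrite subr_ge0 ge_min lexx.
have mq : measurable_fun setT (fun x => f x - p n x) by exact: measurable_funB.
have mE g : measurable_fun setT g -> measurable_fun A (EFin \o g).
  by move=> mg; apply/measurable_EFinP; exact: measurable_funTS.
rewrite (eq_integral (fun x => (f x - p n x)%:E + (p n x)%:E)%E); last first.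
  by move=> x _; rewrite -EFinD subrK.
rewrite ge0_integralD//.
- apply: leeD.
    apply: le_trans hq; apply: ge0_subset_integral => //.
    + by apply/measurable_EFinP; exact: measurable_funTS.
    + by move=> x _; rewrite lee_fin.
  rewrite -integral_cst//; apply: ge0_le_integral => //.
  + by move=> x _; rewrite lee_fin.
  + exact: mE.
  + by move=> x _; rewrite lee_fin ge_min lexx orbT.
- by move=> x _; rewrite lee_fin.
- exact: (mE _ mq).
- by move=> x _; rewrite lee_fin.
- exact: mE.
Qed.

End NonnegIntegrals.

Section LebesgueTranslation.
Context {R : realType}.
Local Notation mu := (@lebesgue_measure R).
Local Notation MR := (measurableTypeR R).

Lemma measurable_shift (a : R) : measurable_fun [set: MR] (fun x : MR => x + a : MR).
Proof. by apply: measurable_funD => //; exact: measurable_id. Qed.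

Lemma lebesgue_measure_shift (a : R) (A : set R) : measurable A ->
  pushforward mu (fun x : MR => (x + a)%R : MR) A = mu A.
Proof.
move=> mA; have ms := measurable_shift a.
apply/esym/(@lebesgue_measure_unique _ (pushforward mu (fun x : MR => x + a : MR))) => //.
move=> _ [[b c]] _ <-; transitivity (mu `]b - a, c - a]%classic).
  rewrite !lebesgue_measure_itv/= !lte_fin ltrD2r; case: ifPn => // _.
  by rewrite -!EFinD; congr (_%:E); ring.
rewrite /pushforward; congr (mu _).
by apply/seteqP; split => x /=; rewrite !in_itv/= ltrBlDr lerBrDr.
Qed.

Lemma ge0_integral_shift (a : R) (D : set R) (f : R -> \bar R) : measurable D ->
  measurable_fun setT f -> (forall x, 0 <= f x)%E ->
  (\int[mu]_(x in [set x : R | D (x + a)%R]) f ((x : R) + a)%R = \int[mu]_(x in D) f x)%E.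
Proof.
move=> mD mf f0; have ms := measurable_shift a.
transitivity (\int[pushforward mu (fun x : MR => (x + a)%R : MR)]_(y in D) f y)%E.
  by rewrite ge0_integral_pushforward//; exact: measurable_funTS.
by apply: eq_measure_integral => A mA _; exact: lebesgue_measure_shift.
Qed.

Lemma twopi_gt0 : 0 < pi *+ 2 :> R.
Proof. by rewrite mulrn_wgt0// pi_gt0. Qed.

Lemma measurable_circle : measurable (@circle R).
Proof. exact: measurable_itv. Qed.

Lemma circleE (x : R) : circle x = (0 <= x <= pi *+ 2) :> Prop.
Proof. by rewrite /circle /= in_itv. Qed.

Lemma lebesgue_circle : mu (@circle R) = (pi *+ 2)%:E.
Proof.
by rewrite lebesgue_measure_itv/= lte_fin twopi_gt0 -EFinB subr0.
Qed.

Lemma circle_integral_cst (c : R) : (\int[mu]_(x in circle) c%:E = (c * (pi *+ 2))%:E)%E.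
Proof. by rewrite EFinM -lebesgue_circle; exact: (integral_cst mu measurable_circle c%:E). Qed.

(** The shifted period [h, 2 pi + h[ is cut at 2 pi and its second piece is moved back by one
    period. *)
Lemma ge0_periodic_integral (f : R -> \bar R) (h : R) : 0 <= h <= pi *+ 2 ->
  measurable_fun setT f -> (forall x, 0 <= f x)%E -> (forall x : R, f (x + pi *+ 2) = f x) ->
  (\int[mu]_(x in circle) f ((x : R) + h)%R = \int[mu]_(x in circle) f x)%E.
Proof.
move=> /andP[h0 h2] mf f0 fp.
have mfS (A : set R) : measurable_fun A f by exact: measurable_funTS.
have mfh : measurable_fun [set: MR] (fun x : MR => f ((x : R) + h)%R).
  exact: (measurableT_comp mf (measurable_shift h)).
(* The closed interval contains both representatives of 0; the half-open one can be cut into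
   disjoint pieces. *)
have E (g : R -> \bar R) : measurable_fun setT g ->
    (\int[mu]_(x in circle) g x = \int[mu]_(x in `[0%R, (pi *+ 2)%R[) g x)%E.
  by move=> mg; rewrite integral_itv_bndo_bndc//; exact: measurable_funTS.
rewrite !E//.
transitivity (\int[mu]_(x in `[h, (pi *+ 2 + h)%R[) f x)%E.
  rewrite -(ge0_integral_shift h (measurable_itv _))//; congr integral.
  by apply/seteqP; split => x /=; rewrite !in_itv/= lerDr ltrD2r.
have S (a b c : R) : a <= b -> b <= c -> (\int[mu]_(x in `[a, c[) f x =
    \int[mu]_(x in `[a, b[) f x + \int[mu]_(x in `[b, c[) f x)%E.
  move=> ab bc; rewrite (@itv_bndbnd_setU _ _ (BLeft a) (BLeft b) (BLeft c)) ?bnd_simp//.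
  apply: ge0_integral_setU => //; first exact: mfS.
  by apply/disj_setPS => x [] /=; rewrite !in_itv/= => /andP[_ h3] /andP[h4 _];
     move: (lt_le_trans h3 h4); rewrite ltxx.
rewrite (S h (pi *+ 2)) ?lerDl// (S 0 h)//.
rewrite addeC; congr (_ + _)%E.
rewrite -(ge0_integral_shift (pi *+ 2) (measurable_itv _))//.
rewrite (_ : [set x | _] = `[0, h[%classic); last first.
  by apply/seteqP; split => x /=; rewrite !in_itv/= lerDr addrC ltrD2l.
by apply: eq_integral => x _; rewrite fp.
Qed.

Lemma periodic_Rintegral (f : R -> R) (h : R) : 0 <= h <= pi *+ 2 ->
  measurable_fun setT f -> (forall x : R, f (x + pi *+ 2) = f x) ->
  (\int[mu]_(x in circle) f ((x : R) + h) = \int[mu]_(x in circle) f x)%R.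
Proof.
move=> hh mf fp; rewrite /Rintegral; congr fine.
rewrite [LHS]integralE [RHS]integralE.
have mE : measurable_fun setT (EFin \o f) by exact/measurable_EFinP.
congr (_ - _)%E.
  rewrite -[RHS](@ge0_periodic_integral _ h)//.
  - by apply: eq_integral => x _; rewrite !funeposE.
  - exact: measurable_funepos.
  - by move=> x; rewrite !funeposE fp.
rewrite -[RHS](@ge0_periodic_integral _ h)//.
- by apply: eq_integral => x _; rewrite !funenegE.
- exact: measurable_funeneg.
- by move=> x; rewrite !funenegE fp.
Qed.

End LebesgueTranslation.

Section Rectangles.
Context {R : realType}.
Local Notation mu := (@lebesgue_measure R).
Local Notation MR := (measurableTypeR R).
Local Notation mu2 := (mu \x mu)%E.

Lemma measurable_rect (J K : set R) : measurable J -> measurable K ->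
  measurable (J `*` K : set (MR * MR)).
Proof. by move=> mJ mK; exact: measurableX. Qed.

Lemma ge0_integral_rect (J K : set R) (f : MR * MR -> \bar R) :
  measurable J -> measurable K -> measurable_fun setT f -> (forall z, 0 <= f z)%E ->
  (\int[mu2]_(z in J `*` K) f z = \int[mu]_(t in J) \int[mu]_(x in K) f (t, x))%E.
Proof.
move=> mJ mK mf f0; rewrite integral_mkcond fubini_tonelli1; first last.
- by move=> z; rewrite patchE; case: ifP.
- by apply/(measurable_restrictT _ _).1 => //; [exact: measurableX|exact: measurable_funTS].
rewrite [RHS]integral_mkcond; apply: eq_integral => t _.
rewrite /fubini_F patchE; case: ifPn => tJ.
  rewrite [RHS]integral_mkcond; apply: eq_integral => x _.
  by rewrite !patchE in_setX tJ.
by apply: integral0_eq => x _; rewrite patchE in_setX (negbTE tJ).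
Qed.

Lemma measurable_slice (f : MR * MR -> R) (t : R) : measurable_fun setT f ->
  measurable_fun [set: MR] (fun x : MR => f (t, x)).
Proof. by move=> mf; exact: (measurableT_comp mf (pair1_measurable t)). Qed.

Lemma measurable_ge0_integral_slice (K : set R) (f : MR * MR -> \bar R) :
  measurable K -> measurable_fun setT f -> (forall z, 0 <= f z)%E ->
  measurable_fun [set: MR] (fun t : MR => \int[mu]_(x in K) f (t, x))%E.
Proof.
move=> mK mf f0.
have := @measurable_fun_fubini_tonelli_F _ _ MR MR R mu (f \_ (setT `*` K)).
have -> : fubini_F mu (f \_ (setT `*` K)) = (fun t : MR => \int[mu]_(x in K) f (t, x))%E.
  apply/funext => t; rewrite /fubini_F [RHS]integral_mkcond; apply: eq_integral => x _.
  by rewrite !patchE in_setX in_setT.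
apply.
  by apply/(measurable_restrictT _ _).1 => //; [exact: measurableX|exact: measurable_funTS].
by move=> z; rewrite patchE; case: ifP.
Qed.

(** Valid at times where the slice is not integrable too: the extended integral is a difference of
    two measurable functions and [fine] is measurable. *)
Lemma measurable_Rintegral_slice (K : set R) (f : MR * MR -> R) :
  measurable K -> measurable_fun setT f ->
  measurable_fun [set: MR] (fun t : MR => \int[mu]_(x in K) f (t, x))%R.
Proof.
move=> mK mf; apply: measurableT_comp => //.
have mE : measurable_fun setT (EFin \o f) by exact/measurable_EFinP.
rewrite (_ : (fun t => _) = (fun t => \int[mu]_(x in K) (EFin \o f)^\+ (t, x) -
    \int[mu]_(x in K) (EFin \o f)^\- (t, x))%E); last first.
  by apply/funext => t; rewrite integralE; congr (_ - _)%E; apply: eq_integral => x _; rewrite ?funeposE ?funenegE.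
apply: emeasurable_funB; apply: measurable_ge0_integral_slice => //.
- exact: measurable_funepos.
- exact: measurable_funeneg.
Qed.

End Rectangles.

Section ComplexMeasurability.
Context {R : realType} d (T : measurableType d).
Implicit Types f g : T -> R[i].

Lemma cmeasurableD f g : cmeasurable f -> cmeasurable g -> cmeasurable (fun x => f x + g x).
Proof.
move=> [f1 f2] [g1 g2]; split.
- by under eq_fun do rewrite cReD; exact: measurable_funD.
- by under eq_fun do rewrite cImD; exact: measurable_funD.
Qed.

Lemma cmeasurableN f : cmeasurable f -> cmeasurable (fun x => - f x).
Proof.
move=> [f1 f2]; split.
- by under eq_fun do rewrite cReN; exact: measurableT_comp.
- by under eq_fun do rewrite cImN; exact: measurableT_comp.
Qed.

Lemma cmeasurableB f g : cmeasurable f -> cmeasurable g -> cmeasurable (fun x => f x - g x).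
Proof. by move=> mf mg; apply: cmeasurableD => //; exact: cmeasurableN. Qed.

Lemma cmeasurableM f g : cmeasurable f -> cmeasurable g -> cmeasurable (fun x => f x * g x).
Proof.
move=> [f1 f2] [g1 g2]; split.
- by under eq_fun do rewrite cReM; apply: measurable_funB; exact: measurable_funM.
- by under eq_fun do rewrite cImM; apply: measurable_funD; exact: measurable_funM.
Qed.

Lemma cmeasurable_conj f : cmeasurable f -> cmeasurable (fun x => (f x)^cj).
Proof.
move=> [f1 f2]; split.
- by under eq_fun do rewrite cRe_conj.
- by under eq_fun do rewrite cIm_conj; exact: measurableT_comp.
Qed.

Lemma cmeasurable_cst (c : R[i]) : cmeasurable (fun _ : T => c).
Proof. by split; exact: measurable_cst. Qed.

Lemma cmeasurable_real (h : T -> R) : measurable_fun setT h -> cmeasurable (fun x => (h x)%:C).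
Proof. by move=> mh; split => //=; exact: measurable_cst. Qed.

Lemma cmeasurable_expi (h : T -> R) : measurable_fun setT h -> cmeasurable (fun x => expi (h x)).
Proof.
move=> mh; split => /=.
- by apply: measurableT_comp => //; apply: continuous_measurable_fun; exact: continuous_cos.
- by apply: measurableT_comp => //; apply: continuous_measurable_fun; exact: continuous_sin.
Qed.

Lemma eq_cmeasurable f g : f =1 g -> cmeasurable f -> cmeasurable g.
Proof. by move=> /funext ->. Qed.

Lemma cmeasurable_sum (J : Type) (s : seq J) (F : J -> T -> R[i]) :
  (forall j, cmeasurable (F j)) -> cmeasurable (fun x => \sum_(j <- s) F j x).
Proof.
move=> mF; elim: s => [|a s IH].
  by under eq_fun do rewrite big_nil; exact: cmeasurable_cst.
by under eq_fun do rewrite big_cons; exact: cmeasurableD.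
Qed.

Lemma measurable_cabsX f n : cmeasurable f -> measurable_fun setT (fun x => cabs (f x) ^+ n).
Proof.
move=> [f1 f2]; apply: measurable_funX.
under eq_fun do rewrite cabsE.
apply: measurableT_comp; first by apply: continuous_measurable_fun; exact: sqrt_continuous.
by apply: measurable_funD; exact: measurable_funX.
Qed.

Lemma measurable_cabs f : cmeasurable f -> measurable_fun setT (fun x => cabs (f x)).
Proof. by move=> /(measurable_cabsX 1). Qed.

End ComplexMeasurability.

Section ComplexIntegral.
Context {R : realType}.
Local Notation mu := (@lebesgue_measure R).
Local Notation MR := (measurableTypeR R).
Local Notation cmeas := (@cmeasurable R _ MR).
Implicit Types (f g : R -> R[i]) (D : set R).

(** Measurability is asked on the whole line and integrability only on D, so the domain can change
    without a new measurability argument. *)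
Definition cint1 D f := cmeas f /\ (\int[mu]_(x in D) (cabs (f x))%:E < +oo)%E.

Lemma cint1_Re D f : measurable D -> cint1 D f ->
  mu.-integrable D (EFin \o (fun x => complex.Re (f x))).
Proof.
move=> mD [mf fy]; apply/integrableP; split.
  by apply/measurable_EFinP; apply: measurable_funTS; exact: mf.1.
apply: le_lt_trans fy; apply: ge0_le_integral => //.
- by apply/measurable_EFinP/measurableT_comp => //; apply: measurable_funTS; exact: mf.1.
- by apply/measurable_EFinP; apply: measurable_funTS; exact: measurable_cabs.
- by move=> x _; rewrite /= lee_fin Re_le_cabs.
Qed.

Lemma cint1_Im D f : measurable D -> cint1 D f ->
  mu.-integrable D (EFin \o (fun x => complex.Im (f x))).
Proof.
move=> mD [mf fy]; apply/integrableP; split.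
  by apply/measurable_EFinP; apply: measurable_funTS; exact: mf.2.
apply: le_lt_trans fy; apply: ge0_le_integral => //.
- by apply/measurable_EFinP/measurableT_comp => //; apply: measurable_funTS; exact: mf.2.
- by apply/measurable_EFinP; apply: measurable_funTS; exact: measurable_cabs.
- by move=> x _; rewrite /= lee_fin Im_le_cabs.
Qed.

Lemma cint1_le D f (h : R -> R) : measurable D -> cmeas f -> measurable_fun [set: MR] h ->
  (forall x, D x -> cabs (f x) <= h x) -> (\int[mu]_(x in D) (h x)%:E < +oo)%E -> cint1 D f.
Proof.
move=> mD mf mh fh hy; split => //; apply: le_lt_trans hy.
by apply: nnint_le => //; [exact: measurable_cabs|move=> x _; exact: cabs_ge0].
Qed.

Lemma cint1D D f g : measurable D -> cint1 D f -> cint1 D g -> cint1 D (fun x => f x + g x).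
Proof.
move=> mD [mf fy] [mg gy].
apply: (@cint1_le _ _ (fun x => cabs (f x) + cabs (g x))) => //.
- exact: cmeasurableD.
- by apply: measurable_funD; exact: measurable_cabs.
- by move=> x _; exact: cabsD.
- rewrite nnintD//; try exact: measurable_cabs; try (by move=> x; exact: cabs_ge0).
  exact: lte_add_pinfty.
Qed.

Lemma cint1Z D f (c : R[i]) : measurable D -> cint1 D f -> cint1 D (fun x => c * f x).
Proof.
move=> mD [mf fy]; split; first by apply: cmeasurableM => //; exact: cmeasurable_cst.
under eq_integral => x _ do rewrite cabsM.
rewrite nnintZ//; [|exact: measurable_cabs|by move=> x; exact: cabs_ge0|exact: cabs_ge0].
apply: lte_mul_pinfty => //; rewrite lee_fin; exact: cabs_ge0.
Qed.

Lemma cint1N D f : measurable D -> cint1 D f -> cint1 D (fun x => - f x).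
Proof.
by move=> mD /(cint1Z (-1) mD); under eq_fun do rewrite mulN1r.
Qed.

Lemma cint1_bounded_mul D f g (M : R) : measurable D -> cint1 D f -> cmeas g ->
  (forall x, cabs (g x) <= M) -> cint1 D (fun x => f x * g x).
Proof.
move=> mD [mf fy] mg gM.
have M0 : 0 <= M by exact: le_trans (cabs_ge0 _) (gM 0).
apply: (@cint1_le _ _ (fun x => M * cabs (f x))) => //.
- exact: cmeasurableM.
- by apply: measurable_funM => //; exact: measurable_cabs.
- by move=> x _; rewrite cabsM mulrC ler_wpM2r// cabs_ge0.
- rewrite nnintZ//; [|exact: measurable_cabs|by move=> x; exact: cabs_ge0].
  by apply: lte_mul_pinfty => //; rewrite lee_fin.
Qed.

Lemma cint1_sum (J : Type) (s : seq J) (F : J -> R -> R[i]) D : measurable D ->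
  (forall j, cint1 D (F j)) -> cint1 D (fun x => \sum_(j <- s) F j x).
Proof.
move=> mD hF; elim: s => [|a s IH].
  split; first by under eq_fun do rewrite big_nil; exact: cmeasurable_cst.
  by under eq_integral => x _ do rewrite big_nil cabs0; rewrite integral0.
by under eq_fun do rewrite big_cons; exact: cint1D.
Qed.

Lemma cint1_subset D D' f : measurable D -> measurable D' -> D `<=` D' ->
  cint1 D' f -> cint1 D f.
Proof.
move=> mD mD' DD [mf fy]; split => //; apply: le_lt_trans fy.
apply: ge0_subset_integral => //.
- by apply/measurable_EFinP; apply: measurable_funTS; exact: measurable_cabs.
- by move=> x _; rewrite lee_fin cabs_ge0.
Qed.

Lemma cintegralD D f g : measurable D -> cint1 D f -> cint1 D g ->
  cintegral D (fun x => f x + g x) = cintegral D f + cintegral D g.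
Proof.
move=> mD hf hg; apply: complex_eq; rewrite ?cReD ?cImD /=.
- rewrite -RintegralD//; [|exact: cint1_Re|exact: cint1_Re].
  by apply: eq_Rintegral => x _; rewrite cReD.
- rewrite -RintegralD//; [|exact: cint1_Im|exact: cint1_Im].
  by apply: eq_Rintegral => x _; rewrite cImD.
Qed.

Lemma integrable_scale D (r : R) (h : R -> R) : measurable D ->
  mu.-integrable D (EFin \o h) -> mu.-integrable D (EFin \o (fun x => r * h x)).
Proof.
by move=> mD hh; have := @integrableZl _ MR R mu D mD r _ hh; apply: eq_integrable => // x _; rewrite /= EFinM.
Qed.

Lemma integrable_add D (h k : R -> R) : measurable D ->
  mu.-integrable D (EFin \o h) -> mu.-integrable D (EFin \o k) ->
  mu.-integrable D (EFin \o (fun x => h x + k x)).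
Proof.
by move=> mD hh hk; have := @integrableD _ MR R mu D mD _ _ hh hk; apply: eq_integrable.
Qed.

Lemma cintegralZ D f (c : R[i]) : measurable D -> cint1 D f ->
  cintegral D (fun x => c * f x) = c * cintegral D f.
Proof.
move=> mD hf; have h1 := cint1_Re mD hf; have h2 := cint1_Im mD hf.
apply: complex_eq; rewrite ?cReM ?cImM /=.
- rewrite -!RintegralZl// -RintegralB//; try exact: integrable_scale.
  by apply: eq_Rintegral => x _; rewrite cReM.
- rewrite -!RintegralZl// -RintegralD//; try exact: integrable_scale.
  by apply: eq_Rintegral => x _; rewrite cImM.
Qed.

Lemma eq_cintegral D f g : (forall x, D x -> f x = g x) -> cintegral D f = cintegral D g.
Proof.
by move=> fg; congr (_ +i* _); apply: eq_Rintegral => x /[!inE] Dx; rewrite fg.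
Qed.

Lemma cintegral0 D : cintegral D (fun=> 0) = 0 :> R[i].
Proof. by rewrite /cintegral/= /Rintegral !integral0. Qed.

Lemma cintegralN D f : measurable D -> cint1 D f ->
  cintegral D (fun x => - f x) = - cintegral D f.
Proof.
move=> mD hf; rewrite -mulN1r -cintegralZ//.
by apply: eq_cintegral => x _; rewrite mulN1r.
Qed.

Lemma cintegralB D f g : measurable D -> cint1 D f -> cint1 D g ->
  cintegral D (fun x => f x - g x) = cintegral D f - cintegral D g.
Proof.
by move=> mD hf hg; rewrite cintegralD//; [rewrite cintegralN|exact: cint1N].
Qed.

Lemma cintegral_sum (J : Type) (s : seq J) (F : J -> R -> R[i]) D : measurable D ->
  (forall j, cint1 D (F j)) ->
  cintegral D (fun x => \sum_(j <- s) F j x) = \sum_(j <- s) cintegral D (F j).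
Proof.
move=> mD hF; elim: s => [|a s IH].
  by rewrite big_nil -[RHS](cintegral0 D); apply: eq_cintegral => x _; rewrite big_nil.
rewrite big_cons -IH -cintegralD//; last exact: cint1_sum.
by apply: eq_cintegral => x _; rewrite big_cons.
Qed.

Lemma cintegral_conj D f : measurable D -> cint1 D f ->
  cintegral D (fun x => (f x)^cj) = (cintegral D f)^cj.
Proof.
move=> mD hf; apply: complex_eq; rewrite ?cRe_conj ?cIm_conj /=.
- by apply: eq_Rintegral => x _; rewrite cRe_conj.
- rewrite -[RHS]mulN1r -RintegralZl//; last exact: cint1_Im.
  by apply: eq_Rintegral => x _; rewrite cIm_conj mulN1r.
Qed.

(** With z the integral, |z|^2 is the integral of the real part of conj(z) f, hence at most |z|
    times the integral of |f|. If f is not integrable the right side is infinite. *)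
Lemma cabs_cintegral_le D f : measurable D -> cmeas f ->
  ((cabs (cintegral D f))%:E <= \int[mu]_(x in D) (cabs (f x))%:E)%E.
Proof.
move=> mD mf.
have [fy|] := ltP (\int[mu]_(x in D) (cabs (f x))%:E)%E +oo%E; last first.
  by rewrite leye_eq => /eqP ->; rewrite leey.
have hf : cint1 D f by [].
set z := cintegral D f.
have [z0|z0] := eqVneq (cabs z) 0.
  by rewrite z0; apply: integral_ge0 => x _; rewrite lee_fin cabs_ge0.
have zp : 0 < cabs z by rewrite lt_neqAle eq_sym z0 cabs_ge0.
have E : (cabs z) ^+ 2 = \int[mu]_(x in D) complex.Re (z^cj * f x).
  have := cintegralZ z^cj mD hf; rewrite -/z mulrC -cabs_sqrC.
  by move=> /(congr1 (@complex.Re R)) /= <-.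
have hz := cint1Z z^cj mD hf.
have I0 : mu.-integrable D (EFin \o (fun x => cabs (f x))).
  apply/integrableP; split.
    by apply/measurable_EFinP; apply: measurable_funTS; exact: measurable_cabs.
  by under eq_integral => x _ do rewrite /= ger0_norm ?cabs_ge0//.
have : cabs z ^+ 2 <= cabs z * \int[mu]_(x in D) cabs (f x).
  rewrite E -RintegralZl//; apply: le_Rintegral => //.
  - exact: cint1_Re.
  - exact: integrable_scale.
  - move=> x _; rewrite (le_trans (ler_norm _))// (le_trans (Re_le_cabs _))//.
    by rewrite cabsM cabs_conj.
rewrite expr2 ler_pM2l// -lee_fin /Rintegral fineK//.
by rewrite ge0_fin_numE//; apply: integral_ge0 => x _; rewrite lee_fin cabs_ge0.
Qed.

Lemma cabs_cintegral_bound D f (B : R) : measurable D -> cmeas f ->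
  (\int[mu]_(x in D) (cabs (f x))%:E <= B%:E)%E -> cabs (cintegral D f) <= B.
Proof.
by move=> mD mf hB; rewrite -lee_fin (le_trans _ hB)// cabs_cintegral_le.
Qed.

Lemma cmeasurable_slice (F : R -> R -> R[i]) t :
  @cmeasurable R _ (MR * MR)%type (fun z => F z.1 z.2) -> cmeas (F t).
Proof. by move=> [m1 m2]; split; [exact: (measurable_slice t m1)|exact: (measurable_slice t m2)]. Qed.

Lemma cmeasurable_cintegral (K : set R) (F : R -> R -> R[i]) : measurable K ->
  @cmeasurable R _ (MR * MR)%type (fun z => F z.1 z.2) ->
  cmeas (fun t => cintegral K (F t)).
Proof.
move=> mK [m1 m2]; split.
- exact: (measurable_Rintegral_slice mK m1).
- exact: (measurable_Rintegral_slice mK m2).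
Qed.

Lemma aeS (P Q : R -> Prop) : (forall x, P x -> Q x) ->
  {ae mu, forall x, P x} -> {ae mu, forall x, Q x}.
Proof. by move=> PQ; apply: (@filterS _ _ (ae_filter_ringOfSetsType mu)). Qed.

Lemma ae_eq_cintegral D f g : measurable D -> cmeas f -> cmeas g ->
  {ae mu, forall x, D x -> f x = g x} -> cintegral D f = cintegral D g.
Proof.
move=> mD mf mg fg; congr (_ +i* _); rewrite /Rintegral; congr fine.
- apply: ae_eq_integral => //.
  + by apply/measurable_EFinP; apply: measurable_funTS; exact: mf.1.
  + by apply/measurable_EFinP; apply: measurable_funTS; exact: mg.1.
  + by apply: aeS fg => x h /h ->.
- apply: ae_eq_integral => //.
  + by apply/measurable_EFinP; apply: measurable_funTS; exact: mf.2.
  + by apply/measurable_EFinP; apply: measurable_funTS; exact: mg.2.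
  + by apply: aeS fg => x h /h ->.
Qed.

Lemma cintegral_setU (A B : set R) f : measurable A -> measurable B ->
  [disjoint A & B] -> cint1 (A `|` B) f ->
  cintegral (A `|` B) f = cintegral A f + cintegral B f.
Proof.
move=> mA mB AB hf; have mAB := measurableU _ _ mA mB.
apply: complex_eq; rewrite ?cReD ?cImD /=.
- by rewrite Rintegral_setU//; exact: cint1_Re.
- by rewrite Rintegral_setU//; exact: cint1_Im.
Qed.

End ComplexIntegral.

Arguments fourier : simpl never.
Arguments cabs : simpl never.
Arguments conjc : simpl never.
Arguments expi : simpl never.

(** * Fourier series on the circle *)

Section FourierBasics.
Context {R : realType}.
Local Notation mu := (@lebesgue_measure R).
Local Notation MR := (measurableTypeR R).
Local Notation cmeas := (@cmeasurable R _ MR).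
Implicit Types (f g : R -> R[i]).
Let mC := @measurable_circle R.

(** Unlike [inL2] there is no periodicity: Duhamel terms, as functions of time on [0, 2 pi], are
    expanded in Fourier series although they are not periodic. *)
Definition cL2 f := cmeas f /\ (L2norm_sq f < +oo)%E.
Definition nrm2 f : R := fine (L2norm_sq f).
Definition ip f g : R[i] := cintegral circle (fun x => f x * (g x)^cj).
Definition ep (n : int) (x : R) : R[i] := expi (n%:~R * x).
Definition tp (s : seq int) (c : int -> R[i]) (x : R) : R[i] := \sum_(n <- s) c n * ep n x.

Lemma inL2_cL2 f : inL2 f -> cL2 f.
Proof. by case. Qed.

Lemma L2norm_sq_ge0 f : (0 <= L2norm_sq f)%E.
Proof. by apply: integral_ge0 => x _; rewrite lee_fin exprn_ge0// cabs_ge0. Qed.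

Lemma nrm2_ge0 f : 0 <= nrm2 f.
Proof. exact/fine_ge0/L2norm_sq_ge0. Qed.

Lemma nrm2E f : cL2 f -> L2norm_sq f = (nrm2 f)%:E.
Proof. by move=> [_ fy]; rewrite fineK// ge0_fin_numE// L2norm_sq_ge0. Qed.

Lemma cL2_le f (h : R -> R) : cmeas f -> measurable_fun [set: MR] h ->
  (forall x, circle x -> cabs (f x) ^+ 2 <= h x) ->
  (\int[mu]_(x in circle) (h x)%:E < +oo)%E -> cL2 f.
Proof.
move=> mf mh fh hy; split => //; apply: le_lt_trans hy.
by apply: nnint_le => //; [exact: measurable_cabsX|move=> x _; rewrite exprn_ge0 ?cabs_ge0].
Qed.

Lemma cL2_bounded f (M : R) : cmeas f -> (forall x, cabs (f x) <= M) -> cL2 f.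
Proof.
move=> mf fM; apply: (@cL2_le _ (fun=> M ^+ 2)) => //.
- by move=> x _; rewrite /= ler_pXn2r ?nnegrE ?cabs_ge0// (le_trans (cabs_ge0 _) (fM x)).
- by rewrite circle_integral_cst ltry.
Qed.

Lemma cabs_ep n x : cabs (ep n x) = 1.
Proof. exact: cabs_expi. Qed.

Lemma ep0 x : ep 0 x = 1.
Proof. by rewrite /ep mul0r expi0. Qed.

Lemma epD m n x : ep (m + n) x = ep m x * ep n x.
Proof. by rewrite /ep intrD mulrDl expiD. Qed.

Lemma epN n x : ep (- n) x = (ep n x)^cj.
Proof. by rewrite /ep rmorphN/= mulNr expiN. Qed.

Lemma epB m n x : ep (m - n) x = ep m x * (ep n x)^cj.
Proof. by rewrite epD epN. Qed.

Lemma epK n x : ep n x * (ep n x)^cj = 1.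
Proof. by rewrite -epB subrr ep0. Qed.

Lemma ep_periodic n x : ep n (x + pi *+ 2) = ep n x.
Proof. exact: expi_periodic. Qed.

Lemma cmeasurable_ep n : cmeas (ep n).
Proof. by apply: cmeasurable_expi; apply: measurable_funM => //; exact: measurable_id. Qed.

Lemma cL2_ep n : cL2 (ep n).
Proof. by apply: (@cL2_bounded _ 1) (cmeasurable_ep n) _ => x; rewrite cabs_ep. Qed.

Lemma cL2D f g : cL2 f -> cL2 g -> cL2 (fun x => f x + g x).
Proof.
move=> [mf fy] [mg gy].
apply: (@cL2_le _ (fun x => 2 * cabs (f x) ^+ 2 + 2 * cabs (g x) ^+ 2)).
- exact: cmeasurableD.
- by apply: measurable_funD; apply: measurable_funM => //; exact: measurable_cabsX.
- move=> x _; have := cabsD (f x) (g x); have := cabs_ge0 (f x + g x).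
  have := sqr_ge0 (cabs (f x) - cabs (g x)); nra.
- rewrite nnintD; first last.
  + by move=> x; rewrite mulr_ge0 ?exprn_ge0 ?cabs_ge0.
  + by move=> x; rewrite mulr_ge0 ?exprn_ge0 ?cabs_ge0.
  + by apply: measurable_funM => //; exact: measurable_cabsX.
  + by apply: measurable_funM => //; exact: measurable_cabsX.
  + exact: mC.
  rewrite !nnintZ//; try exact: measurable_cabsX; try by move=> x; rewrite exprn_ge0 ?cabs_ge0.
  by apply: lte_add_pinfty; apply: lte_mul_pinfty.
Qed.

Lemma cL2M f g (M : R) : cL2 f -> cmeas g -> (forall x, cabs (g x) <= M) ->
  cL2 (fun x => f x * g x).
Proof.
move=> [mf fy] mg gM.
apply: (@cL2_le _ (fun x => M ^+ 2 * cabs (f x) ^+ 2)).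
- exact: cmeasurableM.
- by apply: measurable_funM => //; exact: measurable_cabsX.
- move=> x _; rewrite cabsM exprMn mulrC ler_wpM2r ?exprn_ge0 ?cabs_ge0//.
  by rewrite ler_pXn2r ?nnegrE ?cabs_ge0// (le_trans (cabs_ge0 _) (gM x)).
- rewrite nnintZ ?sqr_ge0//; [|exact: measurable_cabsX|by move=> x; rewrite exprn_ge0 ?cabs_ge0].
  by apply: lte_mul_pinfty => //; rewrite lee_fin sqr_ge0.
Qed.

Lemma cL2Z f (c : R[i]) : cL2 f -> cL2 (fun x => c * f x).
Proof.
move=> hf; under eq_fun do rewrite mulrC.
by apply: (@cL2M _ _ (cabs c)) => //; exact: cmeasurable_cst.
Qed.

Lemma cL2N f : cL2 f -> cL2 (fun x => - f x).
Proof. by move=> /(cL2Z (-1)); under eq_fun do rewrite mulN1r. Qed.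

Lemma cL2B f g : cL2 f -> cL2 g -> cL2 (fun x => f x - g x).
Proof. by move=> hf hg; apply: cL2D => //; exact: cL2N. Qed.

Lemma cL2_tp s c : cL2 (tp s c).
Proof.
rewrite /tp; elim: s => [|a s IH].
  under eq_fun do rewrite big_nil; apply: (@cL2_bounded _ 0); first exact: cmeasurable_cst.
  by move=> x; rewrite cabs0.
by under eq_fun do rewrite big_cons; apply: cL2D => //; apply: cL2Z; exact: cL2_ep.
Qed.

Lemma cL2_cint1M f g : cL2 f -> cL2 g -> cint1 circle (fun x => f x * (g x)^cj).
Proof.
move=> [mf fy] [mg gy].
apply: (@cint1_le _ _ _ (fun x => cabs (f x) ^+ 2 + cabs (g x) ^+ 2)) => //.
- by apply: cmeasurableM => //; exact: cmeasurable_conj.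
- by apply: measurable_funD; exact: measurable_cabsX.
- move=> x _; rewrite cabsM cabs_conj.
  have := cabs_ge0 (f x); have := cabs_ge0 (g x).
  have := sqr_ge0 (cabs (f x) - cabs (g x)); nra.
- rewrite nnintD//; try exact: measurable_cabsX; try by move=> x; rewrite exprn_ge0 ?cabs_ge0.
  exact: lte_add_pinfty.
Qed.

Lemma cL2_cint1 f : cL2 f -> cint1 circle f.
Proof.
move=> hf; have := cL2_cint1M hf (cL2_ep 0).
by under eq_fun do rewrite ep0 rmorph1 mulr1.
Qed.

Lemma ipDl f1 f2 g : cL2 f1 -> cL2 f2 -> cL2 g ->
  ip (fun x => f1 x + f2 x) g = ip f1 g + ip f2 g.
Proof.
move=> h1 h2 hg; rewrite /ip -cintegralD//; try exact: cL2_cint1M.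
by apply: eq_cintegral => x _; rewrite mulrDl.
Qed.

Lemma ipZl f g c : cL2 f -> cL2 g -> ip (fun x => c * f x) g = c * ip f g.
Proof.
move=> hf hg; rewrite /ip -cintegralZ//; last exact: cL2_cint1M.
by apply: eq_cintegral => x _; rewrite mulrA.
Qed.

Lemma ipC f g : cL2 f -> cL2 g -> ip g f = (ip f g)^cj.
Proof.
move=> hf hg; rewrite /ip -cintegral_conj//; last exact: cL2_cint1M.
by apply: eq_cintegral => x _; rewrite cconjM conjcK mulrC.
Qed.

Lemma ipBl f1 f2 g : cL2 f1 -> cL2 f2 -> cL2 g ->
  ip (fun x => f1 x - f2 x) g = ip f1 g - ip f2 g.
Proof.
move=> h1 h2 hg; rewrite ipDl//; last exact: cL2N.
congr (_ + _); rewrite -mulN1r -ipZl//.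
by apply: eq_cintegral => x _; rewrite mulN1r.
Qed.

Lemma ip_nrm2 f : cL2 f -> ip f f = (nrm2 f)%:C.
Proof.
move=> hf; apply: complex_eq; rewrite /ip/=.
- rewrite /nrm2 /L2norm_sq /Rintegral; congr fine; apply: eq_integral => x _.
  by rewrite -cabs_sqrC.
- rewrite /Rintegral integral0_eq// => x _; rewrite -cabs_sqrC//.
Qed.

Lemma fourier_ip f n : fourier f n = (pi *+ 2)^-1%:C * ip f (ep n).
Proof. by rewrite /fourier /ip; congr (_ * _); apply: eq_cintegral => x _; rewrite expiN. Qed.

Lemma twopiC_neq0 : (pi *+ 2)%:C != 0 :> R[i].
Proof. by rewrite eq_complex/= negb_and gt_eqF ?twopi_gt0. Qed.

Lemma ip_fourier f n : ip f (ep n) = (pi *+ 2)%:C * fourier f n.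
Proof. by rewrite fourier_ip mulrA -rmorphM/= divff ?mul1r// gt_eqF// twopi_gt0. Qed.

Lemma fourierB f g n : cL2 f -> cL2 g ->
  fourier (fun x => f x - g x) n = fourier f n - fourier g n.
Proof. by move=> hf hg; rewrite !fourier_ip ipBl ?mulrBr//; exact: cL2_ep. Qed.

Lemma cintegral_shift f h : 0 <= h <= pi *+ 2 -> cmeas f -> (forall x, f (x + pi *+ 2) = f x) ->
  cintegral circle (fun x => f (x + h)) = cintegral circle f.
Proof.
move=> hh mf pf; congr (_ +i* _).
- by apply: (@periodic_Rintegral _ (fun y => complex.Re (f y))) => [//||x]; [exact: mf.1|rewrite pf].
- by apply: (@periodic_Rintegral _ (fun y => complex.Im (f y))) => [//||x]; [exact: mf.2|rewrite pf].
Qed.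

Lemma cint1_shift f h : 0 <= h <= pi *+ 2 -> cint1 circle f -> (forall x, f (x + pi *+ 2) = f x) ->
  cint1 circle (fun x => f (x + h)).
Proof.
move=> hh [mf fy] pf; split.
  split.
  - exact: (measurableT_comp mf.1 (measurable_shift h)).
  - exact: (measurableT_comp mf.2 (measurable_shift h)).
rewrite (@ge0_periodic_integral _ (fun y => (cabs (f y))%:E))//.
- by apply/measurable_EFinP; exact: measurable_cabs.
- by move=> x; rewrite lee_fin cabs_ge0.
- by move=> x; rewrite pf.
Qed.

Lemma fourier_shift f h n : 0 <= h <= pi *+ 2 -> cint1 circle f ->
  (forall x, f (x + pi *+ 2) = f x) ->
  fourier (fun x => f (x + h)) n = ep n h * fourier f n.
Proof.
move=> hh hf pf; rewrite /fourier mulrCA; congr (_ * _).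
pose F y := f y * (ep n y)^cj.
have hF : cint1 circle F.
  apply: (@cint1_bounded_mul _ _ _ _ 1) => //.
    by apply: cmeasurable_conj; exact: cmeasurable_ep.
  by move=> x; rewrite cabs_conj cabs_ep.
have pF x : F (x + pi *+ 2) = F x by rewrite /F pf ep_periodic.
transitivity (ep n h * cintegral circle F); last first.
  by congr (_ * _); apply: eq_cintegral => x _; rewrite expiN.
rewrite -(cintegral_shift hh hF.1 pF) -cintegralZ//; last exact: cint1_shift.
apply: eq_cintegral => x _; rewrite /F mulrCA; congr (_ * _).
by rewrite expiN /ep mulrDr expiD rmorphM/= mulrCA epK mulr1.
Qed.

(** Translation by pi/|k| changes the sign of [ep k] and preserves the integral over a period, so
    the integral vanishes for k != 0 without a primitive. *)
Lemma ip_ep m n : ip (ep m) (ep n) = if m == n then (pi *+ 2)%:C else 0.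
Proof.
have E : ip (ep m) (ep n) = cintegral circle (ep (m - n)).
  by apply: eq_cintegral => x _; rewrite epB.
case: eqVneq => [mn|mn].
  rewrite E mn subrr; apply: complex_eq => /=.
  - rewrite (@eq_Rintegral _ _ _ _ _ (cst 1)); last by move=> x _; rewrite mul0r cos0.
    by rewrite Rintegral_cst//= mul1r [X in fine X]lebesgue_circle.
  - rewrite (@eq_Rintegral _ _ _ _ _ (cst 0)); last by move=> x _; rewrite mul0r sin0.
    by rewrite Rintegral_cst// mul0r.
rewrite {}E; have : m - n != 0 by rewrite subr_eq0.
move: (m - n) => {mn} k k0.
have kp : 1 <= `|k%:~R| :> R by rewrite -intr_norm ler1z; lia.
pose h : R := pi / `|k%:~R|.
have kp0 : 0 < `|k%:~R| :> R by exact: lt_le_trans kp.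
have hh : 0 <= h <= pi *+ 2.
  rewrite divr_ge0 ?pi_ge0//= ler_pdivrMr// mulr2n mulrDl.
  by rewrite ler_wpDr ?mulr_ge0 ?pi_ge0// ler_peMr ?pi_ge0.
have eh : ep k h = -1.
  rewrite /ep /h; have [k1|k1] := leP 0 (k%:~R : R).
    rewrite ger0_norm// mulrCA divff ?mulr1; last first.
      by rewrite gt_eqF//; move: kp0; rewrite ger0_norm.
    by rewrite /expi cospi sinpi; apply: complex_eq => /=; rewrite ?oppr0.
  rewrite ltr0_norm// invrN mulrN mulrN mulrCA divff ?mulr1 ?lt_eqF//.
  by rewrite expiN /expi cospi sinpi; apply: complex_eq => /=; rewrite ?oppr0.
have := cintegral_shift hh (cmeasurable_ep k) (ep_periodic k).
rewrite (@eq_cintegral _ _ _ (fun x => (-1) * ep k x)); last first.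
  by move=> x _; rewrite /ep mulrDr expiD -[expi (k%:~R * h)]/(ep k h) eh mulrC.
rewrite cintegralZ//; last exact: (cL2_cint1 (cL2_ep k)).
move=> /eqP; rewrite mulN1r eq_sym -subr_eq0 opprK -mulr2n mulrn_eq0/= => /eqP //.
Qed.

Lemma fourier_ep m n : fourier (ep m) n = (m == n)%:R.
Proof.
rewrite fourier_ip ip_ep; case: eqP => _; last by rewrite mulr0.
by rewrite -rmorphM/= mulVf// gt_eqF// twopi_gt0.
Qed.

Lemma ip_tp s c g : cL2 g -> ip (tp s c) g = \sum_(n <- s) c n * ip (ep n) g.
Proof.
move=> hg; rewrite /ip /tp.
rewrite (@eq_cintegral _ _ _ (fun x => \sum_(n <- s) c n * (ep n x * (g x)^cj))); last first.
  by move=> x _; rewrite mulr_suml; apply: eq_bigr => n _; rewrite mulrA.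
have h n : cint1 circle (fun x => ep n x * (g x)^cj) by apply: cL2_cint1M => //; exact: cL2_ep.
rewrite cintegral_sum//; last by move=> n; exact: cint1Z.
by apply: eq_bigr => n _; rewrite cintegralZ.
Qed.

Lemma fourier_tp s c n : uniq s -> fourier (tp s c) n = if n \in s then c n else 0.
Proof.
move=> us; rewrite fourier_ip ip_tp; last exact: cL2_ep.
rewrite mulr_sumr (eq_bigr (fun m => if m == n then c m else 0)); last first.
  move=> m _; rewrite ip_ep; case: eqP => _; last by rewrite !mulr0.
  by rewrite mulrCA -rmorphM/= mulVf ?mulr1// gt_eqF// twopi_gt0.
case: ifPn => ns.
  by rewrite (bigD1_seq n)//= eqxx big1 ?addr0// => m /negbTE ->.
by rewrite big_seq big1// => m ms; case: eqP => // mn; rewrite -mn ms in ns.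
Qed.

(* The expansion behind both Bessel's inequality and best approximation. *)
Lemma nrm2_subr_tp f s c : cL2 f -> uniq s ->
  nrm2 (fun x => f x - tp s c x) =
  nrm2 f - pi *+ 2 * \sum_(n <- s) cabs (fourier f n) ^+ 2 +
  pi *+ 2 * \sum_(n <- s) cabs (fourier f n - c n) ^+ 2.
Proof.
move=> hf us; have hp := cL2_tp s c; have hd := cL2B hf hp.
apply: (@complexI R); rewrite -ip_nrm2//.
have -> : ip (fun x => f x - tp s c x) (fun x => f x - tp s c x) =
    ip f f - ip (tp s c) f - ((ip (tp s c) f)^cj - ip (tp s c) (tp s c)).
  rewrite (ipBl hf hp hd) (ipC hd hf) (ipC hd hp) (ipBl hf hp hf) (ipBl hf hp hp) !cconjB.
  by rewrite -(ipC hf hf) -(ipC hp hp) -(ipC hf hp) opprB addrA; ring.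
rewrite !ip_tp// ip_nrm2//.
have e1 n : ip (ep n) f = (pi *+ 2)%:C * (fourier f n)^cj.
  by rewrite (ipC hf (cL2_ep n)) ip_fourier conj_realM.
have e2 n : n \in s -> ip (ep n) (tp s c) = (pi *+ 2)%:C * (c n)^cj.
  by move=> ns; rewrite (ipC hp (cL2_ep n)) ip_fourier fourier_tp// ns conj_realM.
have -> : \sum_(n <- s) c n * ip (ep n) (tp s c) = (pi *+ 2)%:C * \sum_(n <- s) c n * (c n)^cj.
  by rewrite mulr_sumr big_seq [RHS]big_seq; apply: eq_bigr => n ns; rewrite e2// mulrCA.
have -> : \sum_(n <- s) c n * ip (ep n) f = (pi *+ 2)%:C * \sum_(n <- s) c n * (fourier f n)^cj.
  by rewrite mulr_sumr; apply: eq_bigr => n _; rewrite e1 mulrCA.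
rewrite conj_realM cconj_sum.
have -> : \sum_(n <- s) (c n * (fourier f n)^cj)^cj = \sum_(n <- s) (c n)^cj * fourier f n.
  by apply: eq_bigr => n _; rewrite cconjM conjcK.
rewrite [RHS]rcD [X in _ = X + _]rcB !rcM !rc_sum.
rewrite -!addrA; congr (_ + _).
have -> : \sum_(n <- s) (cabs (fourier f n - c n) ^+ 2)%:C =
    \sum_(n <- s) (cabs (fourier f n) ^+ 2)%:C - \sum_(n <- s) c n * (fourier f n)^cj -
    \sum_(n <- s) (c n)^cj * fourier f n + \sum_(n <- s) c n * (c n)^cj :> R[i].
  rewrite -!sumrB -big_split/=; apply: eq_bigr => n _.
  rewrite !cabs_sqrC cconjB; ring.
ring.
Qed.

Lemma bessel f : cL2 f -> bsum (fun n => cabs (fourier f n) ^+ 2) (nrm2 f / (pi *+ 2)).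
Proof.
move=> hf s us; rewrite ler_pdivlMr ?twopi_gt0// mulrC -subr_ge0.
have := nrm2_ge0 (fun x => f x - tp s (fourier f) x).
rewrite nrm2_subr_tp// [X in _ + _ * X](_ : _ = 0) ?mulr0 ?addr0//.
by rewrite big1// => n _; rewrite subrr cabs0 expr0n.
Qed.

Lemma nrm2_tp s c : uniq s -> nrm2 (tp s c) = pi *+ 2 * \sum_(n <- s) cabs (c n) ^+ 2.
Proof.
move=> us; apply: (@complexI R); rewrite -ip_nrm2; last exact: cL2_tp.
rewrite ip_tp; last exact: cL2_tp.
rewrite rcM rc_sum mulr_sumr big_seq [RHS]big_seq; apply: eq_bigr => n ns.
rewrite (ipC (cL2_tp s c) (cL2_ep n)) ip_fourier fourier_tp// ns conj_realM.
by rewrite cabs_sqrC mulrCA.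
Qed.

Lemma nrm2_fourier_le f s c : cL2 f -> uniq s ->
  nrm2 (fun x => f x - tp s (fourier f) x) <= nrm2 (fun x => f x - tp s c x).
Proof.
move=> hf us; rewrite !nrm2_subr_tp// lerD2l.
rewrite [X in _ * X <= _](_ : _ = 0) ?mulr0.
  by apply: mulr_ge0; [exact/ltW/twopi_gt0|apply: sumr_ge0 => n _; rewrite exprn_ge0 ?cabs_ge0].
by rewrite big1// => n _; rewrite subrr cabs0 expr0n.
Qed.

Lemma nrm2D f g : cL2 f -> cL2 g ->
  nrm2 (fun x => f x + g x) <= 2 * nrm2 f + 2 * nrm2 g.
Proof.
move=> hf hg; have hD := cL2D hf hg.
rewrite -lee_fin EFinD !EFinM -!nrm2E// /L2norm_sq.
rewrite -!nnintZ//; try by [exact: measurable_cabsX hf.1|exact: measurable_cabsX hg.1];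
  try by move=> x; rewrite exprn_ge0 ?cabs_ge0.
rewrite -nnintD//; first last.
- by move=> x; rewrite mulr_ge0 ?exprn_ge0 ?cabs_ge0.
- by move=> x; rewrite mulr_ge0 ?exprn_ge0 ?cabs_ge0.
- by apply: measurable_funM => //; exact: measurable_cabsX hg.1.
- by apply: measurable_funM => //; exact: measurable_cabsX hf.1.
apply: nnint_le => //.
- exact: measurable_cabsX hD.1.
- by apply: measurable_funD; apply: measurable_funM => //; [exact: measurable_cabsX hf.1|exact: measurable_cabsX hg.1].
- by move=> x _; rewrite exprn_ge0 ?cabs_ge0.
- move=> x _; have := cabsD (f x) (g x); have := cabs_ge0 (f x + g x).
  have := sqr_ge0 (cabs (f x) - cabs (g x)); nra.
Qed.

End FourierBasics.

(** * Approximation by trigonometric polynomials *)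

Section Kernel.
Context {R : realType}.
Local Notation mu := (@lebesgue_measure R).
Local Notation MR := (measurableTypeR R).
Let mC := @measurable_circle R.

(** Frequencies may repeat in the list, so sums and products are plain concatenations; [ctrig_tp]
    collects equal frequencies afterwards. *)
Definition ctrig (P : R -> R[i]) :=
  exists l : seq (int * R[i]), forall x, P x = \sum_(p <- l) p.2 * ep p.1 x.

Lemma ctrig_tp P : ctrig P -> exists N c, forall x, P x = tp (zr N) c x.
Proof.
move=> [l hP]; have [N hN] := zr_exists (map fst l).
exists N, (fun m => \sum_(p <- l) if p.1 == m then p.2 else 0) => x.
rewrite hP /tp.
under [RHS]eq_bigr => m _ do rewrite mulr_suml.
rewrite exchange_big/= big_seq [RHS]big_seq; apply: eq_bigr => p pl.
rewrite (bigD1_seq p.1) ?zr_uniq ?hN ?map_f//= eqxx big1 ?addr0// => m mp.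
by rewrite eq_sym (negbTE mp) mul0r.
Qed.

Lemma ctrigD P Q : ctrig P -> ctrig Q -> ctrig (fun x => P x + Q x).
Proof. by move=> [l hl] [k hk]; exists (l ++ k) => x; rewrite big_cat/= hl hk. Qed.

Lemma ctrigM P Q : ctrig P -> ctrig Q -> ctrig (fun x => P x * Q x).
Proof.
move=> [l hl] [k hk]; exists [seq (p.1 + q.1, p.2 * q.2) | p <- l, q <- k] => x.
rewrite big_allpairs_dep/= hl hk mulr_suml; apply: eq_bigr => p _.
by rewrite mulr_sumr; apply: eq_bigr => q _; rewrite epD mulrACA.
Qed.

Lemma ctrig_ep n c : ctrig (fun x => c * ep n x).
Proof. by exists [:: (n, c)] => x; rewrite big_seq1. Qed.

Lemma ctrig_cst c : ctrig (fun=> c).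
Proof. by have := ctrig_ep 0 c; under eq_fun do rewrite ep0 mulr1. Qed.

(** This is cos^2(x/2); its normalized powers are the de la Vallee Poussin kernels, nonnegative
    trigonometric polynomials concentrating at 0. *)
Definition fq (x : R) : R := (1 + cos x) / 2.

Lemma fq_ge0 x : 0 <= fq x.
Proof. by rewrite /fq divr_ge0// -lerBlDl sub0r cos_geN1. Qed.

Lemma fq_le1 x : fq x <= 1.
Proof. by rewrite /fq ler_pdivrMr// mul1r -[leRHS]/(1 + 1) lerD2l cos_le1. Qed.

Lemma ctrig_fq N : ctrig (fun x => (fq x ^+ N)%:C).
Proof.
elim: N => [|N IH]; first by under eq_fun do rewrite expr0; exact: (ctrig_cst 1).
under eq_fun do rewrite exprS rcM; apply: ctrigM => //.
suff -> : (fun x => (fq x)%:C) =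
  (fun x => (2^-1)%:C * ep 0 x + ((4^-1)%:C * ep 1 x + (4^-1)%:C * ep (-1) x)).
  by apply: ctrigD; [|apply: ctrigD]; exact: ctrig_ep.
apply/funext => x; rewrite epN ep0 /ep mul1r /expi /fq /conjc.
by apply: complex_eq; rewrite ?(cReD, cImD, cReM, cImM)/=; field.
Qed.

Lemma cos_le (a b : R) : 0 <= a -> a <= b -> b <= pi -> cos b <= cos a.
Proof.
move=> a0; rewrite le_eqVlt => /orP[/eqP ->//|ab] bpi; apply/ltW.
by rewrite ltr_cos// in_itv/= ?a0 ?(ltW (lt_le_trans ab bpi))// (le_trans a0 (ltW ab)).
Qed.

(** The argument will be a difference of two points of [0, 2 pi], so it must keep distance d from 0
    and also from the maxima at 2 pi and -2 pi. *)
Lemma fq_away (d x : R) : 0 <= d -> d <= `|x| -> `|x| <= pi *+ 2 - d -> fq x <= fq d.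
Proof.
move=> d0 dx xd; rewrite /fq ler_pM2r// lerD2l -(cos_norm x).
have [h|h] := leP `|x| pi; first exact: cos_le.
have -> : cos `|x| = cos (pi *+ 2 - `|x|) by rewrite cosB cos2pi sin2pi mul1r mul0r addr0.
apply: cos_le => //; first by rewrite lerBrDr -lerBrDl.
by rewrite lerBlDr mulr2n lerD2l ltW.
Qed.

Lemma continuous_fq : continuous fq.
Proof.
move=> x; rewrite /fq; apply: cvgM; last exact: cvg_cst.
by apply: cvgD; [exact: cvg_cst|exact: continuous_cos].
Qed.

Lemma measurable_fqX N : measurable_fun [set: MR] (fun x : MR => fq x ^+ N).
Proof.
by apply: measurable_funX; apply: continuous_measurable_fun; exact: continuous_fq.
Qed.

Lemma measurable_fq_shift N (x : R) : measurable_fun [set: MR] (fun y : MR => fq (x - y) ^+ N).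
Proof.
have : measurable_fun [set: MR] (fun y : MR => x - y : MR).
  by apply: measurable_funB => //; exact: measurable_id.
exact: (measurableT_comp (measurable_fqX N)).
Qed.

Lemma circle_integrable (h : R -> R) (M : R) : measurable_fun [set: MR] h ->
  (forall x, circle x -> `|h x| <= M) -> mu.-integrable circle (EFin \o h).
Proof.
move=> mh hM; apply/integrableP; split.
  by apply/measurable_EFinP; exact: measurable_funTS.
apply: (@le_lt_trans _ _ (\int[mu]_(x in circle) M%:E)%E); last first.
  by rewrite circle_integral_cst ltry.
apply: ge0_le_integral => //=.
- by apply/measurable_EFinP/measurableT_comp => //; exact: measurable_funTS.
Qed.

Definition fqc (N : nat) : R := \int[mu]_(y in circle) (fq y ^+ N).

Lemma fqX_le1 N x : `|fq x ^+ N| <= 1.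
Proof. by rewrite ger0_norm ?exprn_ge0 ?fq_ge0// exprn_ile1 ?fq_ge0 ?fq_le1. Qed.

Lemma fqcE N x : circle x -> \int[mu]_(y in circle) (fq (x - y) ^+ N) = fqc N.
Proof.
rewrite circleE => /andP[x0 x2].
rewrite -[RHS](@periodic_Rintegral _ (fun y => fq y ^+ N) (pi *+ 2 - x)).
- apply: eq_Rintegral => y _; congr (_ ^+ N); rewrite /fq; congr ((1 + _) / 2).
  have -> : (y : R) + (pi *+ 2 - x) = ((y : R) - x) + pi *+ 2 by ring.
  by rewrite cosD2pi -cosN opprB.
- by rewrite subr_ge0 x2/= gerBl.
- exact: measurable_fqX.
- by move=> y; rewrite /fq cosD2pi.
Qed.

(** On [0, e] the kernel is at least its value at e. Applied at half the distance where the kernel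
    must be negligible, this bounds the mass below by a geometric sequence of larger ratio. *)
Lemma fqc_lower N (e : R) : 0 < e -> e <= pi -> e * fq e ^+ N <= fqc N.
Proof.
move=> e0 epi; rewrite -lee_fin /fqc /Rintegral fineK; last first.
  apply: integrable_fin_num => //; apply: (@circle_integrable _ 1); first exact: measurable_fqX.
  by move=> x _; exact: fqX_le1.
apply: (@le_trans _ _ (\int[mu]_(y in `[0%R, e]) (fq y ^+ N)%:E)%E); last first.
  apply: ge0_subset_integral => //.
  - by apply/measurable_EFinP; apply: measurable_funTS; exact: measurable_fqX.
  - by move=> x _; rewrite lee_fin exprn_ge0 ?fq_ge0.
  - move=> x /=; rewrite circleE in_itv/= => /andP[-> h]/=.
    by rewrite (le_trans h)// (le_trans epi)// mulr2n lerDl pi_ge0.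
have -> : (e * fq e ^+ N)%:E = (\int[mu]_(y in `[0%R, e]) (fq e ^+ N)%:E)%E.
  have E : mu `[0%R, e]%classic = e%:E by rewrite lebesgue_measure_itv/= lte_fin e0 -EFinB subr0.
  rewrite mulrC EFinM -E; apply/esym.
  exact: (integral_cst mu (measurable_itv `[0%R, e]) (fq e ^+ N)%:E).
apply: ge0_le_integral => //.
- by move=> x _; rewrite lee_fin exprn_ge0 ?fq_ge0.
- by apply/measurable_EFinP; apply: measurable_funTS; exact: measurable_fqX.
- move=> x; rewrite /= in_itv/= => /andP[x0 xe]; rewrite lee_fin.
  apply: lerXn2r; rewrite ?nnegrE ?fq_ge0// /fq ler_pM2r// lerD2l.
  exact: cos_le.
Qed.

Lemma fq_gt0 (e : R) : 0 < e -> e < pi -> 0 < fq e.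
Proof.
move=> e0 epi; rewrite /fq divr_gt0// -ltrBlDl sub0r -cospi.
by rewrite ltr_cos// in_itv/= ?pi_ge0 ?lexx// (ltW e0) ltW.
Qed.

Lemma fqc_gt0 N : 0 < fqc N.
Proof.
have h : 0 < (1 : R) < pi by rewrite ltr01/= (lt_le_trans _ (pi_ge2 R))// ltr1n.
case/andP: h => h1 h2.
by apply: (lt_le_trans _ (fqc_lower N h1 (ltW h2))); rewrite mul1r exprn_gt0// fq_gt0.
Qed.

Definition kmean (g : R -> R) (N : nat) (x : R) : R :=
  (fqc N)^-1 * \int[mu]_(y in circle) (g y * fq (x - y) ^+ N).

Section Mean.
Context (g : R -> R) (M : R).
Context (mg : measurable_fun [set: MR] g) (gM : forall x, `|g x| <= M).

Lemma kmean_integrable N x : mu.-integrable circle (EFin \o (fun y => g y * fq (x - y) ^+ N)).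
Proof.
have M0 : 0 <= M by exact: le_trans (gM 0).
apply: (@circle_integrable _ M).
  by apply: measurable_funM => //; exact: measurable_fq_shift.
by move=> y _; rewrite normrM -[leRHS]mulr1 ler_pM// fqX_le1.
Qed.

Lemma ctrig_kmean N : ctrig (fun x => (kmean g N x)%:C).
Proof.
have [l hl] := ctrig_fq N.
exists [seq (p.1, (fqc N)^-1%:C * (p.2 * ip (fun y => (g y)%:C) (ep p.1))) | p <- l] => x.
rewrite big_map/= /kmean rcM.
have hg : cL2 (fun y => (g y)%:C).
  by apply: (@cL2_bounded _ _ M); [exact: cmeasurable_real|move=> y; rewrite cabs_real].
have -> : (\int[mu]_(y in circle) (g y * fq (x - y) ^+ N))%:C =
    cintegral circle (fun y => \sum_(p <- l) (p.2 * ep p.1 x) * ((g y)%:C * (ep p.1 y)^cj)).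
  transitivity (cintegral circle (fun y => (g y * fq (x - y) ^+ N)%:C)).
    by apply: complex_eq => //=; rewrite Rintegral_cst// mul0r.
  apply: eq_cintegral => y _; rewrite rcM hl mulr_sumr; apply: eq_bigr => p _.
  by rewrite /ep mulrBr expiD expiN; ring.
rewrite cintegral_sum//; last first.
  by move=> p; apply: cint1Z => //; apply: cL2_cint1M => //; exact: cL2_ep.
rewrite mulr_sumr; apply: eq_bigr => p _; rewrite cintegralZ//; last first.
  by apply: cL2_cint1M => //; exact: cL2_ep.
by rewrite -/(ip _ _); ring.
Qed.

Lemma kmean_sub N x : circle x -> `|kmean g N x - g x| <=
  (fqc N)^-1 * \int[mu]_(y in circle) (`|g y - g x| * fq (x - y) ^+ N).
Proof.
move=> Cx; have c0 := fqc_gt0 N.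
have iq : mu.-integrable circle (EFin \o (fun y => fq (x - y) ^+ N)).
  by apply: (@circle_integrable _ 1); [exact: measurable_fq_shift|move=> y _; exact: fqX_le1].
have -> : kmean g N x - g x = (fqc N)^-1 * \int[mu]_(y in circle) ((g y - g x) * fq (x - y) ^+ N).
  rewrite -[X in _ - X](mulKf (lt0r_neq0 c0)) /kmean -mulrBr; congr (_ * _).
  rewrite -(fqcE N Cx) mulrC -RintegralZl// -RintegralB//; first last.
  - exact: integrable_scale.
  - exact: kmean_integrable.
  by apply: eq_Rintegral => y _; rewrite mulrBl.
rewrite normrM ger0_norm ?invr_ge0 ?(ltW c0)// ler_pM2l ?invr_gt0//.
have M0 : 0 <= M by exact: le_trans (gM 0).
apply: le_trans (le_normr_Rintegral _ _) _ => //.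
  apply: (@circle_integrable _ (M + M)).
    by apply: measurable_funM; [exact: measurable_funB|exact: measurable_fq_shift].
  move=> y _; rewrite normrM -[leRHS]mulr1 ler_pM ?fqX_le1//.
  by rewrite (le_trans (ler_normB _ _))// lerD.
rewrite le_eqVlt; apply/orP; left; apply/eqP; apply: eq_Rintegral => y _.
by rewrite normrM [X in _ * X]ger0_norm// exprn_ge0// fq_ge0.
Qed.

Lemma kmean_bound N x : circle x -> `|kmean g N x - g x| <= 2 * M.
Proof.
move=> Cx; have c0 := fqc_gt0 N.
apply: (le_trans (kmean_sub N Cx)); rewrite ler_pdivrMl// mulrC.
have iq : mu.-integrable circle (EFin \o (fun y => fq (x - y) ^+ N)).
  by apply: (@circle_integrable _ 1); [exact: measurable_fq_shift|move=> y _; exact: fqX_le1].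
rewrite -(fqcE N Cx) -RintegralZl//; apply: le_Rintegral => //.
- have M0 : 0 <= M by exact: le_trans (gM 0).
  apply: (@circle_integrable _ (M + M)).
    by apply: measurable_funM; [apply: measurableT_comp => //; exact: measurable_funB|exact: measurable_fq_shift].
  move=> y _; rewrite normrM -[leRHS]mulr1 ler_pM ?fqX_le1// normr_id.
  by rewrite (le_trans (ler_normB _ _))// lerD.
- exact: integrable_scale.
- move=> y _; rewrite ler_wpM2r ?exprn_ge0 ?fq_ge0//.
  by rewrite (le_trans (ler_normB _ _))// mulr_natl mulr2n lerD.
Qed.

(* Away from its maximum the kernel is exponentially small relative to its mass. *)
Lemma kmean_cvg (x e : R) : continuous_at x g -> 0 < x < pi *+ 2 -> 0 < e ->
  exists N0 : nat, forall N, (N0 <= N)%N -> `|kmean g N x - g x| <= e.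
Proof.
move=> cg /andP[x0 x2] e0.
have Cx : circle x by rewrite circleE !ltW.
have M0 : 0 <= M by exact: le_trans (gM 0).
have [d [d0 hd]] : exists d, 0 < d /\ forall y, `|x - y| < d -> `|g y - g x| <= e / 2.
  have /cvgrPdist_le/(_ (e / 2)) := cg; rewrite divr_gt0// => /(_ isT).
  move=> [d /= d0 hd]; exists d; split => // y hy.
  by rewrite distrC; exact: hd.
(* Besides the modulus of continuity, dl is at most the distance of x to both end points, so that |x
   - y| <= 2 pi - dl for all y in the circle, as [fq_away] requires. *)
pose dl := Num.min (Num.min d 1) (Num.min x (pi *+ 2 - x)).
have dl0 : 0 < dl by rewrite !lt_min d0 x0 ltr01 subr_gt0 x2.
have dl1 : dl <= 1 by rewrite !ge_min lexx orbT.
have pi1 : 1 < pi :> R by rewrite (lt_le_trans _ (pi_ge2 R))// ltr1n.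
have h2 : 0 < dl / 2 by rewrite divr_gt0.
have h2pi : dl / 2 < pi by apply: le_lt_trans pi1; lra.
have q2 : 0 < fq (dl / 2) by exact: fq_gt0.
(* The kernel at distance dl, divided by its mass, decays like r^N. *)
pose r := fq dl / fq (dl / 2).
have r1 : `|r| < 1.
  rewrite ger0_norm ?divr_ge0 ?fq_ge0 ?(ltW q2)// ltr_pdivrMr// mul1r.
  rewrite /fq ltr_pM2r// ltrD2l ltr_cos ?in_itv/=; [lra| |].
    by rewrite (ltW h2) (ltW h2pi).
  by rewrite (ltW dl0) (le_trans dl1 (ltW pi1)).
have /cvgrPdist_le/(_ (e / 2 / (8 * pi * M / dl + 1))) := cvg_expr r1.
have c8 : 0 <= 8 * pi * M / dl by rewrite divr_ge0 ?mulr_ge0 ?pi_ge0 ?(ltW dl0).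
rewrite divr_gt0 ?divr_gt0 ?ltr_wpDl// => /(_ isT) [N0 _ hN].
exists N0 => N NN; apply: (le_trans (kmean_sub N Cx)); have c0 := fqc_gt0 N.
rewrite ler_pdivrMl//.
have iq : mu.-integrable circle (EFin \o (fun y => fq (x - y) ^+ N)).
  by apply: (@circle_integrable _ 1); [exact: measurable_fq_shift|move=> y _; exact: fqX_le1].
have ic : mu.-integrable circle (EFin \o (fun y => 2 * M * fq dl ^+ N)).
  by apply: (@circle_integrable _ `|2 * M * fq dl ^+ N|).
apply: (@le_trans _ _ (\int[mu]_(y in circle) (e / 2 * fq (x - y) ^+ N + 2 * M * fq dl ^+ N))).
  apply: le_Rintegral => //.
  - apply: (@circle_integrable _ (M + M)).
      by apply: measurable_funM; [apply: measurableT_comp => //; exact: measurable_funB|exact: measurable_fq_shift].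
    move=> y _; rewrite normrM -[leRHS]mulr1 ler_pM ?fqX_le1// normr_id.
    by rewrite (le_trans (ler_normB _ _))// lerD.
  - by apply: integrable_add => //; exact: integrable_scale.
  - move=> y; rewrite circleE => /andP[y0 y2].
    have [h|h] := ltP `|x - y| dl.
      rewrite ler_wpDr ?mulr_ge0 ?exprn_ge0 ?fq_ge0// ler_wpM2r ?exprn_ge0 ?fq_ge0//.
      by apply: hd; apply: (lt_le_trans h); rewrite !ge_min lexx.
    rewrite ler_wpDl ?mulr_ge0 ?exprn_ge0 ?fq_ge0 ?(ltW e0) ?divr_ge0 ?(ltW e0)//.
    apply: ler_pM; rewrite ?exprn_ge0 ?fq_ge0//.
      by rewrite (le_trans (ler_normB _ _))// mulr_natl mulr2n lerD.
    apply: lerXn2r; rewrite ?nnegrE ?fq_ge0//; apply: fq_away => //; first exact: ltW.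
    have dlx : dl <= x by rewrite !ge_min lexx !orbT.
    have dlx2 : dl <= pi *+ 2 - x by rewrite !ge_min lexx !orbT.
    by rewrite ler_norml; apply/andP; split; lra.
rewrite RintegralD//; last exact: integrable_scale.
rewrite RintegralZl// fqcE// Rintegral_cst// [X in fine X]lebesgue_circle/=.
have hr : fq dl ^+ N <= fqc N * (2 / dl) * r ^+ N.
  have := fqc_lower N h2 (ltW h2pi); have A0 := exprn_gt0 N q2.
  have -> : r ^+ N = fq dl ^+ N / fq (dl / 2) ^+ N by exact: expr_div_n.
  move: A0.
  have B0 : 0 <= fq dl ^+ N by rewrite exprn_ge0// fq_ge0.
  move: (fq (dl / 2) ^+ N) (fq dl ^+ N) (fqc N) B0 c0 => A B c B0 c0 A0 hl.
  rewrite (_ : c * (2 / dl) * (B / A) = B * (c * (2 / dl) / A)); last by ring.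
  rewrite ler_peMr// ler_pdivlMr// mul1r.
  have -> : A = (dl / 2 * A) * (2 / dl) by field; rewrite gt_eqF.
  by rewrite ler_wpM2r// divr_ge0// ltW.
have hN' := hN _ NN; rewrite /= sub0r normrN ger0_norm in hN'; last first.
  by rewrite exprn_ge0// divr_ge0 ?fq_ge0.
have : 2 * M * fq dl ^+ N * (pi *+ 2) <= fqc N * (e / 2).
  apply: (@le_trans _ _ (fqc N * ((8 * pi * M / dl) * r ^+ N))).
    have : 0 <= 4 * M * pi by rewrite !mulr_ge0 ?pi_ge0.
    move=> h4; have := ler_wpM2l h4 hr.
    rewrite (_ : 4 * M * pi * (fqc N * (2 / dl) * r ^+ N) = fqc N * ((8 * pi * M / dl) * r ^+ N)); last by ring.
    by apply: le_trans; rewrite (_ : 2 * M * fq dl ^+ N * (pi *+ 2) = 4 * M * pi * fq dl ^+ N)//; ring.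
  rewrite ler_pM2l// (le_trans (ler_wpM2l c8 hN'))// mulrA mulrAC.
  by apply: frac_le => //; rewrite divr_ge0// ltW.
move=> h; rewrite (_ : fqc N * e = e / 2 * fqc N + fqc N * (e / 2)); last by field.
by rewrite lerD2l.
Qed.

Lemma kmean_L2 e : continuous g -> 0 < e -> exists N : nat,
  (\int[mu]_(x in circle) ((kmean g N x - g x) ^+ 2)%:E <= e%:E)%E.
Proof.
move=> cg e0.
pose F (N : nat) x : \bar R := ((kmean g N x - g x) ^+ 2)%:E.
have mk N : measurable_fun [set: MR] (kmean g N).
  have [l hl] := ctrig_kmean N.
  have mP : @cmeasurable R _ MR (fun x => (kmean g N x)%:C).
    by under eq_fun do rewrite hl; apply: cmeasurable_sum => p;
      apply: cmeasurableM; [exact: cmeasurable_cst|exact: cmeasurable_ep].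
  exact: mP.1.
have mF N : measurable_fun circle (F N).
  have m2 : measurable_fun [set: MR] (fun x : MR => kmean g N x - g x) by exact: measurable_funB.
  by apply/measurable_EFinP; apply: measurable_funTS; exact: (measurable_funX 2 m2).
(* [g] is continuous on the line but not periodic, so the means need not converge at 0 and 2 pi;
   these two points are negligible. *)
have H1 : {ae mu, forall x, circle x -> F ^~ x @ \oo --> cst 0%E x}.
  exists [set 0; pi *+ 2]; split.
  + by apply: measurableU; exact: measurable_set1.
  + by apply: countable_lebesgue_measure0; apply: finite_set_countable; exact: finite_set2.
  + move=> x /= /not_implyP[]; rewrite circleE => /andP[x0 x2] nc.
    apply: contrapT => hx; apply: nc.
    have x0' : 0 < x by rewrite lt_neqAle x0 andbT; apply/eqP => h; apply: hx; left.
    have x2' : x < pi *+ 2 by rewrite lt_neqAle x2 andbT; apply/eqP => h; apply: hx; right.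
    apply: cvg_EFin; first by near=> N.
    apply/cvgrPdist_le => /= d d0.
    have d1 : 0 < Num.min d 1 by rewrite lt_min d0 ltr01.
    have x02 : 0 < x < pi *+ 2 by rewrite x0' x2'.
    have [N0 hN0] := kmean_cvg (cg x) x02 d1.
    exists N0 => // N /= /hN0; rewrite le_min => /andP[h1 h2].
    rewrite sub0r normrN ger0_norm ?sqr_ge0// -[_ ^+ 2]real_normK ?num_real//.
    by rewrite expr2; apply: le_trans h1; rewrite ler_piMr.
have H2 : mu.-integrable circle (cst ((2 * M) ^+ 2)%:E).
  apply/integrableP; split; first exact: measurable_cst.
  by under eq_integral => x _ do rewrite /= ger0_norm ?sqr_ge0//; rewrite circle_integral_cst ltry.
have H3 : {ae mu, forall x, forall N, circle x -> (`|F N x| <= cst ((2 * M) ^+ 2)%:E x)%E}.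
  apply: aeW => x N Cx; rewrite /F /= lee_fin ger0_norm ?sqr_ge0//.
  rewrite -[leLHS]real_normK ?num_real//; apply: lerXn2r; rewrite ?nnegrE//.
  + by rewrite mulr_ge0// (le_trans (normr_ge0 (g 0))).
  + exact: kmean_bound.
have [_ _ hlim] := @dominated_convergence _ MR R mu circle mC F (cst 0%E) (cst ((2 * M) ^+ 2)%:E)
  mF (measurable_cst _) H1 H2 H3.
move: hlim; rewrite integral0 => /(_ [set x | (x < e%:E)%E]) [].
  by apply: open_nbhs_nbhs; split; [exact: open_ereal_lt_ereal|rewrite /= lte_fin].
by move=> N _ hN; exists N; apply/ltW; exact: (hN N (leqnn N)).
Unshelve. all: by end_near. Qed.

End Mean.

End Kernel.

Section Completeness.
Context {R : realType}.
Local Notation mu := (@lebesgue_measure R).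
Local Notation MR := (measurableTypeR R).
Let mC := @measurable_circle R.

Definition clip (n y : R) : R := Num.max (- n) (Num.min y n).

Lemma clipP n y : 0 <= n ->
  [\/ - n <= y <= n /\ clip n y = y, y < - n /\ clip n y = - n | n < y /\ clip n y = n].
Proof.
move=> n0; rewrite /clip.
have [h1|h1] := leP y n; last by apply: Or33; split => //; rewrite max_r//; lra.
have [h2|h2] := leP (- n) y; first by apply: Or31.
by apply: Or32.
Qed.

Lemma clip_bound n y : 0 <= n -> `|clip n y| <= n.
Proof. by move=> n0; have [[h ->]|[h ->]|[h ->]] := clipP y n0; rewrite ler_norml; lra. Qed.

Lemma clipK n y : 0 <= n -> clip n (clip n y) = clip n y.
Proof.
move=> n0; have := clip_bound y n0; rewrite ler_norml => /andP[h1 h2].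
by rewrite {1}/clip min_l// max_r.
Qed.

(** The difference of the clipped values is bounded both by 2 n and by |y - z|. The product of the
    two bounds turns closeness in L^1, which approximation by continuous functions provides, into
    closeness in L^2. *)
Lemma clip_lip n y z : 0 <= n -> (clip n y - clip n z) ^+ 2 <= 2 * n * `|y - z|.
Proof.
move=> n0.
have l2 : `|clip n y - clip n z| <= 2 * n.
  by rewrite (le_trans (ler_normB _ _))// mulr_natl mulr2n lerD// clip_bound.
rewrite -[leLHS]real_normK ?num_real// expr2 ler_pM//.
have h1 := ler_norm (y - z); have h2 := ler_norm (z - y); rewrite distrC in h2.
by have [[a ->]|[a ->]|[a ->]] := clipP y n0; have [[b ->]|[b ->]|[b ->]] := clipP z n0;
  rewrite ler_norml; lra.
Qed.

(* Truncate, approximate by a continuous function in L1, then mollify. *)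
Lemma real_L2_approx (h : R -> R) (e : R) : measurable_fun [set: MR] h ->
  (\int[mu]_(x in circle) (h x ^+ 2)%:E < +oo)%E -> 0 < e ->
  exists P : R -> R[i], ctrig P /\
    (\int[mu]_(x in circle) (cabs ((h x)%:C - P x) ^+ 2)%:E <= e%:E)%E.
Proof.
move=> mh hy e0.
have mh2 : measurable_fun [set: MR] (fun x => h x ^+ 2) by exact: measurable_funX.
(* Three errors of size e/9, since the square of a sum of three terms costs a factor 3. *)
have e9 : 0 < e / 9 by rewrite divr_gt0.
have [n hn] := @truncation_tail _ MR R mu circle mC (fun x => h x ^+ 2) _ mh2 (fun x => sqr_ge0 _) hy e9.
pose clip := clip n%:R; have n0 : 0 <= n%:R :> R by [].
have clip_bd y : `|clip y| <= n%:R by exact: clip_bound.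
have mclip (k : R -> R) : measurable_fun [set: MR] k -> measurable_fun [set: MR] (fun x => clip (k x)).
  by move=> mk; apply: measurable_maxr => //; exact: measurable_minr.
(* The truncation acts on y^2 at height n and the clipping on y at height n; the inequality n <= n^2
   for naturals compares them. *)
have clip_tail y : (y - clip y) ^+ 2 <= y ^+ 2 - Num.min (y ^+ 2) n%:R.
  have nn : (n%:R : R) <= n%:R ^+ 2.
    by rewrite expr2 -natrM ler_nat; case: (n) => // k; rewrite leq_pmulr.
  have m1 : Num.min (y ^+ 2) n%:R <= y ^+ 2 by rewrite ge_min lexx.
  have m2 : Num.min (y ^+ 2) n%:R <= n%:R by rewrite ge_min lexx orbT.
  by rewrite /clip; have [[hh ->]|[hh ->]|[hh ->]] := clipP y n0; nra.
have ic : mu.-integrable circle (EFin \o (fun x => clip (h x))).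
  by apply: (@circle_integrable _ _ n%:R) => //; exact: mclip.
have [|gk [cgk igk gkcvg]] := approximation_continuous_integrable mC _ ic.
  by rewrite [X in (X < _)%E]lebesgue_circle ltry.
have [k hk] : exists k, (\int[mu]_(z in circle) `|(clip (h z) - gk k z)%:E| <= (e / 9 / (2 * n%:R + 1))%:E)%E.
  have : nbhs 0%E [set x : \bar R | (x < (e / 9 / (2 * n%:R + 1))%:E)%E].
    apply: open_nbhs_nbhs; split; first exact: open_ereal_lt_ereal.
    by rewrite /= lte_fin divr_gt0// ltr_wpDl// mulr_ge0.
  by move=> /gkcvg[N _ hN]; exists N; apply/ltW/hN => /=.
pose g x := clip (gk k x).
have cg : continuous g.
  move=> x; apply: (@continuous_max _ _ (cst (- n%:R)) (gk k \min cst n%:R)); first exact: cvg_cst.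
  by apply: continuous_min; [exact: cgk|exact: cvg_cst].
have mgk : measurable_fun [set: MR] (gk k) by exact: continuous_measurable_fun.
have mg : measurable_fun [set: MR] g by exact: mclip.
have [N hN] := kmean_L2 mg (fun x => clip_bd _) cg e9.
exists (fun x => (kmean g N x)%:C); split; first exact: (ctrig_kmean mg (fun x => clip_bd _)).
have mk : measurable_fun [set: MR] (kmean g N).
  have [l hl] := ctrig_kmean mg (fun x => clip_bd _) N.
  have mP : @cmeasurable R _ MR (fun x => (kmean g N x)%:C).
    by under eq_fun do rewrite hl; apply: cmeasurable_sum => p;
      apply: cmeasurableM; [exact: cmeasurable_cst|exact: cmeasurable_ep].
  exact: mP.1.
have mclh : measurable_fun [set: MR] (fun x => clip (h x)) by exact: mclip.
have m1 : measurable_fun [set: MR] (fun x => 3 * (h x - clip (h x)) ^+ 2).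
  by apply: measurable_funM => //; apply: measurable_funX; exact: measurable_funB.
have m2 : measurable_fun [set: MR] (fun x => 3 * (clip (h x) - g x) ^+ 2).
  by apply: measurable_funM => //; apply: measurable_funX; exact: measurable_funB.
have m3 : measurable_fun [set: MR] (fun x => 3 * (kmean g N x - g x) ^+ 2).
  by apply: measurable_funM => //; apply: measurable_funX; exact: measurable_funB.
apply: (@le_trans _ _ (\int[mu]_(x in circle) ((3 * (h x - clip (h x)) ^+ 2 +
   3 * (clip (h x) - g x) ^+ 2) + 3 * (kmean g N x - g x) ^+ 2)%:E)%E).
  apply: nnint_le => //.
  - by apply: measurable_cabsX; apply: cmeasurableB; exact: cmeasurable_real.
  - by apply: measurable_funD => //; exact: measurable_funD.
  - by move=> x _; rewrite exprn_ge0 ?cabs_ge0.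
  - move=> x _; rewrite -rcB cabs_real real_normK ?num_real//.
    move: (h x) (clip (h x)) (g x) (kmean g N x) => a b c d.
    have := sqr_ge0 ((a - b) - (b - c)); have := sqr_ge0 ((a - b) + (d - c)).
    have := sqr_ge0 ((b - c) + (d - c)); nra.
rewrite nnintD//; first last.
- by move=> x; rewrite mulr_ge0 ?sqr_ge0.
- by move=> x; apply: addr_ge0; apply: mulr_ge0 => //; exact: sqr_ge0.
- exact: measurable_funD.
rewrite nnintD//; first last.
- by move=> x; rewrite mulr_ge0 ?sqr_ge0.
- by move=> x; rewrite mulr_ge0 ?sqr_ge0.
rewrite !nnintZ//; try (by move=> x; rewrite sqr_ge0); try (apply: measurable_funX; exact: measurable_funB).
have -> : e%:E = (3%:E * (e / 9)%:E + 3%:E * (e / 9)%:E + 3%:E * (e / 9)%:E)%E.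
  by rewrite -!EFinM -!EFinD; congr (_%:E); field.
apply: leeD; [apply: leeD|]; apply: lee_wpmul2l => //.
- apply: le_trans hn; apply: nnint_le => //.
  + by apply: measurable_funX; exact: measurable_funB.
  + by apply: measurable_funB => //; exact: measurable_minr.
  + by move=> x _; rewrite sqr_ge0.
- apply: (@le_trans _ _ (\int[mu]_(x in circle) ((2 * n%:R + 1) * `|clip (h x) - gk k x|)%:E)%E).
    apply: nnint_le => //.
    + by apply: measurable_funX; exact: measurable_funB.
    + by apply: measurable_funM => //; apply: measurableT_comp => //; exact: measurable_funB.
    + by move=> x _; rewrite sqr_ge0.
    + move=> x _; have -> : clip (h x) - g x = clip (clip (h x)) - clip (gk k x).
        by congr (_ - _); rewrite /clip clipK.
      by apply: le_trans (clip_lip _ _ n0) _; rewrite ler_wpM2r// lerDl.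
  rewrite nnintZ//; first last.
  + by apply: measurableT_comp => //; exact: measurable_funB.
  apply: (@le_trans _ _ ((2 * n%:R + 1)%:E * (e / 9 / (2 * n%:R + 1))%:E)%E).
    by apply: lee_wpmul2l.
  by rewrite -EFinM lee_fin mulrC divfK// gt_eqF// ltr_wpDl// mulr_ge0.
Qed.

Lemma trig_dense (f : R -> R[i]) (e : R) : cL2 f -> 0 < e ->
  exists N c, nrm2 (fun x => f x - tp (zr N) c x) <= e.
Proof.
move=> hf e0; have [[mr mi] fy] := hf.
have part (h : R -> R) : measurable_fun [set: MR] h -> (forall x, `|h x| <= cabs (f x)) ->
    exists P, ctrig P /\
    (\int[mu]_(x in circle) (cabs ((h x)%:C - P x) ^+ 2)%:E <= (e / 4)%:E)%E.
  move=> mh hle; apply: real_L2_approx => //; last by rewrite divr_gt0.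
  apply: le_lt_trans fy; apply: nnint_le => //.
  - exact: measurable_funX.
  - by apply: measurable_cabsX; split.
  - by move=> x _; rewrite sqr_ge0.
  - by move=> x _; rewrite -[leLHS]real_normK ?num_real// lerXn2r ?nnegrE ?cabs_ge0.
have [P [cP hP]] := part _ mr (fun x => Re_le_cabs _).
have [Q [cQ hQ]] := part _ mi (fun x => Im_le_cabs _).
have cPQ : ctrig (fun x => P x + 'i * Q x).
  by apply: ctrigD => //; apply: ctrigM => //; exact: ctrig_cst.
have [N [c hc]] := ctrig_tp cPQ; exists N, c.
have cL (S : R -> R[i]) : ctrig S -> cL2 S.
  by move=> /ctrig_tp[K [k hk]]; rewrite (_ : S = tp (zr K) k); [exact: cL2_tp|exact/funext].
have hr : cL2 (fun x => (complex.Re (f x))%:C - P x).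
  apply: cL2B; last exact: cL.
  apply: (@cL2_le _ _ (fun x => cabs (f x) ^+ 2)) => //.
  - by apply: measurable_cabsX; split.
  - by move=> x _; rewrite cabs_real lerXn2r ?nnegrE ?cabs_ge0// Re_le_cabs.
have hi : cL2 (fun x => (complex.Im (f x))%:C - Q x).
  apply: cL2B; last exact: cL.
  apply: (@cL2_le _ _ (fun x => cabs (f x) ^+ 2)) => //.
  - by apply: measurable_cabsX; split.
  - by move=> x _; rewrite cabs_real lerXn2r ?nnegrE ?cabs_ge0// Im_le_cabs.
rewrite (_ : (fun x => _) = (fun x => ((complex.Re (f x))%:C - P x) + 'i * ((complex.Im (f x))%:C - Q x))); last first.
  apply/funext => x; rewrite -hc.
  by apply: complex_eq; rewrite ?(cReD, cImD, cReM, cImM, cReN, cImN)/=; ring.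
apply: (le_trans (nrm2D hr (cL2Z _ hi))).
have -> : nrm2 (fun x => 'i * ((complex.Im (f x))%:C - Q x)) = nrm2 (fun x => (complex.Im (f x))%:C - Q x).
  by congr fine; apply: eq_integral => x _; rewrite cabsM cabs_i mul1r.
have h1 : nrm2 (fun x => (complex.Re (f x))%:C - P x) <= e / 4 by rewrite -lee_fin -nrm2E.
have h2 : nrm2 (fun x => (complex.Im (f x))%:C - Q x) <= e / 4 by rewrite -lee_fin -nrm2E.
lra.
Qed.

(** Density gives one good polynomial of some degree N0; padded with zero coefficients it competes
    at every degree N >= N0, and the Fourier partial sum is the best approximation there. *)
Theorem fourier_complete (f : R -> R[i]) (e : R) : cL2 f -> 0 < e -> exists N0 : nat, forall N, (N0 <= N)%N ->
  nrm2 (fun x => f x - tp (zr N) (fourier f) x) <= e.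
Proof.
move=> hf e0; have [N0 [c hc]] := trig_dense hf e0; exists N0 => N NN.
pose c' n := if n \in zr N0 then c n else 0.
apply: (le_trans (nrm2_fourier_le c' hf (zr_uniq N))).
rewrite (_ : (fun x => _) = (fun x => f x - tp (zr N0) c x))//.
apply/funext => x; congr (_ - _); rewrite /tp.
rewrite (bigID (fun n => n \in zr N0))/= [X in _ + X]big1 ?addr0; last first.
  by move=> n /negbTE h; rewrite /c' h mul0r.
rewrite -big_filter (perm_big (zr N0)).
  by apply: eq_big_seq => n h; rewrite /c' h.
apply: uniq_perm; rewrite ?filter_uniq ?zr_uniq// => n.
by rewrite mem_filter andb_idr// => /zr_sub; apply.
Qed.

(** Completeness makes the remainder arbitrarily small in the expansion of the norm, so control of
    the symmetric partial sums is enough. *)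
Lemma parseval_le (f : R -> R[i]) (B : R) : cL2 f ->
  (forall N, \sum_(n <- zr N) cabs (fourier f n) ^+ 2 <= B) -> nrm2 f <= pi *+ 2 * B.
Proof.
move=> hf hB; apply/ler_addgt0Pr => e e0.
have [N0 /(_ N0 (leqnn _))] := fourier_complete hf e0.
rewrite nrm2_subr_tp ?zr_uniq// [X in _ + _ * X](_ : _ = 0); last first.
  by rewrite big1// => n _; rewrite subrr cabs0 expr0n.
have := hB N0; have := (@twopi_gt0 R); nra.
Qed.

End Completeness.

(** * Strichartz inequality and its dual *)

Section SpaceTime.
Context {R : realType}.
Local Notation mu := (@lebesgue_measure R).
Local Notation MR := (measurableTypeR R).
Local Notation mu2 := (mu \x mu)%E.
Let mC := @measurable_circle R.
Implicit Types (p q : int * int) (z : R * R).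

Definition torus2 : set (R * R) := circle `*` circle.
(** A frequency is a pair (n, k) with the spatial index first, a point is a pair (t, x) with time
    first; hence the crossed projections. *)
Definition e2 p z : R[i] := ep p.2 z.1 * ep p.1 z.2.
Definition tp2 (A : seq (int * int)) (c : int * int -> R[i]) z : R[i] :=
  \sum_(p <- A) c p * e2 p z.
Definition box (s1 s2 : seq int) : seq (int * int) := [seq (n, k) | n <- s1, k <- s2].

Lemma measurable_torus2 : measurable (torus2 : set (MR * MR)).
Proof. exact: measurable_rect. Qed.
Let mT := measurable_torus2.

Lemma torus2_lty : (mu2 torus2 < +oo)%E.
Proof.
have -> : mu2 torus2 = (mu circle * mu circle)%E by rewrite /torus2 product_measure1E.
by rewrite lebesgue_circle -EFinM ltry.
Qed.

Lemma box_uniq s1 s2 : uniq s1 -> uniq s2 -> uniq (box s1 s2).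
Proof. by move=> u1 u2; apply: allpairs_uniq => // -[a b] [c d]. Qed.

Lemma mem_box s1 s2 p : (p \in box s1 s2) = (p.1 \in s1) && (p.2 \in s2).
Proof.
apply/allpairsP/idP => [[[a b] [h1 h2 ->]]|/andP[h1 h2]]; first by rewrite h1 h2.
by exists p; case: p h1 h2.
Qed.

Lemma sum_box (T : nmodType) s1 s2 (F : int * int -> T) :
  \sum_(p <- box s1 s2) F p = \sum_(n <- s1) \sum_(k <- s2) F (n, k).
Proof. exact: big_allpairs_dep. Qed.

Lemma e2D p q z : e2 (p + q) z = e2 p z * e2 q z.
Proof. by rewrite /e2 !epD mulrACA. Qed.

Lemma cmeasurable_fst_comp (f : R -> R[i]) : @cmeasurable R _ MR f ->
  @cmeasurable R _ (MR * MR)%type (fun z => f z.1).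
Proof.
by move=> [m1 m2]; split; [exact: (measurableT_comp m1 measurable_fst)|exact: (measurableT_comp m2 measurable_fst)].
Qed.

Lemma cmeasurable_snd_comp (f : R -> R[i]) : @cmeasurable R _ MR f ->
  @cmeasurable R _ (MR * MR)%type (fun z => f z.2).
Proof.
by move=> [m1 m2]; split; [exact: (measurableT_comp m1 measurable_snd)|exact: (measurableT_comp m2 measurable_snd)].
Qed.

Lemma cmeasurable_e2 p : @cmeasurable R _ (MR * MR)%type (e2 p).
Proof.
apply: cmeasurableM.
- by apply: cmeasurable_fst_comp; exact: cmeasurable_ep.
- by apply: cmeasurable_snd_comp; exact: cmeasurable_ep.
Qed.

Lemma cmeasurable_tp2 A c : @cmeasurable R _ (MR * MR)%type (tp2 A c).
Proof.
apply: cmeasurable_sum => p; apply: cmeasurableM; first exact: cmeasurable_cst.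
exact: cmeasurable_e2.
Qed.

Lemma tp2_box s1 s2 c t x :
  tp2 (box s1 s2) c (t, x) = tp s1 (fun n => tp s2 (fun k => c (n, k)) t) x.
Proof.
rewrite /tp2 sum_box /tp; apply: eq_bigr => n _; rewrite mulr_suml.
by apply: eq_bigr => k _; rewrite /e2/= mulrA.
Qed.

Lemma tp_integral_sqr s (c : int -> R[i]) : uniq s ->
  (\int[mu]_(x in circle) (cabs (tp s c x) ^+ 2)%:E =
  (pi *+ 2 * \sum_(n <- s) cabs (c n) ^+ 2)%:E)%E.
Proof. by move=> us; rewrite -nrm2_tp// -nrm2E//; exact: cL2_tp. Qed.

Lemma tp2_integral_sqr s1 s2 c : uniq s1 -> uniq s2 ->
  (\int[mu2]_(z in torus2) (cabs (tp2 (box s1 s2) c z) ^+ 2)%:E =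
  ((pi *+ 2) ^+ 2 * \sum_(p <- box s1 s2) cabs (c p) ^+ 2)%:E)%E.
Proof.
move=> u1 u2; rewrite ge0_integral_rect//; first last.
- by move=> z; rewrite lee_fin exprn_ge0 ?cabs_ge0.
- by apply/measurable_EFinP; apply: measurable_cabsX; exact: cmeasurable_tp2.
transitivity (\int[mu]_(t in circle) (\sum_(n <- s1) pi *+ 2 * cabs (tp s2 (fun k => c (n, k)) t) ^+ 2)%:E)%E.
  apply: eq_integral => t _; under eq_integral => x _ do rewrite tp2_box.
  by rewrite tp_integral_sqr// mulr_sumr.
have mt n : measurable_fun [set: MR] (fun t => cabs (tp s2 (fun k => c (n, k)) t) ^+ 2).
  by apply: measurable_cabsX; exact: (cL2_tp _ _).1.
rewrite nnint_sum//; first last.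
- by move=> n t; rewrite mulr_ge0 ?exprn_ge0 ?cabs_ge0// ltW ?twopi_gt0.
- by move=> n; apply: measurable_funM.
rewrite sum_box mulr_sumr -sumEFin; apply: eq_bigr => n _.
rewrite nnintZ//; first last.
- exact/ltW/twopi_gt0.
- by move=> t; rewrite exprn_ge0 ?cabs_ge0.
by rewrite tp_integral_sqr// -EFinM mulrA expr2.
Qed.

Lemma sum_translate (V : nmodType) (A B : seq (int * int)) p (F : int * int -> V) :
  uniq A -> uniq B -> (forall q, q \in A -> p + q \in B) ->
  \sum_(q <- B) (if q - p \in A then F (q - p) else 0) = \sum_(q <- A) F q.
Proof.
move=> uA uB AB; rewrite -big_mkcond -big_filter.
rewrite (perm_big [seq p + q | q <- A])/=; last first.
  apply: uniq_perm; first exact: filter_uniq.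
    by rewrite map_inj_uniq// => x y /addrI.
  move=> q; rewrite mem_filter; apply/andP/mapP => [[h _]|[r rA ->]].
    by exists (q - p) => //; rewrite subrKC.
  by rewrite addrAC subrr add0r; split => //; exact: AB.
by rewrite big_map; apply: eq_bigr => q _; rewrite addrAC subrr add0r.
Qed.

Lemma tp2_sqr A B c z : uniq A -> uniq B -> (forall p q, p \in A -> q \in A -> p + q \in B) ->
  tp2 A c z ^+ 2 =
  tp2 B (fun q => \sum_(p <- A) if q - p \in A then c p * c (q - p) else 0) z.
Proof.
move=> uA uB AB; rewrite /tp2 expr2.
under [RHS]eq_bigr => q _ do rewrite mulr_suml.
rewrite exchange_big/= mulr_suml big_seq [RHS]big_seq; apply: eq_bigr => p pA.
rewrite [RHS](eq_bigr (fun q => if q - p \in A then c p * e2 p z * (c (q - p) * e2 (q - p) z) else 0)); last first.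
  move=> q _; case: ifP => _; last by rewrite mul0r.
  by rewrite [RHS]mulrACA -e2D subrKC.
rewrite (@sum_translate _ A B p (fun q => c p * e2 p z * (c q * e2 q z)))//; last by move=> q; exact: AB.
by rewrite mulr_sumr.
Qed.

(* Cauchy-Schwarz on the convolution representing the coefficients of the square *)
Lemma tp2_L4 (W : int * int -> R) (S : R) s1 s2 c : uniq s1 -> uniq s2 ->
  (forall p, 0 < W p) ->
  (forall q, \sum_(p <- box s1 s2) (if q - p \in box s1 s2 then (W p)^-1 * (W (q - p))^-1 else 0) <= S) ->
  (\int[mu2]_(z in torus2) (cabs (tp2 (box s1 s2) c z) ^+ 4)%:E <=
  ((pi *+ 2) ^+ 2 * (S * (\sum_(p <- box s1 s2) W p * cabs (c p) ^+ 2) ^+ 2))%:E)%E.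
Proof.
move=> u1 u2 W0 hS; set A := box s1 s2; have uA : uniq A by exact: box_uniq.
(* The square of the polynomial has its frequencies in the sumset of A with itself, which the box of
   coordinate sumsets contains. *)
pose S1 := undup [seq a + b | a <- s1, b <- s1].
pose S2 := undup [seq a + b | a <- s2, b <- s2].
pose B := box S1 S2; have uB : uniq B by apply: box_uniq; exact: undup_uniq.
have AB p q : p \in A -> q \in A -> p + q \in B.
  rewrite !mem_box => /andP[h1 h2] /andP[h3 h4]; rewrite !mem_undup.
  by apply/andP; split; apply: allpairs_f.
pose d q := \sum_(p <- A) if q - p \in A then c p * c (q - p) else 0.
have -> : (\int[mu2]_(z in torus2) (cabs (tp2 A c z) ^+ 4)%:E =
    \int[mu2]_(z in torus2) (cabs (tp2 B d z) ^+ 2)%:E)%E.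
  apply: eq_integral => z _; rewrite -(tp2_sqr _ _ uA uB AB) cabsX -exprM//.
rewrite tp2_integral_sqr ?undup_uniq// lee_fin ler_wpM2l ?sqr_ge0//.
have S0 : 0 <= S.
  apply: le_trans (hS 0); apply: sumr_ge0 => p _; case: ifP => // _.
  by rewrite mulr_ge0// invr_ge0 ltW.
pose g p q : R := if q - p \in A then W p * cabs (c p) ^+ 2 * (W (q - p) * cabs (c (q - p)) ^+ 2) else 0.
apply: (@le_trans _ _ (\sum_(q <- B) S * \sum_(p <- A) g p q)).
  apply: ler_sum => q _.
  pose al p : R := if q - p \in A then Num.sqrt ((W p)^-1 * (W (q - p))^-1) else 0.
  pose be p : R := if q - p \in A then Num.sqrt (W p * W (q - p)) * (cabs (c p) * cabs (c (q - p))) else 0.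
  have WW p : 0 <= W p * W (q - p) by rewrite mulr_ge0 ?ltW.
  have WV p : 0 <= (W p)^-1 * (W (q - p))^-1 by rewrite mulr_ge0 ?invr_ge0 ?ltW.
  have h1 : cabs (d q) <= \sum_(p <- A) al p * be p.
    apply: le_trans (cabs_sum _ _ _) _; apply: ler_sum => p _.
    rewrite /al /be; case: ifP => _; last by rewrite cabs0 mul0r.
    rewrite mulrA -sqrtrM// (_ : _ * _ * (_ * _) = 1) ?sqrtr1 ?mul1r ?cabsM//.
    by field; rewrite !gt_eqF.
  apply: (@le_trans _ _ ((\sum_(p <- A) al p * be p) ^+ 2)).
    by apply: lerXn2r; rewrite ?nnegrE ?cabs_ge0// (le_trans (cabs_ge0 _) h1).
  apply: sum_sqr_le.
    apply: le_trans (hS q); apply: ler_sum => p _; rewrite /al -/A.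
    by case: ifP => _; rewrite ?expr0n// sqr_sqrtr.
  apply: ler_sum => p _; rewrite /be /g; case: ifP => _; last by rewrite expr0n.
  by rewrite exprMn sqr_sqrtr// exprMn mulrACA.
rewrite -mulr_sumr ler_wpM2l// exchange_big/= expr2 mulr_suml big_seq [leRHS]big_seq.
apply: ler_sum => p pA; rewrite (@sum_translate _ A B p (fun q => W p * cabs (c p) ^+ 2 * (W q * cabs (c q) ^+ 2)))//.
  by rewrite mulr_sumr.
by move=> q; exact: AB.
Qed.

(** The modulation k + n^2 vanishes on the frequencies of free waves. The exponent 7/8 exceeds 3/4,
    for the counting sums, and stays below 1, for [fourier_duhamel_sol_le]. *)
Definition modw p : R := brk (p.2 + p.1 ^+ 2) `^ (7 / 8).

Lemma modw_gt0 p : 0 < modw p.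
Proof. exact: brkpow_gt0. Qed.

(** Bourgain's periodic L^4 estimate in X^{0,b} with b = 7/16, slightly above the optimal 3/8; K is
    the fourth root produced by [tp2_L4] and the uniform counting bound. *)
Lemma strichartz_L4 : exists2 K : R, 0 < K & forall s1 s2 c, uniq s1 -> uniq s2 ->
  (\int[mu2]_(z in torus2) (cabs (tp2 (box s1 s2) c z) ^+ 4)%:E <=
  (K ^+ 4 * (\sum_(p <- box s1 s2) modw p * cabs (c p) ^+ 2) ^+ 2)%:E)%E.
Proof.
have [C C0 hC] := @strichartz_sum R.
have P0 := @twopi_gt0 R.
have K0 : 0 < (pi *+ 2) ^+ 2 * C by rewrite mulr_gt0// exprn_gt0.
exists (Num.sqrt (Num.sqrt ((pi *+ 2) ^+ 2 * C))); first by rewrite !sqrtr_gt0.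
move=> s1 s2 c u1 u2; rewrite (exprM _ 2 2) !sqr_sqrtr ?sqrtr_ge0 ?(ltW K0)// -mulrA.
apply: tp2_L4 => //; first exact: modw_gt0.
move=> [N K]; apply: (le_trans _ (hC K N s1 s2 u1 u2)); rewrite sum_box.
apply: ler_sum => n _; apply: ler_sum => k _.
by case: ifP => _; rewrite ?mulr_ge0 ?brkpow_ge0// /modw -!powRN/=.
Qed.

(* Holder's inequality with exponents 2, 4, 4. *)
Lemma integral_244 (V W Q : R * R -> R) (a b q : R) :
  measurable_fun [set: MR * MR] V -> measurable_fun [set: MR * MR] W -> measurable_fun [set: MR * MR] Q ->
  (forall z, 0 <= V z) -> (forall z, 0 <= W z) -> (forall z, 0 <= Q z) ->
  0 <= a -> 0 <= b -> 0 <= q ->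
  (\int[mu2]_(z in torus2) (V z ^+ 2)%:E <= (a ^+ 2)%:E)%E ->
  (\int[mu2]_(z in torus2) (W z ^+ 4)%:E <= (b ^+ 4)%:E)%E ->
  (\int[mu2]_(z in torus2) (Q z ^+ 4)%:E <= (q ^+ 4)%:E)%E ->
  (\int[mu2]_(z in torus2) (V z * (W z * Q z))%:E <= (a * (b * q))%:E)%E.
Proof.
move=> mV mW mQ V0 W0 Q0 a0 b0 q0 hV hW hQ.
apply: (integral_cauchy_schwarz mT) => //.
- exact: measurable_funM.
- by move=> z; rewrite mulr_ge0.
- by rewrite mulr_ge0.
under eq_integral => z _ do rewrite exprMn.
rewrite exprMn; apply: (integral_cauchy_schwarz mT) => //.
- exact: measurable_funX.
- exact: measurable_funX.
- by move=> z; rewrite exprn_ge0.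
- by move=> z; rewrite exprn_ge0.
- by rewrite exprn_ge0.
- by rewrite exprn_ge0.
- by under eq_integral => z _ do rewrite -exprM; rewrite -exprM.
- by under eq_integral => z _ do rewrite -exprM; rewrite -exprM.
Qed.

Definition sfourier (G : R -> R -> R[i]) (n : int) (t : R) : R[i] := fourier (G t) n.
Definition stfourier (G : R -> R -> R[i]) p : R[i] := fourier (sfourier G p.1) p.2.

Lemma cmeasurable_sfourier (G : R -> R -> R[i]) n :
  @cmeasurable R _ (MR * MR)%type (fun z => G z.1 z.2) -> @cmeasurable R _ MR (sfourier G n).
Proof.
move=> mG; apply: cmeasurableM; first exact: cmeasurable_cst.
apply: (@cmeasurable_cintegral _ _ (fun t x => G t x * expi (- (n%:~R * x)))) => //.
apply: cmeasurableM => //.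
have := cmeasurable_conj (cmeasurable_snd_comp (cmeasurable_ep n)).
by apply: eq_cmeasurable => z; rewrite expiN.
Qed.

Lemma cabs_fourier_le (f : R -> R[i]) n : @cmeasurable R _ MR f ->
  ((cabs (fourier f n))%:E <= \int[mu]_(x in circle) (cabs (f x))%:E)%E.
Proof.
move=> mf; rewrite /fourier cabsM cabs_real ger0_norm ?invr_ge0 ?(ltW (@twopi_gt0 R))//.
have m1 : @cmeasurable R _ MR (fun x => f x * expi (- (n%:~R * x))).
  apply: cmeasurableM => //; under eq_fun do rewrite expiN.
  by apply: cmeasurable_conj; exact: cmeasurable_ep.
have h := cabs_cintegral_le mC m1.
apply: (@le_trans _ _ ((cabs (cintegral circle (fun x => f x * expi (- (n%:~R * x)))))%:E)).
  rewrite lee_fin ler_piMl ?cabs_ge0// invf_le1 ?twopi_gt0//.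
  by rewrite mulr2n (le_trans _ (lerD (pi_ge2 R) (pi_ge2 R)))// -natrD ler1n.
apply: (le_trans h); rewrite le_eqVlt; apply/orP; left; apply/eqP.
by apply: eq_integral => x _; rewrite cabsM cabs_expi mulr1.
Qed.

Section DualStrichartz.
Context (G : R -> R -> R[i]).
Context (mG : @cmeasurable R _ (MR * MR)%type (fun z => G z.1 z.2)).
Context (iG : forall t, circle t -> cint1 circle (G t)).
Context (iG2 : (\int[mu2]_(z in torus2) (cabs (G z.1 z.2))%:E < +oo)%E).

Lemma sfourier_cint1 n : cint1 circle (sfourier G n).
Proof.
split; first exact: cmeasurable_sfourier.
apply: le_lt_trans iG2; rewrite ge0_integral_rect//; first last.
- by move=> z; rewrite lee_fin cabs_ge0.
- by apply/measurable_EFinP; exact: measurable_cabs.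
apply: ge0_le_integral => //.
- by move=> t _; rewrite lee_fin cabs_ge0.
- by apply/measurable_EFinP; apply: measurable_funTS; apply: measurable_cabs; exact: cmeasurable_sfourier.
- apply: measurable_funTS; apply: (@measurable_ge0_integral_slice _ _ (fun z => (cabs (G z.1 z.2))%:E)) => //.
  + by apply/measurable_EFinP; exact: measurable_cabs.
  + by move=> z; rewrite lee_fin cabs_ge0.
- by move=> t Ct; apply: cabs_fourier_le; exact: (iG Ct).1.
Qed.

(** [stfourier] is an iterated integral, so the pairing rests on linearity alone and no integrals
    are exchanged. *)
Lemma stfourier_pairing s1 s2 (d : int * int -> R[i]) :
  \sum_(p <- box s1 s2) (d p)^cj * stfourier G p =
  (((pi *+ 2) ^+ 2)^-1)%:C * cintegral circle (fun t => cintegral circle (fun x =>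
     G t x * (tp2 (box s1 s2) d (t, x))^cj)).
Proof.
have h1 t p : circle t -> cint1 circle (fun x => G t x * (ep p.1 x)^cj).
  move=> Ct; apply: (@cint1_bounded_mul _ _ _ _ 1) => //; first exact: iG.
    by apply: cmeasurable_conj; exact: cmeasurable_ep.
  by move=> x; rewrite cabs_conj cabs_ep.
rewrite (@eq_cintegral _ _ _ (fun t => \sum_(p <- box s1 s2) ((pi *+ 2)%:C * (d p)^cj) * (sfourier G p.1 t * (ep p.2 t)^cj))); last first.
  move=> t Ct; rewrite (@eq_cintegral _ _ _ (fun x => \sum_(p <- box s1 s2) ((d p)^cj * (ep p.2 t)^cj) * (G t x * (ep p.1 x)^cj))); last first.
    move=> x _; rewrite /tp2 cconj_sum mulr_sumr; apply: eq_bigr => p _.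
    by rewrite /e2 !cconjM/=; ring.
  rewrite cintegral_sum//; last by move=> p; apply: cint1Z => //; exact: h1.
  apply: eq_bigr => p _; rewrite cintegralZ//; last exact: h1.
  rewrite -/(ip (G t) (ep p.1)) ip_fourier /sfourier; ring.
have h2 p : cint1 circle (fun t => sfourier G p.1 t * (ep p.2 t)^cj).
  apply: (@cint1_bounded_mul _ _ _ _ 1) => //; first exact: sfourier_cint1.
    by apply: cmeasurable_conj; exact: cmeasurable_ep.
  by move=> x; rewrite cabs_conj cabs_ep.
rewrite cintegral_sum//; last by move=> p; exact: cint1Z.
rewrite mulr_sumr; apply: eq_bigr => p _; rewrite cintegralZ//.
rewrite -/(ip (sfourier G p.1) (ep p.2)) ip_fourier /stfourier.
have P0 := @twopiC_neq0 R.
rewrite rmorphV/= ?unitfE ?expf_neq0// ?gt_eqF ?twopi_gt0// expr2 rcM.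
by rewrite [X in _ = _ * X]mulrACA mulKf// mulf_neq0.
Qed.

End DualStrichartz.

(** Duality: the weighted square sum X of the coefficients of G is its pairing with the polynomial
    of coefficients [modw]^-1 times those of G. Holder's inequality and [strichartz_L4] bound it by
    a constant times a b X^(1/2), and one factor X^(1/2) is divided out. Domination by V W takes the
    place of a norm in L^(4/3). *)
Lemma dual_strichartz : exists2 C : R, 0 < C &
  forall (G : R -> R -> R[i]) (V W : R * R -> R) (a b : R),
  @cmeasurable R _ (MR * MR)%type (fun z => G z.1 z.2) ->
  (forall t, circle t -> cint1 circle (G t)) ->
  measurable_fun [set: MR * MR] V -> measurable_fun [set: MR * MR] W ->
  (forall z, 0 <= V z) -> (forall z, 0 <= W z) -> 0 <= a -> 0 <= b ->
  (forall z, torus2 z -> cabs (G z.1 z.2) <= V z * W z) ->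
  (\int[mu2]_(z in torus2) (V z ^+ 2)%:E <= (a ^+ 2)%:E)%E ->
  (\int[mu2]_(z in torus2) (W z ^+ 4)%:E <= (b ^+ 4)%:E)%E ->
  (forall n, cint1 circle (sfourier G n)) /\
  forall s1 s2, uniq s1 -> uniq s2 ->
    \sum_(p <- box s1 s2) (modw p)^-1 * cabs (stfourier G p) ^+ 2 <= C * (a * b) ^+ 2.
Proof.
have [K K0 hK] := strichartz_L4; have P0 := @twopi_gt0 R.
have kp : 0 < ((pi *+ 2) ^+ 2)^-1 :> R by rewrite invr_gt0 exprn_gt0.
exists ((((pi *+ 2) ^+ 2)^-1 * K) ^+ 2); first by rewrite exprn_gt0// mulr_gt0.
move=> G V W a b mG iG mV mW V0 W0 a0 b0 GVW hV hW.
pose m2 := fine (mu2 torus2).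
have m2E : mu2 torus2 = m2%:E by rewrite fineK// ge0_fin_numE// torus2_lty.
have m20 : 0 <= m2 by rewrite fine_ge0.
have pair (Q : R * R -> R) (q : R) : measurable_fun [set: MR * MR] Q -> (forall z, 0 <= Q z) -> 0 <= q ->
    (\int[mu2]_(z in torus2) (Q z ^+ 4)%:E <= (q ^+ 4)%:E)%E ->
    (\int[mu2]_(z in torus2) (cabs (G z.1 z.2) * Q z)%:E <= (a * (b * q))%:E)%E.
  move=> mQ Q0 q0 hQ; apply: le_trans (integral_244 mV mW mQ V0 W0 Q0 a0 b0 q0 hV hW hQ).
  apply: nnint_le => //.
  - by apply: measurable_funM => //; exact: measurable_cabs.
  - by apply: measurable_funM => //; exact: measurable_funM.
  - by move=> z _; rewrite mulr_ge0 ?cabs_ge0.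
  - by move=> z Tz; rewrite mulrA ler_wpM2r// GVW.
have iG2 : (\int[mu2]_(z in torus2) (cabs (G z.1 z.2))%:E < +oo)%E.
  (* Testing against the constant 1 gives the integrability of G; m2 + 1 appears because the bound
     has to be a fourth power and m2 <= (m2 + 1)^4. *)
  have h1 : (\int[mu2]_(z in torus2) (((fun=> 1) : R * R -> R) z ^+ 4)%:E <= ((m2 + 1) ^+ 4)%:E)%E.
    rewrite expr1n; apply: (@le_trans _ _ m2%:E).
      by rewrite -m2E [leLHS](integral_cst mu2 mT 1%:E) mul1e.
    rewrite lee_fin; have h : m2 <= m2 + 1 by rewrite lerDl.
    apply: (le_trans h); rewrite -[leLHS]expr1 ler_weXn2l// lerDr//.
  have := pair (fun=> 1) (m2 + 1) (measurable_cst _) (fun=> ler01) _ h1.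
  rewrite addr_ge0// => /(_ isT) h2; apply: (le_lt_trans _ (ltry (a * (b * (m2 + 1))))).
  by apply: le_trans h2; under [leRHS]eq_integral => z _ do rewrite mulr1.
split; first by move=> n; exact: sfourier_cint1.
move=> s1 s2 u1 u2; set A := box s1 s2.
set X := \sum_(p <- A) _.
have X0 : 0 <= X.
  by apply: sumr_ge0 => p _; rewrite mulr_ge0 ?exprn_ge0 ?cabs_ge0// invr_ge0 ltW// modw_gt0.
(* The extremal test polynomial: its weighted norm is again X and its pairing with G is X. *)
pose d p : R[i] := ((modw p)^-1)%:C * stfourier G p.
have XE : X%:C = \sum_(p <- A) (d p)^cj * stfourier G p.
  rewrite rc_sum; apply: eq_bigr => p _.
  by rewrite rcM cabs_sqrC /d; rewrite (conj_realM (modw p)^-1 (stfourier G p)); ring.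
have dX : \sum_(p <- A) modw p * cabs (d p) ^+ 2 = X.
  apply: eq_bigr => p _; rewrite /d cabsM cabs_real exprMn.
  by rewrite ger0_norm ?invr_ge0 ?(ltW (modw_gt0 _))// expr2 mulrA mulVKf ?gt_eqF// modw_gt0.
pose s := Num.sqrt X; have s0 : 0 <= s by rewrite sqrtr_ge0.
have sX : s ^+ 2 = X by rewrite sqr_sqrtr.
have hQ : (\int[mu2]_(z in torus2) (cabs (tp2 A d z) ^+ 4)%:E <= ((K * s) ^+ 4)%:E)%E.
  by apply: le_trans (hK _ _ _ u1 u2) _; rewrite dX exprMn -sX -exprM.
have mQ : measurable_fun [set: MR * MR] (fun z => cabs (tp2 A d z)).
  by apply: measurable_cabs; exact: cmeasurable_tp2.
have := pair _ (K * s) mQ (fun z => cabs_ge0 _) _ hQ; rewrite mulr_ge0 ?(ltW K0)// => /(_ isT) hGQ.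
have mH : @cmeasurable R _ (MR * MR)%type (fun z => G z.1 z.2 * (tp2 A d z)^cj).
  by apply: cmeasurableM => //; apply: cmeasurable_conj; exact: cmeasurable_tp2.
have mH' : @cmeasurable R _ (MR * MR)%type (fun z => G z.1 z.2 * (tp2 A d (z.1, z.2))^cj).
  by apply: eq_cmeasurable mH => -[].
have hX : X <= ((pi *+ 2) ^+ 2)^-1 * (a * (b * (K * s))).
  have -> : X = cabs X%:C by rewrite cabs_real ger0_norm.
  rewrite XE stfourier_pairing// cabsM cabs_real ger0_norm ?(ltW kp)// ler_pM2l//.
  apply: cabs_cintegral_bound => //.
    exact: (@cmeasurable_cintegral _ _ (fun t x => G t x * (tp2 A d (t, x))^cj)).
  apply: le_trans hGQ; rewrite ge0_integral_rect//; first last.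
  - by move=> z; rewrite lee_fin mulr_ge0 ?cabs_ge0.
  - by apply/measurable_EFinP; apply: measurable_funM => //; exact: measurable_cabs.
  apply: ge0_le_integral => //.
  - by move=> t _; rewrite lee_fin cabs_ge0.
  - apply/measurable_EFinP; apply: measurable_funTS; apply: measurable_cabs.
    exact: (@cmeasurable_cintegral _ _ (fun t x => G t x * (tp2 A d (t, x))^cj)).
  - apply: measurable_funTS; apply: (@measurable_ge0_integral_slice _ _ (fun z => (cabs (G z.1 z.2) * cabs (tp2 A d z))%:E)) => //.
    + by apply/measurable_EFinP; apply: measurable_funM => //; exact: measurable_cabs.
    + by move=> z; rewrite lee_fin mulr_ge0 ?cabs_ge0.
  - move=> t Ct; apply: (le_trans (cabs_cintegral_le mC _)).
      exact: (@cmeasurable_slice _ (fun t x => G t x * (tp2 A d (t, x))^cj) t mH').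
    by under eq_integral => x _ do rewrite cabsM cabs_conj.
have C0 : 0 <= ((pi *+ 2) ^+ 2)^-1 * K :> R by rewrite mulr_ge0// ltW.
rewrite -sX -exprMn; have [->|sn0] := eqVneq s 0; first by rewrite expr0n sqr_ge0.
have sp : 0 < s by rewrite lt_neqAle eq_sym sn0.
apply: lerXn2r; rewrite ?nnegrE//; first by rewrite mulr_ge0// mulr_ge0.
rewrite -(ler_pM2r sp) -expr2 sX (le_trans hX)// le_eqVlt; apply/orP; left; apply/eqP; ring.
Qed.

End SpaceTime.

(** * Calculus of complex-valued functions *)

Section ComplexCalculus.
Context {R : realType}.
Local Notation mu := (@lebesgue_measure R).
Local Notation MR := (measurableTypeR R).
Local Notation mu2 := (mu \x mu)%E.
Implicit Types (F G f g : R -> R[i]).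

Lemma rect_fubini (J K : set R) (f : R -> R -> R) : measurable J -> measurable K ->
  measurable_fun [set: MR * MR] (fun z : MR * MR => f z.1 z.2) ->
  (forall t, J t -> mu.-integrable K (EFin \o f t)) ->
  (forall s, K s -> mu.-integrable J (EFin \o f^~ s)) ->
  (\int[mu2]_(z in J `*` K) `|f z.1 z.2|%:E < +oo)%E ->
  \int[mu]_(t in J) (\int[mu]_(s in K) f t s) = \int[mu]_(s in K) (\int[mu]_(t in J) f t s).
Proof.
move=> mJ mK mf fJ fK fy; rewrite /Rintegral; congr fine.
pose h (z : MR * MR) : \bar R := ((fun z => (f z.1 z.2)%:E) \_ (J `*` K)) z.
have mJK := measurable_rect mJ mK.
have ih : (mu \x mu)%E.-integrable setT h.
  apply/integrableP; split.
    by apply/(measurable_restrictT _ mJK)/measurable_funTS; exact/measurable_EFinP.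
  move: fy; rewrite [X in (X < _)%E -> _]integral_mkcond; apply: le_lt_trans.
  rewrite le_eqVlt; apply/orP; left; apply/eqP; apply: eq_integral => z _.
  by rewrite /h !patchE; case: ifP => // _; rewrite abse0.
have hE t s : h (t, s) = if t \in J then if s \in K then (f t s)%:E else 0%E else 0%E.
  rewrite /h patchE/= in_setX/=; by case: (t \in J) => //=; case: (s \in K).
transitivity (\int[mu]_t \int[mu]_s h (t, s))%E.
  rewrite integral_mkcond; apply: eq_integral => t _; rewrite patchE.
  case: ifPn => tJ; last first.
    by rewrite integral0_eq// => s _; rewrite hE (negbTE tJ).
  rewrite fineK; last first.
    by apply: (@integrable_fin_num _ MR R mu K mK); apply: fJ; move: tJ; rewrite inE.
  by rewrite integral_mkcond; apply: eq_integral => s _; rewrite hE tJ patchE.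
rewrite (Fubini ih) [RHS]integral_mkcond; apply: eq_integral => s _; rewrite patchE.
case: ifPn => sK; last first.
  by rewrite integral0_eq// => t _; rewrite hE (negbTE sK) if_same.
rewrite fineK; last first.
  by apply: (@integrable_fin_num _ MR R mu J mJ); apply: fK; move: sK; rewrite inE.
by rewrite [RHS]integral_mkcond; apply: eq_integral => t _; rewrite hE sK patchE.
Qed.

Lemma cintegral_fubini (J K : set R) (H : R -> R -> R[i]) : measurable J -> measurable K ->
  @cmeasurable R _ (MR * MR)%type (fun z => H z.1 z.2) ->
  (forall t, J t -> cint1 K (H t)) -> (forall s, K s -> cint1 J (H^~ s)) ->
  (\int[mu2]_(z in J `*` K) (cabs (H z.1 z.2))%:E < +oo)%E ->
  cintegral J (fun t => cintegral K (H t)) = cintegral K (fun s => cintegral J (H^~ s)).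
Proof.
move=> mJ mK mH hJ hK hy; have mJK := measurable_rect mJ mK.
apply: complex_eq => /=.
- apply: (@rect_fubini J K (fun t s => complex.Re (H t s))) => //.
  + exact: mH.1.
  + by move=> t Jt; apply: cint1_Re => //; exact: hJ.
  + by move=> s Ks; apply: cint1_Re => //; exact: hK.
  + apply: le_lt_trans hy; apply: nnint_le => //.
    * exact: (measurableT_comp _ mH.1).
    * exact: measurable_cabs.
    * by move=> z _; exact: Re_le_cabs.
- apply: (@rect_fubini J K (fun t s => complex.Im (H t s))) => //.
  + exact: mH.2.
  + by move=> t Jt; apply: cint1_Im => //; exact: hJ.
  + by move=> s Ks; apply: cint1_Im => //; exact: hK.
  + apply: le_lt_trans hy; apply: nnint_le => //.
    * exact: (measurableT_comp _ mH.2).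
    * exact: measurable_cabs.
    * by move=> z _; exact: Im_le_cabs.
Qed.

Definition ccont f := continuous (fun x : R => complex.Re (f x)) /\ continuous (fun x : R => complex.Im (f x)).

Definition is_cderive (t : R) F (z : R[i]) :=
  is_derive t (1 : R) (fun x => complex.Re (F x)) (complex.Re z) /\
  is_derive t (1 : R) (fun x => complex.Im (F x)) (complex.Im z).

Lemma is_cderive_ccont F f : (forall t, is_cderive t F (f t)) -> ccont F.
Proof.
move=> h; split => x; apply: differentiable_continuous; apply/derivable1_diffP.
- by have [[]] := h x.
- by have [_ []] := h x.
Qed.

Lemma ccont_cmeasurable f : ccont f -> @cmeasurable R _ MR f.
Proof. by move=> [h1 h2]; split; exact: continuous_measurable_fun. Qed.

Lemma ccont_cst (c : R[i]) : ccont (fun=> c).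
Proof. by split => x; exact: cst_continuous. Qed.

Lemma ccontD f g : ccont f -> ccont g -> ccont (fun x => f x + g x).
Proof.
move=> [f1 f2] [g1 g2]; split.
- under eq_fun do rewrite cReD; move=> x.
  by apply: cvgD; [exact: f1|exact: g1].
- under eq_fun do rewrite cImD; move=> x.
  by apply: cvgD; [exact: f2|exact: g2].
Qed.

Lemma ccontM f g : ccont f -> ccont g -> ccont (fun x => f x * g x).
Proof.
move=> [f1 f2] [g1 g2]; split.
- under eq_fun do rewrite cReM; move=> x.
  by apply: cvgB; apply: cvgM; [exact: f1|exact: g1|exact: f2|exact: g2].
- under eq_fun do rewrite cImM; move=> x.
  by apply: cvgD; apply: cvgM; [exact: f1|exact: g2|exact: f2|exact: g1].
Qed.

Lemma ccont_conj f : ccont f -> ccont (fun x => (f x)^cj).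
Proof.
move=> [f1 f2]; split.
- by under eq_fun do rewrite cRe_conj.
- by under eq_fun do rewrite cIm_conj; move=> x; apply: cvgN; exact: f2.
Qed.

Lemma ccont_sum (T : Type) (s : seq T) (f : T -> R -> R[i]) :
  (forall i, ccont (f i)) -> ccont (fun x => \sum_(i <- s) f i x).
Proof.
move=> h; elim: s => [|a s IH]; first by under eq_fun do rewrite big_nil; exact: ccont_cst.
by under eq_fun do rewrite big_cons; exact: ccontD.
Qed.

Lemma ccont_cabs f : ccont f -> continuous (fun x : R => cabs (f x)).
Proof.
move=> [f1 f2]; under eq_fun do rewrite cabsE; move=> x.
apply: (@continuous_comp _ _ _ (fun x => complex.Re (f x) ^+ 2 + complex.Im (f x) ^+ 2) Num.sqrt x); last exact: sqrt_continuous.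
by apply: cvgD; apply: cvgM; [exact: f1|exact: f1|exact: f2|exact: f2].
Qed.

Lemma is_cderive_cst t (c : R[i]) : is_cderive t (fun=> c) 0.
Proof. by split; exact: is_derive_cst. Qed.

Lemma is_cderiveD t F G z w : is_cderive t F z -> is_cderive t G w ->
  is_cderive t (fun x => F x + G x) (z + w).
Proof.
move=> [f1 f2] [g1 g2]; split.
- under eq_fun do rewrite cReD; rewrite cReD; exact: is_deriveD.
- under eq_fun do rewrite cImD; rewrite cImD; exact: is_deriveD.
Qed.

Lemma is_cderiveM t F G z w : is_cderive t F z -> is_cderive t G w ->
  is_cderive t (fun x => F x * G x) (z * G t + F t * w).
Proof.
move=> [f1 f2] [g1 g2]; split.
- under eq_fun do rewrite cReM; rewrite cReD !cReM.
  apply: is_derive_eq; rewrite /GRing.scale/=; ring.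
- under eq_fun do rewrite cImM; rewrite cImD !cImM.
  apply: is_derive_eq; rewrite /GRing.scale/=; ring.
Qed.

Lemma is_cderiveZ t c F z : is_cderive t F z -> is_cderive t (fun x => c * F x) (c * z).
Proof. by move=> h; have := is_cderiveM (is_cderive_cst t c) h; rewrite mul0r add0r. Qed.

Lemma is_cderive_conj t F z : is_cderive t F z -> is_cderive t (fun x => (F x)^cj) (z^cj).
Proof.
move=> [f1 f2]; split.
- by under eq_fun do rewrite cRe_conj; rewrite cRe_conj.
- by under eq_fun do rewrite cIm_conj; rewrite cIm_conj; exact: is_deriveN.
Qed.

Lemma is_cderive_sum (T : Type) (s : seq T) t (F : T -> R -> R[i]) (z : T -> R[i]) :
  (forall i, is_cderive t (F i) (z i)) ->
  is_cderive t (fun x => \sum_(i <- s) F i x) (\sum_(i <- s) z i).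
Proof.
move=> h; elim: s => [|a s IH].
  by under eq_fun do rewrite big_nil; rewrite big_nil; exact: is_cderive_cst.
by under eq_fun do rewrite big_cons; rewrite big_cons; exact: is_cderiveD.
Qed.

Lemma is_cderive_expi t (c : R) : is_cderive t (fun x => expi (c * x)) ('i * c%:C * expi (c * t)).
Proof.
have h : is_derive t 1 (fun x => c * x) c.
  by apply: is_derive_eq; rewrite /GRing.scale/= mulr1.
split => /=.
- have := @is_derive1_comp _ (@cos R) (fun x => c * x) t _ _ (is_derive_cos _) h.
  by rewrite /comp => h1; apply: is_derive_eq; rewrite /GRing.scale/=; ring.
- have := @is_derive1_comp _ (@sin R) (fun x => c * x) t _ _ (is_derive_sin _) h.
  by rewrite /comp => h1; apply: is_derive_eq; rewrite /GRing.scale/=; ring.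
Qed.

Lemma ccont_expi (c : R) : ccont (fun x => expi (c * x)).
Proof. by apply: is_cderive_ccont => t; exact: is_cderive_expi. Qed.

Lemma real_ftc (F f : R -> R) (a b : R) : a <= b -> continuous f ->
  (forall t, is_derive t (1 : R) F (f t)) -> \int[mu]_(x in `[a, b]) f x = F b - F a.
Proof.
rewrite le_eqVlt => /predU1P[<-|ab] cf dF.
  by rewrite subrr set_itv1 Rintegral_set1.
have cF : continuous F.
  by move=> x; apply: differentiable_continuous; apply/derivable1_diffP; case: (dF x).
rewrite /Rintegral (@continuous_FTC2 R f F a b ab) //.
- exact: continuous_subspaceT.
- split => [x _||].
  + by case: (dF x).
  + exact: cvg_at_right_filter (cF a).
  + exact: cvg_at_left_filter (cF b).
- by move=> x _; rewrite derive1E; case: (dF x).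
Qed.

Lemma cintegral_ftc F f (a b : R) : a <= b -> ccont f -> (forall t, is_cderive t F (f t)) ->
  cintegral `[a, b] f = F b - F a.
Proof.
move=> ab [c1 c2] dF; apply: complex_eq; rewrite ?cReD ?cImD ?cReN ?cImN/=.
- by apply: (@real_ftc (fun t => complex.Re (F t)) (fun t => complex.Re (f t))) => // t; case: (dF t).
- by apply: (@real_ftc (fun t => complex.Im (F t)) (fun t => complex.Im (f t))) => // t; case: (dF t).
Qed.

Lemma ccont_bounded f (a b : R) : ccont f -> exists2 M : R, 0 <= M & forall t, a <= t <= b -> cabs (f t) <= M.
Proof.
move=> /ccont_cabs cf.
have [ab|ba] := leP a b; last first.
  by exists 0 => // t /andP[h1 h2]; have := lt_le_trans ba (le_trans h1 h2); rewrite ltxx.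
have [c _ hc] := @EVT_max R (fun x => cabs (f x)) a b ab (continuous_subspaceT cf).
by exists (cabs (f c)); [exact: cabs_ge0|move=> t tab; apply: hc; rewrite in_itv].
Qed.

Lemma integral_itv_cst (a b M : R) : a <= b -> (\int[mu]_(x in `[a, b]) M%:E = (M * (b - a))%:E)%E.
Proof.
move=> ab; transitivity (M%:E * mu `[a, b])%E; first exact: (integral_cst mu (measurable_itv _) M%:E).
rewrite lebesgue_measure_itv/= lte_fin; case: ltP => [_|ba]; first by rewrite -EFinB -EFinM.
by rewrite mule0 (_ : b = a) ?subrr ?mulr0//; apply/eqP; rewrite eq_le ba ab.
Qed.

Lemma itv_cint1 f (a b M : R) : @cmeasurable R _ MR f -> (forall t, a <= t <= b -> cabs (f t) <= M) ->
  cint1 `[a, b] f.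
Proof.
move=> mf h; apply: (@cint1_le _ _ _ (fun=> `|M|)) => //.
  by move=> x; rewrite /= in_itv => /h/le_trans -> //; exact: ler_norm.
have [ab|ba] := leP a b; first by rewrite integral_itv_cst// ltry.
by rewrite set_itv_ge ?integral_set0// -leNgt bnd_simp.
Qed.

Lemma ccont_cint1 f (a b : R) : ccont f -> cint1 `[a, b] f.
Proof.
move=> cf; have [M _ hM] := ccont_bounded a b cf.
exact: itv_cint1 (ccont_cmeasurable cf) hM.
Qed.

Lemma cabs_cintegral_itv f (a b M : R) : a <= b -> @cmeasurable R _ MR f -> 0 <= M ->
  (forall t, a <= t <= b -> cabs (f t) <= M) -> cabs (cintegral `[a, b] f) <= M * (b - a).
Proof.
move=> ab mf M0 h; apply: cabs_cintegral_bound => //.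
apply: (@le_trans _ _ (\int[mu]_(x in `[a, b]) M%:E)%E).
  apply: (@nnint_le _ MR R mu `[a, b]%classic (measurable_itv _) (fun x => cabs (f x)) (fun=> M)) => //.
  - exact: measurable_cabs.
  - by move=> x _; exact: cabs_ge0.
by rewrite integral_itv_cst.
Qed.

Lemma cintegral_itv_cat f (a b c : R) : a <= b -> b <= c -> cint1 `[a, c] f ->
  cintegral `[a, c] f = cintegral `[a, b] f + cintegral `[b, c] f.
Proof.
move=> ab bc hf; have mf := hf.1.
have E : (`[a, c] = `[a, b] `|` `]b, c])%classic.
  apply/seteqP; split => x /=; rewrite !in_itv/=.
    by move=> /andP[h1 h2]; case: (leP x b) => h; [left|right]; rewrite ?h1 ?h2.
  by case=> /andP[h1 h2]; [rewrite h1 (le_trans h2)|rewrite h2 (le_trans ab (ltW h1))].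
rewrite E cintegral_setU//; first last.
- by rewrite -E.
- apply/disj_setPS => x /=; rewrite !in_itv/= => -[/andP[_ h1] /andP[h2 _]].
  by have := lt_le_trans h2 h1; rewrite ltxx.
have hb : cint1 `]b, c] f.
  apply: cint1_subset hf => // x /=; rewrite !in_itv/= => /andP[h1 ->].
  by rewrite (le_trans ab (ltW h1)).
congr (_ + _); congr (_ +i* _).
- by apply: (@Rintegral_itv_obnd_cbnd R b (BRight c)); exact: cint1_Re.
- by apply: (@Rintegral_itv_obnd_cbnd R b (BRight c)); exact: cint1_Im.
Qed.

Lemma cintegral_itv1 f (a b : R) : b <= a -> cintegral `[a, b] f = 0.
Proof.
rewrite le_eqVlt => /predU1P[->|ba]; apply: complex_eq => /=.
- by rewrite set_itv1 Rintegral_set1.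
- by rewrite set_itv1 Rintegral_set1.
- by rewrite set_itv_ge ?Rintegral_set0// -leNgt bnd_simp.
- by rewrite set_itv_ge ?Rintegral_set0// -leNgt bnd_simp.
Qed.

Lemma oriented_cintegralB f (c a b : R) : a <= b -> (forall x y, cint1 `[x, y] f) ->
  oriented_cintegral c b f - oriented_cintegral c a f = cintegral `[a, b] f.
Proof.
move=> ab hf; rewrite /oriented_cintegral.
have [ca|ac] := leP c a.
  rewrite (cintegral_itv1 _ ca) (cintegral_itv1 _ (le_trans ca ab)).
  by rewrite (cintegral_itv_cat ca ab)// !subr0 addrAC subrr add0r.
rewrite (cintegral_itv1 f (ltW ac)).
have [cb|bc] := leP c b.
  by rewrite (cintegral_itv1 f cb) (cintegral_itv_cat (ltW ac) cb)// subr0 sub0r opprK addrC.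
rewrite (cintegral_itv1 f (ltW bc)) (cintegral_itv_cat ab (ltW bc))//; ring.
Qed.

Lemma cintegral_ep (n : int) (s b : R) : n != 0 -> s <= b ->
  cintegral `[s, b] (fun t => (ep n t)^cj) = ((ep n s)^cj - (ep n b)^cj) / ('i * n%:~R).
Proof.
move=> n0 sb.
have nC : 'i * n%:~R != 0 :> R[i].
  by rewrite mulf_neq0// ?intr_eq0// neq0Ci.
have -> : (fun t => (ep n t)^cj) = (fun t : R => expi (- n%:~R * t)).
  by apply/funext => t; rewrite /ep -expiN mulNr.
rewrite (@cintegral_ftc (fun t => (- ('i * n%:~R)^-1) * expi (- n%:~R * t)))//; first last.
- move=> t; have := is_cderiveZ (- ('i * n%:~R)^-1) (is_cderive_expi t (- n%:~R)).
  congr is_cderive; have -> : (- n%:~R)%:C = - n%:~R :> R[i] by rewrite rmorphN/= rmorph_int.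
  by rewrite mulrN (mulNr ('i * _)) mulrNN mulrA mulVf ?mul1r.
- exact: ccont_expi.
by rewrite /ep -!expiN !mulNr; ring.
Qed.

Lemma real_ftc1 (f : R -> R) (a t : R) : a < t -> continuous f ->
  is_derive t (1 : R) (fun x => \int[mu]_(s in `[a, x]) f s) (f t).
Proof.
move=> ab cf; have tt1 : t < t + 1 by rewrite ltrDl.
have fi : mu.-integrable `[a, (t + 1)%R] (EFin \o f).
  apply: continuous_compact_integrable; first exact: segment_compact.
  exact: continuous_subspaceT.
have [h1 h2] := continuous_FTC1_closed tt1 fi ab (cf t).
by apply: DeriveDef => //; rewrite -derive1E.
Qed.

Lemma is_cderive_cintegral f (a t : R) : a < t -> ccont f ->
  is_cderive t (fun x => cintegral `[a, x] f) (f t).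
Proof. by move=> ab [c1 c2]; split => /=; exact: real_ftc1. Qed.

Lemma is_cderive_near t F G z : (\forall x \near t, F x = G x) -> is_cderive t F z -> is_cderive t G z.
Proof.
move=> FG [h1 h2]; split.
- by apply: near_eq_is_derive h1; apply: filterS FG => x ->.
- by apply: near_eq_is_derive h2; apply: filterS FG => x ->.
Qed.

(** The base point is moved to t - 1, so that t lies in the interior of an ordinary interval
    whatever the position of c. *)
Lemma is_cderive_oriented f (c t : R) : ccont f -> is_cderive t (fun x => oriented_cintegral c x f) (f t).
Proof.
move=> cf; have h : is_cderive t (fun x => oriented_cintegral c (t - 1) f + cintegral `[(t - 1)%R, x] f) (0 + f t).
  apply: is_cderiveD; first exact: is_cderive_cst.
  by apply: is_cderive_cintegral => //; rewrite gtrBl.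
rewrite add0r in h; apply: is_cderive_near h; near=> x.
rewrite -(@oriented_cintegralB f c (t - 1) x) ?subrKC//.
  by apply: ltW; near: x; apply: lt_nbhsr; rewrite gtrBl.
by move=> a b; exact: ccont_cint1.
Unshelve. all: by end_near.
Qed.

End ComplexCalculus.

(** * The linear equation with square integrable potential *)

Section DuhamelStrichartz.
Context {R : realType}.
Local Notation mu := (@lebesgue_measure R).
Local Notation MR := (measurableTypeR R).
Local Notation mu2 := (mu \x mu)%E.
Let mC := @measurable_circle R.
Let mT := @measurable_torus2 R.
Implicit Types (G : R -> R -> R[i]) (V W : R * R -> R) (a b : R) (n k l : int).

Lemma cconj1 : (1 : R[i])^cj = 1.
Proof. exact: cconj_real. Qed.

(** G plays the role of potential times solution: V has L^2 norm at most a and W has L^4 norm at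
    most b over one space-time period. Integrability of the slices is asked at every time, not only
    almost every time. *)
Definition forcing G V W a b : Prop :=
  [/\ @cmeasurable R _ (MR * MR)%type (fun z => G z.1 z.2) /\
      (forall t, circle t -> cint1 circle (G t)),
      measurable_fun [set: MR * MR] V /\ measurable_fun [set: MR * MR] W,
      [/\ forall z, 0 <= V z, forall z, 0 <= W z, 0 <= a & 0 <= b],
      forall z, torus2 z -> cabs (G z.1 z.2) <= V z * W z &
      (\int[mu2]_(z in torus2) (V z ^+ 2)%:E <= (a ^+ 2)%:E)%E /\
      (\int[mu2]_(z in torus2) (W z ^+ 4)%:E <= (b ^+ 4)%:E)%E].

(** The n-th coefficient of G after undoing the free evolution, i.e. the integrand of Duhamel's
    formula in the interaction picture. *)
Definition twisted G n (s : R) : R[i] := expi (s * n%:~R ^+ 2) * sfourier G n s.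

(** The last clause keeps only k = -n^2, where the weight is 1: it is an l^2 bound for the integrals
    of the twisted coefficients over a full period. *)
Lemma dual_bound : exists2 C : R, 0 < C & forall G V W a b, forcing G V W a b ->
  [/\ forall n, cint1 circle (sfourier G n),
      forall s1 s2, uniq s1 -> uniq s2 ->
        \sum_(p <- box s1 s2) (modw p)^-1 * cabs (stfourier G p) ^+ 2 <= C * (a * b) ^+ 2 &
      bsum (fun n => cabs (stfourier G (n, - n ^+ 2)) ^+ 2) (C * (a * b) ^+ 2)].
Proof.
have [C C0 hC] := @dual_strichartz R; exists C => //.
move=> G V W a b [[mG iG] [mV mW] [V0 W0 a0 b0] GVW [hV hW]].
have [h1 h2] := hC G V W a b mG iG mV mW V0 W0 a0 b0 GVW hV hW; split => // s us.
pose s2 := undup [seq - n ^+ 2 | n <- s].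
have := h2 s s2 us (undup_uniq _); apply: le_trans; rewrite sum_box.
rewrite big_seq [leRHS]big_seq; apply: ler_sum => n ns.
have ms : - n ^+ 2 \in s2 by rewrite mem_undup; apply: map_f.
rewrite (bigD1_seq _ ms (undup_uniq _))/= /modw/= addNr brk0 powR1 invr1 mul1r lerDl.
apply: sumr_ge0 => k _; rewrite mulr_ge0 ?exprn_ge0 ?cabs_ge0//.
by rewrite invr_ge0 ltW// (@modw_gt0 R (n, k)).
Qed.

Lemma forcing_restrict G V W a b (A : set R) : measurable A -> forcing G V W a b ->
  forcing (fun t x => (\1_A t)%:C * G t x) V W a b.
Proof.
move=> mA [[mG iG] mVW pos GVW hVW]; split => //.
- split; last by move=> t Ct; apply: cint1Z => //; exact: iG.
  by apply: cmeasurableM => //; apply: (@cmeasurable_fst_comp R (fun t => (\1_A t)%:C)); apply: cmeasurable_real.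
- move=> z Tz; apply: le_trans (GVW z Tz); rewrite cabsM cabs_real indicE.
  by case: (_ \in A); rewrite ?normr1 ?mul1r// normr0 mul0r cabs_ge0.
Qed.

(** For these two values of c no integrability of f is involved, and indicator functions take no
    others. *)
Lemma fourierZ (f : R -> R[i]) (c : R[i]) n : (c = 0 \/ c = 1) -> fourier (fun x => c * f x) n = c * fourier f n.
Proof.
case=> ->; rewrite ?mul1r ?mul0r /fourier; last first.
  by congr (_ * _); apply: eq_cintegral => x _; rewrite mul1r.
by rewrite (@eq_cintegral _ _ _ (fun=> 0)) ?cintegral0 ?mulr0// => x _; rewrite !mul0r.
Qed.

Lemma sfourier_restrict G (A : set R) n t :
  sfourier (fun t x => (\1_A t)%:C * G t x) n t = (\1_A t)%:C * sfourier G n t.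
Proof.
by rewrite /sfourier fourierZ// indicE; case: (_ \in A); [right|left].
Qed.

Lemma cintegral_restrict (A D : set R) (f : R -> R[i]) : A `<=` D ->
  cintegral D (fun x => (\1_A x)%:C * f x) = cintegral A f.
Proof.
move=> AD; apply: complex_eq => /=; rewrite /Rintegral; congr fine;
  rewrite integral_mkcond [RHS]integral_mkcond; apply: eq_integral => x _;
  rewrite !patchE; (case: ifPn => xD; last first;
    [by rewrite ifN//; apply: contra xD; rewrite !inE; exact: AD|]);
  by rewrite indicE; case: ifP => _; rewrite ?mul1r// mul0r.
Qed.

Lemma stfourierE G n k : stfourier G (n, k) =
  (pi *+ 2)^-1%:C * cintegral circle (fun s => twisted G n s * (ep (k + n ^+ 2) s)^cj).
Proof.
rewrite /stfourier /fourier; congr (_ * _); apply: eq_cintegral => s _ /=.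
rewrite /twisted epD cconjM /ep -!expiN rmorphXn/= (mulrC (expi (s * _))) -[RHS]mulrA; congr (_ * _).
by rewrite mulrCA (mulrC s) -expiD subrr expi0 mulr1.
Qed.

(** Multiplying G by the indicator of [t1, t2] preserves the domination by V W, so the bound for a
    full period holds on every subinterval with the same constant. *)
Lemma dual_interval : exists2 C : R, 0 < C & forall G V W a b, forcing G V W a b ->
  forall t1 t2 : R, 0 <= t1 -> t2 <= pi *+ 2 ->
  bsum (fun n => cabs (cintegral `[t1, t2] (twisted G n)) ^+ 2) (C * (a * b) ^+ 2).
Proof.
have [C C0 hC] := dual_bound; have P0 := @twopi_gt0 R.
exists ((pi *+ 2) ^+ 2 * C); first by rewrite mulr_gt0// exprn_gt0.
move=> G V W a b fG t1 t2 t10 t22.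
have [_ _ hd] := hC _ _ _ _ _ (forcing_restrict (measurable_itv `[t1, t2]) fG).
move=> s us; rewrite -mulrA; apply: le_trans (bsumZ (sqr_ge0 (pi *+ 2)) hd us).
apply: ler_sum => n _; rewrite stfourierE addNr.
rewrite (@eq_cintegral _ circle _ (fun s => (\1_`[t1, t2] s)%:C * twisted G n s)); last first.
  by move=> r _; rewrite ep0 cconj1 mulr1 /twisted sfourier_restrict mulrCA.
rewrite cintegral_restrict; last first.
  move=> r; rewrite circleE /= in_itv/= => /andP[h1 h2].
  by rewrite (le_trans t10 h1) (le_trans h2 t22).
rewrite cabsM cabs_real ger0_norm ?invr_ge0 ?(ltW P0)// -exprMn mulVKf// gt_eqF//.
Qed.

(** The integral up to t is written over the full circle with an indicator, which makes it jointly
    measurable and ready for Fubini's theorem. *)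
Definition duhamel G n (t : R) : R[i] :=
  cintegral circle (fun s => (\1_[set r | r <= t] s)%:C * twisted G n s).

Lemma duhamelE G n t : circle t -> duhamel G n t = cintegral `[0, t] (twisted G n).
Proof.
rewrite circleE => /andP[t0 t2]; rewrite /duhamel -(@cintegral_restrict `[0, t] circle)/=.
  apply: eq_cintegral => s; rewrite circleE => /andP[s0 s2]; congr (_%:C * _).
  by rewrite !indicE; congr (_%:R); congr nat_of_bool; apply/idP/idP; rewrite !inE/= in_itv/= s0.
move=> s /=; rewrite in_itv circleE/= => /andP[-> h]; exact: le_trans h t2.
Qed.

Lemma cmeasurable_expi_sqr n : @cmeasurable R _ MR (fun s => expi (s * n%:~R ^+ 2)).
Proof. by apply: cmeasurable_expi; apply: measurable_funM. Qed.

Lemma cint1_twisted G n : cint1 circle (sfourier G n) -> cint1 circle (twisted G n).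
Proof.
move=> h; have := @cint1_bounded_mul _ _ _ _ 1 mC h (cmeasurable_expi_sqr n).
rewrite /twisted; under [X in _ -> cint1 _ X]eq_fun do rewrite mulrC.
by apply => x; rewrite cabs_expi.
Qed.

Lemma measurable_triangle : @cmeasurable R _ (MR * MR)%type (fun z => (\1_[set r : R | r <= z.1] z.2)%:C).
Proof.
apply: cmeasurable_real.
have -> : (fun z : R * R => \1_[set r : R | r <= z.1] z.2 : R) = \1_[set z : R * R | z.2 <= z.1].
  by apply/funext => z; rewrite !indicE; congr (_%:R); congr nat_of_bool; apply/idP/idP; rewrite !inE.
apply: measurable_indic; rewrite -[X in measurable X]setTI.
apply: measurable_fun_le => //.
Qed.

Lemma cmeasurable_duhamel G n : cint1 circle (sfourier G n) -> @cmeasurable R _ MR (duhamel G n).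
Proof.
move=> h; apply: (@cmeasurable_cintegral _ _ (fun t s => (\1_[set r : R | r <= t] s)%:C * twisted G n s)) => //.
apply: cmeasurableM; first exact: measurable_triangle.
by apply: cmeasurable_snd_comp; exact: (cint1_twisted h).1.
Qed.

Lemma indic_cabs_le (A : set R) (s : R) (z : R[i]) : cabs ((\1_A s)%:C * z) <= cabs z.
Proof.
rewrite cabsM cabs_real indicE; case: (_ \in A); rewrite ?normr1 ?mul1r//.
by rewrite normr0 mul0r cabs_ge0.
Qed.

Lemma cint1_indic (A D : set R) (f : R -> R[i]) : measurable D -> measurable A -> cint1 D f ->
  cint1 D (fun s => (\1_A s)%:C * f s).
Proof.
move=> mD mA hf; apply: (@cint1_le _ _ _ (fun s => cabs (f s))) => //.
- by apply: cmeasurableM; [exact: cmeasurable_real|exact: hf.1].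
- exact: measurable_cabs hf.1.
- by move=> s _; exact: indic_cabs_le.
- exact: hf.2.
Qed.

Lemma cabs_duhamel_le G n : cint1 circle (sfourier G n) -> exists2 M : R, 0 <= M & forall t, cabs (duhamel G n t) <= M.
Proof.
move=> /cint1_twisted h; pose M := fine (\int[mu]_(s in circle) (cabs (twisted G n s))%:E)%E.
have ME : (\int[mu]_(s in circle) (cabs (twisted G n s))%:E = M%:E)%E.
  by rewrite fineK// ge0_fin_numE ?h.2//; apply: integral_ge0 => s _; rewrite lee_fin cabs_ge0.
exists M; first by rewrite fine_ge0//; apply: integral_ge0 => s _; rewrite lee_fin cabs_ge0.
move=> t; apply: cabs_cintegral_bound => //.
  by apply: cmeasurableM; [apply: cmeasurable_real; apply: measurable_indic; exact: measurable_itv `]-oo, t]|exact: h.1].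
rewrite -ME; apply: nnint_le => //.
- apply: measurable_cabs; apply: cmeasurableM; last exact: h.1.
  by apply: cmeasurable_real; apply: measurable_indic; exact: measurable_itv `]-oo, t].
- exact: measurable_cabs h.1.
- by move=> s _; exact: cabs_ge0.
- by move=> s _; exact: indic_cabs_le.
Qed.

(* Exchanging the integrals over the triangle s <= t turns the primitive into a factor 1/l. *)
Lemma duhamel_coefficient G n l : cint1 circle (sfourier G n) -> l != 0 ->
  cintegral circle (fun t => duhamel G n t * (ep l t)^cj) =
  (cintegral circle (fun s => twisted G n s * (ep l s)^cj) -
   cintegral circle (twisted G n)) / ('i * l%:~R).
Proof.
move=> hn l0; have ht := cint1_twisted hn.
have mep : @cmeasurable R _ MR (fun t => (ep l t)^cj) by apply: cmeasurable_conj; exact: cmeasurable_ep.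
have bep t : cabs (ep l t)^cj <= 1 :> R by rewrite cabs_conj cabs_ep.
pose H t s := ((\1_[set r : R | r <= t] s)%:C * twisted G n s) * (ep l t)^cj.
have mle t : measurable [set r : R | r <= t].
  by have := measurable_itv `]-oo, t]; rewrite set_itvNyc.
have cle t : cint1 circle (fun s => (\1_[set r : R | r <= t] s)%:C * twisted G n s).
  exact: cint1_indic.
transitivity (cintegral circle (fun t => cintegral circle (H t))).
  apply: eq_cintegral => t _; rewrite mulrC -cintegralZ//.
  by apply: eq_cintegral => s _; rewrite mulrC.
have mH : @cmeasurable R _ (MR * MR)%type (fun z => H z.1 z.2).
  apply: cmeasurableM; last exact: (cmeasurable_fst_comp mep).
  apply: cmeasurableM; first exact: measurable_triangle.
  by apply: cmeasurable_snd_comp; exact: ht.1.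
rewrite cintegral_fubini//; first last.
- apply: (@le_lt_trans _ _ (\int[mu2]_(z in circle `*` circle) (cabs (twisted G n z.2))%:E)%E).
    apply: nnint_le => //.
    + exact: measurable_cabs.
    + by apply: measurable_cabs; apply: cmeasurable_snd_comp; exact: ht.1.
    + by move=> z _; exact: cabs_ge0.
    + move=> z _; rewrite /H cabsM -[leRHS]mulr1; apply: ler_pM => //; try exact: cabs_ge0.
      exact: indic_cabs_le.
  rewrite ge0_integral_rect//; first last.
  + by move=> z; rewrite lee_fin cabs_ge0.
  + by apply/measurable_EFinP; apply: measurable_cabs; apply: cmeasurable_snd_comp; exact: ht.1.
  have E : (\int[mu]_(s in circle) (cabs (twisted G n s))%:E)%E \is a fin_num.
    by rewrite ge0_fin_numE ?ht.2//; apply: integral_ge0 => s _; rewrite lee_fin cabs_ge0.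
  by rewrite /= -(fineK E) circle_integral_cst ltry.
- move=> s _; apply: (@cint1_le _ _ _ (fun=> cabs (twisted G n s))) => //.
  + by have := mH; case=> m1 m2; split; [exact: (measurableT_comp m1 (pair2_measurable s))|exact: (measurableT_comp m2 (pair2_measurable s))].
  + move=> t _; rewrite /H cabsM -[leRHS]mulr1; apply: ler_pM => //; try exact: cabs_ge0.
    exact: indic_cabs_le.
  + by rewrite circle_integral_cst ltry.
- by move=> t _; apply: (@cint1_bounded_mul _ _ _ _ 1) => //; exact: cmeasurable_cst.
transitivity (cintegral circle (fun s => ('i * l%:~R)^-1 * (twisted G n s * (ep l s)^cj - twisted G n s))).
  apply: eq_cintegral => s; rewrite circleE => /andP[s0 s2].
  have sub : (`[s, (pi *+ 2)%R] `<=` circle)%classic.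
    by move=> t; rewrite circleE /= in_itv/= => /andP[h ->]; rewrite (le_trans s0 h).
  rewrite (@eq_cintegral _ _ _ (fun t => twisted G n s * ((\1_`[s, (pi *+ 2)%R] t)%:C * (ep l t)^cj))); last first.
    move=> t; rewrite circleE => /andP[t0 t2]; rewrite /H mulrAC [RHS]mulrC; congr (_%:C * _ * _).
    by rewrite !indicE; congr (_%:R); congr nat_of_bool; apply/idP/idP; rewrite !inE/= in_itv/= t2 andbT.
  have he : cint1 circle (fun t : R => (ep l t)^cj).
    by apply: (@itv_cint1 R _ _ _ 1) => // t _.
  rewrite cintegralZ//; last by apply: cint1_indic => //; exact: measurable_itv.
  rewrite cintegral_restrict// cintegral_ep//.
  (* The upper end point contributes the constant 1, the source of the second integral in the
     formula. *)
  have -> : (ep l (pi *+ 2))^cj = 1 :> R[i].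
    by rewrite -[X in ep l X]add0r ep_periodic /ep mulr0 expi0 cconj1.
  by rewrite mulrA mulrBr mulr1 mulrC.
have h1 : cint1 circle (fun s => twisted G n s * (ep l s)^cj).
  exact: (@cint1_bounded_mul _ _ _ _ 1).
rewrite cintegralZ//; last by apply: cint1D => //; exact: cint1N.
by rewrite cintegralB// mulrC.
Qed.

End DuhamelStrichartz.

Section DuhamelSolutions.
Context {R : realType}.
Local Notation mu := (@lebesgue_measure R).
Local Notation MR := (measurableTypeR R).
Local Notation mu2 := (mu \x mu)%E.
Let mC := @measurable_circle R.
Let mT := @measurable_torus2 R.
Implicit Types (G : R -> R -> R[i]) (V W : R * R -> R) (a b : R) (n k l : int).

(** The n-th coefficient of the linear evolution of data [A0] forced by c G; c will be i times the
    sign of the equation. *)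
Definition duhamel_sol (A0 : int -> R[i]) (c : R[i]) G n (t : R) : R[i] :=
  (expi (t * n%:~R ^+ 2))^cj * (A0 n + c * duhamel G n t).

Lemma cL2_duhamel_sol A0 c G n : cint1 circle (sfourier G n) -> cL2 (duhamel_sol A0 c G n).
Proof.
move=> h; have [M M0 hM] := cabs_duhamel_le h.
apply: (@cL2_bounded _ _ (cabs (A0 n) + cabs c * M)).
  apply: cmeasurableM; first by apply: cmeasurable_conj; exact: cmeasurable_expi_sqr.
  apply: cmeasurableD; first exact: cmeasurable_cst.
  by apply: cmeasurableM; [exact: cmeasurable_cst|exact: cmeasurable_duhamel].
move=> t; rewrite /duhamel_sol cabsM cabs_conj cabs_expi mul1r.
by apply: le_trans (cabsD _ _) _; rewrite lerD2l cabsM ler_wpM2l ?cabs_ge0.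
Qed.

Lemma cabs_duhamel_sol A0 c G n t : cabs c <= 1 ->
  cabs (duhamel_sol A0 c G n t) ^+ 2 <= 2 * cabs (A0 n) ^+ 2 + 2 * cabs (duhamel G n t) ^+ 2.
Proof.
move=> hc; rewrite /duhamel_sol cabsM cabs_conj cabs_expi mul1r.
set x := cabs (A0 n); set y := cabs (duhamel G n t).
have h : cabs (A0 n + c * duhamel G n t) <= x + y.
  by apply: le_trans (cabsD _ _) _; rewrite lerD2l cabsM ler_piMl ?cabs_ge0.
apply: (@le_trans _ _ ((x + y) ^+ 2)).
  by apply: lerXn2r; rewrite ?nnegrE ?cabs_ge0// addr_ge0 ?cabs_ge0.
rewrite -subr_ge0 (_ : _ - _ = (x - y) ^+ 2) ?sqr_ge0//; ring.
Qed.

Lemma duhamel_sol_bound : exists2 C : R, 0 < C & forall G V W a b A0 c S0,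
  forcing G V W a b -> cabs c <= 1 -> bsum (fun n => cabs (A0 n) ^+ 2) S0 ->
  forall t, circle t -> bsum (fun n => cabs (duhamel_sol A0 c G n t) ^+ 2) (C * (S0 + (a * b) ^+ 2)).
Proof.
have [C C0 hC] := @dual_interval R; exists (2 * (1 + C)); first by rewrite mulr_gt0 ?addr_gt0.
move=> G V W a b A0 c S0 fG hc hS t Ct; have := Ct; rewrite circleE => /andP[t0 t2].
have hI := hC _ _ _ _ _ fG 0 t (lexx _) t2.
have S00 := bsum_ge0 hS.
move=> s us.
apply: (@le_trans _ _ (2 * S0 + 2 * (C * (a * b) ^+ 2))); last first.
  rewrite -mulrDr -mulrA ler_pM2l// mulrDl mul1r mulrDr -addrA lerD2l.
  by rewrite addrA lerDr addr_ge0 ?sqr_ge0// mulr_ge0// ltW.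
apply: le_trans (bsumD (bsumZ (ler0n _ 2) hS) (bsumZ (ler0n _ 2) hI) us).
by apply: ler_sum => n _; rewrite -(duhamelE _ _ Ct); exact: cabs_duhamel_sol.
Qed.

Lemma fourier_duhamel_sol A0 c G n k : cint1 circle (sfourier G n) ->
  fourier (duhamel_sol A0 c G n) k = (pi *+ 2)^-1%:C *
   (A0 n * cintegral circle (fun t => (ep (k + n ^+ 2) t)^cj) +
    c * cintegral circle (fun t => duhamel G n t * (ep (k + n ^+ 2) t)^cj)).
Proof.
move=> h; rewrite /fourier; congr (_ * _).
have mep : @cmeasurable R _ MR (fun t => (ep (k + n ^+ 2) t)^cj).
  by apply: cmeasurable_conj; exact: cmeasurable_ep.
have bep t : cabs (ep (k + n ^+ 2) t)^cj <= 1 :> R by rewrite cabs_conj cabs_ep.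
have h1 : cint1 circle (fun t : R => (ep (k + n ^+ 2) t)^cj).
  by apply: (@itv_cint1 R _ _ _ 1) => // t _.
have [M M0 hM] := cabs_duhamel_le h.
have h2 : cint1 circle (fun t : R => duhamel G n t * (ep (k + n ^+ 2) t)^cj).
  apply: (@cint1_bounded_mul _ _ _ _ 1) => //.
  by apply: (@itv_cint1 R _ _ _ M) => //; exact: cmeasurable_duhamel.
rewrite -cintegralZ// -[X in _ + X]cintegralZ// -cintegralD//; [|exact: cint1Z|exact: cint1Z].
apply: eq_cintegral => t _; rewrite /duhamel_sol.
have -> : expi (- (k%:~R * t)) = expi (t * n%:~R ^+ 2) * (ep (k + n ^+ 2) t)^cj.
  rewrite /ep -expiN -expiD intrD rmorphXn/=; congr expi; ring.
have := expiK (t * n%:~R ^+ 2); rewrite expiN; set e := expi _; set f := (ep _ _)^cj => ee.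
by rewrite [LHS]mulrACA (mulrC e^cj) ee mul1r mulrDl !mulrA.
Qed.

(** Off the parabola the free part has no coefficient, and the Duhamel part equals c (z1 - z0) / (i
    l) with l the modulation. The weight times l^(-2) is of order -9/8: for z1 this is better than
    the -7/8 controlled by duality, and for z0, which does not depend on k, it is summable in k. *)
Lemma fourier_duhamel_sol_le A0 c G n k : cint1 circle (sfourier G n) -> cabs c <= 1 ->
  k + n ^+ 2 != 0 ->
  modw (n, k) * cabs (fourier (duhamel_sol A0 c G n) k) ^+ 2 <=
  8 * ((modw (n, k))^-1 * cabs (stfourier G (n, k)) ^+ 2) +
  8 * (brk (k + n ^+ 2) `^ (- (9 / 8)) * cabs (stfourier G (n, - n ^+ 2)) ^+ 2).
Proof.
move=> h hc l0; set l := k + n ^+ 2 in l0 *.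
rewrite fourier_duhamel_sol// -/l duhamel_coefficient//.
have -> : cintegral circle (fun t => (ep l t)^cj) = 0 :> R[i].
  have := ip_ep (R := R) 0 l; rewrite eq_sym (negbTE l0) => <-.
  by apply: eq_cintegral => t _; rewrite ep0 mul1r.
rewrite mulr0 add0r.
set z1 := stfourier G (n, k); set z0 := stfourier G (n, - n ^+ 2).
have -> : (pi *+ 2)^-1%:C * (c * ((cintegral circle (fun s => twisted G n s * (ep l s)^cj) -
    cintegral circle (twisted G n)) / ('i * l%:~R))) = c * ((z1 - z0) / ('i * l%:~R)).
  rewrite /z1 /z0 !stfourierE -/l addNr [in RHS](@eq_cintegral _ circle (fun s => twisted G n s * (ep 0 s)^cj) (twisted G n)); last first.
    by move=> s _; rewrite ep0 cconj1 mulr1.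
  by rewrite -mulrBr mulrCA !mulrA.
have lge : 1 <= `|l%:~R| :> R by rewrite -intr_norm ler1z -gtz0_ge1 normr_gt0.
have lp : 0 < `|l%:~R| :> R := lt_le_trans ltr01 lge.
have cl : cabs ('i * l%:~R : R[i]) = `|l%:~R|.
  by rewrite cabsM cabs_i mul1r -(rmorph_int (real_complex R)) cabs_real.
set x := cabs z1; set y := cabs z0.
have hz : cabs (c * ((z1 - z0) / ('i * l%:~R))) <= (x + y) / `|l%:~R|.
  rewrite !cabsM cabsV cl; apply: le_trans (ler_piMl _ hc) _.
    by rewrite mulr_ge0 ?cabs_ge0// invr_ge0 ltW.
  by rewrite ler_wpM2r ?invr_ge0 ?(ltW lp)// cabsB.
rewrite /modw/= -/l; set B := brk l : R.
have B0 : 0 < B := brk_gt0 l; have B1 : 1 <= B := brk_ge1 l.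
have Bl : B <= 2 * `|l%:~R| by rewrite /B /brk mulr2n mulrDl mul1r lerD2r.
have hl : (`|l%:~R| ^+ 2)^-1 <= 4 * B `^ (- 2).
  rewrite powRN powR_mulrn ?(ltW B0)// ler_pdivlMr ?exprn_gt0// ler_pdivrMl ?exprn_gt0//.
  have := ler_pM (ltW B0) (ltW B0) Bl Bl; rewrite -!expr2 => /le_trans; apply.
  by rewrite exprMn mulrC -natrX.
have step : cabs (c * ((z1 - z0) / ('i * l%:~R))) ^+ 2 <= (2 * x ^+ 2 + 2 * y ^+ 2) * (4 * B `^ (- 2)).
  apply: (@le_trans _ _ (((x + y) / `|l%:~R|) ^+ 2)).
    by apply: lerXn2r; rewrite ?nnegrE ?cabs_ge0// (le_trans (cabs_ge0 _) hz).
  rewrite exprMn exprVn; apply: ler_pM; rewrite ?sqr_ge0 ?invr_ge0 ?sqr_ge0//.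
  rewrite -subr_ge0 (_ : _ - _ = (x - y) ^+ 2) ?sqr_ge0//; ring.
apply: (@le_trans _ _ (B `^ (7 / 8) * ((2 * x ^+ 2 + 2 * y ^+ 2) * (4 * B `^ (- 2))))).
  by rewrite ler_wpM2l// powR_ge0.
have E : B `^ (7 / 8) * B `^ (- 2) = B `^ (- (9 / 8)).
  by rewrite -powRD; [congr (_ `^ _); field|rewrite (gt_eqF B0) implybT].
have -> : B `^ (7 / 8) * ((2 * x ^+ 2 + 2 * y ^+ 2) * (4 * B `^ (- 2))) =
  8 * (B `^ (- (9 / 8)) * x ^+ 2) + 8 * (B `^ (- (9 / 8)) * y ^+ 2) by rewrite -E; ring.
rewrite lerD2r ler_pM2l// ler_wpM2r ?sqr_ge0// -powRN ler_powR// lerN2.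
by rewrite ler_pM2r ?invr_gt0// ler_nat.
Qed.

End DuhamelSolutions.

Section DuhamelL4.
Context {R : realType}.
Local Notation mu := (@lebesgue_measure R).
Local Notation MR := (measurableTypeR R).
Local Notation mu2 := (mu \x mu)%E.
Let mC := @measurable_circle R.
Let mT := @measurable_torus2 R.
Implicit Types (G : R -> R -> R[i]) (V W : R * R -> R) (a b : R) (n k l : int).

Lemma bounded_convergence (D : set R) (r : nat -> R -> R) (B e : R) : measurable D ->
  (mu D < +oo)%E -> (forall N, measurable_fun [set: MR] (r N)) ->
  (forall N t, D t -> 0 <= r N t <= B) ->
  (forall t d, D t -> 0 < d -> exists N0, forall N, (N0 <= N)%N -> r N t <= d) ->
  0 < e -> exists N0, forall N, (N0 <= N)%N -> (\int[mu]_(t in D) (r N t)%:E <= e%:E)%E.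
Proof.
move=> mD Dy mr rB rc e0; pose F N x : \bar R := (r N x)%:E.
have mF N : measurable_fun D (F N) by apply/measurable_EFinP; apply: measurable_funTS; exact: (mr N).
have H1 : {ae mu, forall x, D x -> F ^~ x @ \oo --> cst 0%E x}.
  apply: aeW => x Dx; apply: cvg_EFin; first by near=> N.
  apply/cvgrPdist_le => /= d d0; have [N0 h] := rc x d Dx d0.
  exists N0 => // N /= /h hN; rewrite sub0r normrN ger0_norm//.
  by have /andP[] := rB N x Dx.
have H2 : mu.-integrable D (cst `|B|%:E).
  apply/integrableP; split; first exact: measurable_cst.
  under eq_integral => x _ do rewrite /= normr_id.
  rewrite [X in (X < _)%E](integral_cst mu mD `|B|%:E).
  by apply: lte_mul_pinfty; rewrite ?lee_fin.
have H3 : {ae mu, forall x, forall N, D x -> (`|F N x| <= cst `|B|%:E x)%E}.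
  apply: aeW => x N /(rB N)/andP[h1 h2]; rewrite /F /= lee_fin ger0_norm//.
  exact: le_trans h2 (ler_norm _).
have [_ _ hlim] := @dominated_convergence _ MR R mu D mD F (cst 0%E) (cst `|B|%:E)
  mF (measurable_cst _) H1 H2 H3.
move: hlim; rewrite integral0 => /(_ [set x | (x < e%:E)%E]) [].
  by apply: open_nbhs_nbhs; split; [exact: open_ereal_lt_ereal|rewrite /= lte_fin].
by move=> N _ hN; exists N => k Nk; apply/ltW; exact: (hN k Nk).
Unshelve. all: by end_near. Qed.

Lemma sum_nrm2_le s (f : int -> R -> R[i]) (B : R) : (forall n, cL2 (f n)) ->
  (forall t, circle t -> \sum_(n <- s) cabs (f n t) ^+ 2 <= B) ->
  \sum_(n <- s) nrm2 (f n) <= pi *+ 2 * B.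
Proof.
move=> hf hB; rewrite -lee_fin -sumEFin.
rewrite (eq_bigr (fun n => L2norm_sq (f n))); last by move=> n _; rewrite nrm2E.
rewrite /L2norm_sq -nnint_sum//; first last.
- by move=> n x; rewrite exprn_ge0 ?cabs_ge0.
- by move=> n; apply: measurable_cabsX; exact: (hf n).1.
rewrite mulrC -circle_integral_cst; apply: nnint_le => //.
- by apply: measurable_sum => n; apply: measurable_cabsX; exact: (hf n).1.
- by move=> x _; apply: sumr_ge0 => n _; rewrite exprn_ge0 ?cabs_ge0.
Qed.

Lemma sum_mkcond_le s n (x : R) : uniq s -> 0 <= x ->
  \sum_(k <- s) (if k == n then x else 0) <= x.
Proof.
move=> us x0; have [ns|ns] := boolP (n \in s).
  by rewrite (bigD1_seq n)//= eqxx big1 ?addr0// => k /negbTE ->.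
by rewrite big1_seq// => k /andP[_ ks]; case: eqP => // kn; rewrite -kn ks in ns.
Qed.

(** On the parabola k = -n^2 the weight is 1, and Bessel's inequality in time reduces the
    coefficients to the uniform l^2 bound at each time; elsewhere [fourier_duhamel_sol_le]
    applies. *)
Lemma duhamel_weighted_sum : exists2 C : R, 0 < C & forall G V W a b A0 c S0,
  forcing G V W a b -> cabs c <= 1 -> bsum (fun n => cabs (A0 n) ^+ 2) S0 ->
  forall s1 s2, uniq s1 -> uniq s2 ->
  \sum_(p <- box s1 s2) modw p * cabs (fourier (duhamel_sol A0 c G p.1) p.2) ^+ 2 <=
  C * (S0 + (a * b) ^+ 2).
Proof.
have [C1 C10 h1] := @duhamel_sol_bound R; have [C2 C20 h2] := @dual_bound R.
have p1 : 1 < 9 / 8 :> R by lra.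
have [B B0 hB] := bsum_brk p1; have P0 := @twopi_gt0 R.
exists (C1 + 8 * C2 + 8 * (B * C2)).
  by rewrite !addr_gt0// mulr_gt0// mulr_gt0.
move=> G V W a b A0 c S0 fG hc hS s1 s2 u1 u2; rewrite sum_box.
have [hi hdual hdiag] := h2 _ _ _ _ _ fG.
have hb := h1 _ _ _ _ _ _ _ _ fG hc hS.
set T := S0 + (a * b) ^+ 2 in hb *; set X := (a * b) ^+ 2 in hdual hdiag *.
have X0 : 0 <= X by exact: sqr_ge0.
have XT : X <= T by rewrite lerDr; exact: bsum_ge0 hS.
pose D n := duhamel_sol A0 c G n.
have hD n : cL2 (D n) by exact: cL2_duhamel_sol.
pose z0 n := cabs (stfourier G (n, - n ^+ 2)) ^+ 2.
apply: (@le_trans _ _ (\sum_(n <- s1) (\sum_(k <- s2) (if k == - n ^+ 2 then nrm2 (D n) / (pi *+ 2) else 0) +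
   \sum_(k <- s2) 8 * ((modw (n, k))^-1 * cabs (stfourier G (n, k)) ^+ 2) +
   \sum_(k <- s2) 8 * (z0 n * brk (k + n ^+ 2) `^ (- (9 / 8)))))).
  apply: ler_sum => n _; rewrite -!big_split/=; apply: ler_sum => k _.
  have n1 : 0 <= 8 * ((modw (n, k))^-1 * cabs (stfourier G (n, k)) ^+ 2).
    by rewrite mulr_ge0// mulr_ge0 ?exprn_ge0 ?cabs_ge0// invr_ge0 ltW// modw_gt0.
  have n2 : 0 <= 8 * (z0 n * brk (k + n ^+ 2) `^ (- (9 / 8))).
    by rewrite mulr_ge0// mulr_ge0 ?exprn_ge0 ?cabs_ge0// brkpow_ge0.
  case: eqP => [kn|kn].
    apply: (@le_trans _ _ (nrm2 (D n) / (pi *+ 2))); last by rewrite -addrA lerDl addr_ge0.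
    rewrite kn /modw/= addNr brk0 powR1 mul1r.
    exact: (bsum_pt (- n ^+ 2) (bessel (hD n))).
  rewrite add0r (mulrC (z0 n)); apply: fourier_duhamel_sol_le => //.
  by apply/eqP => h; apply: kn; apply/eqP; rewrite -addr_eq0 h.
rewrite !big_split/= [leRHS]mulrDl [X in _ <= X + _]mulrDl; apply: lerD; first apply: lerD.
- apply: (@le_trans _ _ (\sum_(n <- s1) nrm2 (D n) / (pi *+ 2))).
    by apply: ler_sum => n _; apply: sum_mkcond_le => //; rewrite divr_ge0 ?nrm2_ge0 ?ltW.
  rewrite -mulr_suml ler_pdivrMr// mulrC; apply: sum_nrm2_le => // t Ct; exact: hb.
- rewrite -mulrA; under eq_bigr => n _ do rewrite -mulr_sumr.
  rewrite -mulr_sumr ler_pM2l// -(sum_box s1 s2 (fun p => (modw p)^-1 * cabs (stfourier G p) ^+ 2)).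
  by apply: le_trans (hdual s1 s2 u1 u2) _; rewrite ler_pM2l.
- apply: (@le_trans _ _ (\sum_(n <- s1) 8 * (z0 n * B))).
    apply: ler_sum => n _; rewrite -mulr_sumr -mulr_sumr ler_pM2l// ler_wpM2l ?exprn_ge0 ?cabs_ge0//.
    exact: (bsum_inj (addIr (n ^+ 2)) hB).
  rewrite -mulr_sumr -mulr_suml -!mulrA ler_pM2l// mulrC ler_pM2l//.
  by apply: le_trans (hdiag _ u1) _; rewrite ler_pM2l.
Qed.

Lemma common_rank (s : seq int) (P : int -> nat -> Prop) :
  (forall n, exists N0, forall N, (N0 <= N)%N -> P n N) ->
  exists N0, forall N, (N0 <= N)%N -> forall n, n \in s -> P n N.
Proof.
move=> h; elim: s => [|n s [N1 IH]]; first by exists 0%N.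
have [N2 h2] := h n; exists (maxn N1 N2) => N; rewrite geq_max => /andP[l1 l2] m.
by rewrite inE => /predU1P[->|ms]; [exact: h2|exact: IH].
Qed.

Lemma torus2_sum_sqr s (h : int -> R -> R[i]) : uniq s -> (forall n, cL2 (h n)) ->
  (\int[mu2]_(z in torus2) (cabs (tp s (fun n => h n z.1) z.2) ^+ 2)%:E =
   (pi *+ 2 * \sum_(n <- s) nrm2 (h n))%:E)%E.
Proof.
move=> us hh; have mh n : @cmeasurable R _ MR (h n) by exact: (hh n).1.
rewrite ge0_integral_rect//; first last.
- by move=> z; rewrite lee_fin exprn_ge0 ?cabs_ge0.
- apply/measurable_EFinP; apply: measurable_cabsX; apply: cmeasurable_sum => n.
  apply: cmeasurableM; first by apply: cmeasurable_fst_comp.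
  by apply: cmeasurable_snd_comp; exact: cmeasurable_ep.
under eq_integral => t _ do rewrite /= tp_integral_sqr// mulr_sumr.
have mc n : measurable_fun [set: MR] (fun t => cabs (h n t) ^+ 2) by exact: measurable_cabsX.
rewrite nnint_sum//; first last.
- by move=> n t; rewrite mulr_ge0 ?exprn_ge0 ?cabs_ge0// ltW// twopi_gt0.
- by move=> n; apply: measurable_funM.
rewrite mulr_sumr -sumEFin; apply: eq_bigr => n _.
rewrite nnintZ//; first last.
- exact/ltW/twopi_gt0.
- by move=> t; rewrite exprn_ge0 ?cabs_ge0.
by rewrite EFinM -nrm2E.
Qed.

(** Each coefficient, though not a trigonometric polynomial in time, is approximated in L^2 of the
    circle by its partial sums. These satisfy the Strichartz bound uniformly, and the bound passes
    to the limit by [L4_lower_semicontinuity]. *)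
Lemma duhamel_L4 : exists2 C : R, 0 < C & forall G V W a b A0 c S0,
  forcing G V W a b -> cabs c <= 1 -> bsum (fun n => cabs (A0 n) ^+ 2) S0 ->
  forall s, uniq s ->
  (\int[mu2]_(z in torus2) (cabs (tp s (fun n => duhamel_sol A0 c G n z.1) z.2) ^+ 4)%:E <=
   ((C * (S0 + (a * b) ^+ 2)) ^+ 2)%:E)%E.
Proof.
have [K K0 hK] := @strichartz_L4 R; have [C C0 hC] := duhamel_weighted_sum.
exists (K ^+ 2 * C); first by rewrite mulr_gt0// exprn_gt0.
move=> G V W a b A0 c S0 fG hc hS s us.
have hi n : cint1 circle (sfourier G n).
  have [C2 _ h2] := @dual_bound R; have [h _ _] := h2 _ _ _ _ _ fG; exact: h.
pose D n := duhamel_sol A0 c G n; have hD n : cL2 (D n) by exact: cL2_duhamel_sol.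
have mt (h : int -> R -> R[i]) : (forall n, cL2 (h n)) ->
    @cmeasurable R _ (MR * MR)%type (fun z => tp s (fun n => h n z.1) z.2).
  move=> hh; apply: cmeasurable_sum => n; apply: cmeasurableM.
    by apply: cmeasurable_fst_comp; exact: (hh n).1.
  by apply: cmeasurable_snd_comp; exact: cmeasurable_ep.
apply: (L4_lower_semicontinuity mT torus2_lty) => //.
- by apply: measurable_cabs; exact: mt.
- by move=> z; exact: cabs_ge0.
- exact: sqr_ge0.
move=> e e0; have P0 := @twopi_gt0 R.
(* The error e is shared among the spatial modes in s; adding 1 keeps the denominator positive when
   s is empty. *)
pose d := e / (pi *+ 2 * ((size s)%:R + 1)).
have d0 : 0 < d by rewrite divr_gt0// mulr_gt0// ltr_wpDl.
have [N0 /(_ N0 (leqnn _)) hN] := common_rank s (fun n => fourier_complete (hD n) d0).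
pose T n t := tp (zr N0) (fourier (D n)) t.
exists (fun z => cabs (tp2 (box s (zr N0)) (fun p => fourier (D p.1) p.2) z)).
exists (fun z => cabs (tp s (fun n => D n z.1 - T n z.1) z.2)).
have hT n : cL2 (fun t => D n t - T n t) by apply: cL2B => //; exact: cL2_tp.
split.
- by split=> [|z]; [apply: measurable_cabs; exact: cmeasurable_tp2|exact: cabs_ge0].
- by split=> [|z]; [apply: measurable_cabs; exact: (mt (fun n t => D n t - T n t) hT)|exact: cabs_ge0].
- move=> [t x] _; rewrite tp2_box /=; apply: le_trans (cabsD _ _).
  rewrite /tp -big_split/= le_eqVlt; apply/orP; left; apply/eqP; congr cabs.
  by apply: eq_bigr => n _; rewrite -mulrDl addrC subrK.
- apply: le_trans (hK _ _ _ us (zr_uniq _)) _; rewrite lee_fin.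
  rewrite -mulrA exprMn -(exprM K 2 2) ler_pM2l ?exprn_gt0//.
  apply: lerXn2r; rewrite ?nnegrE.
  + by apply: sumr_ge0 => p _; rewrite mulr_ge0 ?exprn_ge0 ?cabs_ge0// ltW// modw_gt0.
  + by rewrite mulr_ge0 ?(ltW C0)// addr_ge0 ?sqr_ge0//; exact: bsum_ge0 hS.
  + exact: (hC _ _ _ _ _ _ _ _ fG hc hS s (zr N0) us (zr_uniq N0)).
- rewrite (torus2_sum_sqr us hT) lee_fin.
  apply: (@le_trans _ _ (pi *+ 2 * \sum_(n <- s) d)).
    by rewrite ler_pM2l// big_seq [leRHS]big_seq; apply: ler_sum => n; exact: hN.
  have E : d * (pi *+ 2 * ((size s)%:R + 1)) = e by rewrite divfK// gt_eqF// mulr_gt0// ltr_wpDl.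
  rewrite big_const_seq count_predT iter_addr_0 -[d *+ _]mulr_natr -[leRHS]E.
  by rewrite mulrCA ler_pM2l// ler_pM2l// lerDl.
Qed.

End DuhamelL4.

(** * Closing the linear estimate on one short window *)

Section LocalLipschitz.
Context {R : realType}.
Local Notation mu := (@lebesgue_measure R).
Local Notation MR := (measurableTypeR R).
Local Notation mu2 := (mu \x mu)%E.
Let mC := @measurable_circle R.
Let mT := @measurable_torus2 R.
Implicit Types (G dl : R -> R -> R[i]) (V W : R * R -> R) (a b tau : R) (n k l : int).

(** This function has two roles: it is the unknown of the L^4 estimate and the factor W in the
    domination of its own forcing. *)
Definition cutoff tau dl (z : R * R) : R := \1_`[0, tau] z.1 * cabs (dl z.1 z.2).

Definition difference_eq tau dl G (c : R[i]) : Prop :=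
  [/\ 0 <= tau <= pi *+ 2, @cmeasurable R _ (MR * MR)%type (fun z => dl z.1 z.2),
      forall t, 0 <= t <= tau -> cL2 (dl t), cabs c <= 1 &
      forall t n, 0 <= t <= tau -> fourier (dl t) n = duhamel_sol (fourier (dl 0)) c G n t].

Lemma measurable_cut tau : measurable_fun [set: MR * MR] (fun z : MR * MR => \1_`[0, tau] z.1 : R).
Proof.
have mI : measurable_fun [set: MR] (\1_`[0, tau] : MR -> R).
  by apply: measurable_indic; exact: measurable_itv.
exact: (measurableT_comp mI measurable_fst).
Qed.

(** [duhamel_L4] covers finitely many spatial modes. At each time the remaining tail of [dl] tends
    to 0 in L^2 and is bounded by the energy, so bounded convergence makes it small in space-time
    and lower semicontinuity finishes. *)
Lemma local_L4 : exists2 C : R, 0 < C & forall tau dl G V a b c,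
  difference_eq tau dl G c -> forcing G V (cutoff tau dl) a b ->
  (\int[mu2]_(z in torus2) (cutoff tau dl z ^+ 4)%:E <=
   ((C * (nrm2 (dl 0%R) + (a * b) ^+ 2)) ^+ 2)%:E)%E.
Proof.
have [C C0 hC] := @duhamel_L4 R; exists C => //.
move=> tau dl G V a b c [/andP[tau0 tau2] mdl hdl hc eq_dl] fG.
have P0 := @twopi_gt0 R; have P1 : 1 <= pi *+ 2 :> R.
  by rewrite mulr2n (le_trans _ (lerD (pi_ge2 R) (pi_ge2 R)))// -natrD ler1n.
have h0 : cL2 (dl 0) by apply: hdl; rewrite lexx.
have hS := bessel h0; set S0 := nrm2 (dl 0) / (pi *+ 2) in hS.
have S0le : S0 <= nrm2 (dl 0) by rewrite ler_pdivrMr// ler_peMr// nrm2_ge0.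
have [C' C'0 hC'] := @duhamel_sol_bound R.
have hb := hC' _ _ _ _ _ _ _ _ fG hc hS; set B := C' * _ in hb.
have circ t : 0 <= t <= tau -> circle t.
  by rewrite circleE => /andP[-> h]; exact: le_trans h tau2.
have nrmB t : 0 <= t <= tau -> nrm2 (dl t) <= pi *+ 2 * B.
  move=> ht; apply: parseval_le; first exact: hdl.
  move=> N; under eq_bigr => n _ do rewrite eq_dl//.
  by apply: hb; [exact: circ|exact: zr_uniq].
pose D n t := duhamel_sol (fourier (dl 0)) c G n t.
have hi n : cint1 circle (sfourier G n).
  have [C2 _ h2] := @dual_bound R; have [h _ _] := h2 _ _ _ _ _ fG; exact: h.
have hD n : cL2 (D n) by exact: cL2_duhamel_sol.
pose E M (z : R * R) := tp (zr M) (fun n => D n z.1) z.2.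
have mE M : @cmeasurable R _ (MR * MR)%type (E M).
  apply: cmeasurable_sum => n; apply: cmeasurableM.
    by apply: cmeasurable_fst_comp; exact: (hD n).1.
  by apply: cmeasurable_snd_comp; exact: cmeasurable_ep.
have i01 z : 0 <= \1_`[0, tau] (z : R) :> R by rewrite indicE.
have i1 z : \1_`[0, tau] (z : R) <= 1 :> R by rewrite indicE lern1 leq_b1.
have mi := measurable_cut tau.
apply: (L4_lower_semicontinuity mT torus2_lty) => //.
- by apply: measurable_funM => //; exact: measurable_cabs.
- by move=> z; rewrite mulr_ge0 ?cabs_ge0.
- exact: sqr_ge0.
move=> e e0.
pose dM M (z : R * R) := \1_`[0, tau] z.1 * cabs (dl z.1 z.2 - E M z).
have md M : measurable_fun [set: MR * MR] (dM M).
  by apply: measurable_funM => //; apply: measurable_cabs; exact: cmeasurableB.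
pose r M t := fine (\int[mu]_(x in circle) (dM M (t, x) ^+ 2)%:E)%E.
have rE M t : 0 <= t <= tau -> (\int[mu]_(x in circle) (dM M (t, x) ^+ 2)%:E = (r M t)%:E)%E /\
    r M t = nrm2 (fun x => dl t x - tp (zr M) (fourier (dl t)) x).
  move=> ht; have hh : cL2 (fun x => dl t x - tp (zr M) (fourier (dl t)) x).
    by apply: cL2B; [exact: hdl|exact: cL2_tp].
  have EE : (\int[mu]_(x in circle) (dM M (t, x) ^+ 2)%:E =
      L2norm_sq (fun x => (dl t x - tp (zr M) (fourier (dl t)) x)%R))%E.
    have mt : `[0, tau]%classic t by rewrite /= in_itv.
    apply: eq_integral => x _; rewrite /dM /= indicE (mem_set mt) mul1r.
    congr (cabs (_ - _) ^+ 2)%:E; rewrite /E /tp /=; apply: eq_bigr => n _.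
    by rewrite eq_dl.
  by split; rewrite /r EE nrm2E.
have r0 M t : ~~ (0 <= t <= tau) -> (\int[mu]_(x in circle) (dM M (t, x) ^+ 2)%:E = 0)%E.
  move=> ht; have nt : ~ `[0, tau]%classic t by rewrite /= in_itv/=; exact/negP.
  by rewrite integral0_eq// => x _; rewrite /dM /= indicE (memNset nt) mul0r expr0n.
have [||||M0 /(_ M0 (leqnn _)) hM0] := @bounded_convergence R circle r (pi *+ 2 * B) e mC _ _ _ _ e0.
- by rewrite [X in (X < _)%E]lebesgue_circle ltry.
- move=> M; apply: (@measurable_Rintegral_slice R circle (fun z => dM M z ^+ 2)) => //.
  exact: measurable_funX.
- move=> M t _; have [ht|ht] := boolP (0 <= t <= tau); last first.
    rewrite /r r0//= lexx mulr_ge0 ?(ltW P0)//.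
    by apply: bsum_ge0 (hb 0 _); rewrite circleE lexx ltW.
  have [_ ->] := rE M t ht; rewrite nrm2_ge0/=; apply: le_trans (nrmB _ ht).
  rewrite nrm2_subr_tp ?zr_uniq//; last exact: hdl.
  rewrite [X in _ + _ * X](_ : _ = 0); last by rewrite big1// => n _; rewrite subrr cabs0 expr0n.
  rewrite mulr0 addr0 gerBl mulr_ge0 ?(ltW P0)//.
  by apply: sumr_ge0 => n _; rewrite exprn_ge0 ?cabs_ge0.
- move=> t d _ d0; have [ht|ht] := boolP (0 <= t <= tau); last first.
    by exists 0%N => N _; rewrite /r r0//= ltW.
  have [N0 hN] := fourier_complete (hdl t ht) d0; exists N0 => N lN.
  by have [_ ->] := rE N t ht; exact: hN.
exists (fun z => cabs (E M0 z)); exists (dM M0); split.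
- by split=> [|z]; [exact: measurable_cabs|exact: cabs_ge0].
- by split=> [//|z]; rewrite mulr_ge0 ?cabs_ge0.
- move=> z _; rewrite /cutoff /dM.
  apply: (@le_trans _ _ (\1_`[0, tau] z.1 * (cabs (E M0 z) + cabs (dl z.1 z.2 - E M0 z)))).
    by rewrite ler_wpM2l//; apply: le_trans (cabsD _ _); rewrite addrC subrK.
  by rewrite mulrDr lerD2r ler_piMl ?cabs_ge0.
- apply: le_trans (hC _ _ _ _ _ _ _ _ fG hc hS _ (zr_uniq M0)) _; rewrite lee_fin.
  have p0 : 0 <= S0 + (a * b) ^+ 2 by rewrite addr_ge0 ?sqr_ge0//; exact: bsum_ge0 hS.
  apply: lerXn2r; rewrite ?nnegrE ?mulr_ge0 ?(ltW C0)//.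
    by apply: le_trans p0 _; rewrite lerD2r.
  by rewrite ler_pM2l// lerD2r.
- rewrite ge0_integral_rect//; first last.
  + by move=> z; rewrite lee_fin sqr_ge0.
  + by apply/measurable_EFinP; exact: measurable_funX.
  apply: le_trans hM0; rewrite le_eqVlt; apply/orP; left; apply/eqP.
  apply: eq_integral => t _; have [ht|ht] := boolP (0 <= t <= tau); last by rewrite /r r0.
  by have [] := rE M0 t ht.
Qed.

(** Undoing the free flow does not change moduli of coefficients, and the increment between two
    times is an integral controlled by [dual_interval]. The argument is symmetric in time, which
    later allows steps in both directions. *)
Lemma local_step : exists2 C : R, 0 < C & forall tau dl G V W a b c,
  difference_eq tau dl G c -> forcing G V W a b ->
  forall t t', 0 <= t <= tau -> 0 <= t' <= tau ->
  nrm2 (dl t) <= 2 * nrm2 (dl t') + C * (a * b) ^+ 2.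
Proof.
have [C C0 hC] := @dual_interval R; have P0 := @twopi_gt0 R.
exists (pi *+ 2 * (2 * C)); first by rewrite !mulr_gt0.
move=> tau dl G V W a b c [/andP[tau0 tau2] mdl hdl hc eq_dl] fG t t' ht ht'.
have circ r : 0 <= r <= tau -> circle r.
  by rewrite circleE => /andP[-> h]; exact: le_trans h tau2.
have hi n : cint1 circle (twisted G n).
  have [C2 _ h2] := @dual_bound R; have [h _ _] := h2 _ _ _ _ _ fG; exact: cint1_twisted.
pose A n r := fourier (dl 0) n + c * duhamel G n r.
have EA n r : 0 <= r <= tau -> cabs (fourier (dl r) n) = cabs (A n r).
  by move=> hr; rewrite eq_dl// /duhamel_sol cabsM cabs_conj cabs_expi mul1r.
have key r1 r2 n : 0 <= r1 <= tau -> 0 <= r2 <= tau -> r1 <= r2 ->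
    A n r2 - A n r1 = c * cintegral `[r1, r2] (twisted G n).
  move=> h1 h2 r12; rewrite /A (duhamelE G n (circ _ h2)) (duhamelE G n (circ _ h1)).
  have /andP[r10 _] := h1; have /andP[_ r2t] := h2.
  have h02 : cint1 `[0, r2] (twisted G n).
    apply: cint1_subset (hi n) => // s; rewrite /= in_itv circleE/= => /andP[-> h].
    exact: le_trans h (le_trans r2t tau2).
  by rewrite (cintegral_itv_cat r10 r12 h02); ring.
have key2 : exists r1 r2, [/\ 0 <= r1, r2 <= pi *+ 2 &
    forall n, cabs (A n t - A n t') <= cabs (cintegral `[r1, r2] (twisted G n))].
  have /andP[t0 t1] := ht; have /andP[t'0 t'1] := ht'.
  have [tt|/ltW tt] := leP t t'.
    exists t, t'; split => // [|n]; first exact: le_trans t'1 tau2.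
    by rewrite -[X in cabs X]opprB cabsN key// cabsM ler_piMl ?cabs_ge0.
  exists t', t; split => // [|n]; first exact: le_trans t1 tau2.
  by rewrite key// cabsM ler_piMl ?cabs_ge0.
have [r1 [r2 [r10 r22 hA]]] := key2.
have hI := hC _ _ _ _ _ fG r1 r2 r10 r22.
have hB := bessel (hdl t' ht').
have -> : 2 * nrm2 (dl t') + pi *+ 2 * (2 * C) * (a * b) ^+ 2 =
    pi *+ 2 * (2 * (nrm2 (dl t') / (pi *+ 2)) + 2 * (C * (a * b) ^+ 2)).
  rewrite mulrDr; congr (_ + _); last by rewrite !mulrA.
  by rewrite [RHS]mulrCA [X in _ = _ * X]mulrC divfK// gt_eqF.
apply: parseval_le; first exact: hdl.
move=> N; apply: le_trans (bsumD (bsumZ (ler0n _ 2) hB) (bsumZ (ler0n _ 2) hI) (zr_uniq N)).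
apply: ler_sum => n _; rewrite (EA n t ht) (EA n t' ht').
set x := cabs (A n t'); set y := cabs (cintegral _ _).
have h : cabs (A n t) <= x + y.
  by rewrite -[A n t](subrK (A n t')) addrC (le_trans (cabsD _ _))// lerD2l hA.
apply: (@le_trans _ _ ((x + y) ^+ 2)).
  by apply: lerXn2r; rewrite ?nnegrE ?cabs_ge0// addr_ge0 ?cabs_ge0.
rewrite -subr_ge0 (_ : _ - _ = (x - y) ^+ 2) ?sqr_ge0//; ring.
Qed.

(** Let b be the L^4 norm of the solution on the window. Then b^2 is at most C (m0 + a^2 b^2) with
    m0 the energy at time 0, and [local_step] compares m0 with the energy at t'. Smallness of a^2
    absorbs the term a^2 b^2, and what remains is linear in the energy at t'. *)
Lemma local_lipschitz : exists2 e0 : R, 0 < e0 & forall tau dl G V a b0 c,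
  difference_eq tau dl G c -> forcing G V (cutoff tau dl) a b0 -> a ^+ 2 <= e0 ->
  forall t t', 0 <= t <= tau -> 0 <= t' <= tau -> nrm2 (dl t) <= 4 * nrm2 (dl t').
Proof.
have [C C0 hC] := local_L4; have [C1 C10 hC1] := local_step.
(* Chosen so that C (C1 + 1) a^2 <= 1/2, the coefficient of the absorbed term. *)
exists ((2 * (C * (C1 + 1)))^-1); first by rewrite invr_gt0 !mulr_gt0 ?addr_gt0.
move=> tau dl G V a b0 c hd fG ae t t' ht ht'.
pose I := (\int[mu2]_(z in torus2) (cutoff tau dl z ^+ 4)%:E)%E.
have I0 : (0 <= I)%E.
  by apply: integral_ge0 => z _; rewrite lee_fin exprn_ge0// mulr_ge0 ?cabs_ge0// indicE.
have Iy : I \is a fin_num.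
  rewrite ge0_fin_numE//; apply: le_lt_trans (ltry (b0 ^+ 4)).
  by case: fG => _ _ _ _ [].
(* The given bound b0 only ensures finiteness; absorption has to be done with the actual norm. *)
pose b := Num.sqrt (Num.sqrt (fine I)).
have b00 : 0 <= b by exact: sqrtr_ge0.
have b4 : b ^+ 4 = fine I by rewrite (exprM _ 2 2) !sqr_sqrtr ?sqrtr_ge0 ?fine_ge0.
have {}fG : forcing G V (cutoff tau dl) a b.
  case: fG => h1 h2 [h3 h4 h5 _] h6 [h7 _]; split => //; split => //.
  by rewrite b4 fineK.
have [/andP[tau0 _] _ _ _ _] := hd.
have h0 : 0 <= (0 : R) <= tau by rewrite lexx.
have := hC _ _ _ _ _ _ _ hd fG; rewrite -/I -(fineK Iy) lee_fin -b4.
set X := C * _ => hX; have X0 : 0 <= X.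
  by rewrite mulr_ge0 ?(ltW C0)// addr_ge0 ?nrm2_ge0 ?sqr_ge0.
have {}hX : b ^+ 2 <= X.
  by rewrite -(ler_pXn2r (n := 2)) ?nnegrE ?exprn_ge0// -exprM.
have s0 := hC1 _ _ _ _ _ _ _ _ hd fG 0 t' h0 ht'.
have s1 := hC1 _ _ _ _ _ _ _ _ hd fG t t' ht ht'.
rewrite exprMn in s0 s1 X X0 hX.
set m := nrm2 (dl t) in s1 *; set m' := nrm2 (dl t') in s0 s1 *; set m0 := nrm2 (dl 0) in s0 X X0 hX.
have m'0 : 0 <= m' by exact: nrm2_ge0.
set y := b ^+ 2 in s0 s1 X X0 hX; have y0 : 0 <= y by exact: sqr_ge0.
set q := a ^+ 2 in s0 s1 X X0 hX ae; have q0 : 0 <= q by exact: sqr_ge0.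
have hq : C * (C1 + 1) * q <= 2^-1.
  have p : 0 < C * (C1 + 1) by rewrite mulr_gt0// addr_gt0.
  by rewrite mulrC -ler_pdivlMr// -invfM.
have Cq0 : 0 <= C * q by rewrite mulr_ge0// ltW.
have Y : y <= C * (2 * m' + (C1 + 1) * q * y).
  apply: le_trans hX _; rewrite /X ler_pM2l//.
  have -> : 2 * m' + (C1 + 1) * q * y = (2 * m' + C1 * (q * y)) + q * y by ring.
  by rewrite lerD2r.
have Y2 : y <= 4 * C * m'.
  have h : C * (C1 + 1) * q * y <= 2^-1 * y by rewrite ler_wpM2r.
  have E : C * (2 * m' + (C1 + 1) * q * y) = 2 * C * m' + C * (C1 + 1) * q * y by ring.
  by rewrite E in Y; lra.
apply: (le_trans s1).
have h2 : C1 * (q * y) <= 2 * m'.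
  apply: (@le_trans _ _ (C1 * (q * (4 * C * m')))).
    by rewrite ler_pM2l// ler_wpM2l.
  have h3 : C * C1 * q * m' <= 2^-1 * m'.
    rewrite ler_wpM2r//; apply: le_trans hq; rewrite ler_wpM2r// ler_pM2l// lerDl//.
  have -> : C1 * (q * (4 * C * m')) = 4 * (C * C1 * q * m') by ring.
  by lra.
by lra.
Qed.

End LocalLipschitz.

(** * Persistence of regularity *)

Section IntervalShift.
Context {R : realType}.
Local Notation mu := (@lebesgue_measure R).
Local Notation MR := (measurableTypeR R).

Lemma Rintegral_shift (t0 : R) (D : set R) (f : R -> R) : measurable D -> measurable_fun [set: MR] f ->
  \int[mu]_(x in [set x : R | D (x + t0)]) f ((x : R) + t0) = \int[mu]_(x in D) f x.
Proof.
move=> mD mf; rewrite /Rintegral; congr fine.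
rewrite [LHS]integralE [RHS]integralE.
have mE : measurable_fun [set: MR] (EFin \o f) by exact/measurable_EFinP.
congr (_ - _)%E.
  rewrite -[RHS](@ge0_integral_shift _ t0)//.
  - by apply: eq_integral => x _; rewrite !funeposE.
  - exact: measurable_funepos.
rewrite -[RHS](@ge0_integral_shift _ t0)//.
- by apply: eq_integral => x _; rewrite !funenegE.
- exact: measurable_funeneg.
Qed.

Lemma shift_itv (t0 a b : R) : [set x : R | (`[t0 + a, t0 + b]%classic : set R) (x + t0)] = `[a, b]%classic.
Proof. by apply/seteqP; split => x /=; rewrite !in_itv/= !(addrC t0) !lerD2r. Qed.

Lemma cintegral_shift_itv (t0 a b : R) (f : R -> R[i]) : @cmeasurable R _ MR f ->
  cintegral `[a, b] (fun s => f (t0 + s)) = cintegral `[t0 + a, t0 + b] f.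
Proof.
move=> [m1 m2]; apply: complex_eq => /=.
- rewrite -(@Rintegral_shift t0 _ _ (measurable_itv _) m1) shift_itv.
  by apply: eq_Rintegral => x _; rewrite addrC.
- rewrite -(@Rintegral_shift t0 _ _ (measurable_itv _) m2) shift_itv.
  by apply: eq_Rintegral => x _; rewrite addrC.
Qed.

End IntervalShift.

Section WickNonlinearity.
Context {R : realType}.
Implicit Types z w : R[i].

Lemma wick_le P z : cabs (wick_nonlinearity P z) <= (1 + `|P|) * (1 + cabs z ^+ 4).
Proof.
rewrite /wick_nonlinearity cabsM cabs_real; set x := cabs z; have x0 : 0 <= x by exact: cabs_ge0.
have p0 : 0 <= `|P| by [].
have xk k : (k < 4)%N -> x ^+ k <= 1 + x ^+ 4.
  move=> k4; have [h|/ltW h] := leP x 1.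
    by apply: (@le_trans _ _ 1); [exact: exprn_ile1|rewrite lerDl exprn_ge0].
  by apply: le_trans (ler_weXn2l h (ltnW k4)) _; rewrite lerDr.
have x4 : x <= 1 + x ^+ 4 := xk 1%N isT.
have x3 : x ^+ 2 * x <= 1 + x ^+ 4 by rewrite -exprSr xk.
apply: (@le_trans _ _ ((x ^+ 2 + `|P|) * x)).
  rewrite ler_wpM2r//; apply: le_trans (ler_normB _ _) _.
  by rewrite ger0_norm ?sqr_ge0.
by rewrite mulrDl mulrDl mul1r lerD// ler_wpM2l.
Qed.

Lemma wick_lipschitz P z w : cabs (wick_nonlinearity P z - wick_nonlinearity P w) <=
  (2 * (cabs z ^+ 2 + cabs w ^+ 2) + `|P|) * cabs (z - w).
Proof.
set x := cabs z; set y := cabs w.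
have x0 : 0 <= x by exact: cabs_ge0.
have y0 : 0 <= y by exact: cabs_ge0.
have -> : wick_nonlinearity P z - wick_nonlinearity P w =
    (x ^+ 2 - P)%:C * (z - w) + (x ^+ 2 - y ^+ 2)%:C * w.
  by rewrite /wick_nonlinearity -/x -/y !rcB; ring.
apply: le_trans (cabsD _ _) _; rewrite !cabsM !cabs_real -/y.
set d := cabs (z - w); have d0 : 0 <= d by exact: cabs_ge0.
have xy : `|x - y| <= d.
  rewrite ler_norml; apply/andP; split.
    rewrite lerNl opprB lerBlDr; have -> : y = cabs (z - (z - w)) by rewrite opprB addrC subrK.
    by apply: le_trans (cabsB _ _) _; rewrite addrC.
  rewrite lerBlDr; have -> : x = cabs ((z - w) + w) by rewrite subrK.
  exact: cabsD.
have h1 : `|x ^+ 2 - P| <= x ^+ 2 + `|P|.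
  by apply: le_trans (ler_normB _ _) _; rewrite ger0_norm ?sqr_ge0.
have h2 : `|x ^+ 2 - y ^+ 2| * y <= d * ((x + y) * y).
  by rewrite subr_sqr normrM (ger0_norm (addr_ge0 x0 y0)) -mulrA ler_wpM2r// mulr_ge0// addr_ge0.
apply: (@le_trans _ _ ((x ^+ 2 + `|P|) * d + d * ((x + y) * y))).
  by apply: lerD => //; rewrite ler_wpM2r.
have p0 : 0 <= `|P| by [].
have h3 : 0 <= x ^+ 2 + y ^+ 2 - x * y by nra.
have := mulr_ge0 d0 h3; nra.
Qed.

Lemma cmeasurable_wick d (T : measurableType d) P (f : T -> R[i]) : cmeasurable f ->
  cmeasurable (fun t => wick_nonlinearity P (f t)).
Proof.
move=> mf; apply: cmeasurableM => //; apply: cmeasurable_real; apply: measurable_funB => //.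
exact: measurable_cabsX.
Qed.

End WickNonlinearity.

Section Solution.
Context {R : realType}.
Local Notation mu := (@lebesgue_measure R).
Local Notation MR := (measurableTypeR R).
Local Notation mu2 := (mu \x mu)%E.
Let mC := @measurable_circle R.
Context (sgn : R) (hsgn : sgn = 1 \/ sgn = -1) (g : R -> R[i]) (u : R -> R -> R[i])
  (hu : is_wick_NLS_solution sgn g u).

Definition force (g : R -> R[i]) (u : R -> R -> R[i]) (s x : R) : R[i] :=
  wick_nonlinearity (wick_constant g) (u s x).
(** Up to the factor i sgn this will be the time derivative of [profile], which is the a_n of the
    overview. *)
Definition tforce g u n (s : R) : R[i] := expi (s * n%:~R ^+ 2) * fourier (force g u s) n.
Definition profile (u : R -> R -> R[i]) n (s : R) : R[i] := expi (s * n%:~R ^+ 2) * fourier (u s) n.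

Lemma sol_measurable : @cmeasurable R _ (MR * MR)%type (fun z => u z.1 z.2).
Proof. by case: hu => -[]. Qed.

Lemma sol_L2 t : cL2 (u t).
Proof. by case: hu => -[/(_ t) /inL2_cL2]. Qed.

Lemma sol_periodic t x : u t (x + pi *+ 2) = u t x.
Proof. by case: hu => -[/(_ t) []]. Qed.

Lemma sol_cmeasurable t : @cmeasurable R _ MR (u t).
Proof. exact: (sol_L2 t).1. Qed.

Lemma sol_L4 (a b : R) :
  (\int[mu2]_(z in `[a, b] `*` circle) (cabs (u z.1 z.2) ^+ 4)%:E < +oo)%E.
Proof.
case: hu => -[_ _ _ /(_ (Num.max `|a| `|b|))] h _ _; apply: le_lt_trans h.
apply: ge0_subset_integral => //.
- exact: measurable_rect (measurable_itv _) mC.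
- exact: measurable_rect (measurable_itv _) mC.
- by apply/measurable_EFinP; apply: measurable_funTS; apply: measurable_cabsX; exact: sol_measurable.
- by move=> z _; rewrite lee_fin exprn_ge0 ?cabs_ge0.
move=> z [/= h h3]; move: h; rewrite in_itv/= => /andP[h1 h2]; split => //=; rewrite in_itv/=.
have ha : `|a| <= Num.max `|a| `|b| by rewrite le_max lexx.
have hb : `|b| <= Num.max `|a| `|b| by rewrite le_max lexx orbT.
rewrite (le_trans h2 (le_trans (ler_norm b) hb)) andbT.
apply: le_trans h1; rewrite lerNl; apply: le_trans ha; by rewrite -normrN ler_norm.
Qed.

Lemma rect_measure (a b : R) :
  mu2 (`[a, b] `*` circle) = (Num.max 0 (b - a) * (pi *+ 2))%:E.
Proof.
have -> : mu2 (`[a, b] `*` circle) = (mu `[a, b] * mu circle)%E by rewrite product_measure1E.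
rewrite lebesgue_circle lebesgue_measure_itv/= lte_fin -subr_gt0.
by case: ltP => _; rewrite -?EFinB -?EFinM ?mul0r ?mul0e.
Qed.

(** At such times the cubic force is integrable in x. The solution class guarantees them only almost
    everywhere; elsewhere a Fourier coefficient of the force has no meaning until regularity is
    known. *)
Definition good (t : R) : Prop := (\int[mu]_(x in circle) (cabs (u t x) ^+ 4)%:E < +oo)%E.

Lemma measurable_slice_L4 : measurable_fun [set: MR]
  (fun t : MR => \int[mu]_(x in circle) (cabs (u t x) ^+ 4)%:E)%E.
Proof.
apply: (@measurable_ge0_integral_slice R circle (fun z => (cabs (u z.1 z.2) ^+ 4)%:E)) => //.
- by apply/measurable_EFinP; apply: measurable_cabsX; exact: sol_measurable.
- by move=> z; rewrite lee_fin exprn_ge0 ?cabs_ge0.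
Qed.

Lemma force_measurable : @cmeasurable R _ (MR * MR)%type (fun z => force g u z.1 z.2).
Proof. by apply: cmeasurable_wick; exact: sol_measurable. Qed.

Lemma good_cint1 t : good t -> cint1 circle (force g u t).
Proof.
move=> gt; set P := wick_constant g.
apply: (@cint1_le _ _ _ (fun x => (1 + `|P|) * (1 + cabs (u t x) ^+ 4))) => //.
- by apply: cmeasurable_wick; exact: sol_cmeasurable.
- apply: measurable_funM => //; apply: measurable_funD => //; apply: measurable_cabsX; exact: sol_cmeasurable.
- by move=> x _; exact: wick_le.
have m4 : measurable_fun [set: MR] (fun x : MR => cabs (u t x) ^+ 4) by apply: measurable_cabsX; exact: sol_cmeasurable.
rewrite nnintZ//; first last.
- by move=> x; rewrite addr_ge0 ?exprn_ge0 ?cabs_ge0.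
- exact: measurable_funD.
apply: lte_mul_pinfty => //.
rewrite nnintD//; last by move=> x; rewrite exprn_ge0 ?cabs_ge0.
by apply: lte_add_pinfty => //; rewrite circle_integral_cst ltry.
Qed.

(** [cabs_fourier_le] holds at every time, with an infinite right side at worst; integrated in time
    it is dominated by the integral of 1 + |u|^4 over the rectangle. *)
Lemma tforce_cint1 n (a b : R) : cint1 `[a, b] (tforce g u n).
Proof.
have mf := force_measurable; set P := wick_constant g.
have h : cint1 `[a, b] (sfourier (force g u) n).
  split; first exact: cmeasurable_sfourier.
  pose h z := (1 + `|P|) * (1 + cabs (u z.1 z.2) ^+ 4).
  have m4 : measurable_fun [set: MR * MR] (fun z : MR * MR => cabs (u z.1 z.2) ^+ 4).
    by apply: measurable_cabsX; exact: sol_measurable.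
  have mh : measurable_fun [set: MR * MR] h by apply: measurable_funM => //; exact: measurable_funD.
  have h0 z : 0 <= h z by rewrite mulr_ge0 ?addr_ge0 ?exprn_ge0 ?cabs_ge0.
  apply: (@le_lt_trans _ _ (\int[mu2]_(z in `[a, b] `*` circle) (h z)%:E)%E).
    rewrite ge0_integral_rect//; first last.
    - exact/measurable_EFinP.
    apply: ge0_le_integral => //.
    - by move=> t _; rewrite lee_fin cabs_ge0.
    - by apply/measurable_EFinP; apply: measurable_funTS; apply: measurable_cabs; exact: cmeasurable_sfourier.
    - apply: measurable_funTS; apply: (@measurable_ge0_integral_slice _ _ (fun z => (h z)%:E)) => //.
      exact/measurable_EFinP.
    - move=> t Ct; apply: (le_trans (cabs_fourier_le _ (cmeasurable_slice t mf))).
      apply: nnint_le => //.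
      + exact: measurable_cabs (cmeasurable_slice t mf).
      + exact: (measurable_slice t mh).
      + by move=> x _; exact: cabs_ge0.
      + by move=> x _; exact: wick_le.
  have mD : measurable (`[a, b] `*` circle : set (MR * MR)) by exact: measurable_rect.
  rewrite nnintZ//; first last.
  - by move=> z; rewrite addr_ge0 ?exprn_ge0 ?cabs_ge0.
  - exact: measurable_funD.
  apply: lte_mul_pinfty => //.
  rewrite nnintD//; last by move=> z; rewrite exprn_ge0 ?cabs_ge0.
  apply: lte_add_pinfty; last exact: sol_L4.
  rewrite [X in (X < _)%E](integral_cst mu2 mD 1%:E) mul1e.
  by rewrite [X in (X < _)%E]rect_measure ltry.
have := @cint1_bounded_mul _ _ _ _ 1 (measurable_itv _) h (cmeasurable_expi_sqr n).
rewrite /tforce; under [X in _ -> cint1 _ X]eq_fun do rewrite mulrC.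
by apply => x; rewrite cabs_expi.
Qed.

Lemma profile_duhamel n (t : R) :
  profile u n t = fourier g n + 'i * sgn%:C * oriented_cintegral 0 t (tforce g u n).
Proof.
case: hu => _ _ /(_ t n); rewrite /profile => ->.
have hK : expi (t * n%:~R ^+ 2) * expi (- (t * n%:~R ^+ 2)) = 1 :> R[i] by rewrite -expiD subrr expi0.
rewrite mulrDr mulrA hK mul1r; congr (_ + _).
rewrite mulrCA; congr (_ * _).
have hZ (a b : R) : cintegral `[a, b] (fun s => expi (- ((t - s) * n%:~R ^+ 2)) * fourier (force g u s) n) =
    expi (- (t * n%:~R ^+ 2)) * cintegral `[a, b] (tforce g u n).
  rewrite -cintegralZ//; last exact: tforce_cint1.
  apply: eq_cintegral => s _; rewrite /tforce mulrA -expiD; congr (expi _ * _); ring.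
by rewrite /oriented_cintegral !hZ -mulrBr mulrA hK mul1r.
Qed.

Lemma profile_increment n (a b : R) : a <= b ->
  profile u n b - profile u n a = 'i * sgn%:C * cintegral `[a, b] (tforce g u n).
Proof.
move=> ab; rewrite !profile_duhamel -(@oriented_cintegralB _ _ 0 a b ab); last first.
  by move=> x y; exact: tforce_cint1.
ring.
Qed.

Lemma cabs_isgn : cabs ('i * sgn%:C) = 1.
Proof. by rewrite cabsM cabs_i mul1r cabs_real; case: hsgn => ->; rewrite ?normrN normr1. Qed.

Lemma fourier_sol0 n : fourier (u 0) n = fourier g n.
Proof.
have := profile_duhamel n 0; rewrite /profile mul0r expi0 mul1r => ->.
by rewrite /oriented_cintegral subrr mulr0 addr0.
Qed.

End Solution.

(** * Short time windows for the solution *)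

Section Windows.
Context {R : realType}.
Local Notation mu := (@lebesgue_measure R).
Local Notation MR := (measurableTypeR R).
Local Notation mu2 := (mu \x mu)%E.
Let mC := @measurable_circle R.
Let mT := @measurable_torus2 R.

Lemma measurable_shift2 (t0 h : R) :
  measurable_fun [set: MR * MR] (fun z : MR * MR => (t0 + z.1, z.2 + h) : MR * MR).
Proof.
apply: measurable_fun_pair => /=.
- by apply: measurable_funD => //; exact: measurable_cst.
- by apply: measurable_funD => //; exact: measurable_cst.
Qed.

Lemma cmeasurable_shift2 (t0 h : R) (F : R -> R -> R[i]) :
  @cmeasurable R _ (MR * MR)%type (fun z => F z.1 z.2) ->
  @cmeasurable R _ (MR * MR)%type (fun z => F (t0 + z.1) (z.2 + h)).
Proof.
move=> [m1 m2]; have ms := measurable_shift2 t0 h.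
by split; [exact: (measurableT_comp m1 ms)|exact: (measurableT_comp m2 ms)].
Qed.

Lemma cL2_shift (f : R -> R[i]) h : 0 <= h <= pi *+ 2 -> (forall x, f (x + pi *+ 2) = f x) ->
  cL2 f -> cL2 (fun x => f (x + h)).
Proof.
move=> hh pf [mf fy]; split.
  by case: mf => m1 m2; split; [exact: (measurableT_comp m1 (measurable_shift h))|exact: (measurableT_comp m2 (measurable_shift h))].
rewrite /L2norm_sq (@ge0_periodic_integral _ (fun y => (cabs (f y) ^+ 2)%:E))//.
- by apply/measurable_EFinP; exact: measurable_cabsX.
- by move=> x; rewrite lee_fin exprn_ge0 ?cabs_ge0.
- by move=> x; rewrite pf.
Qed.

(** Translating in time and using periodicity in x, an integral over a window anywhere in time
    becomes one over the fixed torus with a sharp cut-off, the form used by [forcing]. *)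
Lemma window_integral (F : R * R -> R) (t0 h tau : R) :
  measurable_fun [set: MR * MR] F -> (forall z, 0 <= F z) ->
  (forall t x, F (t, x + pi *+ 2) = F (t, x)) ->
  0 <= h <= pi *+ 2 -> 0 <= tau <= pi *+ 2 ->
  (\int[mu2]_(z in torus2) (\1_`[0%R, tau] z.1 * F ((t0 + z.1)%R, (z.2 + h)%R))%:E =
   \int[mu2]_(z in `[t0, (t0 + tau)%R] `*` circle) (F z)%:E)%E.
Proof.
move=> mF F0 pF hh /andP[tau0 tau2].
have mE : measurable_fun [set: MR * MR] (fun z : MR * MR => (F z)%:E) by exact/measurable_EFinP.
have F0E z : (0 <= (F z)%:E)%E by rewrite lee_fin.
pose phi t := (\int[mu]_(x in circle) (F (t, x))%:E)%E.
have mphi : measurable_fun [set: MR] phi by exact: (@measurable_ge0_integral_slice R circle _ mC mE).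
have phi0 t : (0 <= phi t)%E by exact: integral_ge0.
have i0 (r : R) : 0 <= \1_`[0%R, tau] r :> R by rewrite indicE.
rewrite ge0_integral_rect//; first last.
- by move=> z; rewrite lee_fin mulr_ge0.
- apply/measurable_EFinP; apply: measurable_funM; first exact: measurable_cut.
  exact: (measurableT_comp mF (measurable_shift2 t0 h)).
rewrite [RHS]ge0_integral_rect//.
rewrite -[RHS](@ge0_integral_shift _ t0)//.
rewrite (_ : [set x : R | (`[t0, t0 + tau]%classic : set R) (x + t0)] = circle `&` `[0, tau]%classic); last first.
  apply/seteqP; split => x /=.
    rewrite !in_itv/= -lerBlDr subrr addrC lerD2l => /andP[h1 h2].
    by split; [rewrite circleE h1 (le_trans h2 tau2)|rewrite h1 h2].
  by rewrite !in_itv/= => -[_ /andP[h1 h2]]; rewrite lerDr h1 addrC lerD2l.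
rewrite integral_mkcondr; apply: eq_integral => r _; rewrite patchE.
case: ifPn => hr; last first.
  rewrite integral0_eq// => x _ /=; rewrite indicE (negbTE hr) mul0r//.
rewrite -[RHS](@ge0_periodic_integral _ (fun x => (F ((r : R) + t0, x))%:E) h)//.
- by apply: eq_integral => x _ /=; rewrite indicE hr mul1r addrC.
- by have := measurable_slice (r + t0) mF => ?; exact/measurable_EFinP.
- by move=> x; rewrite pF.
Qed.

Context (sgn : R) (hsgn : sgn = 1 \/ sgn = -1) (g : R -> R[i]) (u : R -> R -> R[i])
  (hu : is_wick_NLS_solution sgn g u).

Definition translate_diff (u : R -> R -> R[i]) (h t x : R) : R[i] := u t (x + h) - u t x.

(** Absolute continuity of the integral of |u|^4, uniform in the position of the window; the larger
    interval up to T + 1 contains all windows because tau <= 1. *)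
Lemma small_windows (T e : R) : 0 < e -> exists2 tau : R, 0 < tau <= 1 /\ tau <= e &
  forall t0, - T <= t0 <= T ->
  (\int[mu2]_(z in `[t0, (t0 + tau)%R] `*` circle) (cabs (u z.1 z.2) ^+ 4)%:E <= e%:E)%E.
Proof.
move=> e0; have e2 : 0 < e / 2 by rewrite divr_gt0.
have mD (a b : R) : measurable (`[a, b] `*` circle : set (MR * MR)).
  exact: measurable_rect (measurable_itv _) mC.
have m4 : measurable_fun [set: MR * MR] (fun z : MR * MR => cabs (u z.1 z.2) ^+ 4).
  by apply: measurable_cabsX; exact: (sol_measurable hu).
have [n hn] := @uniform_integrability _ _ R mu2 _ (mD (- T) (T + 1)) _ _ m4
  (fun z => exprn_ge0 4 (cabs_ge0 _)) (sol_L4 hu _ _) e2.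
have P0 := @twopi_gt0 R.
have q0 : 0 < n%:R * (pi *+ 2) + 1 :> R by rewrite ltr_wpDl// mulr_ge0// ltW.
(* Uniform integrability bounds a window by e/2 plus n times its measure 2 pi tau; the last entry
   makes this product at most e/2. *)
exists (Num.min (Num.min 1 e) (e / 2 / (n%:R * (pi *+ 2) + 1))).
  by rewrite !lt_min ltr01 e0 divr_gt0//= !ge_min !lexx !orbT.
set tau := Num.min _ _; move=> t0 /andP[h1 h2].
have tau0 : 0 <= tau by rewrite !le_min ler01 (ltW e0) divr_ge0// ltW.
have tau1 : tau <= 1 by rewrite !ge_min lexx.
have tau2 : tau <= e / 2 / (n%:R * (pi *+ 2) + 1) by rewrite ge_min lexx orbT.
apply: le_trans (hn _ (mD t0 (t0 + tau)) _) _.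
  move=> z [/= h h3]; move: h; rewrite in_itv/= => /andP[k1 k2]; split => //=; rewrite in_itv/=.
  by rewrite (le_trans h1 k1) (le_trans k2)// lerD.
rewrite [X in (_ + _ * X <= _)%E]rect_measure -EFinM -EFinD lee_fin.
rewrite [t0 + tau - t0]addrAC subrr add0r max_r// [leRHS](splitr e) lerD2l mulrCA.
apply: (@le_trans _ _ (tau * (n%:R * (pi *+ 2) + 1))).
  by rewrite ler_wpM2l// lerDl.
by rewrite -ler_pdivlMr.
Qed.

Definition good_window (t0 tau : R) : set R := [set r | 0 <= r <= tau /\ good u (t0 + r)].

Lemma measurable_good_window t0 tau : measurable (good_window t0 tau : set MR).
Proof.
have -> : good_window t0 tau = `[0, tau]%classic `&`
    (fun r : R => r + t0) @^-1` [set t | good u t].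
  by apply/seteqP; split => r /=; rewrite in_itv/= addrC.
apply: measurableI; first exact: measurable_itv.
rewrite -[X in measurable X]setTI; apply: measurable_shift => //.
have -> : [set t | good u t] = (fun t => \int[mu]_(x in circle) (cabs (u t x) ^+ 4)%:E)%E @^-1` [set y | (y < +oo)%E].
  by [].
rewrite -[X in measurable X]setTI; apply: (measurable_slice_L4 hu) => //.
rewrite (_ : [set y | _] = [set` Interval -oo%O (BLeft (+oo%E : \bar R))]); first exact: emeasurable_itv.
by apply/seteqP; split => y /=; rewrite in_itv.
Qed.

Lemma ae_good_window t0 tau : {ae mu, forall r, 0 <= r <= tau -> good u (t0 + r)}.
Proof.
have mP := measurable_slice_L4 hu.
pose phi := (fun t : MR => \int[mu]_(x in circle) (cabs (u t x) ^+ 4)%:E)%E.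
have phi0 t : (0 <= phi t)%E by apply: integral_ge0 => y _; rewrite lee_fin exprn_ge0 ?cabs_ge0.
have ms : measurable_fun [set: MR] (fun r : MR => phi (r + t0)).
  exact: (measurableT_comp mP (measurable_shift t0)).
have := @ae_nnint_lty _ MR R mu `[0, tau]%classic (measurable_itv _) _ ms (fun r => phi0 _).
have -> : (`[0, tau]%classic : set R) = [set x : R | (`[t0 + 0, t0 + tau]%classic : set R) (x + t0)].
  by rewrite shift_itv.
rewrite (@ge0_integral_shift _ t0 _ phi)//.
have h := sol_L4 hu (t0 + 0) (t0 + tau); rewrite ge0_integral_rect// in h; first last.
- by move=> z; rewrite lee_fin exprn_ge0 ?cabs_ge0.
- by apply/measurable_EFinP; apply: measurable_cabsX; exact: (sol_measurable hu).
move=> /(_ h); apply: aeS => r hr hr2; rewrite /good addrC; apply: hr.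
by rewrite /= in_itv/= addr0 lerDr addrC lerD2l.
Qed.

End Windows.

Section Persistence.
Context {R : realType}.
Local Notation mu := (@lebesgue_measure R).
Local Notation MR := (measurableTypeR R).
Local Notation mu2 := (mu \x mu)%E.
Let mC := @measurable_circle R.
Let mT := @measurable_torus2 R.
Context (sgn : R) (hsgn : sgn = 1 \/ sgn = -1) (g : R -> R[i]) (u : R -> R -> R[i])
  (hu : is_wick_NLS_solution sgn g u).

Section Window.
Context (h t0 tau : R) (hh : 0 <= h <= pi *+ 2) (htau : 0 <= tau <= 1).
Let P := wick_constant g.
Let dl r x := translate_diff u h (t0 + r) x.
Let A := good_window u t0 tau.
(** Restricted to the good times of the window, so that every slice is integrable as [forcing]
    requires; the discarded times form a null set and do not affect the Duhamel integrals. *)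
Let G r x := (\1_A r)%:C * (force g u (t0 + r) (x + h) - force g u (t0 + r) x).
Let V (z : R * R) := \1_`[0, tau] z.1 *
  (2 * (cabs (u (t0 + z.1) (z.2 + h)) ^+ 2 + cabs (u (t0 + z.1) z.2) ^+ 2) + `|P|).

Lemma tau_circle : 0 <= tau <= pi *+ 2.
Proof.
case/andP: htau => -> h1; apply: (le_trans h1).
by rewrite mulr2n (le_trans _ (lerD (pi_ge2 R) (pi_ge2 R)))// -natrD ler1n.
Qed.

Lemma cmeasurable_shift2_0 (F : R -> R -> R[i]) :
  @cmeasurable R _ (MR * MR)%type (fun z => F z.1 z.2) ->
  @cmeasurable R _ (MR * MR)%type (fun z => F (t0 + z.1) z.2).
Proof.
by move=> /(cmeasurable_shift2 t0 0); apply: eq_cmeasurable => z; rewrite addr0.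
Qed.

Lemma measurable_window_diff : @cmeasurable R _ (MR * MR)%type (fun z => dl z.1 z.2).
Proof.
apply: cmeasurableB.
- by apply: cmeasurable_shift2; exact: (sol_measurable hu).
- by apply: cmeasurable_shift2_0; exact: (sol_measurable hu).
Qed.

Lemma cL2_translate_diff t : cL2 (translate_diff u h t).
Proof.
by apply: cL2B; [apply: cL2_shift => //|]; try exact: (sol_L2 hu); exact: (sol_periodic hu).
Qed.

Lemma fourier_translate_diff t n : fourier (translate_diff u h t) n = (ep n h - 1) * fourier (u t) n.
Proof.
have h1 := sol_L2 hu t; have h2 := sol_periodic hu t.
rewrite fourierB//; last exact: cL2_shift.
by rewrite fourier_shift//; [rewrite mulrBl mul1r|exact: cL2_cint1].
Qed.

Lemma good_windowP r : A r -> good u (t0 + r).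
Proof. by case. Qed.

Lemma force_periodic t x : force g u t (x + pi *+ 2) = force g u t x.
Proof. by rewrite /force (sol_periodic hu). Qed.

Lemma window_force_cint1 r : cint1 circle (G r).
Proof.
have [Ar|Ar] := pselect (A r); last first.
  rewrite /G indicE (memNset Ar); split.
    by under eq_fun do rewrite mul0r; exact: cmeasurable_cst.
  by under eq_integral => x _ do rewrite mul0r cabs0; rewrite integral0.
have h1 := good_cint1 hu (good_windowP Ar).
apply: cint1Z => //; apply: cint1D => //; last exact: cint1N.
by apply: cint1_shift => //; exact: force_periodic.
Qed.

Lemma sfourier_window_force n r : A r ->
  sfourier G n r = (ep n h - 1) * fourier (force g u (t0 + r)) n.
Proof.
move=> Ar; have h1 := good_cint1 hu (good_windowP Ar).
have h2 : cint1 circle (fun x => force g u (t0 + r) (x + h)).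
  by apply: cint1_shift => //; exact: force_periodic.
rewrite /sfourier /G indicE (mem_set Ar) fourierZ; last by right.
rewrite mul1r mulrBl mul1r -fourier_shift//; last exact: force_periodic.
have mep : @cmeasurable R _ MR (fun x => expi (- (n%:~R * x))).
  by under eq_fun do rewrite expiN; apply: cmeasurable_conj; exact: cmeasurable_ep.
have bep x : cabs (expi (- (n%:~R * x)) : R[i]) <= 1 by rewrite cabs_expi.
rewrite /fourier -mulrBr -cintegralB//; first last.
- exact: (@cint1_bounded_mul _ _ _ _ 1).
- exact: (@cint1_bounded_mul _ _ _ _ 1).
by congr (_ * _); apply: eq_cintegral => x _; rewrite mulrBl.
Qed.

(** At almost every time translation acts on the coefficients of the force by the multiplier
    [ep n h - 1], which comes out of the time integral; the conjugated exponential accounts for the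
    starting time t0. *)
Lemma duhamel_window n r : 0 <= r <= tau ->
  duhamel G n r = (ep n h - 1) * (expi (t0 * n%:~R ^+ 2))^cj * cintegral `[t0, (t0 + r)%R] (tforce g u n).
Proof.
move=> /andP[r0 rt]; have /andP[_ tau2] := tau_circle.
rewrite duhamelE; last by rewrite circleE r0 (le_trans rt tau2).
have hi := tforce_cint1 hu n t0 (t0 + r).
have mtf : @cmeasurable R _ MR (tforce g u n) := hi.1.
have mtf2 : @cmeasurable R _ MR (fun s : R => tforce g u n (t0 + s)).
  have mm : measurable_fun [set: MR] (fun s : MR => t0 + s : MR).
    by under eq_fun do rewrite addrC; exact: measurable_shift.
  by case: mtf => m1 m2; split; [exact: (measurableT_comp m1 mm)|exact: (measurableT_comp m2 mm)].
have hi2 : cint1 `[0, r] (fun s : R => tforce g u n (t0 + s)).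
  split => //; case: hi => _; apply: le_lt_trans.
  have m0 : measurable_fun [set: MR] (fun s : MR => (cabs (tforce g u n s))%:E).
    by apply/measurable_EFinP; exact: measurable_cabs.
  have p0 (s : R) : (0 <= (cabs (tforce g u n s))%:E)%E by rewrite lee_fin cabs_ge0.
  have := @ge0_integral_shift R t0 _ _ (measurable_itv `[t0 + 0, t0 + r]) m0 p0.
  rewrite shift_itv addr0 => <-; rewrite le_eqVlt; apply/orP; left; apply/eqP.
  by apply: eq_integral => x _; rewrite addrC.
rewrite -{2}(addr0 t0) -(@cintegral_shift_itv _ t0 0 r _ mtf) -cintegralZ//.
apply: ae_eq_cintegral => //.
- apply: cmeasurableM; first exact: cmeasurable_expi_sqr.
  apply: cmeasurable_sfourier; apply: cmeasurableM.
    apply: (@cmeasurable_fst_comp R (fun r => (\1_A r)%:C)); apply: cmeasurable_real.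
    by apply: measurable_indic; exact: (measurable_good_window hu).
  apply: cmeasurableB.
  + by apply: cmeasurable_shift2; exact: (force_measurable hu).
  + by apply: cmeasurable_shift2_0; exact: (force_measurable hu).
- by apply: cmeasurableM => //; exact: cmeasurable_cst.
apply: aeS (ae_good_window hu t0 tau) => s hs; rewrite /= in_itv/= => /andP[s0 sr].
have As : A s by split; [|apply: hs]; rewrite s0 (le_trans sr rt).
rewrite /twisted sfourier_window_force// /tforce.
have -> : expi ((t0 + s) * n%:~R ^+ 2) = expi (t0 * n%:~R ^+ 2) * expi (s * n%:~R ^+ 2) :> R[i].
  by rewrite mulrDl expiD.
have K : (expi (t0 * n%:~R ^+ 2))^cj * expi (t0 * n%:~R ^+ 2) = 1 :> R[i].
  by rewrite -expiN -expiD addNr expi0.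
rewrite -[LHS]mul1r -K; ring.
Qed.

Lemma window_difference_eq : difference_eq tau dl G ('i * sgn%:C).
Proof.
split.
- exact: tau_circle.
- exact: measurable_window_diff.
- by move=> r _; exact: cL2_translate_diff.
- by rewrite cabs_isgn.
move=> r n hr; have /andP[r0 _] := hr.
rewrite /duhamel_sol duhamel_window// /dl !fourier_translate_diff addr0.
have ab : t0 <= t0 + r by rewrite lerDl.
have hp := profile_increment hu n ab.
have E t : fourier (u t) n = (expi (t * n%:~R ^+ 2))^cj * profile u n t.
  by rewrite /profile mulrA -expiN -expiD addNr expi0 mul1r.
rewrite !E; set I := cintegral _ _ in hp *; set p := profile u n _ in hp *; set q := profile u n t0 in hp *.
have -> : p = q + 'i * sgn%:C * I by rewrite -hp addrC subrK.
have -> : expi ((t0 + r) * n%:~R ^+ 2) = expi (t0 * n%:~R ^+ 2) * expi (r * n%:~R ^+ 2) :> R[i].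
  by rewrite mulrDl expiD.
by rewrite cconjM; ring.
Qed.

Lemma window_V_ge0 z : 0 <= V z.
Proof.
by rewrite mulr_ge0// ?indicE// addr_ge0// mulr_ge0// addr_ge0// exprn_ge0 ?cabs_ge0.
Qed.

Lemma measurable_window_u4 h' : measurable_fun [set: MR * MR]
  (fun z : MR * MR => \1_`[0, tau] z.1 * cabs (u (t0 + z.1) (z.2 + h')) ^+ 4).
Proof.
apply: measurable_funM; first exact: measurable_cut.
by apply: measurable_cabsX; apply: cmeasurable_shift2; exact: (sol_measurable hu).
Qed.

Lemma measurable_window_V : measurable_fun [set: MR * MR] V.
Proof.
apply: measurable_funM; first exact: measurable_cut.
apply: measurable_funD => //; apply: measurable_funM => //; apply: measurable_funD.
- by apply: measurable_cabsX; apply: cmeasurable_shift2; exact: (sol_measurable hu).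
- by apply: measurable_cabsX; apply: cmeasurable_shift2_0; exact: (sol_measurable hu).
Qed.

Context (e1 : R) (he1 : 0 <= e1) (htau1 : tau <= e1)
  (hI : (\int[mu2]_(z in `[t0, (t0 + tau)%R] `*` circle) (cabs (u z.1 z.2) ^+ 4)%:E <= e1%:E)%E).

Lemma window_u4 h' : 0 <= h' <= pi *+ 2 ->
  (\int[mu2]_(z in torus2) (\1_`[0%R, tau] z.1 * cabs (u (t0 + z.1)%R (z.2 + h')%R) ^+ 4)%:E <= e1%:E)%E.
Proof.
move=> hh'; apply: le_trans hI; rewrite le_eqVlt; apply/orP; left; apply/eqP.
apply: (@window_integral _ (fun z => cabs (u z.1 z.2) ^+ 4)) => //.
- by apply: measurable_cabsX; exact: (sol_measurable hu).
- by move=> z; rewrite exprn_ge0 ?cabs_ge0.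
- by move=> t x /=; rewrite (sol_periodic hu).
- exact: tau_circle.
Qed.

Lemma window_one : (\int[mu2]_(z in torus2) (\1_`[0%R, tau] z.1 * 1)%:E <= (e1 * (pi *+ 2))%:E)%E.
Proof.
have h0 : 0 <= (0 : R) <= pi *+ 2 by rewrite lexx ltW// twopi_gt0.
have := @window_integral R (fun=> 1) t0 0 tau (measurable_cst _) (fun=> ler01) (fun _ _ => erefl) h0 tau_circle.
move=> /= ->; have mD : measurable (`[t0, t0 + tau] `*` circle : set (MR * MR)).
  exact: measurable_rect (measurable_itv _) mC.
rewrite [X in (X <= _)%E](integral_cst mu2 mD 1%:E) mul1e [X in (X <= _)%E]rect_measure lee_fin.
rewrite ler_pM2r ?twopi_gt0// [t0 + tau - t0]addrAC subrr add0r max_r//.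
by case/andP: htau.
Qed.

(** From (2 x + 2 y + p)^2 <= 12 x^2 + 12 y^2 + 3 p^2 with x, y the squared moduli of u and its
    translate and p = |P|. The whole bound is proportional to e1, hence small for short windows. *)
Lemma window_V_small :
  (\int[mu2]_(z in torus2) (V z ^+ 2)%:E <= (e1 * (24 + 3 * P ^+ 2 * (pi *+ 2)))%:E)%E.
Proof.
have h0 : 0 <= (0 : R) <= pi *+ 2 by rewrite lexx ltW// twopi_gt0.
pose F1 (z : R * R) := \1_`[0, tau] z.1 * cabs (u (t0 + z.1) (z.2 + h)) ^+ 4.
pose F2 (z : R * R) := \1_`[0, tau] z.1 * cabs (u (t0 + z.1) (z.2 + 0)) ^+ 4.
pose F3 (z : R * R) : R := \1_`[0, tau] z.1 * 1.
have m1 : measurable_fun [set: MR * MR] F1 := measurable_window_u4 h.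
have m2 : measurable_fun [set: MR * MR] F2 := measurable_window_u4 0.
have m3 : measurable_fun [set: MR * MR] F3 by apply: measurable_funM => //; exact: measurable_cut.
have p1 z : 0 <= F1 z by rewrite mulr_ge0 ?exprn_ge0 ?cabs_ge0// indicE.
have p2 z : 0 <= F2 z by rewrite mulr_ge0 ?exprn_ge0 ?cabs_ge0// indicE.
have p3 z : 0 <= F3 z by rewrite mulr_ge0// indicE.
apply: (@le_trans _ _ (\int[mu2]_(z in torus2) ((12 * F1 z + 12 * F2 z)%R + 3 * P ^+ 2 * F3 z)%:E)%E).
  apply: nnint_le => //.
  - by apply: measurable_funX; exact: measurable_window_V.
  - by apply: measurable_funD; [apply: measurable_funD|]; exact: measurable_funM.
  - by move=> z _; exact: sqr_ge0.
  move=> z _; rewrite /V /F1 /F2 /F3 addr0 exprMn indicE.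
  case: (_ \in _); rewrite ?expr0n ?mul0r ?mulr0 ?addr0// expr1n !mul1r mulr1.
  set a := cabs _; set b := cabs _; rewrite -(real_normK (num_real P)); set p := `|P|.
  have -> : a ^+ 4 = (a ^+ 2) ^+ 2 by rewrite -exprM.
  have -> : b ^+ 4 = (b ^+ 2) ^+ 2 by rewrite -exprM.
  set x := a ^+ 2; set y := b ^+ 2.
  have q1 := sqr_ge0 (2 * x - 2 * y); have q2 := sqr_ge0 (2 * x - p); have q3 := sqr_ge0 (2 * y - p).
  by nra.
have c0 : 0 <= 3 * P ^+ 2 by rewrite mulr_ge0// sqr_ge0.
move: c0; set c := 3 * P ^+ 2 => c0.
rewrite nnintD//; first last.
- by move=> z; rewrite mulr_ge0.
- by move=> z; rewrite addr_ge0// mulr_ge0.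
- exact: measurable_funM.
- by apply: measurable_funD; exact: measurable_funM.
rewrite nnintD//; first last.
- by move=> z; rewrite mulr_ge0.
- by move=> z; rewrite mulr_ge0.
- exact: measurable_funM.
- exact: measurable_funM.
rewrite !nnintZ// (_ : e1 * _ = (12 * e1 + 12 * e1) + c * (e1 * (pi *+ 2))); last by ring.
rewrite !EFinD !EFinM; apply: leeD; first apply: leeD.
- by apply: lee_wpmul2l; rewrite ?lee_fin//; exact: window_u4.
- by apply: lee_wpmul2l; rewrite ?lee_fin//; exact: window_u4.
- by rewrite -[(e1%:E * _)%E]EFinM; apply: lee_wpmul2l; rewrite ?lee_fin//; exact: window_one.
Qed.

(** From |a - b|^4 <= 8 (|a|^4 + |b|^4). This supplies the finiteness that [local_lipschitz] needs
    before absorption. *)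
Lemma window_W : (\int[mu2]_(z in torus2) (cutoff tau dl z ^+ 4)%:E <= (16 * e1)%:E)%E.
Proof.
have h0 : 0 <= (0 : R) <= pi *+ 2 by rewrite lexx ltW// twopi_gt0.
pose F1 (z : R * R) := \1_`[0, tau] z.1 * cabs (u (t0 + z.1) (z.2 + h)) ^+ 4.
pose F2 (z : R * R) := \1_`[0, tau] z.1 * cabs (u (t0 + z.1) (z.2 + 0)) ^+ 4.
have m1 : measurable_fun [set: MR * MR] F1 := measurable_window_u4 h.
have m2 : measurable_fun [set: MR * MR] F2 := measurable_window_u4 0.
have p1 z : 0 <= F1 z by rewrite mulr_ge0 ?exprn_ge0 ?cabs_ge0// indicE.
have p2 z : 0 <= F2 z by rewrite mulr_ge0 ?exprn_ge0 ?cabs_ge0// indicE.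
apply: (@le_trans _ _ (\int[mu2]_(z in torus2) (8 * F1 z + 8 * F2 z)%:E)%E).
  apply: nnint_le => //.
  - apply: measurable_funX; apply: measurable_funM; first exact: measurable_cut.
    by apply: measurable_cabs; exact: measurable_window_diff.
  - by apply: measurable_funD; exact: measurable_funM.
  - by move=> z _; rewrite exprn_ge0// mulr_ge0 ?cabs_ge0// indicE.
  move=> z _; rewrite /cutoff /F1 /F2 addr0 exprMn indicE.
  case: (_ \in _); rewrite ?expr0n ?mul0r ?mulr0 ?addr0// expr1n !mul1r.
  rewrite /dl /translate_diff; set a := u _ _; set b := u _ _.
  have := cabsB a b; have := cabs_ge0 (a - b); have := cabs_ge0 a; have := cabs_ge0 b.
  set d := cabs (a - b); set x := cabs a; set y := cabs b => y0 x0 d0 dxy.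
  apply: (@le_trans _ _ ((x + y) ^+ 4)).
    by apply: lerXn2r; rewrite ?nnegrE// addr_ge0.
  have q1 : (x + y) ^+ 2 <= 2 * (x ^+ 2 + y ^+ 2) by have := sqr_ge0 (x - y); nra.
  have q2 : ((x + y) ^+ 2) ^+ 2 <= (2 * (x ^+ 2 + y ^+ 2)) ^+ 2.
    by apply: lerXn2r; rewrite ?nnegrE ?sqr_ge0// mulr_ge0// addr_ge0 ?sqr_ge0.
  rewrite (exprM _ 2 2) (exprM x 2 2) (exprM y 2 2); apply: (le_trans q2).
  by have := sqr_ge0 (x ^+ 2 - y ^+ 2); set X := x ^+ 2; set Y := y ^+ 2; nra.
rewrite nnintD//; first last.
- by move=> z; rewrite mulr_ge0.
- by move=> z; rewrite mulr_ge0.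
- exact: measurable_funM.
- exact: measurable_funM.
rewrite !nnintZ// (_ : 16 * e1 = 8 * e1 + 8 * e1); last by ring.
rewrite !EFinD !EFinM; apply: leeD.
- by apply: lee_wpmul2l; rewrite ?lee_fin//; exact: window_u4.
- by apply: lee_wpmul2l; rewrite ?lee_fin//; exact: window_u4.
Qed.

Lemma window_forcing : forcing G V (cutoff tau dl)
  (Num.sqrt (e1 * (24 + 3 * P ^+ 2 * (pi *+ 2)))) (Num.sqrt (Num.sqrt (16 * e1))).
Proof.
have k0 : 0 <= e1 * (24 + 3 * P ^+ 2 * (pi *+ 2)).
  by rewrite mulr_ge0// addr_ge0// mulr_ge0 ?(ltW (@twopi_gt0 R))// mulr_ge0// sqr_ge0.
split.
- split; last by move=> t _; exact: window_force_cint1.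
  apply: cmeasurableM.
    apply: (@cmeasurable_fst_comp R (fun r => (\1_A r)%:C)); apply: cmeasurable_real.
    by apply: measurable_indic; exact: (measurable_good_window hu).
  apply: cmeasurableB.
  + by apply: cmeasurable_shift2; exact: (force_measurable hu).
  + by apply: cmeasurable_shift2_0; exact: (force_measurable hu).
- split; first exact: measurable_window_V.
  apply: measurable_funM; first exact: measurable_cut.
  by apply: measurable_cabs; exact: measurable_window_diff.
- split; [exact: window_V_ge0| |exact: sqrtr_ge0|exact: sqrtr_ge0].
  by move=> z; rewrite mulr_ge0 ?cabs_ge0// indicE.
- move=> z _; rewrite /G; have [Az|Az] := pselect (A z.1); last first.
    by rewrite indicE (memNset Az) mul0r cabs0 mulr_ge0 ?window_V_ge0// mulr_ge0 ?cabs_ge0// indicE.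
  rewrite /V /cutoff !indicE (mem_set Az) mul1r mem_set ?mul1r; last first.
    by case: Az => + _; rewrite /= in_itv.
  exact: wick_lipschitz.
- split; first by rewrite sqr_sqrtr//; exact: window_V_small.
  by rewrite (exprM _ 2 2) !sqr_sqrtr ?sqrtr_ge0 ?mulr_ge0//; exact: window_W.
Qed.

End Window.

(** A translate of u has the same L^4 norm on a window as u, so e1 depends on neither h nor t0. *)
Lemma window_lipschitz : exists2 e1 : R, 0 < e1 & forall h t0 tau,
  0 <= h <= pi *+ 2 -> 0 <= tau <= 1 -> tau <= e1 ->
  (\int[mu2]_(z in `[t0, (t0 + tau)%R] `*` circle) (cabs (u z.1 z.2) ^+ 4)%:E <= e1%:E)%E ->
  forall r r', 0 <= r <= tau -> 0 <= r' <= tau ->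
  nrm2 (translate_diff u h (t0 + r)) <= 4 * nrm2 (translate_diff u h (t0 + r')).
Proof.
have [e0 e00 he0] := @local_lipschitz R; set K := 24 + 3 * wick_constant g ^+ 2 * (pi *+ 2).
have K0 : 0 < K.
  by rewrite ltr_wpDr// mulr_ge0 ?(ltW (@twopi_gt0 R))// mulr_ge0// sqr_ge0.
exists (e0 / K); first by rewrite divr_gt0.
move=> h t0 tau hh htau ht1 hI; have e10 : 0 <= e0 / K by rewrite divr_ge0// ltW.
apply: (he0 _ _ _ _ _ _ _ (window_difference_eq t0 hh htau) (window_forcing hh htau e10 ht1 hI)).
rewrite sqr_sqrtr -/K; first by rewrite (divfK (lt0r_neq0 K0)).
by rewrite mulr_ge0// ltW.
Qed.

End Persistence.

(** * Detecting frequencies by dyadic translations *)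

Section DyadicTranslations.
Context {R : realType}.
Local Notation brk := (@brk R).

Lemma cabs_expiB1_cos (x : R) : cabs (expi x - 1) ^+ 2 = 2 - 2 * cos x.
Proof.
rewrite cabs_sqr cReD cImD cReN cImN /= subr0; have := cos2Dsin2 x; nra.
Qed.

(** Interpolation between the bounds |n h| and 2 for the distance of [ep n h] to 1, according to
    whether [brk n] h is below or above 1. *)
Lemma ep_sub1_le (n : int) (h r : R) : 0 <= r <= 2 -> 0 <= h ->
  cabs (ep n h - 1) ^+ 2 <= 4 * (brk n * h) `^ r.
Proof.
move=> /andP[r0 r2] h0; set y := brk n * h.
have y0 : 0 <= y by rewrite mulr_ge0// ltW// brk_gt0.
have hx : `|n%:~R * h| <= y.
  by rewrite normrM (ger0_norm h0) ler_wpM2r// /brk lerDr.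
have h1 : cabs (ep n h - 1) <= `|n%:~R * h| by exact: cabs_expiB1_le.
have h2 : cabs (ep n h - 1) <= 2 by rewrite -expi0; exact: cabs_expiB_le2.
have [y1|/ltW y1] := leP y 1.
  apply: (@le_trans _ _ (y ^+ 2)).
    by apply: lerXn2r; rewrite ?nnegrE ?cabs_ge0// (le_trans h1).
  apply: (@le_trans _ _ (y `^ r)); last by rewrite ler_peMl ?powR_ge0// ler1n.
  have [->|yn0] := eqVneq y 0; first by rewrite expr0n powR_ge0.
  rewrite -powR_mulrn//; apply: ger_powR => //.
  by rewrite lt_neqAle eq_sym yn0 y0.
apply: (@le_trans _ _ (2 ^+ 2)); first by apply: lerXn2r; rewrite ?nnegrE ?cabs_ge0.
by rewrite -natrX ler_peMr// -(powRr0 y) ler_powR.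
Qed.

Lemma dyadic_lower_bound : exists2 c : R, 0 < c & forall (n : int) (j : nat), (2 ^ j <= `|n| < 2 ^ j.+1)%N ->
  c <= cabs (ep n (2 ^- j) - 1) ^+ 2.
Proof.
have c1 : cos 1 < 1 :> R.
  rewrite -[ltRHS]cos0 ltr_cos ?in_itv/= ?lexx ?pi_ge0 ?ler01//.
  by rewrite (le_trans _ (pi_ge2 R))// ler1n.
exists (2 - 2 * cos 1); first by lra.
move=> n j /andP[l1 l2]; rewrite /ep cabs_expiB1_cos lerD2l lerN2 ler_pM2l//.
rewrite -(cos_norm (n%:~R * _)); set x := `|_|.
have E : x = `|n|%N%:R / 2 ^+ j.
  by rewrite /x normrM [X in _ * X]ger0_norm ?invr_ge0 ?exprn_ge0// -intr_norm -abszE -pmulrn.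
have p0 : 0 < 2 ^+ j :> R by rewrite exprn_gt0.
have x1 : 1 <= x by rewrite E ler_pdivlMr// mul1r -natrX ler_nat.
have x2 : x <= 2 by rewrite E ler_pdivrMr// -exprS -natrX ler_nat ltnW.
have p2 := pi_ge2 R.
have [->//|x1'] := eqVneq x 1.
apply: ltW; rewrite ltr_cos ?in_itv/= ?ler01 ?(le_trans x2)//.
- by rewrite lt_neqAle eq_sym x1'.
- by rewrite (le_trans _ p2)// ler1n.
- by rewrite (le_trans ler01).
Qed.

Lemma brk_dyadic (n : int) (j : nat) : (2 ^ j <= `|n| < 2 ^ j.+1)%N -> brk n <= 4 * 2 ^+ j.
Proof.
move=> /andP[l1 l2]; rewrite /brk -intr_norm -abszE -pmulrn addrC natr1.
by rewrite -natrX -natrM ler_nat (leq_trans l2)// expnS leq_mul2r orbT.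
Qed.

Lemma geometric_sum_le (q : R) (J : nat) : 0 <= q -> q < 1 -> \sum_(j < J) q ^+ j <= (1 - q)^-1.
Proof.
move=> q0 q1; have p : 0 < 1 - q by rewrite subr_gt0.
rewrite -[leRHS]mul1r ler_pdivlMr// mulrC -opprB mulNr -subrX1 opprB.
by rewrite gerBl exprn_ge0.
Qed.

Lemma inHs_bsum (s : R) (g : R -> R[i]) : 0 <= s -> inHs s g ->
  exists B, bsum (fun n => brk n `^ (2 * s) * cabs (fourier g n) ^+ 2) B.
Proof.
move=> s0 [_ hy]; set E := (\esum_(n in _) _)%E in hy.
have E0 : (0 <= E)%E.
  by apply: esum_ge0 => n _; rewrite lee_fin mulr_ge0 ?powR_ge0 ?exprn_ge0 ?cabs_ge0.
have EE : E = (fine E)%:E by rewrite fineK// ge0_fin_numE.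
exists (2 `^ s * fine E) => S uS.
apply: (@le_trans _ _ (\sum_(n <- S) 2 `^ s * (((1 + n%:~R ^+ 2) `^ s) * cabs (fourier g n) ^+ 2))).
  apply: ler_sum => n _; rewrite mulrA ler_wpM2r ?exprn_ge0 ?cabs_ge0//.
  rewrite -powRM ?addr_ge0 ?sqr_ge0// powRrM powR_mulrn ?brk_ge0//.
  apply: ge0_ler_powR => //; rewrite ?nnegrE ?exprn_ge0 ?mulr_ge0 ?addr_ge0 ?sqr_ge0//.
  rewrite /brk -(real_normK (num_real n%:~R)); set x := `|_|.
  by have := sqr_ge0 (1 - x); nra.
rewrite -mulr_sumr ler_wpM2l ?powR_ge0// -lee_fin -EE -sumEFin fsbig_seq//.
apply: esum_ge; exists [set` S]; first by split; [exact: finite_seq|exact: subsetT].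
exact: lexx.
Qed.

End DyadicTranslations.

Section SobolevPersistence.
Context {R : realType}.
Local Notation mu := (@lebesgue_measure R).
Local Notation MR := (measurableTypeR R).
Local Notation mu2 := (mu \x mu)%E.
Let mC := @measurable_circle R.
Local Notation brk := (@brk R).
Context (sgn : R) (hsgn : sgn = 1 \/ sgn = -1) (g : R -> R[i]) (u : R -> R -> R[i])
  (hu : is_wick_NLS_solution sgn g u).

(** [window_lipschitz] is iterated over about T/tau windows, forwards or backwards, each costing a
    factor 4; neither tau nor the number of windows depends on h. *)
Lemma translation_persistence (T : R) : exists2 K : R, 0 < K & forall h t,
  0 <= h <= pi *+ 2 -> `|t| <= T ->
  nrm2 (translate_diff u h t) <= K * nrm2 (translate_diff u h 0).
Proof.
have [e1 e10 hw] := window_lipschitz hsgn hu.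
have [tau [/andP[tau0 tau1] taue] hI] := small_windows hu T e10.
have step h : 0 <= h <= pi *+ 2 -> forall k t, `|t| <= T -> `|t| <= k%:R * tau ->
    nrm2 (translate_diff u h t) <= 4 ^+ k * nrm2 (translate_diff u h 0).
  move=> hh; elim=> [|k IH] t tT tk.
    move: tk; rewrite mul0r normr_le0 => /eqP ->; by rewrite expr0 mul1r.
  have win t0 r r' := hw h t0 tau hh _ taue _ r r'.
  have tau01 : 0 <= tau <= 1 by rewrite (ltW tau0).
  have go t0 r r' : `|t0| <= T -> 0 <= r <= tau -> 0 <= r' <= tau ->
      nrm2 (translate_diff u h (t0 + r)) <= 4 * nrm2 (translate_diff u h (t0 + r')).
    by move=> ht0 hr hr'; apply: (hw h t0 tau) => //; apply: hI; rewrite -ler_norml.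
  have kt : k.+1%:R * tau = k%:R * tau + tau by rewrite -natr1 mulrDl mul1r.
  (* The step towards 0 has length tau, or |t| if that is shorter, so the induction ends at time 0
     from either side. *)
  have [d [d0 dt] [td tdk]] : exists2 d : R, 0 <= d <= tau /\ d <= `|t| & `|t| - d <= k%:R * tau /\ True.
    exists (Num.min tau `|t|).
      by rewrite le_min (ltW tau0) normr_ge0 !ge_min !lexx orbT.
    split=> //; rewrite lerBlDr minEle; case: ifP => _; first by rewrite -kt.
    by rewrite lerDr mulr_ge0// ltW.
  rewrite exprS -mulrA.
  have d00 : 0 <= d by case/andP: d0.
  have dz : 0 <= (0 : R) <= tau by rewrite lexx ltW.
  have [t_ge|t_lt] := leP 0 t.
    rewrite ger0_norm// in dt td tT.
    apply: (@le_trans _ _ (4 * nrm2 (translate_diff u h (t - d)))).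
      have ht0 : `|t - d| <= T by rewrite ger0_norm ?subr_ge0// (le_trans _ tT)// gerBl.
      by have := go (t - d) d 0 ht0 d0 dz; rewrite subrK addr0.
    rewrite ler_pM2l//; apply: IH; rewrite ger0_norm ?subr_ge0//.
    by rewrite (le_trans _ tT)// gerBl.
  rewrite ltr0_norm// in dt td; have tT' := tT; rewrite ltr0_norm// in tT.
  have td0 : t + d <= 0 by rewrite -(opprK t) addrC subr_le0.
  apply: (@le_trans _ _ (4 * nrm2 (translate_diff u h (t + d)))).
    by have := go t 0 d tT' dz d0; rewrite addr0.
  rewrite ler_pM2l//; apply: IH; rewrite ler0_norm// opprD//.
  by rewrite (le_trans _ tT)// gerBl.
pose N := Num.truncn (T / tau); exists (4 ^+ N.+1); first by rewrite exprn_gt0.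
move=> h t hh tT; apply: step => //; apply: (le_trans tT).
by rewrite -ler_pdivrMr// ltW// truncnS_gt.
Qed.

Lemma profile_increment_le n (T t t' : R) : - T <= t <= T -> - T <= t' <= T ->
  ((cabs (profile u n t - profile u n t'))%:E <=
   \int[mu]_(s in `[(- T)%R, T]) (cabs (tforce g u n s))%:E)%E.
Proof.
wlog tt : t t' / t' <= t => [H h1 h2|/andP[h1 h2] /andP[h3 h4]].
  have [le|/ltW le] := leP t' t; first exact: H.
  by rewrite -opprB cabsN; exact: H.
rewrite (profile_increment hu)// cabsM cabs_isgn// mul1r.
have hi a b := tforce_cint1 hu n a b.
apply: le_trans (cabs_cintegral_le (measurable_itv _) (hi 0 0).1) _.
apply: ge0_subset_integral => //.
- by apply/measurable_EFinP; apply: measurable_funTS; apply: measurable_cabs; exact: (hi 0 0).1.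
- by move=> x _; rewrite lee_fin cabs_ge0.
- move=> x; rewrite /= !in_itv/= => /andP[k1 k2].
  by rewrite (le_trans h3 k1) (le_trans k2 h2).
Qed.

Lemma fourier_cabs_profile n t : cabs (fourier (u t) n) = cabs (profile u n t).
Proof. by rewrite /profile cabsM cabs_expi mul1r. Qed.

(** Needed for n = 0: translation differences annihilate the mean of u, which is bounded here by the
    time integral of the force. *)
Lemma profile_bounded n (T : R) : exists M : R, forall t, `|t| <= T -> cabs (profile u n t) <= M.
Proof.
have hi := tforce_cint1 hu n (- T) T.
pose I := (\int[mu]_(s in `[(- T)%R, T]) (cabs (tforce g u n s))%:E)%E.
have IE : I = (fine I)%:E.
  by rewrite fineK// ge0_fin_numE ?hi.2//; apply: integral_ge0 => s _; rewrite lee_fin cabs_ge0.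
exists (fine I + cabs (profile u n 0)) => t ht.
have h := ht; rewrite ler_norml in h.
have h0 : - T <= 0 <= T by rewrite oppr_le0 andbb (le_trans _ ht).
have := profile_increment_le n h h0; rewrite -/I IE lee_fin => hd.
rewrite -[profile u n t](subrK (profile u n 0)).
by apply: le_trans (cabsD _ _) _; rewrite lerD2r.
Qed.

(** On the shell |n| ~ 2^j the translation by 2^(-j) sees every mode with a fixed weight, and its
    L^2 size at time 0 is at most a multiple of 2^(-j s') by the regularity of g. Persistence
    carries this to time t; the gap between s and s' makes the sum over shells geometric. *)
Lemma sobolev_persistence (hg : inHhalf_minus g) (s T : R) : 0 <= s < 2^-1 ->
  exists B, forall t, `|t| <= T ->
  bsum (fun n => brk n `^ (2 * s) * cabs (fourier (u t) n) ^+ 2) B.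
Proof.
move=> /andP[s0 s1]; pose s' := (s + 2^-1) / 2.
have ss' : s < s' by rewrite /s'; lra.
have s'1 : s' < 2^-1 by rewrite /s'; lra.
have s'0 : 0 <= s' by rewrite (le_trans s0)// ltW.
have [Bg hBg] := inHs_bsum s'0 (hg _ s'1).
have [K K0 hK] := translation_persistence T.
have [c c0 hc] := @dyadic_lower_bound R.
have [M hM] := profile_bounded 0 T.
have P0 := @twopi_gt0 R; have P2 := pi_ge2 R.
have Bg0 := bsum_ge0 hBg.
pose h j : R := 2 ^- j.
have h0 j : 0 < h j by rewrite invr_gt0 exprn_gt0.
have hh j : 0 <= h j <= pi *+ 2.
  rewrite (ltW (h0 j))/= (@le_trans _ _ 1)//.
    by rewrite invf_le1 ?exprn_gt0// exprn_ege1// ler1n.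
  by rewrite mulr2n (le_trans _ (lerD P2 P2))// -natrD ler1n.
have r02 : 0 <= 2 * s' <= 2 by lra.
have key t j : `|t| <= T ->
    bsum (fun n => cabs (ep n (h j) - 1) ^+ 2 * cabs (fourier (u t) n) ^+ 2) (K * (4 * (h j `^ (2 * s') * Bg))).
  move=> tT; have hd := bessel (cL2_translate_diff hu (hh j) t).
  have h0d : nrm2 (translate_diff u (h j) 0) <= pi *+ 2 * (4 * (h j `^ (2 * s') * Bg)).
    apply: parseval_le; first exact: (cL2_translate_diff hu (hh j)).
    move=> N; rewrite mulrA; apply: le_trans (bsumZ _ hBg (zr_uniq N)); last first.
      by rewrite mulr_ge0// powR_ge0.
    apply: ler_sum => n _; rewrite (fourier_translate_diff hu (hh j)) cabsM exprMn (fourier_sol0 hu) mulrA.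
    rewrite ler_wpM2r ?exprn_ge0 ?cabs_ge0//.
    apply: le_trans (ep_sub1_le _ r02 (ltW (h0 j))) _.
    by rewrite powRM ?brk_ge0 ?(ltW (h0 j))// mulrA (mulrAC 4).
  move=> S uS; apply: (@le_trans _ _ (nrm2 (translate_diff u (h j) t) / (pi *+ 2))).
    apply: le_trans (hd S uS); apply: ler_sum => n _.
    by rewrite (fourier_translate_diff hu (hh j)) cabsM exprMn.
  rewrite ler_pdivrMr//; apply: le_trans (hK _ _ (hh j) tT) _.
  by rewrite -mulrA ler_pM2l// mulrC.
(* Ratio of the geometric series: 2^(2 s j) from the weight against 2^(-2 s' j) from the translation
   estimate. *)
pose q : R := 2 `^ (2 * s - 2 * s').
have q0 : 0 <= q by exact: powR_ge0.
have q1 : q < 1.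
  rewrite /q -(opprB (2 * s')) powRN invf_lt1 ?powR_gt0//.
  have d0 : 0 < 2 * s' - 2 * s by lra.
  have := @gt0_ltr_powR R _ d0 1 2; rewrite powR1 !nnegrE; apply => //.
  by rewrite ltr1n.
pose D := 4 / c * (K * (4 * Bg)).
have D0 : 0 <= D by rewrite !mulr_ge0// ?invr_ge0 ltW.
exists (M ^+ 2 + D / (1 - q)) => t tT S uS.
(* Only the shells with j < J meet the finite set S; the final bound does not depend on J. *)
pose J := (\max_(n <- S) `|n|).+1%N.
have hJ n : n \in S -> (`|n| < 2 ^ J)%N.
  move=> nS; apply: (@leq_trans J); last exact/ltnW/ltn_expl.
  by rewrite ltnS /J (big_rem n)//= leq_maxl.
pose a n := cabs (fourier (u t) n) ^+ 2.
have a0 n : 0 <= a n by rewrite exprn_ge0 ?cabs_ge0.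
pose b j n := 4 / c * ((2 ^+ j) `^ (2 * s) * (cabs (ep n (h j) - 1) ^+ 2 * a n)).
have b0 j n : 0 <= b j n.
  rewrite mulr_ge0 ?divr_ge0// ?(ltW c0)// mulr_ge0 ?powR_ge0// mulr_ge0// exprn_ge0 ?cabs_ge0//.
apply: (@le_trans _ _ (\sum_(n <- S) ((if n == 0 then M ^+ 2 else 0) + \sum_(j < J) b j n))).
  rewrite big_seq [leRHS]big_seq; apply: ler_sum => n nS.
  case: eqP => [->|/eqP n0].
    rewrite brk0 powR1 mul1r; apply: ler_wpDr; first by apply: sumr_ge0.
    apply: lerXn2r; rewrite ?nnegrE ?cabs_ge0//.
      by rewrite (le_trans _ (hM t tT))// cabs_ge0.
    by rewrite fourier_cabs_profile; exact: hM.
  rewrite add0r; have np : (0 < `|n|)%N by rewrite absz_gt0.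
  pose j := trunc_log 2 `|n|.
  have hj : (2 ^ j <= `|n| < 2 ^ j.+1)%N by exact: trunc_log_bounds.
  have jJ : (j < J)%N.
    rewrite -(ltn_exp2l _ _ (ltnSn 1)); case/andP: hj => l1 _.
    exact: leq_ltn_trans l1 (hJ n nS).
  rewrite (bigD1 (Ordinal jJ))//=; apply: ler_wpDr; first by apply: sumr_ge0.
  rewrite -/(a n) [b _ n](_ : _ = 4 / c * (2 ^+ j) `^ (2 * s) * cabs (ep n (h j) - 1) ^+ 2 * a n); last by rewrite /b/=; ring.
  rewrite ler_wpM2r//.
  apply: (@le_trans _ _ (4 * (2 ^+ j) `^ (2 * s))).
    apply: (@le_trans _ _ ((4 * 2 ^+ j) `^ (2 * s))).
      apply: ge0_ler_powR; rewrite ?nnegrE ?mulr_ge0 ?exprn_ge0 ?brk_ge0//.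
      exact: brk_dyadic.
    rewrite powRM ?exprn_ge0// ler_wpM2r ?powR_ge0//.
    by rewrite -[leRHS]powRr1// ler_powR ?ler1n//; lra.
  rewrite [leRHS]mulrAC ler_wpM2r ?powR_ge0// -mulrA -[leLHS]mulr1 ler_pM2l//.
  rewrite mulrC ler_pdivlMr// mul1r; exact: hc.
rewrite big_split/=; apply: lerD.
  by apply: sum_mkcond_le => //; exact: sqr_ge0.
rewrite exchange_big/=; apply: (@le_trans _ _ (\sum_(j < J) D * q ^+ j)).
  apply: ler_sum => j _; rewrite /b -mulr_sumr /D -!mulrA ler_wpM2l// ler_wpM2l ?invr_ge0 ?(ltW c0)//.
  rewrite -mulr_sumr; apply: (@le_trans _ _ ((2 ^+ j) `^ (2 * s) * (K * (4 * (h j `^ (2 * s') * Bg))))).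
    by rewrite ler_wpM2l ?powR_ge0//; exact: key.
  have -> : q ^+ j = (2 ^+ j) `^ (2 * s) * h j `^ (2 * s').
    have e (r : R) : (2 ^+ j) `^ r = 2 `^ (j%:R * r) by rewrite -powR_mulrn// -(powRrM 2 j%:R).
    have eh : h j `^ (2 * s') = 2 `^ (- (j%:R * (2 * s'))).
      by rewrite /h -powR_inv1 ?exprn_ge0// -(powRrM (2 ^+ j)) mulN1r e mulrN.
    rewrite e eh -powRD; last by rewrite pnatr_eq0 implybT.
    by rewrite /q -powR_mulrn ?powR_ge0// -(powRrM 2 (2 * s - _)); congr (_ `^ _); ring.
  by rewrite le_eqVlt; apply/orP; left; apply/eqP; ring.
by rewrite -mulr_sumr ler_wpM2l// geometric_sum_le.
Qed.

End SobolevPersistence.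

(** * Differentiability of the coefficients and conservation of mass *)

Section SpatialL4.
Context {R : realType}.
Local Notation mu := (@lebesgue_measure R).
Local Notation MR := (measurableTypeR R).
Local Notation mu2 := (mu \x mu)%E.
Local Notation brk := (@brk R).
Let mC := @measurable_circle R.

Lemma tp_L4 : exists2 C : R, 0 < C & forall s (c : int -> R[i]), uniq s ->
  (\int[mu]_(x in circle) (cabs (tp s c x) ^+ 4)%:E <=
   (C * (\sum_(n <- s) brk n `^ (3 / 4) * cabs (c n) ^+ 2) ^+ 2)%:E)%E.
Proof.
have p1 : 1 < 3 / 2 :> R by lra.
have [B B0 hB] := bsum_brk p1; have P0 := @twopi_gt0 R.
exists (pi *+ 2 * (2 * B)); first by rewrite !mulr_gt0.
move=> s c us.
pose W (p : int * int) : R := brk p.1 `^ (3 / 4).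
have hS q : \sum_(p <- box s [:: 0%R]) (if q - p \in box s [:: 0%R] then (W p)^-1 * (W (q - p))^-1 else 0) <= 2 * B.
  rewrite sum_box; under eq_bigr => n _ do rewrite big_seq1.
  apply: (@le_trans _ _ (\sum_(n <- s) (brk n `^ (- (3 / 2)) + brk (q.1 - n) `^ (- (3 / 2))))).
    apply: ler_sum => n _; have x0 := @brkpow_ge0 R n (- (3 / 4)); have y0 := @brkpow_ge0 R (q.1 - n) (- (3 / 4)).
    have E m : brk m `^ (- (3 / 2)) = (brk m `^ (- (3 / 4))) ^+ 2.
      by rewrite brkpow_sqr; congr (_ `^ _); lra.
    rewrite !E; case: ifP => _; last by rewrite addr_ge0 ?sqr_ge0.
    rewrite /W/= -!powRN; set x := _ `^ _ in x0 *; set y := _ `^ _ in y0 *; nra.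
  have -> : 2 * B = B + B by ring.
  rewrite big_split/= lerD//; first exact: hB.
  have inj : injective (fun n => q.1 - n) by move=> a b /addrI /oppr_inj.
  exact: (bsum_inj inj hB).
have W0 p : 0 < W p by exact: brkpow_gt0.
have := tp2_L4 (fun p => c p.1) us (isT : uniq [:: 0%R]) W0 hS.
rewrite sum_box; under eq_bigr => n _ do rewrite big_seq1 /W/=.
rewrite ge0_integral_rect//; first last.
- by move=> z; rewrite lee_fin exprn_ge0 ?cabs_ge0.
- by apply/measurable_EFinP; apply: measurable_cabsX; exact: cmeasurable_tp2.
have E t : (\int[mu]_(x in circle) (cabs (tp2 (box s [:: 0%R]) (fun p => c p.1) (t, x)) ^+ 4)%:E =
    \int[mu]_(x in circle) (cabs (tp s c x) ^+ 4)%:E)%E.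
  apply: eq_integral => x _; rewrite tp2_box /tp; congr (cabs _ ^+ 4)%:E.
  by apply: eq_bigr => n _; rewrite big_seq1 ep0 mulr1.
under eq_integral => t _ do rewrite E.
set I := (\int[mu]_(x in circle) _)%E.
rewrite [X in (X <= _)%E](integral_cst mu mC I) [X in (_ * X <= _)%E]lebesgue_circle.
move=> h; have h2 : (I * (pi *+ 2)%:E <= (pi *+ 2 * (2 * B) * (\sum_(n <- s) brk n `^ (3 / 4) * cabs (c n) ^+ 2) ^+ 2)%:E * (pi *+ 2)%:E)%E.
  by apply: le_trans h _; rewrite -EFinM lee_fin le_eqVlt; apply/orP; left; apply/eqP; rewrite /W/=; ring.
by move: h2; rewrite lee_pmul2r// lte_fin.
Qed.

Lemma mem_zrN (M : nat) (n : int) : n \notin zr M -> (M.+1%:R <= `|n%:~R : R|).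
Proof. by rewrite mem_zr -ltnNge => h; rewrite -intr_norm -abszE -pmulrn ler_nat. Qed.

Lemma nrm2_tail_le (f : R -> R[i]) (r B : R) (M : nat) : cL2 f -> 0 <= r ->
  bsum (fun n => brk n `^ r * cabs (fourier f n) ^+ 2) B ->
  nrm2 (fun x => f x - tp (zr M) (fourier f) x) <= pi *+ 2 * (M.+1%:R `^ (- r) * B).
Proof.
move=> hf r0 hB; have hT := cL2_tp (zr M) (fourier f).
apply: parseval_le; first exact: cL2B.
move=> N; have M0 : 0 <= M.+1%:R `^ (- r) :> R by exact: powR_ge0.
apply: le_trans (bsumZ M0 hB (zr_uniq N)); apply: ler_sum => n _.
rewrite fourierB// fourier_tp ?zr_uniq//; case: ifPn => nM.
  by rewrite subrr cabs0 expr0n/= !mulr_ge0 ?brkpow_ge0 ?exprn_ge0 ?cabs_ge0.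
rewrite subr0 mulrA ler_peMl ?exprn_ge0 ?cabs_ge0//.
have Mp : 0 < M.+1%:R `^ r :> R by rewrite powR_gt0.
rewrite powRN mulrC ler_pdivlMr// mul1r; apply: ge0_ler_powR => //.
- by rewrite nnegrE.
- by rewrite nnegrE brk_ge0.
- by apply: le_trans (mem_zrN nM) _; rewrite /brk lerDr.
Qed.

Lemma L4_of_sobolev : exists2 C : R, 0 < C & forall (f : R -> R[i]) (B : R), cL2 f ->
  bsum (fun n => brk n `^ (3 / 4) * cabs (fourier f n) ^+ 2) B ->
  (\int[mu]_(x in circle) (cabs (f x) ^+ 4)%:E <= (C * B ^+ 2)%:E)%E /\
  forall M, (\int[mu]_(x in circle) (cabs (tp (zr M) (fourier f) x) ^+ 4)%:E <= (C * B ^+ 2)%:E)%E.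
Proof.
have [C C0 hC] := tp_L4; exists C => // f B hf hB; have B0 := bsum_ge0 hB.
have hM M : (\int[mu]_(x in circle) (cabs (tp (zr M) (fourier f) x) ^+ 4)%:E <= (C * B ^+ 2)%:E)%E.
  apply: le_trans (hC _ _ (zr_uniq M)) _; rewrite lee_fin ler_pM2l//.
  apply: lerXn2r; rewrite ?nnegrE//; last exact: hB (zr_uniq M).
  by apply: sumr_ge0 => n _; rewrite mulr_ge0 ?brkpow_ge0 ?exprn_ge0 ?cabs_ge0.
split => //; apply: (@L4_lower_semicontinuity _ MR R mu circle mC) => //.
- by rewrite [X in (X < _)%E]lebesgue_circle ltry.
- exact: measurable_cabs hf.1.
- by move=> x; exact: cabs_ge0.
- by rewrite mulr_ge0 ?sqr_ge0// ltW.
move=> e e0; have [N /(_ N (leqnn _)) hN] := fourier_complete hf e0.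
have hT := cL2_tp (zr N) (fourier f).
exists (fun x => cabs (tp (zr N) (fourier f) x)), (fun x => cabs (f x - tp (zr N) (fourier f) x)); split.
- by split=> [|x]; [exact: measurable_cabs hT.1|exact: cabs_ge0].
- by split=> [|x]; [exact: measurable_cabs (cL2B hf hT).1|exact: cabs_ge0].
- by move=> x _; apply: le_trans (cabsD _ _); rewrite addrC subrK.
- exact: hM.
- by rewrite -[X in (X <= _)%E]/(L2norm_sq _) nrm2E ?lee_fin//; exact: cL2B.
Qed.

(** The Lipschitz factor of the nonlinearity is quadratic, so L^4 bounds put it in L^2, and
    Cauchy-Schwarz against the L^2 difference bounds all coefficients at once. *)
Lemma wick_fourier_diff (P Q d : R) (f h : R -> R[i]) n : 0 <= Q -> 0 <= d -> cL2 f -> cL2 h ->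
  (\int[mu]_(x in circle) (cabs (f x) ^+ 4)%:E <= Q%:E)%E ->
  (\int[mu]_(x in circle) (cabs (h x) ^+ 4)%:E <= Q%:E)%E ->
  nrm2 (fun x => f x - h x) <= d ^+ 2 ->
  cabs (fourier (fun x => wick_nonlinearity P (f x)) n - fourier (fun x => wick_nonlinearity P (h x)) n) <=
    Num.sqrt (24 * Q + 3 * P ^+ 2 * (pi *+ 2)) * d.
Proof.
move=> Q0 d0 hf hh f4 h4 hd; have P0 := @twopi_gt0 R.
have mf := hf.1; have mh := hh.1.
have mw := cmeasurable_wick P mf; have mv := cmeasurable_wick P mh.
have m4 k (F : R -> R[i]) : cL2 F -> measurable_fun [set: MR] (fun x : MR => cabs (F x) ^+ k).
  by move=> hF; apply: measurable_cabsX; exact: hF.1.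
have wint (F : R -> R[i]) : cL2 F -> (\int[mu]_(x in circle) (cabs (F x) ^+ 4)%:E <= Q%:E)%E ->
    cint1 circle (fun x => wick_nonlinearity P (F x)).
  move=> hF F4; apply: (@cint1_le _ _ _ (fun x => (1 + `|P|) * (1 + cabs (F x) ^+ 4))) => //.
  - by apply: cmeasurable_wick; exact: hF.1.
  - by apply: measurable_funM => //; apply: measurable_funD => //; exact: m4.
  - by move=> x _; exact: wick_le.
  rewrite nnintZ//; first last.
  - by move=> x; rewrite addr_ge0 ?exprn_ge0 ?cabs_ge0.
  - by apply: measurable_funD => //; exact: m4.
  apply: lte_mul_pinfty => //; rewrite nnintD//; first last.
  - by move=> x; rewrite exprn_ge0 ?cabs_ge0.
  - exact: m4.
  by apply: lte_add_pinfty; [rewrite circle_integral_cst ltry|exact: le_lt_trans F4 (ltry _)].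
have bep x : cabs (expi (- (n%:~R * x)) : R[i]) <= 1 by rewrite cabs_expi.
have mep : @cmeasurable R _ MR (fun x => expi (- (n%:~R * x))).
  by under eq_fun do rewrite expiN; apply: cmeasurable_conj; exact: cmeasurable_ep.
have -> : fourier (fun x => wick_nonlinearity P (f x)) n - fourier (fun x => wick_nonlinearity P (h x)) n =
    fourier (fun x => wick_nonlinearity P (f x) - wick_nonlinearity P (h x)) n.
  rewrite /fourier -mulrBr -cintegralB//; first last.
  - by apply: (@cint1_bounded_mul _ _ _ _ 1) => //; exact: wint.
  - by apply: (@cint1_bounded_mul _ _ _ _ 1) => //; exact: wint.
  by congr (_ * _); apply: eq_cintegral => x _; rewrite mulrBl.
rewrite -lee_fin; apply: le_trans (cabs_fourier_le _ (cmeasurableB mw mv)) _.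
pose V x := 2 * (cabs (f x) ^+ 2 + cabs (h x) ^+ 2) + `|P|.
have mV : measurable_fun [set: MR] V.
  by apply: measurable_funD => //; apply: measurable_funM => //; apply: measurable_funD; exact: m4.
have V0 x : 0 <= V x by rewrite addr_ge0// mulr_ge0// addr_ge0// exprn_ge0 ?cabs_ge0.
apply: (@le_trans _ _ (\int[mu]_(x in circle) (V x * cabs (f x - h x))%:E)%E).
  apply: nnint_le => //.
  - exact: measurable_cabs (cmeasurableB mw mv).
  - by apply: measurable_funM => //; exact: measurable_cabs (cmeasurableB mf mh).
  - by move=> x _; exact: cabs_ge0.
  - by move=> x _; exact: wick_lipschitz.
have c0 : 0 <= 3 * P ^+ 2 by rewrite mulr_ge0// sqr_ge0.
have K0 : 0 <= 24 * Q + 3 * P ^+ 2 * (pi *+ 2) by apply: addr_ge0; apply: mulr_ge0 => //; exact: ltW.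
apply: (@integral_cauchy_schwarz _ MR R mu circle mC) => //.
- exact: measurable_cabs (cmeasurableB mf mh).
- by move=> x; exact: cabs_ge0.
- rewrite sqr_sqrtr//.
  apply: (@le_trans _ _ (\int[mu]_(x in circle) ((12 * cabs (f x) ^+ 4 + 12 * cabs (h x) ^+ 4)%R + 3 * P ^+ 2)%:E)%E).
    apply: nnint_le => //.
    + exact: measurable_funX.
    + by apply: measurable_funD => //; apply: measurable_funD; apply: measurable_funM => //; exact: m4.
    + by move=> x _; exact: sqr_ge0.
    move=> x _; rewrite /V; set a := cabs _; set b := cabs _.
    rewrite -(real_normK (num_real P)); set p := `|P|.
    have -> : a ^+ 4 = (a ^+ 2) ^+ 2 by rewrite -exprM.
    have -> : b ^+ 4 = (b ^+ 2) ^+ 2 by rewrite -exprM.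
    set X := a ^+ 2; set Y := b ^+ 2.
    have q1 := sqr_ge0 (2 * X - 2 * Y); have q2 := sqr_ge0 (2 * X - p); have q3 := sqr_ge0 (2 * Y - p).
    by nra.
  have p4 (F : R -> R[i]) x : 0 <= 12 * cabs (F x) ^+ 4 by rewrite mulr_ge0// exprn_ge0 ?cabs_ge0.
  rewrite nnintD//; first last.
  + by move=> x; rewrite addr_ge0.
  + by apply: measurable_funD; apply: measurable_funM => //; exact: m4.
  rewrite nnintD//; first last.
  + by apply: measurable_funM => //; exact: m4.
  + by apply: measurable_funM => //; exact: m4.
  rewrite circle_integral_cst !nnintZ//; first last.
  + by move=> x; rewrite exprn_ge0 ?cabs_ge0.
  + exact: m4.
  + by move=> x; rewrite exprn_ge0 ?cabs_ge0.
  + exact: m4.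
  rewrite (_ : 24 * Q + _ = (12 * Q + 12 * Q) + 3 * P ^+ 2 * (pi *+ 2)); last by ring.
  rewrite (EFinD (12 * Q + 12 * Q)) (EFinD (12 * Q)) (EFinM 12 Q).
  apply: leeD => //; apply: leeD.
  + by apply: lee_wpmul2l; rewrite ?lee_fin.
  + by apply: lee_wpmul2l; rewrite ?lee_fin.
by rewrite -[X in (X <= _)%E]/(L2norm_sq _) nrm2E ?lee_fin//; exact: cL2B.
Qed.

End SpatialL4.

(** * Cubic convolutions and uniform limits *)

Section CubicSums.
Context {R : realType}.
Local Notation MR := (measurableTypeR R).
Local Notation brk := (@brk R).

Definition triples (s : seq int) : seq (int * (int * int)) := [seq (a, q) | a <- s, q <- box s s].

Lemma sum_triples (V : nmodType) s (F : int * (int * int) -> V) :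
  \sum_(p <- triples s) F p = \sum_(a <- s) \sum_(b <- s) \sum_(d <- s) F (a, (b, d)).
Proof. by rewrite big_allpairs_dep; apply: eq_bigr => a _; rewrite sum_box. Qed.

Definition cubic s (c : int -> R[i]) (n : int) : R[i] :=
  \sum_(p <- triples s) (if p.1 - p.2.1 + p.2.2 == n then c p.1 * (c p.2.1)^cj * c p.2.2 else 0).

Lemma fourier_ep_sum (J : Type) (s : seq J) (k : J -> R[i]) (m : J -> int) n :
  fourier (fun x => \sum_(j <- s) k j * ep (m j) x) n = \sum_(j <- s) (if m j == n then k j else 0).
Proof.
rewrite fourier_ip /ip (@eq_cintegral _ circle _ (fun x => \sum_(j <- s) k j * (ep (m j) x * (ep n x)^cj))); last first.
  by move=> x _; rewrite mulr_suml; apply: eq_bigr => j _; rewrite mulrA.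
have h j : cint1 circle (fun x => ep (m j) x * (ep n x)^cj) by apply: cL2_cint1M; exact: cL2_ep.
rewrite cintegral_sum; [|exact: measurable_circle|by move=> j; apply: cint1Z => //; exact: measurable_circle].
rewrite mulr_sumr; apply: eq_bigr => j _.
rewrite cintegralZ//; last exact: measurable_circle.
rewrite mulrCA -/(ip (ep (m j)) (ep n)) -fourier_ip fourier_ep.
by case: eqP; rewrite ?mulr1 ?mulr0.
Qed.

Lemma tp_cube s (c : int -> R[i]) x :
  tp s c x * (tp s c x)^cj * tp s c x =
  \sum_(p <- triples s) (c p.1 * (c p.2.1)^cj * c p.2.2) * ep (p.1 - p.2.1 + p.2.2) x.
Proof.
rewrite sum_triples /tp cconj_sum mulr_suml mulr_suml; apply: eq_bigr => a _.
rewrite [X in X * _]mulr_sumr [LHS]mulr_suml; apply: eq_bigr => b _.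
rewrite mulr_sumr; apply: eq_bigr => d _; rewrite /= epD epB cconjM; ring.
Qed.

Lemma fourier_wick_tp (P : R) s (c : int -> R[i]) n : uniq s ->
  fourier (fun x => wick_nonlinearity P (tp s c x)) n =
  cubic s c n - P%:C * (if n \in s then c n else 0).
Proof.
move=> us; pose f x := tp s c x * (tp s c x)^cj * tp s c x; pose h x := P%:C * tp s c x.
have fE x : f x = \sum_(p <- triples s) (c p.1 * (c p.2.1)^cj * c p.2.2) * ep (p.1 - p.2.1 + p.2.2) x.
  exact: tp_cube.
have hf : cL2 f.
  have -> : f = fun x => \sum_(p <- triples s) (c p.1 * (c p.2.1)^cj * c p.2.2) * ep (p.1 - p.2.1 + p.2.2) x.
    by apply/funext => x; exact: fE.
  apply: (@cL2_bounded _ _ (\sum_(p <- triples s) cabs (c p.1 * (c p.2.1)^cj * c p.2.2))).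
    apply: cmeasurable_sum => p; apply: cmeasurableM; first exact: cmeasurable_cst.
    exact: cmeasurable_ep.
  move=> x; apply: le_trans (cabs_sum _ _ _) _; apply: ler_sum => p _.
  by rewrite cabsM cabs_ep mulr1.
have hh : cL2 h by apply: cL2Z; exact: cL2_tp.
transitivity (fourier (fun x => f x - h x) n).
  congr (fourier _ n); apply/funext => x.
  by rewrite /wick_nonlinearity /f /h rcB mulrBl cabs_sqrC.
rewrite fourierB//; congr (_ - _).
  have -> : f = fun x => \sum_(p <- triples s) (c p.1 * (c p.2.1)^cj * c p.2.2) * ep (p.1 - p.2.1 + p.2.2) x.
    by apply/funext => x; exact: fE.
  exact: fourier_ep_sum.
rewrite fourier_ip ipZl; [|exact: cL2_tp|exact: cL2_ep].
by rewrite mulrCA -fourier_ip fourier_tp.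
Qed.

Lemma uniform_limit_continuous (f : R -> R) :
  (forall T e, 0 < e -> exists2 F : R -> R, continuous F & forall t, `|t| <= T -> `|f t - F t| <= e) ->
  continuous f.
Proof.
move=> h t0; apply/cvgrPdist_le => /= e e0.
have e3 : 0 < e / 3 by rewrite divr_gt0.
have [F cF hF] := h (`|t0| + 1) (e / 3) e3.
have /cvgrPdist_le/(_ _ e3) nF := cF t0.
have nb : \forall t \near t0, `|t0 - t| <= 1 by exists 1 => //= y hy; exact: ltW.
near=> t.
have ht : `|t| <= `|t0| + 1.
  have : `|t0 - t| <= 1 by near: t.
  by move=> h1; rewrite -[t](subrK t0) addrC (le_trans (ler_normD _ _))// lerD2l distrC.
have h0 : `|t0| <= `|t0| + 1 by rewrite lerDl.
have h1 := hF _ h0; have h2 := hF _ ht.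
have h3 : `|F t0 - F t| <= e / 3 by near: t.
have -> : f t0 - f t = (f t0 - F t0) + (F t0 - F t) + (F t - f t) by ring.
rewrite (le_trans (ler_normD _ _))// (le_trans (lerD (ler_normD _ _) (lexx _)))//.
rewrite distrC in h2; lra.
Unshelve. all: by end_near. Qed.

Lemma uniform_limit_ccont (f : R -> R[i]) :
  (forall T e, 0 < e -> exists2 F : R -> R[i], ccont F & forall t, `|t| <= T -> cabs (f t - F t) <= e) ->
  ccont f.
Proof.
move=> h; split; apply: uniform_limit_continuous => T e e0; have [F [c1 c2] hF] := h T e e0.
- exists (fun x => complex.Re (F x)) => // t /hF; apply: le_trans.
  by rewrite -cReN -cReD; exact: Re_le_cabs.
- exists (fun x => complex.Im (F x)) => // t /hF; apply: le_trans.
  by rewrite -cImN -cImD; exact: Im_le_cabs.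
Qed.

End CubicSums.

Section Regularity.
Context {R : realType}.
Local Notation mu := (@lebesgue_measure R).
Local Notation MR := (measurableTypeR R).
Local Notation brk := (@brk R).
Context (sgn : R) (hsgn : sgn = 1 \/ sgn = -1) (g : R -> R[i]) (hg : inHhalf_minus g)
  (u : R -> R -> R[i]) (hu : is_wick_NLS_solution sgn g u).

Lemma ccont_coeff n : ccont (fun t => fourier (u t) n).
Proof.
have P0 := @twopi_gt0 R.
have key t0 e : 0 < e -> \forall t \near t0, cabs (fourier (u t0) n - fourier (u t) n) <= e.
  move=> e0; have [[_ /(_ t0) hc _ _] _ _] := hu.
  have d0 : 0 < e ^+ 2 * (pi *+ 2) by rewrite mulr_gt0// exprn_gt0.
  have nb : nbhs (0%E : \bar R) [set y | (y < (e ^+ 2 * (pi *+ 2))%:E)%E].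
    by apply: open_nbhs_nbhs; split; [exact: open_ereal_lt_ereal|rewrite /= lte_fin].
  have H : \forall t \near t0, (L2norm_sq (fun x => (u t x - u t0 x)%R) < (e ^+ 2 * (pi *+ 2))%:E)%E.
    exact: hc nb.
  apply: filterS H => t ht.
  have h1 := cL2B (sol_L2 hu t) (sol_L2 hu t0).
  rewrite /= nrm2E// lte_fin in ht.
  rewrite -opprB cabsN -fourierB; [|exact: (sol_L2 hu)|exact: (sol_L2 hu)].
  rewrite -(@ler_pXn2r _ 2) ?nnegrE ?cabs_ge0//; last exact: ltW.
  apply: le_trans (bsum_pt n (bessel h1)) _; rewrite ler_pdivrMr//; exact: ltW.
split => t0; apply/cvgrPdist_le => e e0; have := key t0 e e0; apply: filterS => t; apply: le_trans.
- by rewrite -cReN -cReD; exact: Re_le_cabs.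
- by rewrite -cImN -cImD; exact: Im_le_cabs.
Qed.

Lemma ccont_expi_sqr n : ccont (fun t : R => expi (t * n%:~R ^+ 2)).
Proof. by under eq_fun do rewrite mulrC; exact: ccont_expi. Qed.

Lemma sol_coeff_bound (r T : R) : 0 <= r < 1 -> exists B, forall t, `|t| <= T ->
  bsum (fun n => brk n `^ r * cabs (fourier (u t) n) ^+ 2) B.
Proof.
move=> /andP[r0 r1]; have hr : 0 <= r / 2 < 2^-1 by rewrite divr_ge0//=; lra.
have [B hB] := sobolev_persistence hsgn hu hg T hr; exists B => t /hB.
by rewrite (_ : 2 * (r / 2) = r) //; field.
Qed.

Definition cutoff_sol (M : nat) (t x : R) : R[i] := tp (zr M) (fourier (u t)) x.

(** Regularity 3/8 has two uses: it gives L^4 bounds for u and for its truncations, and the L^2 tail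
    of order M^(-3/8). The rate is uniform in n and in |t| <= T. *)
Lemma force_cutoff (T : R) : exists2 C : R, 0 <= C & forall M n t, `|t| <= T ->
  cabs (fourier (force g u t) n -
        fourier (fun x => wick_nonlinearity (wick_constant g) (cutoff_sol M t x)) n) <=
    C * M.+1%:R `^ (- (3 / 8)).
Proof.
have [C C0 hC] := @L4_of_sobolev R.
have [B hB] : exists B, forall t, `|t| <= T ->
  bsum (fun n => brk n `^ (3 / 4) * cabs (fourier (u t) n) ^+ 2) B.
  by apply: sol_coeff_bound; lra.
set P := wick_constant g; pose Q := C * `|B| ^+ 2.
exists (Num.sqrt (24 * Q + 3 * P ^+ 2 * (pi *+ 2)) * Num.sqrt (pi *+ 2 * `|B|)).
  by rewrite mulr_ge0 ?sqrtr_ge0.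
move=> M n t tT; have hBt := hB t tT; have B0 := bsum_ge0 hBt.
have hut := sol_L2 hu t; have [q1 q2] := hC _ _ hut hBt.
have m0 : 0 <= M.+1%:R `^ (- (3 / 8)) :> R by exact: powR_ge0.
rewrite -[leRHS]mulrA; apply: (@wick_fourier_diff R P Q _ (u t) (cutoff_sol M t)) => //.
- by rewrite mulr_ge0 ?sqr_ge0// ltW.
- exact: cL2_tp.
- by rewrite /Q ger0_norm.
- by rewrite /Q ger0_norm//; exact: q2.
rewrite exprMn sqr_sqrtr ?mulr_ge0 ?(ltW (@twopi_gt0 R))// ger0_norm//.
have r0 : 0 <= 3 / 4 :> R by lra.
apply: le_trans (nrm2_tail_le M hut r0 hBt) _.
rewrite -mulrA ler_wpM2l ?(ltW (@twopi_gt0 R))// mulrC ler_wpM2l//.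
by rewrite expr2 -powRD ?pnatr_eq0 ?implybT// (_ : - (3 / 4) = - (3 / 8) + - (3 / 8))//; lra.
Qed.

Lemma powR_cvg0_nat (r e : R) : 0 < r -> 0 < e -> exists N, forall M, (N <= M)%N -> M.+1%:R `^ (- r) <= e.
Proof.
move=> r0 e0; pose y := e `^ (- r^-1); exists (Num.truncn y) => M NM.
have y0 : 0 < y by rewrite powR_gt0.
have hy : y <= M.+1%:R.
  by apply: ltW; apply: (lt_le_trans (truncnS_gt y)); rewrite ler_nat ltnS.
apply: (@le_trans _ _ (y `^ (- r))).
  by apply: le_powRN => //; exact: ltW.
by rewrite /y -powRrM mulrNN mulVf ?gt_eqF// powRr1// ltW.
Qed.

Definition cutoff_force (M : nat) n (t : R) : R[i] :=
  expi (t * n%:~R ^+ 2) * fourier (fun x => wick_nonlinearity (wick_constant g) (cutoff_sol M t x)) n.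

Lemma ccont_cutoff_force M n : ccont (cutoff_force M n).
Proof.
apply: ccontM; first exact: ccont_expi_sqr.
have -> : (fun t => fourier (fun x => wick_nonlinearity (wick_constant g) (cutoff_sol M t x)) n) =
    fun t => cubic (zr M) (fourier (u t)) n + (- (wick_constant g)%:C) * (if n \in zr M then fourier (u t) n else 0).
  by apply/funext => t; rewrite fourier_wick_tp ?zr_uniq// mulNr.
apply: ccontD.
  apply: (@ccont_sum R _ (triples (zr M)) (fun p t => if p.1 - p.2.1 + p.2.2 == n
    then fourier (u t) p.1 * (fourier (u t) p.2.1)^cj * fourier (u t) p.2.2 else 0)) => p.
  case: (_ == n); last exact: ccont_cst.
  apply: ccontM; last exact: ccont_coeff.
  by apply: ccontM; [exact: ccont_coeff|apply: ccont_conj; exact: ccont_coeff].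
apply: ccontM; first exact: ccont_cst.
by case: (n \in _); [exact: ccont_coeff|exact: ccont_cst].
Qed.

Lemma tforce_cutoff (T : R) : exists2 C : R, 0 <= C & forall M n t, `|t| <= T ->
  cabs (tforce g u n t - cutoff_force M n t) <= C * M.+1%:R `^ (- (3 / 8)).
Proof.
have [C C0 hC] := force_cutoff T; exists C => // M n t tT.
by rewrite /tforce /cutoff_force -mulrBr cabsM cabs_expi mul1r hC.
Qed.

(** A locally uniform limit of the truncated coefficients, which are polynomials in the continuous
    coefficients of u. This upgrades the integrated Duhamel formula to a differential equation valid
    at every time. *)
Lemma ccont_tforce n : ccont (tforce g u n).
Proof.
apply: uniform_limit_ccont => T e e0; have [C C0 hC] := tforce_cutoff T.
have r0 : 0 < 3 / 8 :> R by lra.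
have C1 : 0 < C + 1 by rewrite ltr_wpDl.
have [N /(_ N (leqnn _)) hN] := powR_cvg0_nat r0 (divr_gt0 e0 C1).
exists (cutoff_force N n); first exact: ccont_cutoff_force.
move=> t tT; apply: le_trans (hC N n t tT) _.
apply: (@le_trans _ _ ((C + 1) * (e / (C + 1)))); last by rewrite mulrCA divff ?mulr1// gt_eqF.
by apply: ler_pM => //; rewrite ?powR_ge0 ?lerDl.
Qed.

Lemma is_cderive_profile n t : is_cderive t (profile u n) ('i * sgn%:C * tforce g u n t).
Proof.
have -> : profile u n = fun t => fourier g n + 'i * sgn%:C * oriented_cintegral 0 t (tforce g u n).
  by apply/funext => r; rewrite (profile_duhamel hu).
rewrite -[X in is_cderive _ _ X]add0r; apply: is_cderiveD; first exact: is_cderive_cst.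
by apply: is_cderiveZ; apply: is_cderive_oriented; exact: ccont_tforce.
Qed.

End Regularity.

(** * Conservation of mass through truncations *)

Section MassConservation.
Context {R : realType}.
Local Notation mu := (@lebesgue_measure R).
Local Notation MR := (measurableTypeR R).
Local Notation brk := (@brk R).
Context (sgn : R) (hsgn : sgn = 1 \/ sgn = -1) (g : R -> R[i]) (hg : inHhalf_minus g)
  (u : R -> R -> R[i]) (hu : is_wick_NLS_solution sgn g u).
Let mC := @measurable_circle R.
Let P := wick_constant g.

Lemma cconjK (z : R[i]) : z^cj^cj = z.
Proof. by apply: complex_eq; rewrite ?cRe_conj ?cIm_conj ?opprK. Qed.

(** Without the factor 2 pi of Parseval's identity, so its limit is the squared norm divided by 2
    pi, that is P/2. *)
Definition mass M t : R := \sum_(n <- zr M) cabs (fourier (u t) n) ^+ 2.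

(* The cut-off nonlinearity is gauge invariant, so its pairing with the cut-off solution is real. *)
Lemma cutoff_pairing_real M t :
  complex.Im (\sum_(n <- zr M) (fourier (u t) n)^cj *
    fourier (fun x => wick_nonlinearity P (cutoff_sol u M t x)) n) = 0.
Proof.
set f := fun x => wick_nonlinearity P (cutoff_sol u M t x); set c := fourier (u t).
have hT := cL2_tp (zr M) c.
have [B hB] : exists B : R, forall x, cabs (cutoff_sol u M t x) <= B.
  exists (\sum_(n <- zr M) cabs (c n)) => x; apply: le_trans (cabs_sum _ _ _) _.
  by apply: ler_sum => n _; rewrite cabsM cabs_ep mulr1.
have hf : cL2 f.
  apply: (@cL2_bounded _ _ ((1 + `|P|) * (1 + B ^+ 4))); first exact: cmeasurable_wick hT.1.
  move=> x; apply: le_trans (wick_le _ _) _; rewrite ler_wpM2l ?addr_ge0// lerD2l.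
  by apply: lerXn2r; rewrite ?nnegrE ?cabs_ge0// (le_trans _ (hB x)) ?cabs_ge0.
have E : \sum_(n <- zr M) (c n)^cj * fourier f n = (pi *+ 2)^-1%:C * ip f (tp (zr M) c).
  rewrite (ipC hT hf) ip_tp// cconj_sum mulr_sumr; apply: eq_bigr => n _.
  by rewrite [(c n * _)^cj]cconjM -(ipC (cL2_ep n) hf) fourier_ip mulrCA.
rewrite E cImM /= mul0r addr0; apply/eqP; rewrite mulf_eq0; apply/orP; right; apply/eqP.
rewrite /Rintegral integral0_eq// => x _; rewrite /f /wick_nonlinearity -/(cutoff_sol u M t x) -mulrA.
by rewrite -cabs_sqrC -rcM.
Qed.

(** Cauchy-Schwarz with weight 3/8. The dual sum of [brk n]^(-3/4) over [-M, M] diverges, but at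
    most like M^(3/8), since the exponent -9/8 is summable; the square root gives 3/16. *)
Lemma l1_cutoff (T : R) : exists2 C : R, 0 <= C & forall M t, `|t| <= T ->
  \sum_(n <- zr M) cabs (fourier (u t) n) <= C * M.+1%:R `^ (3 / 16).
Proof.
have [B hB] : exists B, forall t, `|t| <= T ->
  bsum (fun n => brk n `^ (3 / 4) * cabs (fourier (u t) n) ^+ 2) B.
  by apply: (sol_coeff_bound hsgn hg hu); lra.
have p1 : 1 < 9 / 8 :> R by lra.
have [K K0 hK] := bsum_brk p1.
exists (Num.sqrt K * Num.sqrt `|B|); first by rewrite mulr_ge0 ?sqrtr_ge0.
move=> M t tT; have hBt := hB t tT; have B0 := bsum_ge0 hBt.
have m0 : 0 <= M.+1%:R `^ (3 / 16) :> R by exact: powR_ge0.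
apply: (@le_trans _ _ (\sum_(n <- zr M) brk n `^ (- (3 / 8)) * (brk n `^ (3 / 8) * cabs (fourier (u t) n)))).
  by apply: ler_sum => n _; rewrite mulrA (mulrC (_ `^ _)) brkpowK mul1r.
have rhs0 : 0 <= Num.sqrt K * Num.sqrt `|B| * M.+1%:R `^ (3 / 16) by rewrite !mulr_ge0 ?sqrtr_ge0.
rewrite -(@ler_pXn2r _ 2) ?nnegrE//; last first.
  by apply: sumr_ge0 => n _; rewrite !mulr_ge0 ?brkpow_ge0 ?cabs_ge0.
apply: (@le_trans _ _ (M.+1%:R `^ (3 / 8) * K * B)); last first.
  rewrite !exprMn !sqr_sqrtr ?(ltW K0)// ger0_norm// expr2 -powRD ?pnatr_eq0 ?implybT//.
  rewrite (_ : 3 / 16 + 3 / 16 = 3 / 8); last by lra.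
  by rewrite le_eqVlt; apply/orP; left; apply/eqP; ring.
apply: sum_sqr_le.
- apply: le_trans (bsumZ (powR_ge0 _ _) hK (zr_uniq M)).
  rewrite big_seq [leRHS]big_seq; apply: ler_sum => n; rewrite mem_zr => nM.
  rewrite brkpow_sqr (_ : - (3 / 8) *+ 2 = 3 / 8 + - (9 / 8)); last by lra.
  have h38 : 0 <= 3 / 8 :> R by lra.
  rewrite brkpowD ler_wpM2r ?brkpow_ge0//; apply: (ge0_ler_powR h38); rewrite ?nnegrE ?brk_ge0//.
  by rewrite /brk -intr_norm -abszE -pmulrn addrC natr1 ler_nat ltnS.
- apply: le_trans (hBt _ (zr_uniq M)).
  apply: ler_sum => n _; rewrite exprMn brkpow_sqr (_ : (3 / 8) *+ 2 = 3 / 4)//; lra.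
Qed.

Definition mass_flux M t : R[i] :=
  'i * sgn%:C * \sum_(n <- zr M) (fourier (u t) n)^cj * fourier (force g u t) n.

Lemma mass_derivative M t : is_cderive t (fun s => (mass M s)%:C) (mass_flux M t + (mass_flux M t)^cj).
Proof.
have -> : (fun s => (mass M s)%:C) = fun s => \sum_(n <- zr M) profile u n s * (profile u n s)^cj.
  by apply/funext => s; rewrite /mass rc_sum; apply: eq_bigr => n _; rewrite fourier_cabs_profile cabs_sqrC.
set z := mass_flux M t; have -> : z + z^cj = \sum_(n <- zr M) ('i * sgn%:C * tforce g u n t * (profile u n t)^cj +
    profile u n t * ('i * sgn%:C * tforce g u n t)^cj).
  rewrite big_split/= /z /mass_flux; have K n : expi (t * n%:~R ^+ 2) * (expi (t * n%:~R ^+ 2))^cj = 1 :> R[i].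
    by rewrite -expiN -expiD subrr expi0.
  have E n : 'i * sgn%:C * tforce g u n t * (profile u n t)^cj =
      'i * sgn%:C * ((fourier (u t) n)^cj * fourier (force g u t) n).
    rewrite /tforce /profile cconjM -mulrA; congr (_ * _).
    by rewrite mulrACA K mul1r mulrC.
  congr (_ + _); first by rewrite mulr_sumr; apply: eq_bigr => n _; rewrite E.
  rewrite mulr_sumr cconj_sum; apply: eq_bigr => n _; by rewrite -E cconjM cconjK mulrC.
apply: is_cderive_sum => n; apply: is_cderiveM; first exact: (is_cderive_profile hsgn hg hu).
by apply: is_cderive_conj; exact: (is_cderive_profile hsgn hg hu).
Qed.

(** The truncated nonlinearity paired with the truncated solution contributes nothing to the real
    part, so only the error of [force_cutoff] remains. It is multiplied by the l^1 sum of the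
    coefficients: 3/16 - 3/8 = -3/16. *)
Lemma mass_derivative_le (T : R) : exists2 C : R, 0 <= C & forall M t, `|t| <= T ->
  cabs (mass_flux M t + (mass_flux M t)^cj) <=
  C * M.+1%:R `^ (- (3 / 16)).
Proof.
have [C1 C10 h1] := l1_cutoff T; have [C2 C20 h2] := force_cutoff hsgn hg hu T.
exists (2 * (C1 * C2)); first by rewrite !mulr_ge0.
move=> M t tT; set z := mass_flux M t.
pose S := \sum_(n <- zr M) (fourier (u t) n)^cj * fourier (fun x => wick_nonlinearity P (cutoff_sol u M t x)) n.
pose w := 'i * sgn%:C * S.
have w0 : w + w^cj = 0.
  have := cutoff_pairing_real M t; rewrite -/S => S0.
  apply: complex_eq; rewrite ?cReD ?cImD ?cRe_conj ?cIm_conj ?subrr//.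
  by rewrite /w !cReM !cImM S0 /= !(mul0r, mulr0, mul1r, subr0, addr0, sub0r, add0r, oppr0).
have -> : z + z^cj = (z - w) + (z - w)^cj.
  by rewrite cconjB addrACA -opprD w0 subr0.
apply: le_trans (cabsD _ _) _; rewrite cabs_conj.
have -> : cabs (z - w) + cabs (z - w) = 2 * cabs (z - w) by ring.
rewrite -[leRHS]mulrA ler_pM2l//.
rewrite /z /mass_flux /w -mulrBr cabsM (cabs_isgn hsgn) mul1r /S -sumrB.
apply: le_trans (cabs_sum _ _ _) _.
apply: (@le_trans _ _ (\sum_(n <- zr M) cabs (fourier (u t) n) * (C2 * M.+1%:R `^ (- (3 / 8))))).
  by apply: ler_sum => n _; rewrite -mulrBr cabsM cabs_conj ler_wpM2l ?cabs_ge0//; exact: h2.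
rewrite -mulr_suml.
apply: (@le_trans _ _ (C1 * M.+1%:R `^ (3 / 16) * (C2 * M.+1%:R `^ (- (3 / 8))))).
  by rewrite ler_wpM2r ?mulr_ge0 ?powR_ge0//; exact: h1.
rewrite (_ : - (3 / 16) = 3 / 16 + - (3 / 8)); last by lra.
rewrite [in leRHS]powRD ?pnatr_eq0 ?implybT// le_eqVlt; apply/orP; left; apply/eqP; ring.
Qed.

Lemma ccont_force n : ccont (fun t => fourier (force g u t) n).
Proof.
have -> : (fun t => fourier (force g u t) n) = fun t => (expi (t * n%:~R ^+ 2))^cj * tforce g u n t.
  by apply/funext => t; rewrite /tforce mulrA -expiN -expiD addNr expi0 mul1r.
apply: ccontM; last exact: (ccont_tforce hsgn hg hu).
by apply: ccont_conj; exact: ccont_expi_sqr.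
Qed.

Lemma ccont_mass_flux M : ccont (fun t => mass_flux M t + (mass_flux M t)^cj).
Proof.
have h : ccont (mass_flux M).
  apply: ccontM; first exact: ccont_cst.
  apply: (@ccont_sum R _ (zr M) (fun n t => (fourier (u t) n)^cj * fourier (force g u t) n)) => n.
  by apply: ccontM; [apply: ccont_conj; exact: (ccont_coeff hu)|exact: ccont_force].
by apply: ccontD => //; exact: ccont_conj.
Qed.

(** Stated with a rate at each M rather than as an identity in the limit, because the truncated mass
    is what multiplies the resonant terms. The rate combines the flux over time with the tail of g
    at time 0. *)
Lemma mass_conservation (T : R) : 0 <= T -> exists2 C : R, 0 <= C & forall M t, `|t| <= T ->
  `|mass M t - P / 2| <= C * M.+1%:R `^ (- (3 / 16)).
Proof.
move=> T0; have [C1 C10 h1] := mass_derivative_le T.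
have hg2 : cL2 g by apply: inL2_cL2; have [] := @hg 0 _; rewrite ?invr_gt0.
have r38 : 0 <= 3 / 8 :> R by lra.
have r12 : 3 / 8 < 2^-1 :> R by lra.
have [B hB] := inHs_bsum r38 (@hg _ r12).
have B0 := bsum_ge0 hB; have P0 := @twopi_gt0 R.
exists (C1 * T + B); first by rewrite addr_ge0// mulr_ge0.
move=> M t tT; set m := M.+1%:R `^ (- (3 / 16)); have m0 : 0 <= m by exact: powR_ge0.
have step a b : a <= b -> (forall s, a <= s <= b -> `|s| <= T) -> `|mass M b - mass M a| <= C1 * m * (b - a).
  move=> ab hs; have F := cintegral_ftc ab (ccont_mass_flux M) (mass_derivative M).
  rewrite -cabs_real rcB -F; apply: cabs_cintegral_itv => //.
  - exact: ccont_cmeasurable (ccont_mass_flux M).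
  - by rewrite mulr_ge0.
  - by move=> s /hs; exact: h1.
have h2 : `|mass M t - mass M 0| <= C1 * T * m.
  have [t0|/ltW t0] := leP 0 t.
    apply: le_trans (step 0 t t0 _) _.
      by move=> s /andP[s0 s1]; rewrite ger0_norm// (le_trans s1)// (le_trans (ler_norm _) tT).
    by rewrite subr0 mulrAC ler_wpM2r// ler_wpM2l// (le_trans (ler_norm _) tT).
  rewrite distrC; apply: le_trans (step t 0 t0 _) _.
    move=> s /andP[s0 s1]; rewrite ler0_norm//; apply: le_trans tT; rewrite ler0_norm// lerN2//.
  rewrite sub0r mulrAC ler_wpM2r// ler_wpM2l//; apply: le_trans tT; by rewrite ler0_norm.
have h3 : `|mass M 0 - P / 2| <= B * m.
  have hT := nrm2_tail_le M hg2 _ hB; have r0 : 0 <= 2 * (3 / 8) :> R by lra.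
  have {hT} := hT r0; have E : mass M 0 = \sum_(n <- zr M) cabs (fourier g n) ^+ 2.
    by apply: eq_bigr => n _; rewrite (fourier_sol0 hu).
  have := nrm2_ge0 (fun x => g x - tp (zr M) (fourier g) x).
  rewrite nrm2_subr_tp ?zr_uniq// [X in _ + _ * X](_ : _ = 0); last first.
    by rewrite big1// => n _; rewrite subrr cabs0 expr0n.
  rewrite mulr0 addr0 -E => k1 k2.
  have PE : P / 2 = nrm2 g / (pi *+ 2).
    by rewrite /P /wick_constant -/(nrm2 g) -[pi *+ 2]mulr_natr invfM mulrA (mulrC pi^-1).
  have gE : nrm2 g = P / 2 * (pi *+ 2) by rewrite PE divfK// gt_eqF.
  rewrite gE mulrC -mulrBr in k1 k2.
  have k1' : 0 <= P / 2 - mass M 0 by rewrite -(pmulr_rge0 _ P0).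
  rewrite distrC ger0_norm//; apply: (@le_trans _ _ (M.+1%:R `^ (- (2 * (3 / 8))) * B)).
    by rewrite -(ler_pM2l P0).
  rewrite mulrC ler_wpM2l// /m ler_powR ?ler1n//; lra.
have -> : mass M t - P / 2 = (mass M t - mass M 0) + (mass M 0 - P / 2) by ring.
by apply: le_trans (ler_normD _ _) _; rewrite mulrDl lerD.
Qed.

End MassConservation.

(** * Trilinear estimates and oscillation *)

Section Trilinear.
Context {R : realType}.
Local Notation brk := (@brk R).
Implicit Types (c : int -> R[i]) (F H : int -> R).

(** The function r recovers the output frequency from a triple in which the distinguished factor,
    carrying the derivatives, is listed first. *)
Definition tsum (r : int -> int -> int -> int) s F H n : R :=
  \sum_(p <- triples s) (if r p.1 p.2.1 p.2.2 == n then F p.1 * (H p.2.1 * H p.2.2) else 0).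

Lemma sum_inj_mkcond_le s (f : int -> int) n (a : R) : uniq s -> injective f -> 0 <= a ->
  \sum_(x <- s) (if f x == n then a else 0) <= a.
Proof.
move=> us inf a0; rewrite -(big_map f xpredT (fun k => if k == n then a else 0)).
by apply: sum_mkcond_le => //; rewrite map_inj_uniq.
Qed.

(* Young's inequality l2 * l1 * l1 -> l2, by Cauchy-Schwarz on the fibres of r. *)
Lemma young (r : int -> int -> int -> int) s S F H (A h : R) :
  uniq s -> uniq S -> (forall y z, injective (fun x => r x y z)) ->
  (forall x, 0 <= F x) -> (forall x, 0 <= H x) ->
  \sum_(x <- s) F x ^+ 2 <= A -> \sum_(x <- s) H x <= h ->
  \sum_(n <- S) tsum r s F H n ^+ 2 <= A * h ^+ 4.
Proof.
move=> us uS inr F0 H0 hA hh.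
have h0 : 0 <= \sum_(x <- s) H x by exact: sumr_ge0.
have HH p : 0 <= H p.2.1 * H p.2.2 :> R by rewrite mulr_ge0.
have sumHH : \sum_(y <- s) \sum_(z <- s) H y * H z <= h ^+ 2.
  under eq_bigr => y _ do rewrite -mulr_sumr.
  by rewrite -mulr_suml -expr2; apply: lerXn2r; rewrite ?nnegrE// (le_trans h0).
pose G n := \sum_(p <- triples s) (if r p.1 p.2.1 p.2.2 == n then F p.1 ^+ 2 * (H p.2.1 * H p.2.2) else 0).
have step n : tsum r s F H n ^+ 2 <= G n * h ^+ 2.
  pose al (p : int * (int * int)) : R := if r p.1 p.2.1 p.2.2 == n then F p.1 * Num.sqrt (H p.2.1 * H p.2.2) else 0.
  pose be (p : int * (int * int)) : R := if r p.1 p.2.1 p.2.2 == n then Num.sqrt (H p.2.1 * H p.2.2) else 0.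
  have -> : tsum r s F H n = \sum_(p <- triples s) al p * be p.
    apply: eq_bigr => p _; rewrite /al /be; case: ifP => _; last by rewrite mul0r.
    by rewrite -mulrA -expr2 sqr_sqrtr.
  apply: sum_sqr_le.
    rewrite le_eqVlt; apply/orP; left; apply/eqP; apply: eq_bigr => p _; rewrite /al.
    by case: ifP => _; rewrite ?expr0n// exprMn sqr_sqrtr.
  apply: le_trans sumHH; rewrite sum_triples exchange_big/=; apply: ler_sum => y _.
  rewrite exchange_big/=; apply: ler_sum => z _.
  rewrite (eq_bigr (fun x => if r x y z == n then H y * H z else 0)).
    by apply: (sum_inj_mkcond_le n us (inr y z)); rewrite mulr_ge0.
  move=> x _; rewrite /be/=; case: ifP => _; rewrite ?expr0n// sqr_sqrtr//.
  by rewrite mulr_ge0.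
apply: (@le_trans _ _ (\sum_(n <- S) G n * h ^+ 2)); first by apply: ler_sum.
have -> : A * h ^+ 4 = A * h ^+ 2 * h ^+ 2 by ring.
rewrite -mulr_suml ler_wpM2r ?sqr_ge0//.
rewrite exchange_big/=; apply: (@le_trans _ _ (\sum_(p <- triples s) F p.1 ^+ 2 * (H p.2.1 * H p.2.2))).
  apply: ler_sum => p _; rewrite (eq_bigr (fun n => if n == r p.1 p.2.1 p.2.2 then F p.1 ^+ 2 * (H p.2.1 * H p.2.2) else 0)).
    by apply: sum_mkcond_le => //; rewrite mulr_ge0// sqr_ge0.
  by move=> n _; rewrite eq_sym.
rewrite sum_triples/=; under eq_bigr => x _ do (under eq_bigr => y _ do rewrite -mulr_sumr); 
  under eq_bigr => x _ do rewrite -mulr_sumr.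
rewrite -mulr_suml; apply: ler_pM => //.
- by apply: sumr_ge0 => x _; exact: sqr_ge0.
- by apply: sumr_ge0 => x _; apply: sumr_ge0 => y _; rewrite mulr_ge0.
Qed.

(** The output frequency is at most three times the largest of the three brackets. Raising the
    exponent on that one by 2 e pays for the decay -e placed on each of the other two. *)
Lemma brk_triple_le (s e : R) (a b d : int) : 0 <= s <= 1 -> 0 <= e ->
  brk (a - b + d) `^ s <= 3 * (brk a `^ (s + 2 * e) * (brk b `^ (- e) * brk d `^ (- e)) +
    brk b `^ (s + 2 * e) * (brk a `^ (- e) * brk d `^ (- e)) +
    brk d `^ (s + 2 * e) * (brk a `^ (- e) * brk b `^ (- e))).
Proof.
move=> /andP[s0 s1] e0.
have key x y z : brk y <= brk x -> brk z <= brk x ->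
    brk x `^ s <= brk x `^ (s + 2 * e) * (brk y `^ (- e) * brk z `^ (- e)).
  move=> yx zx.
  have -> : brk x `^ s = brk x `^ (s + 2 * e) * (brk x `^ (- e) * brk x `^ (- e)).
    by rewrite -!brkpowD; congr (_ `^ _); ring.
  rewrite ler_wpM2l ?brkpow_ge0//.
  by apply: ler_pM; rewrite ?brkpow_ge0//; apply: le_powRN; rewrite ?brk_gt0.
have low x y z : 0 <= brk x `^ (s + 2 * e) * (brk y `^ (- e) * brk z `^ (- e)).
  by rewrite !mulr_ge0 ?brkpow_ge0.
have tri : brk (a - b + d) <= brk a + brk b + brk d.
  by rewrite -(brkN b); apply: le_trans (brkDs _ _) _; rewrite lerD2r brkDs.
have big x : brk a <= brk x -> brk b <= brk x -> brk d <= brk x -> brk (a - b + d) `^ s <= 3 * brk x `^ s.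
  move=> h1 h2 h3; have h : brk (a - b + d) <= 3 * brk x by apply: le_trans tri _; lra.
  apply: (@le_trans _ _ ((3 * brk x) `^ s)).
    by apply: ge0_ler_powR => //; rewrite nnegrE ?mulr_ge0 ?brk_ge0.
  rewrite powRM ?brk_ge0// ler_wpM2r ?brkpow_ge0//.
  by rewrite -[leRHS]powRr1// ler_powR// ler1n.
have := low a b d; have := low b a d; have := low d a b => l1 l2 l3.
have [ab|/ltW ba] := leP (brk a) (brk b).
  have [bd|/ltW db] := leP (brk b) (brk d).
    have ad := le_trans ab bd.
    by have := big d ad bd (lexx _); have := key d a b ad bd; lra.
  by have := big b ab (lexx _) db; have := key b a d ab db; lra.
have [ad|/ltW da] := leP (brk a) (brk d).
  have bd := le_trans ba ad.
  by have := big d ad bd (lexx _); have := key d a b ad bd; lra.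
by have := big a (lexx _) ba da; have := key a b d ba da; lra.
Qed.

(** Cauchy-Schwarz with the exponents -(1 + e)/2 and (1 - e)/2, whose sum is -e; the first one is
    square summable. *)
Lemma l1_of_sobolev (e : R) : 0 < e -> exists2 K : R, 0 < K & forall (c : int -> R[i]) B,
  bsum (fun n => brk n `^ (1 - e) * cabs (c n) ^+ 2) B ->
  bsum (fun n => brk n `^ (- e) * cabs (c n)) (Num.sqrt (K * B)).
Proof.
move=> e0; have p1 : 1 < 1 + e by rewrite ltrDl.
have [K K0 hK] := bsum_brk p1; exists K => // c B hB s us.
have B0 := bsum_ge0 hB.
rewrite -(@ler_pXn2r _ 2) ?nnegrE ?sqrtr_ge0//; last first.
  by apply: sumr_ge0 => n _; rewrite mulr_ge0 ?brkpow_ge0 ?cabs_ge0.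
rewrite sqr_sqrtr ?mulr_ge0 ?(ltW K0)//.
rewrite (eq_bigr (fun n => brk n `^ (- (1 + e) / 2) * (brk n `^ ((1 - e) / 2) * cabs (c n)))); last first.
  by move=> n _; rewrite mulrA -brkpowD; congr (_ `^ _ * _); field.
apply: sum_sqr_le.
- apply: le_trans (hK s us); apply: ler_sum => n _; rewrite brkpow_sqr.
  by rewrite (_ : _ *+ 2 = - (1 + e))//; field.
- apply: le_trans (hB s us); apply: ler_sum => n _; rewrite exprMn brkpow_sqr.
  by rewrite (_ : _ *+ 2 = 1 - e)//; field.
Qed.

(** The derivatives fall on the largest frequency, estimated in l^2, and the other two factors are
    in l^1 after the loss e. The bound does not depend on M; 81 is 27 from squaring three times a
    sum of three terms, taken for three sums. *)
Lemma trilinear_estimate (s e B h : R) c : 0 <= s <= 1 -> 0 < e ->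
  bsum (fun n => brk n `^ (2 * (s + 2 * e)) * cabs (c n) ^+ 2) B ->
  bsum (fun n => brk n `^ (- e) * cabs (c n)) h ->
  forall M, bsum (fun n => brk n `^ (2 * s) * cabs (cubic (zr M) c n) ^+ 2) (81 * (B * h ^+ 4)).
Proof.
move=> s01 e0 hB hh M S uS.
pose F n := brk n `^ (s + 2 * e) * cabs (c n); pose H n := brk n `^ (- e) * cabs (c n).
have F0 n : 0 <= F n by rewrite mulr_ge0 ?brkpow_ge0 ?cabs_ge0.
have H0 n : 0 <= H n by rewrite mulr_ge0 ?brkpow_ge0 ?cabs_ge0.
have us := zr_uniq M; set s' := zr M in us *.
have hF : \sum_(x <- s') F x ^+ 2 <= B.
  apply: le_trans (hB _ us); apply: ler_sum => n _; rewrite exprMn brkpow_sqr.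
  by rewrite (_ : (s + 2 * e) *+ 2 = 2 * (s + 2 * e))//; ring.
(* One relation n = n1 - n2 + n3, with the distinguished factor in each of its three positions. *)
pose r1 (x y z : int) := x - y + z; pose r2 (x y z : int) := y - x + z; pose r3 (x y z : int) := y - z + x.
have i1 y z : injective (fun x => r1 x y z) by move=> x x' /addIr /addIr.
have i2 y z : injective (fun x => r2 x y z) by move=> x x' /addIr /addrI /oppr_inj.
have i3 y z : injective (fun x => r3 x y z) by move=> x x' /addrI.
have y1 := young us uS i1 F0 H0 hF (hh _ us).
have y2 := young us uS i2 F0 H0 hF (hh _ us).
have y3 := young us uS i3 F0 H0 hF (hh _ us).
have e2 n : tsum r2 s' F H n = \sum_(p <- triples s') (if p.1 - p.2.1 + p.2.2 == n then F p.2.1 * (H p.1 * H p.2.2) else 0).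
  by rewrite /tsum !sum_triples exchange_big.
have e3 n : tsum r3 s' F H n = \sum_(p <- triples s') (if p.1 - p.2.1 + p.2.2 == n then F p.2.2 * (H p.1 * H p.2.1) else 0).
  rewrite /tsum !sum_triples exchange_big/=; apply: eq_bigr => a _; exact: exchange_big.
have key n : brk n `^ s * cabs (cubic s' c n) <= 3 * (tsum r1 s' F H n + tsum r2 s' F H n + tsum r3 s' F H n).
  rewrite e2 e3 /tsum -!big_split/= mulr_sumr; apply: (@le_trans _ _ (brk n `^ s *
    \sum_(p <- triples s') (if p.1 - p.2.1 + p.2.2 == n then cabs (c p.1) * cabs (c p.2.1) * cabs (c p.2.2) else 0))).
    rewrite ler_wpM2l ?brkpow_ge0//; apply: le_trans (cabs_sum _ _ _) _; apply: ler_sum => p _.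
    by case: ifP => _; rewrite ?cabs0// !cabsM cabs_conj.
  rewrite mulr_sumr; apply: ler_sum => -[a [b d]] _ /=; rewrite /r1.
  case: eqP => [<-|_]; last by rewrite !addr0 !mulr0.
  have := brk_triple_le a b d s01 (ltW e0); set X := cabs (c a); set Y := cabs (c b); set Z := cabs (c d).
  have XYZ : 0 <= X * Y * Z by rewrite !mulr_ge0 ?cabs_ge0.
  move=> /(ler_wpM2r XYZ) /le_trans; apply.
  by rewrite /F /H -/X -/Y -/Z le_eqVlt; apply/orP; left; apply/eqP; ring.
apply: (@le_trans _ _ (\sum_(n <- S) 27 * (tsum r1 s' F H n ^+ 2 + tsum r2 s' F H n ^+ 2 + tsum r3 s' F H n ^+ 2))).
  apply: ler_sum => n _; rewrite (_ : 2 * s = s *+ 2); last by ring.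
  rewrite -brkpow_sqr -exprMn.
  have k := key n; set a := tsum r1 s' F H n in k *; set b := tsum r2 s' F H n in k *; set d := tsum r3 s' F H n in k *.
  apply: (@le_trans _ _ ((3 * (a + b + d)) ^+ 2)).
    have l0 : 0 <= brk n `^ s * cabs (cubic s' c n) by rewrite mulr_ge0 ?brkpow_ge0 ?cabs_ge0.
    by apply: lerXn2r; rewrite ?nnegrE// (le_trans l0).
  by have := sqr_ge0 (a - b); have := sqr_ge0 (a - d); have := sqr_ge0 (b - d); nra.
rewrite -mulr_sumr !big_split/=; have := lerD (lerD y1 y2) y3; lra.
Qed.

End Trilinear.

(** * Sobolev bounds for the force and time majorants *)

Section Amplitudes.
Context {R : realType}.
Local Notation mu := (@lebesgue_measure R).
Local Notation MR := (measurableTypeR R).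
Local Notation brk := (@brk R).
Context (sgn : R) (hsgn : sgn = 1 \/ sgn = -1) (g : R -> R[i]) (hg : inHhalf_minus g)
  (u : R -> R -> R[i]) (hu : is_wick_NLS_solution sgn g u).
Let P := wick_constant g.

Lemma sqrD_le2 (x y : R) : (x + y) ^+ 2 <= 2 * x ^+ 2 + 2 * y ^+ 2.
Proof. by rewrite -subr_ge0 (_ : _ - _ = (x - y) ^+ 2) ?sqr_ge0//; ring. Qed.

Lemma cabs_sqrD_le2 (z w : R[i]) : cabs (z + w) ^+ 2 <= 2 * cabs z ^+ 2 + 2 * cabs w ^+ 2.
Proof.
apply: le_trans (sqrD_le2 _ _).
by apply: lerXn2r; rewrite ?nnegrE ?cabs_ge0 ?addr_ge0 ?cabs_ge0// cabsD.
Qed.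

(** For truncated data the trilinear estimate is uniform in M, and the Wick term is linear. The
    truncation error is uniform in n but carries no weight, so M is chosen after the finite set
    S. *)
Lemma force_sobolev (s T : R) : 0 <= s < 2^-1 -> exists K, forall t, `|t| <= T ->
  bsum (fun n => brk n `^ (2 * s) * cabs (fourier (force g u t) n) ^+ 2) K.
Proof.
move=> /andP[s0 s1]; pose e := (2^-1 - s) / 4; have e0 : 0 < e by rewrite /e; lra.
have s01 : 0 <= s <= 1 by rewrite s0; lra.
have [B1 hB1] : exists B, forall t, `|t| <= T ->
    bsum (fun n => brk n `^ (2 * (s + 2 * e)) * cabs (fourier (u t) n) ^+ 2) B.
  by apply: (sol_coeff_bound hsgn hg hu); rewrite /e; lra.
have [B2 hB2] : exists B, forall t, `|t| <= T ->
    bsum (fun n => brk n `^ (1 - e) * cabs (fourier (u t) n) ^+ 2) B.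
  by apply: (sol_coeff_bound hsgn hg hu); rewrite /e; lra.
have [K K0 hK] := @l1_of_sobolev R e e0.
have [C C0 hC] := force_cutoff hsgn hg hu T.
pose D := 81 * (B1 * Num.sqrt (K * B2) ^+ 4).
exists (2 * (2 * D + 2 * (P ^+ 2 * B1)) + 1) => t tT S uS.
have hb1 := hB1 t tT; have tri := trilinear_estimate s01 e0 hb1 (hK _ _ (hB2 t tT)).
(* Total weight of S; d is chosen so that W times the squared truncation error contributes at most
   1. *)
pose W := \sum_(n <- S) brk n `^ (2 * s).
have W0 : 0 <= W by apply: sumr_ge0 => n _; exact: brkpow_ge0.
have r0 : 0 < 3 / 8 :> R by lra.
pose d := (1 + 2 * W * (C + 1) ^+ 2)^-1.
have q0 : 0 < 1 + 2 * W * (C + 1) ^+ 2 by rewrite ltr_wpDr// mulr_ge0 ?sqr_ge0// mulr_ge0.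
have d0 : 0 < d by rewrite invr_gt0.
have [M /(_ M (leqnn _)) hM] := powR_cvg0_nat r0 d0.
have m0 : 0 <= M.+1%:R `^ (- (3 / 8)) :> R by exact: powR_ge0.
set m := M.+1%:R `^ (- (3 / 8)) in hM m0.
have m1 : m <= 1 by apply: le_trans hM _; rewrite invf_le1// lerDl mulr_ge0 ?sqr_ge0// mulr_ge0.
pose N n := fourier (fun x => wick_nonlinearity P (cutoff_sol u M t x)) n.
have hN n : brk n `^ (2 * s) * cabs (N n) ^+ 2 <=
    2 * (brk n `^ (2 * s) * cabs (cubic (zr M) (fourier (u t)) n) ^+ 2) +
    2 * (P ^+ 2 * (brk n `^ (2 * (s + 2 * e)) * cabs (fourier (u t) n) ^+ 2)).
  rewrite /N fourier_wick_tp ?zr_uniq//.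
  have p0 := brkpow_ge0 n (2 * s).
  apply: (@le_trans _ _ (brk n `^ (2 * s) * (2 * cabs (cubic (zr M) (fourier (u t)) n) ^+ 2 + 2 * (P ^+ 2 * cabs (fourier (u t) n) ^+ 2)))).
    rewrite ler_wpM2l//; apply: le_trans (cabs_sqrD_le2 _ _) _; rewrite lerD2l ler_pM2l//.
    rewrite cabsN cabsM cabs_real exprMn real_normK ?num_real// ler_wpM2l ?sqr_ge0//.
    by case: ifP => _; rewrite // cabs0 expr0n/= exprn_ge0 ?cabs_ge0.
  rewrite mulrDr lerD//; first by rewrite mulrCA.
  rewrite mulrCA ler_pM2l// mulrCA ler_wpM2l ?sqr_ge0// ler_wpM2r ?exprn_ge0 ?cabs_ge0//.
  by apply: brkpow_le; lra.
have sumN : \sum_(n <- S) brk n `^ (2 * s) * cabs (N n) ^+ 2 <= 2 * D + 2 * (P ^+ 2 * B1).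
  apply: le_trans (bsumD (bsumZ (ler0n _ 2) (tri M)) (bsumZ (ler0n _ 2) (bsumZ (sqr_ge0 P) hb1)) uS).
  by apply: ler_sum => n _; exact: hN.
apply: (@le_trans _ _ (\sum_(n <- S) (2 * (brk n `^ (2 * s) * cabs (N n) ^+ 2) + brk n `^ (2 * s) * (2 * (C * m) ^+ 2)))).
  apply: ler_sum => n _; rewrite [X in _ <= X + _]mulrCA -mulrDr ler_wpM2l ?brkpow_ge0//.
  rewrite -[fourier (force g u t) n](subrK (N n)) addrC.
  apply: le_trans (cabs_sqrD_le2 _ _) _; rewrite lerD2l ler_pM2l//.
  by apply: lerXn2r; rewrite ?nnegrE ?cabs_ge0 ?mulr_ge0//; exact: hC.
rewrite big_split/= -mulr_sumr -mulr_suml -/W; apply: lerD; first by rewrite ler_pM2l.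
have Cm : (C * m) ^+ 2 <= (C + 1) ^+ 2 * d.
  rewrite exprMn; apply: ler_pM; rewrite ?sqr_ge0//.
    by apply: lerXn2r; rewrite ?nnegrE ?addr_ge0// lerDl.
  by apply: le_trans hM; rewrite expr2 ler_piMl.
apply: (@le_trans _ _ (W * (2 * ((C + 1) ^+ 2 * d)))); first by rewrite ler_wpM2l// ler_pM2l.
rewrite mulrA mulrA -(mulrC d) ler_pdivrMl// mulr1 (mulrC W) lerDr//.
Qed.

(** A single number dominates both the supremum of |a_n| on [-T, T] and the L^1 norm of its
    derivative, the two quantities entering an integration by parts. *)
Definition amp (T : R) n : R :=
  cabs (fourier g n) + fine (\int[mu]_(s in `[(- T)%R, T]) (cabs (tforce g u n s))%:E)%E.

Lemma tforce_norm T n : (\int[mu]_(s in `[(- T)%R, T]) (cabs (tforce g u n s))%:E =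
  (fine (\int[mu]_(s in `[(- T)%R, T]) (cabs (tforce g u n s))%:E))%:E)%E.
Proof.
have hi := tforce_cint1 hu n (- T) T.
by rewrite fineK// ge0_fin_numE ?hi.2//; apply: integral_ge0 => s _; rewrite lee_fin cabs_ge0.
Qed.

Lemma tforce_norm_ge0 T n : 0 <= fine (\int[mu]_(s in `[(- T)%R, T]) (cabs (tforce g u n s))%:E)%E.
Proof. by rewrite fine_ge0//; apply: integral_ge0 => s _; rewrite lee_fin cabs_ge0. Qed.

Lemma amp_ge0 T n : 0 <= amp T n.
Proof. by rewrite addr_ge0 ?cabs_ge0 ?tforce_norm_ge0. Qed.

Lemma profile_amp T n t : `|t| <= T -> cabs (profile u n t) <= amp T n.
Proof.
move=> tT; have h := tT; rewrite ler_norml in h.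
have h0 : - T <= 0 <= T by rewrite oppr_le0 andbb (le_trans _ tT).
have := profile_increment_le hsgn hu n h h0; rewrite tforce_norm lee_fin => hd.
rewrite -[profile u n t](subrK (profile u n 0)) addrC.
apply: le_trans (cabsD _ _) _; apply: lerD => //.
by rewrite -fourier_cabs_profile (fourier_sol0 hu).
Qed.

(** Cauchy-Schwarz in time replaces the L^1 norm of the derivative by its L^2 norm; the weighted sum
    over n then goes inside the time integral, where [force_sobolev] holds at each time. *)
Lemma amp_sobolev (s T : R) : 0 <= s < 2^-1 -> 0 <= T ->
  exists K, bsum (fun n => brk n `^ (2 * s) * amp T n ^+ 2) K.
Proof.
move=> hs T0; have /andP[s0 s1] := hs.
have [Bg hBg] := inHs_bsum s0 (@hg _ s1).
have [K hK] := force_sobolev T hs.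
exists (2 * Bg + 2 * (T *+ 2 * (K * (T *+ 2)))) => S uS.
have TT : - T <= T by rewrite (le_trans _ T0)// oppr_le0.
have T2 : T - - T = T *+ 2 by rewrite opprK mulr2n.
have T20 : 0 <= T *+ 2 by rewrite mulrn_wge0.
have mJ : measurable (`[(- T)%R, T]%classic : set MR) by exact: measurable_itv.
have mf n : measurable_fun [set: MR] (fun t : MR => cabs (tforce g u n t)).
  by apply: measurable_cabs; exact: (tforce_cint1 hu n 0 0).1.
have mf2 n : measurable_fun [set: MR] (fun t : MR => cabs (tforce g u n t) ^+ 2).
  by apply: measurable_cabsX; exact: (tforce_cint1 hu n 0 0).1.
pose J n := (\int[mu]_(t in `[(- T)%R, T]) (cabs (tforce g u n t) ^+ 2)%:E)%E.
have J0 n : (0 <= J n)%E by apply: integral_ge0 => t _; rewrite lee_fin exprn_ge0 ?cabs_ge0.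
have sumJ : (\sum_(n <- S) (brk n `^ (2 * s))%:E * J n <= (K * (T *+ 2))%:E)%E.
  apply: (@le_trans _ _ (\int[mu]_(t in `[(- T)%R, T]) (\sum_(n <- S) brk n `^ (2 * s) * cabs (tforce g u n t) ^+ 2)%:E)%E).
    rewrite nnint_sum//; first last.
    - by move=> n t; rewrite mulr_ge0 ?brkpow_ge0// exprn_ge0 ?cabs_ge0.
    - by move=> n; apply: measurable_funM.
    rewrite le_eqVlt; apply/orP; left; apply/eqP; apply: eq_bigr => n _.
    by rewrite nnintZ ?brkpow_ge0// => t; rewrite exprn_ge0 ?cabs_ge0.
  rewrite -T2 -(integral_itv_cst K TT); apply: nnint_le => //.
  - by apply: measurable_sum => n; apply: measurable_funM.
  - by move=> t _; apply: sumr_ge0 => n _; rewrite mulr_ge0 ?brkpow_ge0// exprn_ge0 ?cabs_ge0.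
  move=> t; rewrite /= in_itv/= -ler_norml => tT; apply: le_trans (hK t tT S uS).
  by apply: ler_sum => n _; rewrite /tforce cabsM cabs_expi mul1r.
have Jfin n : n \in S -> J n \is a fin_num.
  move=> nS; rewrite ge0_fin_numE//.
  have : ((brk n `^ (2 * s))%:E * J n < +oo)%E.
    apply: le_lt_trans (ltry (K * (T *+ 2))); apply: le_trans sumJ.
    rewrite (big_rem n)//= leeDl// sume_ge0// => k _.
    by rewrite mule_ge0// lee_fin brkpow_ge0.
  case: (J n) (J0 n) => [r _ _|_|//]; first exact: ltry.
  by rewrite gt0_muley// lte_fin brkpow_gt0.
have key n : n \in S -> fine (\int[mu]_(t in `[(- T)%R, T]) (cabs (tforce g u n t))%:E)%E ^+ 2 <= T *+ 2 * fine (J n).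
  move=> nS; have j0 : 0 <= fine (J n) by rewrite fine_ge0.
  have h : (\int[mu]_(t in `[(- T)%R, T]) (cabs (tforce g u n t) * 1)%:E <= (Num.sqrt (fine (J n)) * Num.sqrt (T *+ 2))%:E)%E.
    apply: (@integral_cauchy_schwarz _ MR R mu _ mJ (fun t => cabs (tforce g u n t)) (fun=> 1)) => //.
    - by move=> t; exact: cabs_ge0.
    - by rewrite sqr_sqrtr// fineK ?Jfin.
    - by rewrite sqr_sqrtr// expr1n integral_itv_cst// mul1r T2.
  move: h; under eq_integral => t _ do rewrite mulr1.
  rewrite tforce_norm lee_fin => h.
  apply: (@le_trans _ _ ((Num.sqrt (fine (J n)) * Num.sqrt (T *+ 2)) ^+ 2)).
    by apply: lerXn2r; rewrite ?nnegrE ?tforce_norm_ge0// mulr_ge0 ?sqrtr_ge0.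
  by rewrite exprMn !sqr_sqrtr// mulrC.
apply: (@le_trans _ _ (\sum_(n <- S) (2 * (brk n `^ (2 * s) * cabs (fourier g n) ^+ 2) +
    2 * (T *+ 2 * (brk n `^ (2 * s) * fine (J n)))))).
  rewrite big_seq [leRHS]big_seq; apply: ler_sum => n nS.
  apply: (@le_trans _ _ (brk n `^ (2 * s) * (2 * cabs (fourier g n) ^+ 2 + 2 * (T *+ 2 * fine (J n))))).
    rewrite ler_wpM2l ?brkpow_ge0//; apply: le_trans (sqrD_le2 _ _) _.
    by rewrite lerD2l ler_pM2l//; exact: key.
  by rewrite le_eqVlt; apply/orP; left; apply/eqP; ring.
rewrite big_split/= -!mulr_sumr; apply: lerD; first by rewrite ler_pM2l//; exact: hBg.
rewrite ler_pM2l// ler_wpM2l// -lee_fin -sumEFin; apply: le_trans sumJ.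
rewrite le_eqVlt; apply/orP; left; apply/eqP; rewrite big_seq [RHS]big_seq.
by apply: eq_bigr => n nS; rewrite EFinM fineK ?Jfin.
Qed.

End Amplitudes.

Section WeightedSum.
Context {R : realType}.
Local Notation brk := (@brk R).

(** Common majorant of the oscillatory integrals for the time increments and for the weighted
    spatial sum. For a fixed middle frequency it factorizes into a function of n1 and the same
    function of n3. *)
Definition trilinear_weight (al : R) (A : int -> R) (p : int * (int * int)) : R :=
  A p.2.1 * ((brk p.1 `^ al * A p.1 * brk (p.1 - p.2.1) `^ (al - 1)) *
             (brk p.2.2 `^ al * A p.2.2 * brk (p.2.2 - p.2.1) `^ (al - 1))).

(** Summing over n removes the constraint on the triple. For a fixed middle frequency m what is left
    is A_m G(m)^2, and Cauchy-Schwarz bounds G(m)^2 by a multiple of [brk m]^(-2 e), just the decay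
    that makes A summable. *)
Lemma trilinear_l1 (al : R) (A : int -> R) : 0 < al < 2^-1 -> (forall n, 0 <= A n) ->
  (forall s, 0 <= s < 2^-1 -> exists B, bsum (fun n => brk n `^ (2 * s) * A n ^+ 2) B) ->
  exists2 K, 0 <= K & forall S M, uniq S ->
  \sum_(n <- S) \sum_(p <- triples (zr M))
    (if p.1 - p.2.1 + p.2.2 == n then trilinear_weight al A p else 0) <= K.
Proof.
(* With this e both al + e < 1/2 and 2 - 2 al - 2 e = 3/2 - al > 1 hold. *)
move=> /andP[al0 al1] A0 hA; pose e := (2^-1 - al) / 2; have e0 : 0 < e by rewrite /e; lra.
have [|B hB] := hA (al + e); first by rewrite /e; lra.
have [|B2 hB2] := hA ((1 - 2 * e) / 2); first by rewrite /e; lra.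
have p1 : 1 < 2 - 2 * al - 2 * e by rewrite /e; lra.
have [K1 K10 hK1] := bsum_brk p1.
have [K2 K20 hK2] := @l1_of_sobolev R (2 * e) (mulr_gt0 (ltr0n _ 2) e0).
have B0 := bsum_ge0 hB.
have hl1 : bsum (fun n => brk n `^ (- (2 * e)) * A n) (Num.sqrt (K2 * B2)).
  have := hK2 (fun n => (A n)%:C) B2; have E n : cabs (A n)%:C = A n :> R by rewrite cabs_real ger0_norm.
  move=> h; apply: (@bsum_le R _ _ _ _ (h _)) => n; first by rewrite E.
  by move=> us; under eq_bigr => m _ do rewrite E; apply: le_trans (hB2 n us); apply: ler_sum => m _;
    rewrite (_ : 2 * ((1 - 2 * e) / 2) = 1 - 2 * e)//; field.
exists (B * K1 * Num.sqrt (K2 * B2)); first by rewrite !mulr_ge0 ?sqrtr_ge0// ltW.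
move=> S M uS; rewrite exchange_big/=.
have w0 p : 0 <= trilinear_weight al A p by rewrite !mulr_ge0 ?brkpow_ge0.
apply: (@le_trans _ _ (\sum_(p <- triples (zr M)) trilinear_weight al A p)).
  apply: ler_sum => p _; rewrite (eq_bigr (fun n => if n == p.1 - p.2.1 + p.2.2 then trilinear_weight al A p else 0)).
    exact: sum_mkcond_le.
  by move=> n _; rewrite eq_sym.
rewrite sum_triples exchange_big/=.
pose G (m : int) : R := \sum_(a <- zr M) brk a `^ al * A a * brk (a - m) `^ (al - 1).
rewrite (eq_bigr (fun m : int => A m * G m ^+ 2)); last first.
  move=> m _; rewrite expr2 /G mulr_suml mulr_sumr; apply: eq_bigr => a _.
  by rewrite !mulr_sumr; apply: eq_bigr => d _.
have hG m : G m ^+ 2 <= B * (K1 * brk m `^ (- (2 * e))).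
  apply: (@le_trans _ _ ((\sum_(a <- zr M) (brk a `^ (al + e) * A a) * (brk a `^ (- e) * brk (a - m) `^ (al - 1))) ^+ 2)).
    rewrite le_eqVlt; apply/orP; left; apply/eqP; congr (_ ^+ 2); apply: eq_bigr => a _.
    rewrite (brkpowD a al e); have := brkpowK a e; set x := brk a `^ al; set y := brk a `^ e; set z := brk a `^ (- e) => yz.
    by rewrite -[LHS]mul1r -yz; ring.
  apply: sum_sqr_le.
    apply: le_trans (hB _ (zr_uniq M)); apply: ler_sum => a _; rewrite exprMn brkpow_sqr.
    by rewrite (_ : (al + e) *+ 2 = 2 * (al + e))//; ring.
  have inj : injective (fun a : int => a - m) by exact: addIr.
  rewrite mulrC; apply: le_trans (bsumZ (brkpow_ge0 m (- (2 * e))) (bsum_inj inj hK1) (zr_uniq M)).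
  apply: ler_sum => a _; rewrite exprMn !brkpow_sqr.
  have -> : brk a `^ (- e *+ 2) = brk a `^ (- (2 * e)) by congr (_ `^ _); ring.
  (* A part 2 e of the decay in a - m is combined with the decay in a to produce decay in m, by
     submultiplicativity of the bracket. *)
  rewrite (_ : (al - 1) *+ 2 = - (2 * e) + - (2 - 2 * al - 2 * e)); last by ring.
  rewrite brkpowD mulrA ler_wpM2r ?brkpow_ge0// -powRM ?brk_ge0//.
  apply: le_powRN; first exact: brk_gt0.
    by rewrite -{1}[m](subKr a) brkB.
  by rewrite mulr_ge0// ltW.
apply: (@le_trans _ _ (\sum_(m <- zr M) (B * K1) * (brk m `^ (- (2 * e)) * A m))).
  by apply: ler_sum => m _; rewrite mulrC mulrA -[X in _ <= X * _]mulrA ler_wpM2r.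
by rewrite -mulr_sumr ler_wpM2l ?mulr_ge0 ?(ltW K10)//; exact: hl1 (zr_uniq M).
Qed.

End WeightedSum.

Section TripleProducts.
Context {R : realType}.
Implicit Types (z w : R[i]) (A B D : R).

Lemma cabs_triple_le z1 z2 z3 A B D : cabs z1 <= A -> cabs z2 <= B -> cabs z3 <= D ->
  cabs (z1 * z2^cj * z3) <= A * B * D.
Proof.
move=> h1 h2 h3; rewrite !cabsM cabs_conj.
by apply: ler_pM; rewrite ?mulr_ge0 ?cabs_ge0//; apply: ler_pM; rewrite ?cabs_ge0.
Qed.

Lemma cabs_triple_derivative_le z1 z2 z3 w1 w2 w3 A B D :
  cabs z1 <= A -> cabs z2 <= B -> cabs z3 <= D ->
  cabs ((w1 * z2^cj + z1 * w2^cj) * z3 + z1 * z2^cj * w3) <=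
  (B * D) * cabs w1 + (A * D) * cabs w2 + (A * B) * cabs w3.
Proof.
move=> h1 h2 h3.
have a0 := le_trans (cabs_ge0 _) h1; have b0 := le_trans (cabs_ge0 _) h2; have d0 := le_trans (cabs_ge0 _) h3.
rewrite mulrDl; apply: le_trans (cabsD _ _) _; apply: lerD; first apply: le_trans (cabsD _ _) _; first apply: lerD.
- have -> : B * D * cabs w1 = cabs w1 * B * D by ring.
  exact: cabs_triple_le.
- have -> : A * D * cabs w2 = A * cabs w2 * D by ring.
  exact: cabs_triple_le.
- exact: cabs_triple_le.
Qed.

End TripleProducts.

Section OscillatoryIntegral.
Context {R : realType}.
Local Notation mu := (@lebesgue_measure R).
Local Notation MR := (measurableTypeR R).
Context (a1 a2 a3 f1 f2 f3 : R -> R[i]) (A B D t t' : R).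
Context (tt : t' <= t)
  (d1 : forall s, is_cderive s a1 (f1 s)) (d2 : forall s, is_cderive s a2 (f2 s))
  (d3 : forall s, is_cderive s a3 (f3 s))
  (c1 : ccont f1) (c2 : ccont f2) (c3 : ccont f3)
  (b1 : forall s, t' <= s <= t -> cabs (a1 s) <= A)
  (b2 : forall s, t' <= s <= t -> cabs (a2 s) <= B)
  (b3 : forall s, t' <= s <= t -> cabs (a3 s) <= D)
  (i1 : (\int[mu]_(s in `[t', t]) (cabs (f1 s))%:E <= A%:E)%E)
  (i2 : (\int[mu]_(s in `[t', t]) (cabs (f2 s))%:E <= B%:E)%E)
  (i3 : (\int[mu]_(s in `[t', t]) (cabs (f3 s))%:E <= D%:E)%E).

Let H s : R[i] := a1 s * (a2 s)^cj * a3 s.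
Let H' s : R[i] := (f1 s * (a2 s)^cj + a1 s * (f2 s)^cj) * a3 s + a1 s * (a2 s)^cj * f3 s.

Let tmem : t' <= t <= t. Proof. by rewrite tt lexx. Qed.
Let A0 : 0 <= A. Proof. exact: le_trans (cabs_ge0 _) (b1 tmem). Qed.
Let B0 : 0 <= B. Proof. exact: le_trans (cabs_ge0 _) (b2 tmem). Qed.
Let D0 : 0 <= D. Proof. exact: le_trans (cabs_ge0 _) (b3 tmem). Qed.

Let dH s : is_cderive s H (H' s).
Proof. by apply: is_cderiveM => //; apply: is_cderiveM => //; exact: is_cderive_conj. Qed.

Let cH : ccont H.
Proof. exact: is_cderive_ccont dH. Qed.

Let cH' : ccont H'.
Proof.
have k1 := is_cderive_ccont d1; have k2 := ccont_conj (is_cderive_ccont d2); have k3 := is_cderive_ccont d3.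
apply: ccontD; last by apply: ccontM => //; exact: ccontM.
apply: ccontM => //; apply: ccontD; first exact: ccontM.
by apply: ccontM => //; exact: ccont_conj.
Qed.

Lemma oscillation_trivial ph :
  cabs (cintegral `[t', t] (fun s => expi (ph * s) * H s)) <= (A * B * D) * (t - t').
Proof.
apply: cabs_cintegral_itv => //.
- by apply: ccont_cmeasurable; apply: ccontM => //; exact: ccont_expi.
- by rewrite !mulr_ge0.
move=> s hs; rewrite [leLHS]cabsM cabs_expi mul1r; apply: cabs_triple_le.
- exact: b1.
- exact: b2.
- exact: b3.
Qed.

(** Integration by parts against the primitive of the exponential: two boundary terms and three
    terms with one derivative, each at most A B D / |ph|, since A, B, D bound the factors as well as
    the L^1 norms of their derivatives. *)
Lemma oscillation_phase ph : ph != 0 ->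
  cabs (cintegral `[t', t] (fun s => expi (ph * s) * H s)) <= 5 / `|ph| * (A * B * D).
Proof.
move=> ph0; pose k : R[i] := ('i * ph%:C)^-1.
have pc : 'i * ph%:C != 0 :> R[i].
  by apply/eqP => h; have := cabsM 'i ph%:C; rewrite h cabs0 cabs_i mul1r cabs_real => /esym/eqP; rewrite normr_eq0 (negbTE ph0).
have ck : cabs k = `|ph|^-1 by rewrite /k cabsV cabsM cabs_i mul1r cabs_real.
pose E s : R[i] := k * expi (ph * s).
have dE s : is_cderive s E (expi (ph * s)).
  have := is_cderiveZ k (is_cderive_expi s ph).
  by rewrite (_ : k * ('i * ph%:C * expi (ph * s)) = expi (ph * s))// mulrA mulVf// mul1r.
have cE : ccont E by apply: is_cderive_ccont => s; exact: dE.
have cEb s : cabs (E s) = `|ph|^-1 by rewrite /E cabsM cabs_expi mulr1 ck.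
have ce : ccont (fun s => expi (ph * s)) by exact: ccont_expi.
pose U s := expi (ph * s) * H s; pose W s := E s * H' s.
have cU : ccont U by exact: ccontM.
have cW : ccont W by exact: ccontM.
have dEH s : is_cderive s (fun x => E x * H x) (U s + W s) by exact: is_cderiveM.
have F := cintegral_ftc tt (ccontD cU cW) dEH.
have F2 := cintegralD (measurable_itv `[t', t]) (ccont_cint1 t' t cU) (ccont_cint1 t' t cW).
rewrite F2 in F; rewrite -/U.
set I := cintegral _ U in F *; set J := cintegral _ W in F.
have -> : I = E t * H t - E t' * H t' - J by rewrite -F addrK.
have bt s : t' <= s <= t -> cabs (E s * H s) <= `|ph|^-1 * (A * B * D).
  move=> hs; rewrite [leLHS]cabsM cEb ler_wpM2l ?invr_ge0//.
  by apply: cabs_triple_le; [exact: b1|exact: b2|exact: b3].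
have bJ : cabs J <= `|ph|^-1 * (3 * (A * B * D)).
  apply: (cabs_cintegral_bound (measurable_itv _) (ccont_cmeasurable cW)).
  have m1 : measurable_fun [set: MR] (fun s => cabs (f1 s)) := measurable_cabs (ccont_cmeasurable c1).
  have m2 : measurable_fun [set: MR] (fun s => cabs (f2 s)) := measurable_cabs (ccont_cmeasurable c2).
  have m3 : measurable_fun [set: MR] (fun s => cabs (f3 s)) := measurable_cabs (ccont_cmeasurable c3).
  have mW : measurable_fun [set: MR] (fun s => cabs (W s)) := measurable_cabs (ccont_cmeasurable cW).
  have pk : 0 <= `|ph|^-1 by rewrite invr_ge0.
  have mJ : measurable (`[t', t]%classic : set MR) by exact: measurable_itv.
  pose g1 s := B * D * cabs (f1 s); pose g2 s := A * D * cabs (f2 s); pose g3 s := A * B * cabs (f3 s).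
  have n1 : measurable_fun [set: MR] g1 by exact: measurable_funM.
  have n2 : measurable_fun [set: MR] g2 by exact: measurable_funM.
  have n3 : measurable_fun [set: MR] g3 by exact: measurable_funM.
  have p1 s : 0 <= g1 s by rewrite !mulr_ge0 ?cabs_ge0.
  have p2 s : 0 <= g2 s by rewrite !mulr_ge0 ?cabs_ge0.
  have p3 s : 0 <= g3 s by rewrite !mulr_ge0 ?cabs_ge0.
  have n12 : measurable_fun [set: MR] (fun s => g1 s + g2 s) by exact: measurable_funD.
  have p12 s : 0 <= g1 s + g2 s by rewrite addr_ge0.
  have n123 : measurable_fun [set: MR] (fun s => g1 s + g2 s + g3 s) by exact: measurable_funD.
  have p123 s : 0 <= g1 s + g2 s + g3 s by rewrite addr_ge0.
  apply: (@le_trans _ _ (\int[mu]_(s in `[t', t]) (`|ph|^-1 * (g1 s + g2 s + g3 s))%:E)%E).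
    apply: (@nnint_le _ MR R mu _ mJ (fun s => cabs (W s)) (fun s => `|ph|^-1 * (g1 s + g2 s + g3 s)) mW).
    - exact: measurable_funM.
    - by move=> s _; exact: cabs_ge0.
    move=> s; rewrite /= in_itv/= => hs; rewrite /W [leLHS]cabsM cEb ler_wpM2l//.
    by apply: cabs_triple_derivative_le; [exact: b1|exact: b2|exact: b3].
  have nZ f c := @nnintZ _ MR R mu `[t', t]%classic mJ f c.
  have nD f h := @nnintD _ MR R mu `[t', t]%classic mJ f h.
  rewrite (nZ _ _ n123 p123 pk) (nD _ _ n12 n3 p12 p3) (nD _ _ n1 n2 p1 p2).
  rewrite EFinM; apply: lee_wpmul2l; first by rewrite lee_fin.
  rewrite (_ : 3 * (A * B * D) = (B * D * A + A * D * B) + A * B * D); last by ring.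
  rewrite EFinD (EFinD (B * D * A)); apply: leeD; first apply: leeD.
  - rewrite (nZ _ _ m1 (fun s => cabs_ge0 _) (mulr_ge0 B0 D0)) (EFinM (B * D) A).
    by apply: lee_wpmul2l; rewrite ?lee_fin ?mulr_ge0.
  - rewrite (nZ _ _ m2 (fun s => cabs_ge0 _) (mulr_ge0 A0 D0)) (EFinM (A * D) B).
    by apply: lee_wpmul2l; rewrite ?lee_fin ?mulr_ge0.
  - rewrite (nZ _ _ m3 (fun s => cabs_ge0 _) (mulr_ge0 A0 B0)) (EFinM (A * B) D).
    by apply: lee_wpmul2l; rewrite ?lee_fin ?mulr_ge0.
apply: le_trans (cabsB _ _) _; apply: le_trans (lerD (cabsB _ _) bJ) _.
have tm' : t' <= t' <= t by rewrite lexx tt.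
have := bt t tmem; have := bt t' tm'; set X := A * B * D; set q := `|ph|^-1 => h1 h2.
by rewrite (_ : 5 * q * X = q * X + q * X + q * (3 * X)) ?lerD//; ring.
Qed.

End OscillatoryIntegral.

(** * Resonant decomposition and increments of the profiles *)

Section Increments.
Context {R : realType}.
Local Notation mu := (@lebesgue_measure R).
Local Notation MR := (measurableTypeR R).
Local Notation brk := (@brk R).

Lemma sum_pick (V : nmodType) s n (F : int -> V) : uniq s ->
  \sum_(x <- s) (if x == n then F x else 0) = if n \in s then F n else 0.
Proof.
move=> us; case: ifPn => ns; last first.
  by rewrite big1_seq// => x /andP[_ xs]; case: eqP => // xn; rewrite -xn xs in ns.
by rewrite (bigD1_seq n)//= eqxx big1 ?addr0// => x /negbTE ->.
Qed.

(* In the cubic sum the frequencies with n1 = n or n3 = n contribute twice the mass minus one diagonal term. *)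
Lemma resonant_sum s (c : int -> R[i]) n : uniq s ->
  \sum_(p <- triples s) (if p.1 - p.2.1 + p.2.2 == n
    then if (p.1 != p.2.1) && (p.2.2 != p.2.1) then 0 else c p.1 * (c p.2.1)^cj * c p.2.2 else 0) =
  if n \in s then (2 * \sum_(k <- s) cabs (c k) ^+ 2)%:C * c n - (cabs (c n) ^+ 2)%:C * c n else 0.
Proof.
move=> us; rewrite sum_triples/=.
(* Inclusion and exclusion: under n1 - n2 + n3 = n, either n2 = n1 and n3 = n, or n3 = n2 and n1 =
   n; both occur only when all three frequencies equal n. *)
transitivity (\sum_(a <- s) \sum_(b <- s) \sum_(d <- s)
   ((if b == a then if d == n then c a * (c b)^cj * c d else 0 else 0) +
    ((if d == b then if a == n then c a * (c b)^cj * c d else 0 else 0) -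
     (if d == b then if b == n then if a == n then c a * (c b)^cj * c d else 0 else 0 else 0)))).
  apply: eq_bigr => a _; apply: eq_bigr => b _; apply: eq_bigr => d _.
  rewrite (eq_sym b a); case: (eqVneq a b) => [<-|ab] /=.
    rewrite subrr add0r (eq_sym d a); case: (eqVneq a d) => [->|ad].
      by case: eqP => _; rewrite ?subrr ?addr0 ?subr0.
    by rewrite subr0 addr0.
  case: (eqVneq d b) => [->|db] /=.
    rewrite subrK add0r; case: (eqVneq a n) => [an|_]; last by case: ifP; rewrite subrr.
    by rewrite -an (eq_sym b a) (negbTE ab) subr0.
  by rewrite if_same subr0 addr0.
have sq x : c x * (c x)^cj = (cabs (c x) ^+ 2)%:C by rewrite cabs_sqrC.
have split3 (f1 f2 f3 : int -> int -> int -> R[i]) :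
    \sum_(a <- s) \sum_(b <- s) \sum_(d <- s) (f1 a b d + (f2 a b d - f3 a b d)) =
    \sum_(a <- s) \sum_(b <- s) \sum_(d <- s) f1 a b d +
    (\sum_(a <- s) \sum_(b <- s) \sum_(d <- s) f2 a b d - \sum_(a <- s) \sum_(b <- s) \sum_(d <- s) f3 a b d).
  rewrite -sumrB -big_split; apply: eq_bigr => a _; rewrite -sumrB -big_split.
  by apply: eq_bigr => b _; rewrite -sumrB -big_split.
rewrite split3.
have E1 : \sum_(a <- s) \sum_(b <- s) \sum_(d <- s) (if b == a then if d == n then c a * (c b)^cj * c d else 0 else 0) =
    if n \in s then (\sum_(k <- s) cabs (c k) ^+ 2)%:C * c n else 0.
  transitivity (\sum_(a <- s) (if n \in s then (cabs (c a) ^+ 2)%:C * c n else 0)).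
    rewrite big_seq [RHS]big_seq; apply: eq_bigr => a As.
    rewrite (eq_bigr (fun b => if b == a then (if n \in s then c a * (c b)^cj * c n else 0) else 0)).
      by rewrite sum_pick// As sq.
    move=> b _; case: (b == a); last by rewrite big1.
    by rewrite sum_pick.
  by case: (n \in s); [rewrite rc_sum mulr_suml|rewrite big1].
have E2 : \sum_(a <- s) \sum_(b <- s) \sum_(d <- s) (if d == b then if a == n then c a * (c b)^cj * c d else 0 else 0) =
    if n \in s then (\sum_(k <- s) cabs (c k) ^+ 2)%:C * c n else 0.
  transitivity (\sum_(a <- s) (if a == n then (\sum_(k <- s) cabs (c k) ^+ 2)%:C * c a else 0)); last first.
    by rewrite sum_pick.
  apply: eq_bigr => a _; case: (a == n); last first.
    by rewrite big1// => b _; rewrite big1// => d _; rewrite if_same.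
  rewrite rc_sum mulr_suml big_seq [RHS]big_seq; apply: eq_bigr => b bs.
  by rewrite sum_pick// bs -sq -mulrA mulrC (mulrC (c b)).
have E3 : \sum_(a <- s) \sum_(b <- s) \sum_(d <- s)
     (if d == b then if b == n then if a == n then c a * (c b)^cj * c d else 0 else 0 else 0) =
    if n \in s then (cabs (c n) ^+ 2)%:C * c n else 0.
  transitivity (\sum_(a <- s) (if a == n then (if n \in s then (cabs (c n) ^+ 2)%:C * c a else 0) else 0)); last first.
    by rewrite sum_pick//; case: (n \in s).
  apply: eq_bigr => a _; case: (a == n); last first.
    by rewrite big1// => b _; rewrite big1// => d _; rewrite !if_same.
  transitivity (\sum_(b <- s) (if b == n then (cabs (c b) ^+ 2)%:C * c a else 0)); last by rewrite sum_pick.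
  rewrite big_seq [RHS]big_seq; apply: eq_bigr => b bs; rewrite sum_pick// bs.
  by case: (b == n) => //; rewrite -sq -mulrA mulrC (mulrC (c b)).
rewrite E1 E2 E3; case: (n \in s); last by rewrite subrr addr0.
by rewrite addrA -mulrDl -rcD -mulr2n -[_ *+ 2]mulr_natl.
Qed.

Context (sgn : R) (hsgn : sgn = 1 \/ sgn = -1) (g : R -> R[i]) (hg : inHhalf_minus g)
  (u : R -> R -> R[i]) (hu : is_wick_NLS_solution sgn g u).
Let P := wick_constant g.

Definition triprod (p : int * (int * int)) (s : R) : R[i] :=
  profile u p.1 s * (profile u p.2.1 s)^cj * profile u p.2.2 s.

(** This is n^2 - n1^2 + n2^2 - n3^2 for n = n1 - n2 + n3, in factorized form. *)
Definition phase (p : int * (int * int)) : int := 2 * (p.2.2 - p.2.1) * (p.1 - p.2.1).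

Definition oscillating (M : nat) n (s : R) : R[i] :=
  \sum_(p <- triples (zr M)) (if p.1 - p.2.1 + p.2.2 == n
    then if (p.1 != p.2.1) && (p.2.2 != p.2.1) then expi ((phase p)%:~R * s) * triprod p s else 0 else 0).

(** The difference of the truncated mass and P/2 tends to 0 by [mass_conservation], which leaves
    only the diagonal term -|a_n|^2 a_n. *)
Definition resonant (M : nat) n (s : R) : R[i] :=
  if n \in zr M then (2 * (mass u M s - P / 2) - cabs (profile u n s) ^+ 2)%:C * profile u n s else 0.

Lemma coeff_profile n s : fourier (u s) n = (expi (s * n%:~R ^+ 2))^cj * profile u n s.
Proof. by rewrite /profile mulrA -expiN -expiD addNr expi0 mul1r. Qed.

Lemma cutoff_force_split M n s : cutoff_force g u M n s = oscillating M n s + resonant M n s.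
Proof.
have us := zr_uniq M; rewrite /cutoff_force fourier_wick_tp// -/P.
set c := fourier (u s).
have -> : cubic (zr M) c n = \sum_(p <- triples (zr M)) (if p.1 - p.2.1 + p.2.2 == n
      then if (p.1 != p.2.1) && (p.2.2 != p.2.1) then c p.1 * (c p.2.1)^cj * c p.2.2 else 0 else 0) +
    (if n \in zr M then (2 * mass u M s)%:C * c n - (cabs (c n) ^+ 2)%:C * c n else 0).
  rewrite /mass -/c -resonant_sum// -big_split/=; apply: eq_bigr => p _.
  by case: ifP => _; rewrite ?addr0//; case: ifP => _; rewrite ?addr0 ?add0r.
rewrite -addrA mulrDr; congr (_ + _).
  rewrite mulr_sumr; apply: eq_bigr => -[a [b d]] _ /=.
  case: eqP => [nE|_]; last by rewrite mulr0.
  case: ifP => _; last by rewrite mulr0.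
  rewrite /triprod /c !coeff_profile/=; set x := profile u a s; set y := profile u b s; set z := profile u d s.
  have -> : expi ((phase (a, (b, d)))%:~R * s) = expi (s * n%:~R ^+ 2) * (expi (s * a%:~R ^+ 2))^cj *
      expi (s * b%:~R ^+ 2) * (expi (s * d%:~R ^+ 2))^cj :> R[i].
    rewrite -!expiN -!expiD; congr expi; rewrite /phase/= -nE !(intrM, intrD, rmorphN)/=; ring.
  by rewrite !cconjM cconjK; ring.
rewrite /resonant; case: (n \in zr M); last by rewrite mulr0 subrr mulr0.
have cn : cabs (c n) = cabs (profile u n s) by rewrite fourier_cabs_profile.
rewrite cn; rewrite -mulrBl -mulrBl -!rcB /profile -/c [LHS]mulrCA; congr (_%:C * _).
by rewrite mulrBr (mulrC 2 (P / 2)) divfK// addrAC.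
Qed.

Lemma ccont_profile n : ccont (profile u n).
Proof. by apply: is_cderive_ccont => t; exact: (is_cderive_profile hsgn hg hu n t). Qed.

Lemma ccont_triprod p : ccont (triprod p).
Proof.
have h := ccont_profile; have h2 := ccont_conj (h p.2.1).
exact: (ccontM (ccontM (h p.1) h2) (h p.2.2)).
Qed.

Lemma ccont_oscillating M n : ccont (oscillating M n).
Proof.
apply: (@ccont_sum R _ (triples (zr M)) (fun p s => if p.1 - p.2.1 + p.2.2 == n
    then if (p.1 != p.2.1) && (p.2.2 != p.2.1) then expi ((phase p)%:~R * s) * triprod p s else 0 else 0)) => p.
case: (_ == n); last exact: ccont_cst.
case: (_ && _); last exact: ccont_cst.
by apply: ccontM; [exact: ccont_expi|exact: ccont_triprod].
Qed.

Lemma ccont_resonant M n : ccont (resonant M n).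
Proof.
have -> : resonant M n = fun s => cutoff_force g u M n s + (-1) * oscillating M n s.
  by apply/funext => s; rewrite cutoff_force_split mulN1r addrAC subrr add0r.
apply: ccontD; first exact: (ccont_cutoff_force hu).
by apply: ccontM; [exact: ccont_cst|exact: ccont_oscillating].
Qed.

Section Weighted.
Context (al T t t' : R) (om : int -> R) (D K K3 : R).
Context (tt : t' <= t) (tT' : - T <= t') (tT : t <= T) (om0 : forall n, 0 <= om n) (D0 : 0 <= D) (T0 : 0 <= T).
Let A := amp g u T.
Context (hosc : forall p, p.1 != p.2.1 -> p.2.2 != p.2.1 ->
  om (p.1 - p.2.1 + p.2.2) * cabs (cintegral `[t', t] (fun s => expi ((phase p)%:~R * s) * triprod p s)) <=
  D * trilinear_weight al A p).
Context (hK : forall S M, uniq S -> \sum_(n <- S) \sum_(p <- triples (zr M))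
    (if p.1 - p.2.1 + p.2.2 == n then trilinear_weight al A p else 0) <= K).
Context (hK3 : bsum (fun n => om n * A n ^+ 3) K3).

Lemma oscillating_integral_le M S : uniq S ->
  \sum_(n <- S) om n * cabs (cintegral `[t', t] (oscillating M n)) <= D * K.
Proof.
move=> uS; have A0 n : 0 <= A n by exact: amp_ge0.
have w0 p : 0 <= trilinear_weight al A p by rewrite !mulr_ge0 ?brkpow_ge0.
apply: (@le_trans _ _ (D * \sum_(n <- S) \sum_(p <- triples (zr M))
    (if p.1 - p.2.1 + p.2.2 == n then trilinear_weight al A p else 0))); last by rewrite ler_wpM2l ?hK.
rewrite mulr_sumr; apply: ler_sum => n _.
pose F (p : int * (int * int)) (s : R) : R[i] := if p.1 - p.2.1 + p.2.2 == n
    then if (p.1 != p.2.1) && (p.2.2 != p.2.1) then expi ((phase p)%:~R * s) * triprod p s else 0 else 0.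
have cF p : ccont (F p).
  rewrite /F; case: (_ == n); last exact: ccont_cst.
  case: (_ && _); last exact: ccont_cst.
  by apply: ccontM; [exact: ccont_expi|exact: ccont_triprod].
have -> : cintegral `[t', t] (oscillating M n) = \sum_(p <- triples (zr M)) cintegral `[t', t] (F p).
  by rewrite -cintegral_sum// => p; exact: ccont_cint1.
apply: (@le_trans _ _ (om n * \sum_(p <- triples (zr M)) cabs (cintegral `[t', t] (F p)))).
  by rewrite ler_wpM2l//; exact: cabs_sum.
rewrite !mulr_sumr; apply: ler_sum => p _; rewrite /F.
case: eqP => [<-|_]; last by rewrite cintegral0 cabs0 !mulr0.
have [/andP[h1 h2]|_] := boolP ((p.1 != p.2.1) && (p.2.2 != p.2.1)); first exact: hosc.
by rewrite cintegral0 cabs0 mulr0 mulr_ge0.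
Qed.

(** Used twice: with weight 1 and D a multiple of (t - t')^al, and with weight [brk n]^(2 al) and D
    constant. On a finite set S the truncation errors are a finite sum times a negative power of M,
    so they vanish as M grows, while the main bounds do not depend on M. *)
Lemma weighted_increment_sum : bsum (fun n => om n * cabs (profile u n t - profile u n t')) (D * K + (t - t') * K3).
Proof.
move=> S uS; have A0 n : 0 <= A n by exact: amp_ge0.
have [C1 C10 h1] := tforce_cutoff hsgn hg hu T.
have [C2 C20 h2] := mass_conservation hsgn hg hu T0.
(* Collects the force truncation error and the mass defect over S; M is taken large depending on
   W. *)
pose W := \sum_(n <- S) om n * (C1 + 2 * C2 * A n).
have W0 : 0 <= W by apply: sumr_ge0 => n _; rewrite mulr_ge0// addr_ge0// !mulr_ge0.
have l0 : 0 <= t - t' by rewrite subr_ge0.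
apply/ler_addgt0Pr => e e0.
have r0 : 0 < 3 / 16 :> R by lra.
have q0 : 0 < (t - t') * W + 1 by rewrite ltr_wpDl// mulr_ge0.
have [M /(_ M (leqnn _)) hM] := powR_cvg0_nat r0 (divr_gt0 e0 q0).
set m := M.+1%:R `^ (- (3 / 16)) in hM; have m0 : 0 <= m by exact: powR_ge0.
have m38 : M.+1%:R `^ (- (3 / 8)) <= m by rewrite /m ler_powR ?ler1n//; lra.
have inT s : t' <= s <= t -> `|s| <= T.
  by move=> /andP[s1 s2]; rewrite ler_norml (le_trans tT' s1) (le_trans s2 tT).
have step n : cabs (profile u n t - profile u n t') <=
    cabs (cintegral `[t', t] (oscillating M n)) + (t - t') * A n ^+ 3 + (t - t') * (m * (C1 + 2 * C2 * A n)).
  rewrite (profile_increment hu)// cabsM (cabs_isgn hsgn) mul1r.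
  have c1 := ccont_tforce hsgn hg hu n; have c2 := ccont_oscillating M n; have c3 := ccont_resonant M n.
  pose dl s := tforce g u n s + (-1) * cutoff_force g u M n s.
  have c4 : ccont dl by apply: ccontD => //; apply: ccontM; [exact: ccont_cst|exact: (ccont_cutoff_force hu)].
  have mJ : measurable (`[t', t]%classic : set R) by exact: measurable_itv.
  have E : cintegral `[t', t] (tforce g u n) = cintegral `[t', t] (oscillating M n) +
      cintegral `[t', t] (resonant M n) + cintegral `[t', t] dl.
    have k2 := ccont_cint1 t' t c2; have k3 := ccont_cint1 t' t c3; have k4 := ccont_cint1 t' t c4.
    rewrite -(cintegralD mJ k2 k3) -(cintegralD mJ (cint1D mJ k2 k3) k4).
    by apply: eq_cintegral => s _; rewrite -cutoff_force_split /dl mulN1r addrC subrK.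
  rewrite E; apply: le_trans (cabsD _ _) _; rewrite -addrA.
  apply: le_trans (lerD (cabsD _ _) (lexx _)) _; rewrite -addrA lerD2l.
  have b4 : cabs (cintegral `[t', t] dl) <= C1 * m * (t - t').
    apply: cabs_cintegral_itv => //; first exact: ccont_cmeasurable.
      by rewrite mulr_ge0.
    move=> s hs; rewrite /dl mulN1r; apply: le_trans (h1 M n s (inT s hs)) _.
    by rewrite ler_wpM2l.
  have b3 : cabs (cintegral `[t', t] (resonant M n)) <= (2 * (C2 * m) * A n + A n ^+ 3) * (t - t').
    have p0 : 0 <= 2 * (C2 * m) * A n + A n ^+ 3 by rewrite addr_ge0 ?exprn_ge0// !mulr_ge0.
    apply: cabs_cintegral_itv => //; first exact: ccont_cmeasurable.
    move=> s hs; rewrite /resonant; case: (n \in zr M); last by rewrite cabs0.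
    have a1 := profile_amp hsgn hu n (inT s hs); rewrite -/A in a1.
    rewrite [leLHS]cabsM cabs_real.
    apply: (@le_trans _ _ ((2 * (C2 * m) + A n ^+ 2) * A n)); last first.
      by rewrite mulrDl -exprSr.
    apply: ler_pM; rewrite ?cabs_ge0//; apply: le_trans (ler_normB _ _) _; apply: lerD.
      by rewrite normrM ger0_norm// ler_pM2l//; exact: h2 (inT s hs).
    by rewrite ger0_norm ?sqr_ge0//; apply: lerXn2r; rewrite ?nnegrE ?cabs_ge0.
  apply: le_trans (lerD b3 b4) _; rewrite le_eqVlt; apply/orP; left; apply/eqP; ring.
apply: (@le_trans _ _ (\sum_(n <- S) (om n * cabs (cintegral `[t', t] (oscillating M n)) +
   (t - t') * (om n * A n ^+ 3) + (t - t') * m * (om n * (C1 + 2 * C2 * A n))))).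
  apply: ler_sum => n _; apply: (le_trans (ler_wpM2l (om0 n) (step n))).
  by rewrite le_eqVlt; apply/orP; left; apply/eqP; ring.
rewrite !big_split/= -!mulr_sumr -/W; apply: lerD; first apply: lerD.
- exact: oscillating_integral_le.
- by rewrite ler_wpM2l//; exact: hK3.
apply: (@le_trans _ _ (m * ((t - t') * W + 1))); last by rewrite -ler_pdivlMr.
by rewrite mulrAC mulrC ler_wpM2l// lerDl.
Qed.

End Weighted.

End Increments.

Section Interpolation.
Context {R : realType}.
Local Notation brk := (@brk R).

(** The minimum of l and 1/y is at most their geometric mean with weights al and 1 - al; the two
    cases decide which of the two bounds on x is used. *)
Lemma min_interpolation (al l y x : R) : 0 <= al <= 1 -> 0 <= l -> 0 < y ->
  x <= l -> x <= 10 / y -> x <= 10 * (l `^ al * y `^ (al - 1)).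
Proof.
move=> /andP[al0 al1] l0 y0 xl xy.
have b0 : 0 <= 1 - al by rewrite subr_ge0.
have yV r : (y^-1) `^ r = y `^ (- r) by rewrite -powR_inv1 ?ltW// -powRrM mulN1r.
have y10 : 0 <= y^-1 by rewrite invr_ge0 ltW.
have p0 : 0 <= l `^ al * y `^ (al - 1) by rewrite mulr_ge0 ?powR_ge0.
have [h|/ltW h] := leP l y^-1.
  apply: (@le_trans _ _ (l `^ al * y `^ (al - 1))); last by rewrite ler_peMl// ler1n.
  apply: (le_trans xl); have [l00|lpos] := eqVneq l 0; first by rewrite [leLHS]l00.
  have {1}-> : l = l `^ al * l `^ (1 - al).
    by rewrite -powRD ?lpos ?implybT// addrC subrK powRr1.
  by rewrite ler_wpM2l ?powR_ge0// -(opprB 1 al) -yV ge0_ler_powR// nnegrE.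
apply: (le_trans xy); rewrite ler_pM2l//.
have -> : y^-1 = y `^ (- al) * y `^ (al - 1).
  have yn : y != 0 by rewrite gt_eqF.
  by rewrite -powRD ?yn ?implybT// addKr powR_inv1// ltW.
by rewrite ler_wpM2r ?powR_ge0// -yV ge0_ler_powR// nnegrE.
Qed.

Lemma brk_le_norm (n : int) : n != 0 -> brk n <= 2 * `|n%:~R|.
Proof.
move=> n0; rewrite /brk -intr_norm mulr2n mulrDl mul1r lerD2r ler1z.
by rewrite -gtz0_ge1 normr_gt0.
Qed.

(** A square summable sequence is bounded, here by 1 + B0, so one of the three factors can be pulled
    out. *)
Lemma bsum_cube (om A : int -> R) (B0 B : R) : (forall n, 0 <= om n) -> (forall n, 0 <= A n) ->
  bsum (fun n => A n ^+ 2) B0 -> bsum (fun n => om n * A n ^+ 2) B ->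
  bsum (fun n => om n * A n ^+ 3) ((1 + B0) * B).
Proof.
move=> om0 A0 h0 h; have B00 := bsum_ge0 h0.
apply: (bsum_le _ (bsumZ (addr_ge0 ler01 B00) h)) => n.
have An : A n <= 1 + B0 by have := bsum_pt n h0; have := A0 n; nra.
rewrite exprS mulrCA ler_wpM2r// mulr_ge0// exprn_ge0//.
Qed.

End Interpolation.

Section SmoothingSums.
Context {R : realType}.
Local Notation mu := (@lebesgue_measure R).
Local Notation MR := (measurableTypeR R).
Local Notation brk := (@brk R).
Context (sgn : R) (hsgn : sgn = 1 \/ sgn = -1) (g : R -> R[i]) (hg : inHhalf_minus g)
  (u : R -> R -> R[i]) (hu : is_wick_NLS_solution sgn g u).

Lemma tforce_amp T t t' n : - T <= t' -> t <= T ->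
  (\int[mu]_(s in `[t', t]) (cabs ('i * sgn%:C * tforce g u n s))%:E <= (amp g u T n)%:E)%E.
Proof.
move=> h1 h2; have [mf _] := tforce_cint1 hu n (- T) T.
under eq_integral => s _ do rewrite [cabs _]cabsM (cabs_isgn hsgn) mul1r.
apply: (@le_trans _ _ (\int[mu]_(s in `[(- T)%R, T]) (cabs (tforce g u n s))%:E)%E).
  apply: ge0_subset_integral => //.
  - by apply/measurable_EFinP; apply: measurable_funTS; exact: measurable_cabs.
  - by move=> s _; rewrite lee_fin cabs_ge0.
  - by move=> s; rewrite /= !in_itv/= => /andP[s1 s2]; rewrite (le_trans h1 s1) (le_trans s2 h2).
by rewrite (tforce_norm hu) lee_fin /amp lerDr cabs_ge0.
Qed.

Lemma triprod_integral_le T t t' p : t' <= t -> - T <= t' -> t <= T ->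
  let I := cintegral `[t', t] (fun s => expi ((phase p)%:~R * s) * triprod u p s) in
  let A := amp g u T in
  cabs I <= A p.1 * A p.2.1 * A p.2.2 * (t - t') /\
  (phase p != 0 -> cabs I <= 5 / `|(phase p)%:~R| * (A p.1 * A p.2.1 * A p.2.2)).
Proof.
move=> tt h1 h2 I A.
have d n s : is_cderive s (profile u n) ('i * sgn%:C * tforce g u n s).
  exact: (is_cderive_profile hsgn hg hu n s).
have c n : ccont (fun s => 'i * sgn%:C * tforce g u n s).
  by apply: ccontM; [exact: ccont_cst|exact: (ccont_tforce hsgn hg hu)].
have b n s : t' <= s <= t -> cabs (profile u n s) <= A n.
  move=> /andP[s1 s2]; apply: (profile_amp hsgn hu).
  by rewrite ler_norml (le_trans h1 s1) (le_trans s2 h2).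
have i n := tforce_amp n h1 h2; split.
  exact: (oscillation_trivial tt (d p.1) (d p.2.1) (d p.2.2) (b p.1) (b p.2.1) (b p.2.2)).
move=> ph0; have ph0' : (phase p)%:~R != 0 :> R by rewrite intr_eq0.
exact: (oscillation_phase tt (d p.1) (d p.2.1) (d p.2.2) (c p.1) (c p.2.1) (c p.2.2)
    (b p.1) (b p.2.1) (b p.2.2) (i p.1) (i p.2.1) (i p.2.2) ph0').
Qed.

(** x is the better of the trivial bound and the bound by parts; both later estimates only
    interpolate between them or keep one. *)
Lemma triprod_integral_min T t t' p : t' <= t -> - T <= t' -> t <= T ->
  p.1 != p.2.1 -> p.2.2 != p.2.1 ->
  exists2 x, cabs (cintegral `[t', t] (fun s => expi ((phase p)%:~R * s) * triprod u p s)) <=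
      amp g u T p.2.1 * (amp g u T p.1 * amp g u T p.2.2) * x &
    [/\ 0 <= x, x <= t - t' & x <= 10 / (brk (p.1 - p.2.1) * brk (p.2.2 - p.2.1))].
Proof.
move=> tt h1 h2 p1 p2; have A0 n : 0 <= amp g u T n by exact: amp_ge0.
have [] := triprod_integral_le p tt h1 h2; move: (amp g u T) (cabs _) A0 => A Y A0 ha hb.
have d1 : p.1 - p.2.1 != 0 by rewrite subr_eq0.
have d2 : p.2.2 - p.2.1 != 0 by rewrite subr_eq0.
have ph0 : phase p != 0 by rewrite /phase !mulf_neq0.
have {}hb := hb ph0; have k1 := @brk_le_norm R _ d1; have k2 := @brk_le_norm R _ d2.
set y := brk (p.1 - p.2.1) * brk (p.2.2 - p.2.1); have y0 : 0 < y by rewrite mulr_gt0 ?brk_gt0.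
have phE : `|(phase p)%:~R| = 2 * `|(p.2.2 - p.2.1)%:~R| * `|(p.1 - p.2.1)%:~R| :> R.
  by rewrite /phase !intrM !normrM; congr (_ * _ * _); rewrite ger0_norm.
(* Nonzero integers satisfy [brk d] <= 2 |d|, so the phase 2 |d1| |d2| is at least y/2, and 5
   divided by it is at most 10/y. *)
have yph : y / 2 <= `|(phase p)%:~R|.
  rewrite phE ler_pdivrMr//.
  have := ler_pM (brk_ge0 _) (brk_ge0 _) k1 k2.
  by move=> h; apply: (le_trans h); rewrite le_eqVlt; apply/orP; left; apply/eqP; ring.
have q : 5 / `|(phase p)%:~R| <= 10 / y.
  rewrite (_ : 10 / y = 5 / (y / 2)); last by field; rewrite gt_eqF.
  by rewrite ler_pM2l// lef_pV2 ?posrE ?divr_gt0// normr_gt0 intr_eq0.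
have AE : A p.2.1 * (A p.1 * A p.2.2) = A p.1 * A p.2.1 * A p.2.2 by rewrite mulrCA mulrA.
have AA0 : 0 <= A p.1 * A p.2.1 * A p.2.2 by rewrite !mulr_ge0.
exists (Num.min (t - t') (10 / y)); last first.
  by rewrite le_min subr_ge0 tt ge_min lexx ge_min lexx orbT; split => //; rewrite divr_ge0 ?ltW.
rewrite AE; case: (leP (t - t') (10 / y)) => _; first exact: ha.
by apply: (le_trans hb); rewrite mulrC ler_wpM2l.
Qed.

(** The interpolated bound lacks the factors [brk p.1]^al and [brk p.2.2]^al of the weight; being at
    least 1 they are inserted for free, so one summation lemma serves both estimates. *)
Lemma triprod_integral_holder al T t t' p : 0 <= al <= 1 -> t' <= t -> - T <= t' -> t <= T ->
  p.1 != p.2.1 -> p.2.2 != p.2.1 ->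
  1 * cabs (cintegral `[t', t] (fun s => expi ((phase p)%:~R * s) * triprod u p s)) <=
  10 * (t - t') `^ al * trilinear_weight al (amp g u T) p.
Proof.
move=> al01 tt h1 h2 p1 p2; rewrite mul1r.
have [x hx [x0 x1 x2]] := triprod_integral_min tt h1 h2 p1 p2.
apply: (le_trans hx); have A0 n : 0 <= amp g u T n by exact: amp_ge0.
move: (amp g u T) A0 => A A0.
have y0 : 0 < brk (p.1 - p.2.1) * brk (p.2.2 - p.2.1) by rewrite mulr_gt0 ?brk_gt0.
have l0 : 0 <= t - t' by rewrite subr_ge0.
have hm := min_interpolation al01 l0 y0 x1 x2; rewrite powRM ?brk_ge0// in hm.
have /andP[al0 _] := al01.
have b1 : 1 <= brk p.1 `^ al * brk p.2.2 `^ al.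
  by rewrite -[1]mulr1; apply: ler_pM => //; exact: brkpow_ge1.
apply: (le_trans (ler_wpM2l _ hm)); first by rewrite !mulr_ge0.
set X := 10 * _; set c := A p.2.1 * _.
have X0 : 0 <= c * X by rewrite !mulr_ge0 ?powR_ge0.
apply: (le_trans (ler_peMl X0 b1)); rewrite /c /X /trilinear_weight le_eqVlt; apply/orP; left; apply/eqP.
move: (A p.1) (A p.2.1) (A p.2.2) (_ `^ al) (_ `^ al) (_ `^ al) (_ `^ (al - 1)) (_ `^ (al - 1)) => *; ring.
Qed.

(** The output frequency is n = (n1 - n2) + n3 = n1 + (n3 - n2). Half of its weight 2 al is split by
    each formula, and the bound 10/y from integration by parts supplies the exponents al - 1 on the
    two differences. *)
Lemma triprod_integral_weighted al T t t' p : 0 <= al -> t' <= t -> - T <= t' -> t <= T ->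
  p.1 != p.2.1 -> p.2.2 != p.2.1 ->
  brk (p.1 - p.2.1 + p.2.2) `^ (2 * al) *
    cabs (cintegral `[t', t] (fun s => expi ((phase p)%:~R * s) * triprod u p s)) <=
  10 * trilinear_weight al (amp g u T) p.
Proof.
move=> al0 tt h1 h2 p1 p2.
have [x hx [x0 x1 x2]] := triprod_integral_min tt h1 h2 p1 p2.
have A0 n : 0 <= amp g u T n by exact: amp_ge0.
move: (cabs _) (cabs_ge0 (cintegral `[t', t] (fun s => expi ((phase p)%:~R * s) * triprod u p s))) hx => Y Y0.
move: (amp g u T) A0 => A A0 hx.
set n := p.1 - p.2.1 + p.2.2; set d1 := p.1 - p.2.1 in x2 *; set d2 := p.2.2 - p.2.1 in x2 *.
have m1 : brk n `^ al <= brk d1 `^ al * brk p.2.2 `^ al by exact: brkpowM.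
have m2 : brk n `^ al <= brk p.1 `^ al * brk d2 `^ al.
  by rewrite (_ : n = p.1 + d2); [exact: brkpowM|rewrite /n /d2 addrA addrAC].
have m : brk n `^ (2 * al) <= (brk d1 `^ al * brk p.2.2 `^ al) * (brk p.1 `^ al * brk d2 `^ al).
  by rewrite mulrDl mul1r brkpowD; apply: ler_pM; rewrite ?brkpow_ge0.
have Z0 : 0 <= A p.2.1 * (A p.1 * A p.2.2) * (10 / (brk d1 * brk d2)).
  by rewrite !mulr_ge0 ?invr_ge0 ?mulr_ge0 ?brk_ge0.
have hx2 := le_trans hx (ler_wpM2l _ x2).
apply: (le_trans (ler_pM _ _ m (hx2 _))); rewrite ?brkpow_ge0 ?mulr_ge0//.
rewrite /trilinear_weight -/d1 -/d2.
have E d : brk d `^ (al - 1) = brk d `^ al / brk d by rewrite brkpowD powR_inv1 ?brk_ge0.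
rewrite !E le_eqVlt; apply/orP; left; apply/eqP.
have := @brk_gt0 R d1; have := @brk_gt0 R d2; move: (brk d1) (brk d2) => b1 b2 b10 b20.
move: (A p.1) (A p.2.1) (A p.2.2) (_ `^ al) (_ `^ al) (_ `^ al) (_ `^ al) => *; field.
by rewrite !gt_eqF.
Qed.

Section Exponent.
Context (al T : R) (al0 : 0 < al) (al1 : al < 2^-1) (T0 : 0 <= T).

Let A := amp g u T.
Let hA s : 0 <= s < 2^-1 -> exists B, bsum (fun n => brk n `^ (2 * s) * A n ^+ 2) B.
Proof. by move=> hs; exact: (amp_sobolev hsgn hg hu hs T0). Qed.
Let A0 n : 0 <= A n. Proof. exact: amp_ge0. Qed.

Let cube s : 0 <= s < 2^-1 -> exists B, bsum (fun n => brk n `^ (2 * s) * A n ^+ 3) B.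
Proof.
move=> hs; have [|B0 h0] := @hA 0; first by rewrite lexx/= invr_gt0 ltr0n.
have [B h] := hA hs; exists ((1 + B0) * B); apply: bsum_cube => // [n|]; first exact: brkpow_ge0.
by apply: bsum_le _ h0 => n; rewrite mulr0 powRr0 mul1r.
Qed.

Lemma profile_holder_sum : exists2 K, 0 <= K & forall t t', - T <= t <= T -> - T <= t' <= T ->
  bsum (fun n => cabs (profile u n t - profile u n t')) (K * `|t - t'| `^ al).
Proof.
have al01 : 0 < al < 2^-1 by rewrite al0.
have [K K0 hK] := trilinear_l1 al01 A0 hA.
have [|K3 hK3] := @cube 0; first by rewrite lexx/= invr_gt0 ltr0n.
have K30 := bsum_ge0 hK3.
pose C := 10 * K + (2 * T) `^ (1 - al) * K3.
have C0 : 0 <= C by rewrite addr_ge0// mulr_ge0 ?powR_ge0.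
exists C => // t t'; wlog tt : t t' / t' <= t => [H h1 h2|/andP[h1 h2] /andP[h3 h4]].
  have [le|/ltW le] := leP t' t; first exact: H.
  by rewrite distrC; under [X in bsum X]eq_fun do rewrite cabsC; exact: H.
have l0 : 0 <= t - t' by rewrite subr_ge0.
rewrite ger0_norm//; have D0 : 0 <= 10 * (t - t') `^ al by rewrite mulr_ge0 ?powR_ge0.
have al2 : 0 <= al <= 1 by rewrite ltW//; lra.
have hosc p := triprod_integral_holder (p := p) al2 tt h3 h2.
have hK3' : bsum (fun n => 1 * A n ^+ 3) K3.
  by apply: bsum_le hK3 => n; rewrite mulr0 powRr0.
have := weighted_increment_sum (om := fun=> 1) hsgn hg hu tt h3 h2 (fun=> ler01) D0 T0 hosc hK hK3'.
move=> h S uS; apply: (le_trans _ (le_trans (h S uS) _)).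
  by apply: ler_sum => n _; rewrite mul1r.
(* The resonant part is Lipschitz in time; on a bounded interval this is stronger than exponent
   al. *)
have lE : t - t' <= (t - t') `^ al * (2 * T) `^ (1 - al).
  have [->|lpos] := eqVneq (t - t') 0; first by rewrite mulr_ge0 ?powR_ge0.
  have {1}-> : t - t' = (t - t') `^ al * (t - t') `^ (1 - al).
    by rewrite -powRD ?lpos ?implybT// (addrC al) subrK powRr1.
  rewrite ler_wpM2l ?powR_ge0// ge0_ler_powR ?nnegrE ?mulr_ge0//; first lra.
  lra.
rewrite /C [leRHS]mulrDl; apply: lerD; first by rewrite mulrAC.
by rewrite [leRHS]mulrAC ler_wpM2r// mulrC.
Qed.

(** Comparison with time 0, where the profile is the coefficient of g. The weight 2 al is what
    exponent al in time costs for the phase t n^2. *)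
Lemma profile_weighted_sum : exists2 K, 0 <= K & forall t, - T <= t <= T ->
  bsum (fun n => brk n `^ (2 * al) * cabs (profile u n t - fourier g n)) K.
Proof.
have al01 : 0 < al < 2^-1 by rewrite al0.
have [K K0 hK] := trilinear_l1 al01 A0 hA.
have al0' : 0 <= al by exact: ltW.
have [|K3 hK3] := @cube al; first by rewrite al0'.
have K30 := bsum_ge0 hK3.
have K' t t' : t' <= t -> - T <= t' -> t <= T -> t - t' <= T ->
    bsum (fun n => brk n `^ (2 * al) * cabs (profile u n t - profile u n t')) (10 * K + T * K3).
  move=> tt h1 h2 h3 S uS.
  have hosc p := triprod_integral_weighted (p := p) al0' tt h1 h2.
  have o0 n : 0 <= brk n `^ (2 * al) by rewrite brkpow_ge0.
  have t10 : 0 <= 10 :> R by [].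
  have h := weighted_increment_sum hsgn hg hu tt h1 h2 o0 t10 T0 hosc hK hK3.
  by apply: (le_trans (h S uS)); rewrite lerD2l ler_wpM2r.
have p0 n : profile u n 0 = fourier g n by rewrite /profile mul0r expi0 mul1r (fourier_sol0 hu).
exists (10 * K + T * K3); first by rewrite addr_ge0 ?mulr_ge0.
move=> t /andP[h1 h2]; have T0' : - T <= 0 by rewrite oppr_le0.
have [t0|/ltW t0] := leP 0 t.
  by have := K' t 0 t0 T0' h2; rewrite subr0 => /(_ h2); apply: bsum_le => n; rewrite p0.
have := K' 0 t t0 h1 T0; rewrite sub0r lerNl => /(_ h1).
by apply: bsum_le => n; rewrite p0 cabsC.
Qed.

End Exponent.

End SmoothingSums.

(** * The nonlinear part of the solution *)

Section AbsoluteSeries.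
Context {R : realType}.
Local Notation brk := (@brk R).
Implicit Types (c : int -> R[i]) (a : int -> R).

(** The limit of the symmetric partial sums, taken componentwise; it is only applied to absolutely
    summable families. *)
Definition csum c : R[i] :=
  lim ((\sum_(n <- zr N) complex.Re (c n)) @[N --> \oo]) +i*
  lim ((\sum_(n <- zr N) complex.Im (c n)) @[N --> \oo]).

Lemma zr_sum_nondecreasing a : (forall n, 0 <= a n) ->
  {homo (fun N => \sum_(n <- zr N) a n) : N M / (N <= M)%N >-> N <= M}.
Proof. by move=> a0 N M NM; apply: ler_sum_sub => //; [exact: zr_uniq|exact: zr_sub]. Qed.

Lemma zr_sum_nneg_cvg a K : (forall n, 0 <= a n) -> bsum a K ->
  cvg ((\sum_(n <- zr N) a n) @[N --> \oo]).
Proof.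
move=> a0 hK; apply: nondecreasing_is_cvgn; first exact: zr_sum_nondecreasing.
by exists K => _ [N _ <-]; apply: hK; exact: zr_uniq.
Qed.

Lemma zr_sum_cvg (f a : int -> R) K : (forall n, `|f n| <= a n) -> bsum a K ->
  cvg ((\sum_(n <- zr N) f n) @[N --> \oo]).
Proof.
move=> fa hK; have a0 n : 0 <= a n by exact: le_trans (fa n).
have f0 n : 0 <= a n + f n by have := fa n; rewrite ler_norml; lra.
have fK : bsum (fun n => a n + f n) (K + K).
  by apply: bsumD => //; apply: bsum_le _ hK => n; exact: le_trans (ler_norm _) (fa n).
rewrite (_ : (fun N => _) = (fun N => \sum_(n <- zr N) (a n + f n)) \- (fun N => \sum_(n <- zr N) a n)).
  by apply: is_cvgB; [exact: zr_sum_nneg_cvg f0 fK|exact: zr_sum_nneg_cvg a0 hK].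
by apply/funext => N /=; rewrite big_split/= addrAC subrr add0r.
Qed.

Lemma csum_near c a K (e : R) : (forall n, cabs (c n) <= a n) -> bsum a K -> 0 < e ->
  exists N0, forall N, (N0 <= N)%N -> cabs (csum c - \sum_(n <- zr N) c n) <= e.
Proof.
move=> ca hK e0; have e2 : 0 < e / 2 by rewrite divr_gt0.
have hr : cvg ((\sum_(n <- zr N) complex.Re (c n)) @[N --> \oo]).
  by apply: zr_sum_cvg hK => n; exact: le_trans (Re_le_cabs _) (ca n).
have hi : cvg ((\sum_(n <- zr N) complex.Im (c n)) @[N --> \oo]).
  by apply: zr_sum_cvg hK => n; exact: le_trans (Im_le_cabs _) (ca n).
have [N1 _ h1] : \forall N \near \oo, `|complex.Re (csum c) - \sum_(n <- zr N) complex.Re (c n)| <= e / 2.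
  by move/cvgrPdist_le : hr; exact.
have [N2 _ h2] : \forall N \near \oo, `|complex.Im (csum c) - \sum_(n <- zr N) complex.Im (c n)| <= e / 2.
  by move/cvgrPdist_le : hi; exact.
exists (maxn N1 N2) => N; rewrite geq_max => /andP[/h1 k1 /h2 k2].
apply: (le_trans (cabs_le_ReIm _)).
rewrite cReD cImD cReN cImN cRe_sum cIm_sum [e]splitr.
by apply: lerD.
Qed.

(** N0 depends on the majorant a only and not on c, so the Fourier series below converges uniformly
    in x. *)
Lemma csum_tail a K (e : R) : (forall n, 0 <= a n) -> bsum a K -> 0 < e ->
  exists N0, forall N c, (N0 <= N)%N -> (forall n, cabs (c n) <= a n) ->
    cabs (csum c - \sum_(n <- zr N) c n) <= e.
Proof.
move=> a0 hK e0; have e2 : 0 < e / 2 by rewrite divr_gt0.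
have ha := zr_sum_nneg_cvg a0 hK; have hm := zr_sum_nondecreasing a0.
have [N0 _ h0] : \forall N \near \oo,
    `|lim ((\sum_(n <- zr N) a n) @[N --> \oo]) - \sum_(n <- zr N) a n| <= e / 2.
  by move/cvgrPdist_le : (ha); exact.
exists N0 => N c NN ca; have [N1 h1] := csum_near ca hK e2.
pose M := maxn N N1.
have k1 := h1 M (leq_maxr _ _); have NM : (N <= M)%N := leq_maxl _ _.
apply: (le_trans (cabs_triangle _ (\sum_(n <- zr M) c n) _)); rewrite [e]splitr lerD//.
have le1 := nondecreasing_cvgn_le hm ha M.
have := le_trans (ler_norm _) (h0 N NN); rewrite /= => le2.
apply: (@le_trans _ _ (\sum_(n <- zr M) a n - \sum_(n <- zr N) a n)); last by lra.
have us := zr_uniq N; have uM := zr_uniq M.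
have splitM (V : zmodType) (f : int -> V) :
    \sum_(n <- zr M) f n - \sum_(n <- zr N) f n = \sum_(n <- zr M | n \notin zr N) f n.
  rewrite [X in X - _](bigID (mem (zr N)))/= [X in X + _ - _](_ : _ = \sum_(n <- zr N) f n).
    by rewrite addrAC subrr add0r.
  rewrite -big_filter; apply: perm_big; apply: uniq_perm; rewrite ?filter_uniq// => n.
  by rewrite mem_filter andb_idr//; exact: zr_sub.
by rewrite !splitM; apply: (le_trans (cabs_sum _ _ _)); apply: ler_sum => n _; exact: ca.
Qed.

Lemma cabs_csum_le c B : bsum (fun n => cabs (c n)) B -> cabs (csum c) <= B.
Proof.
move=> hB; apply/ler_addgt0Pr => e e0.
have [N /(_ N (leqnn _)) h] := csum_near (fun n => lexx _) hB e0.
rewrite -[csum c](subrK (\sum_(n <- zr N) c n)) addrC.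
apply: (le_trans (cabsD _ _)); apply: lerD => //.
by apply: (le_trans (cabs_sum _ _ _)); apply: hB; exact: zr_uniq.
Qed.

Lemma cabs_csumB_le c c' K K' B : bsum (fun n => cabs (c n)) K -> bsum (fun n => cabs (c' n)) K' ->
  bsum (fun n => cabs (c n - c' n)) B -> cabs (csum c - csum c') <= B.
Proof.
move=> hK hK' hB; apply/ler_addgt0Pr => e e0; have e2 : 0 < e / 2 by rewrite divr_gt0.
have [N1 h1] := csum_near (fun n => lexx _) hK e2.
have [N2 h2] := csum_near (fun n => lexx _) hK' e2.
pose N := maxn N1 N2; have k1 := h1 N (leq_maxl _ _); have k2 := h2 N (leq_maxr _ _).
have k3 : cabs (\sum_(n <- zr N) c n - \sum_(n <- zr N) c' n) <= B.
  by rewrite -sumrB; apply: (le_trans (cabs_sum _ _ _)); apply: hB; exact: zr_uniq.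
apply: (le_trans (cabs_triangle _ (\sum_(n <- zr N) c n) _)).
have := cabs_triangle (\sum_(n <- zr N) c n) (\sum_(n <- zr N) c' n) (csum c').
rewrite (cabsC (\sum_(n <- zr N) c' n)); lra.
Qed.

End AbsoluteSeries.

Section Phases.
Context {R : realType}.
Local Notation brk := (@brk R).

Lemma cabs_expiB_holder (al x y : R) : 0 < al <= 1 -> cabs (expi x - expi y) <= 2 * `|x - y| `^ al.
Proof.
move=> /andP[al0 al1]; have h1 := cabs_expiB_le x y; have h2 := cabs_expiB_le2 x y.
move: `|x - y| (normr_ge0 (x - y)) h1 => r r0 h1.
have [r1|/ltW r1] := leP r 1; last first.
  have E : 1 `^ al = 1 :> R by rewrite powR1.
  by apply: (le_trans h2); rewrite ler_peMr// -E ge0_ler_powR ?nnegrE// ltW.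
have p0 := powR_ge0 r al; apply: (le_trans h1); apply: (@le_trans _ _ (r `^ al)); last by lra.
have [->|rn] := eqVneq r 0; first exact: powR_ge0.
rewrite -[leLHS]powRr1// ger_powR// r1 andbT lt_def rn//.
Qed.

(** The time phase has speed n^2 and the space phase speed |n|; raising both to the power al, the
    worse factor is [brk n]^(2 al). *)
Lemma free_wave_holder (al t t' x x' : R) (n : int) : 0 < al <= 1 ->
  cabs ((expi (t * n%:~R ^+ 2))^cj * ep n x - (expi (t' * n%:~R ^+ 2))^cj * ep n x') <=
  2 * brk n `^ (2 * al) * (`|t - t'| `^ al + `|x - x'| `^ al).
Proof.
move=> hal; have /andP[/ltW al0 _] := hal.
apply: (le_trans (cabs_triangle _ ((expi (t' * n%:~R ^+ 2))^cj * ep n x) _)).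
rewrite -mulrBl -mulrBr !cabsM cabs_ep mulr1 cabs_conj cabs_expi mul1r mulrDr.
have nb : `|n%:~R : R| <= brk n by rewrite /brk lerDr.
have b1 := brk_ge1 n : 1 <= brk n.
apply: lerD.
  rewrite -!expiN; apply: (le_trans (cabs_expiB_holder _ _ hal)); rewrite -mulrA ler_pM2l//.
  rewrite -opprD normrN -mulrBl normrM mulrC powRM// ler_wpM2r ?powR_ge0// powRrM.
  apply: ge0_ler_powR; rewrite ?nnegrE ?powR_ge0// normrX powR_mulrn ?brk_ge0//.
  by apply: lerXn2r; rewrite ?nnegrE ?brk_ge0.
apply: (le_trans (cabs_expiB_holder _ _ hal)); rewrite -mulrA ler_pM2l//.
rewrite -mulrBr normrM powRM// ler_wpM2r ?powR_ge0//.
apply: (@le_trans _ _ (brk n `^ al)); first by apply: ge0_ler_powR; rewrite ?nnegrE ?brk_ge0.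
by apply: brkpow_le; lra.
Qed.

Lemma cabs_wave_diff (E F E' F' b b' : R[i]) : cabs E = 1 -> cabs F = 1 ->
  cabs (E * b * F - E' * b' * F') <= cabs (b - b') + cabs (E * F - E' * F') * cabs b'.
Proof.
move=> hE hF; have -> : E * b * F - E' * b' * F' = E * F * (b - b') + (E * F - E' * F') * b' by ring.
by apply: (le_trans (cabsD _ _)); rewrite !cabsM hE hF !mul1r.
Qed.

(** Taking the power 1/al turns the estimates for all lifts into a lower bound for the set of
    distances, which therefore holds for its infimum. *)
Lemma torus_dist_powR (al C X tau x y : R) : 0 < al -> 0 <= C -> 0 <= X -> 0 <= tau ->
  (forall k : int, X <= C * (tau + `|x - y + (pi *+ 2) * k%:~R|) `^ al) ->
  X <= C * (tau + torus_dist x y) `^ al.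
Proof.
move=> al0; rewrite le_eqVlt => /orP[/eqP <-|C0] X0 tau0 h.
  by have := h 0; rewrite !mul0r.
have aln : al != 0 by rewrite gt_eqF.
have aV : 0 <= al^-1 by rewrite invr_ge0 ltW.
have XC : 0 <= X / C by rewrite divr_ge0// ltW.
have k1 (k : int) : (X / C) `^ al^-1 <= tau + `|x - y + (pi *+ 2) * k%:~R|.
  have q0 : 0 <= tau + `|x - y + (pi *+ 2) * k%:~R| by rewrite addr_ge0.
  have E (r : R) : 0 <= r -> r = (r `^ al) `^ al^-1 by move=> r0; rewrite -powRrM mulfV// powRr1.
  rewrite [leRHS]E//.
  by apply: ge0_ler_powR; rewrite ?nnegrE ?powR_ge0// ler_pdivrMr// mulrC; exact: h.
have k2 : (X / C) `^ al^-1 - tau <= torus_dist x y.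
  apply: lb_le_inf; first by eexists; exists 0.
  by move=> _ [k _ <-]; rewrite lerBlDl.
rewrite -ler_pdivrMl// mulrC.
have E (r : R) : 0 <= r -> r = (r `^ al^-1) `^ al by move=> r0; rewrite -powRrM mulVf// powRr1.
rewrite [leLHS]E//.
have k3 : (X / C) `^ al^-1 <= tau + torus_dist x y by rewrite -lerBlDl.
by apply: ge0_ler_powR; rewrite ?nnegrE ?powR_ge0 ?(ltW al0)// (le_trans (powR_ge0 _ _) k3).
Qed.

End Phases.

Section Smoothing.
Context {R : realType}.
Local Notation mu := (@lebesgue_measure R).
Local Notation MR := (measurableTypeR R).
Local Notation brk := (@brk R).
Let mC := @measurable_circle R.

Lemma nrm2_small_ae (f : R -> R[i]) : cL2 f -> (forall e, 0 < e -> nrm2 f <= e) ->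
  mu.-negligible [set x | circle x /\ f x != 0].
Proof.
move=> hf h; have [mf _] := hf.
have n0 : nrm2 f = 0.
  by apply/eqP; rewrite eq_le nrm2_ge0 andbT; apply/ler_addgt0Pr => e e0; rewrite add0r h.
have mf2 : measurable_fun circle (fun x : MR => (cabs (f x) ^+ 2)%:E).
  by apply/measurable_EFinP; apply: measurable_funTS; exact: measurable_cabsX.
have E : (\int[mu]_(x in circle) `|(cabs (f x) ^+ 2)%:E| = 0)%E.
  rewrite -[RHS](_ : L2norm_sq f = _); last by rewrite nrm2E// n0.
  by apply: eq_integral => x _; rewrite gee0_abs// lee_fin exprn_ge0 ?cabs_ge0.
have := (@ae_eq_integral_abs _ MR R mu circle mC _ mf2).1 E.
apply: negligibleS => x /= [cx /eqP fx]; apply/not_implyP; split => //.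
move=> [] /eqP; rewrite sqrf_eq0 => /eqP/cabs0_eq0; exact: fx.
Qed.

(** The line is covered by countably many translates of one period, and translates of a null set are
    null. *)
Lemma periodic_ae (f : R -> R[i]) : @cmeasurable R _ MR f -> periodic f (pi *+ 2) ->
  mu.-negligible [set x | circle x /\ f x != 0] -> {ae mu, forall x, f x = 0}.
Proof.
move=> mf pf; pose E : set R := [set x | circle x /\ f x != 0].
have pfn (n : nat) x : f (x + n%:R * (pi *+ 2)) = f x.
  elim: n => [|n IH]; first by rewrite mul0r addr0.
  by rewrite -natr1 mulrDl mul1r addrA pf IH.
have pfz (k : int) x : f (x + k%:~R * (pi *+ 2)) = f x.
  case: k => n; first exact: pfn.
  by rewrite NegzE rmorphN/= mulNr -[LHS](pfn n.+1) subrK.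
have mE : measurable (E : set MR).
  rewrite (_ : E = circle `&` ((fun x => cabs (f x)) @^-1` [set~ 0])).
    apply: measurableI => //; rewrite -[X in measurable X]setTI.
    by apply: measurable_cabs => //; apply: measurableC; exact: measurable_set1.
  apply/seteqP; split => x [cx fx]; split => //.
    by move=> /= /cabs0_eq0/eqP; exact/negP.
  by apply/eqP => h; apply: fx; rewrite /= h cabs0.
move=> nE; have E0 : mu E = 0%E by case: nE => B [mB B0 EB]; exact: (subset_measure0 mE mB EB B0).
have nk (k : int) : mu.-negligible [set x | E (x + k%:~R * (pi *+ 2))].
  exists [set x | E (x + k%:~R * (pi *+ 2))]; split => //.
    have := measurable_shift (k%:~R * (pi *+ 2)) measurableT mE; rewrite setTI; exact.
  by have := lebesgue_measure_shift (k%:~R * (pi *+ 2)) mE; rewrite /pushforward E0.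
have : mu.-negligible (\bigcup_n ([set x | E (x + n%:Z%:~R * (pi *+ 2))] `|`
    [set x | E (x + (- n%:Z)%:~R * (pi *+ 2))])).
  by apply: negligible_bigcup => n; apply: negligibleU; exact: nk.
apply: negligibleS => x /= /eqP fx.
pose k := - Num.floor (x / (pi *+ 2)).
have P0 := @twopi_gt0 R.
have Ek : E (x + k%:~R * (pi *+ 2)).
  split; last by rewrite pfz.
  rewrite circleE /k rmorphN/= mulNr subr_ge0 -ler_pdivlMr// floor_le/=.
  have := floorD1_gt (x / (pi *+ 2)); rewrite ltr_pdivrMr// intrD mulrDl mul1r; lra.
case: (ltP k 0) => k0.
  by exists `|k|%N => //; right; rewrite /= abszE ltr0_norm// opprK.
by exists `|k|%N => //; left; rewrite /= abszE ger0_norm.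
Qed.

Lemma free_partial_sum_tp (g : R -> R[i]) N t x :
  free_partial_sum g N t x = tp (zr N) (fun n => (expi (t * n%:~R ^+ 2))^cj * fourier g n) x.
Proof.
rewrite /tp (sum_zr N (fun n => (expi (t * n%:~R ^+ 2))^cj * fourier g n * ep n x)).
by apply: eq_bigr => k _ /=; rewrite expiD expiN /ep mulrA [X in X * _]mulrC.
Qed.

Lemma compact_time_bound (K : set (R * R)) : compact K -> exists2 T, 0 <= T & forall z, K z -> - T <= z.1 <= T.
Proof.
move=> cK; have : compact (fst @` K : set R^o).
  apply: continuous_compact => //; apply: continuous_subspaceT => z; exact: cvg_fst.
move=> /compact_bounded [M [_ hM]]; exists (`|M| + 1) => [|z Kz]; first by rewrite addr_ge0.
rewrite -ler_norml; apply: (hM (`|M| + 1)); last by exists z.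
by rewrite (le_lt_trans (ler_norm M))// ltrDl.
Qed.

Context (sgn : R) (hsgn : sgn = 1 \/ sgn = -1) (g : R -> R[i]) (hg : inHhalf_minus g)
  (u : R -> R -> R[i]) (hu : is_wick_NLS_solution sgn g u).

Definition smooth_coeff t x n : R[i] :=
  (expi (t * n%:~R ^+ 2))^cj * (profile u n t - fourier g n) * ep n x.

(** The representative of u minus its free evolution with coefficients e^(-itn^2) (a_n(t) - a_n(0));
    the series converges absolutely at every point. *)
Definition smooth_part t x : R[i] := csum (smooth_coeff t x).

Lemma cabs_smooth_coeff t x n : cabs (smooth_coeff t x n) = cabs (profile u n t - fourier g n).
Proof. by rewrite /smooth_coeff [LHS]cabsM cabs_ep mulr1 [LHS]cabsM cabs_conj cabs_expi mul1r. Qed.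

Lemma smooth_part_periodic t : periodic (smooth_part t) (pi *+ 2).
Proof.
move=> x; congr csum; apply/funext => n.
by rewrite /smooth_coeff; congr (_ * _); exact: ep_periodic.
Qed.

Lemma smooth_coeff_bsum t : exists K, bsum (fun n => cabs (profile u n t - fourier g n)) K.
Proof.
(* Any exponent strictly between 0 and 1/2 would do, the weight being at least 1. *)
have a0 : 0 < 4^-1 :> R by rewrite invr_gt0.
have a1 : 4^-1 < 2^-1 :> R by rewrite ltf_pV2 ?posrE// ltr_nat.
have [K K0 hK] := profile_weighted_sum hsgn hg hu a0 a1 (normr_ge0 t); exists K.
apply: bsum_le (hK t _) => [n|]; last by rewrite -ler_norml.
by rewrite ler_peMl ?cabs_ge0// brkpow_ge1// mulr_ge0// ltW.
Qed.

Lemma smooth_partial_sum N t x : \sum_(n <- zr N) smooth_coeff t x n =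
  tp (zr N) (fourier (u t)) x - free_partial_sum g N t x.
Proof.
rewrite free_partial_sum_tp /tp -sumrB; apply: eq_bigr => n _.
by rewrite (coeff_profile u n t) /smooth_coeff mulrBr mulrBl.
Qed.

Lemma ccont_tp s (c : int -> R[i]) : ccont (tp s c).
Proof.
apply: (@ccont_sum R _ s (fun n x => c n * ep n x)) => n.
by apply: ccontM; [exact: ccont_cst|exact: ccont_expi].
Qed.

Lemma smooth_part_tail t (e : R) : 0 < e -> exists N0, forall N x, (N0 <= N)%N ->
  cabs (smooth_part t x - (tp (zr N) (fourier (u t)) x - free_partial_sum g N t x)) <= e.
Proof.
move=> e0; have [K hK] := smooth_coeff_bsum t.
have [N0 h] := csum_tail (fun n => cabs_ge0 (profile u n t - fourier g n)) hK e0.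
exists N0 => N x NN; rewrite -smooth_partial_sum; apply: h => // n.
by rewrite cabs_smooth_coeff.
Qed.

Lemma ccont_smooth_part t : ccont (smooth_part t).
Proof.
apply: uniform_limit_ccont => T e e0; have [N h] := smooth_part_tail t e0.
exists (fun x => tp (zr N) (fourier (u t)) x - free_partial_sum g N t x); last by move=> x _; exact: h.
under eq_fun do rewrite free_partial_sum_tp -mulN1r.
apply: ccontD; first exact: ccont_tp.
by apply: ccontM; [exact: ccont_cst|exact: ccont_tp].
Qed.

(** The increment of each term splits into the change of the profile, summable with exponent al in
    time, and the change of the free wave times the coefficient at t', summable thanks to the weight
    2 al. *)
Lemma smooth_part_holder (al : R) (K : set (R * R)) : 0 < al -> al < 2^-1 -> compact K ->
  finite_holder_norm al K smooth_part.
Proof.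
move=> al0 al1 /compact_time_bound [T T0 hT].
have [K1 K10 h1] := profile_holder_sum hsgn hg hu al0 al1 T0.
have [K2 K20 h2] := profile_weighted_sum hsgn hg hu al0 al1 T0.
have al01 : 0 < al <= 1 by rewrite al0; lra.
have b2 t : - T <= t <= T -> bsum (fun n => cabs (profile u n t - fourier g n)) K2.
  move=> /h2; apply: bsum_le => n.
  by rewrite ler_peMl ?cabs_ge0// brkpow_ge1// mulr_ge0// ltW.
have c2 t x : - T <= t <= T -> bsum (fun n => cabs (smooth_coeff t x n)) K2.
  by move=> /b2; apply: bsum_le => n; rewrite cabs_smooth_coeff.
(* K1 comes from the profiles; a free wave costs 2 (tau^al + d^al) <= 4 (tau + d)^al, multiplied by
   the weighted sum K2. *)
pose C := K1 + 4 * K2; have C0 : 0 <= C by rewrite addr_ge0 ?mulr_ge0.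
exists C; split => [[t x] /hT /= tT|[t x] [t' x'] /hT /= tT /hT /= tT'].
  by apply: (le_trans (cabs_csum_le (c2 t x tT))); rewrite /C; lra.
apply: torus_dist_powR => //; first exact: cabs_ge0.
(* Periodicity replaces x' by another lift, so the bound is shown for every lift before passing to
   the distance on the torus. *)
move=> k; pose y := x' - (pi *+ 2) * k%:~R.
have -> : smooth_part t' x' = smooth_part t' y.
  congr csum; apply/funext => n; rewrite /smooth_coeff; congr (_ * _).
  rewrite /ep /y mulrBr -[LHS]mulr1 expiD; congr (_ * _).
  by rewrite mulrCA -intrM mulrC -mulNr -rmorphN expi2piM.
set tau := `|t - t'|; set d := `|x - x' + _|.
have dE : d = `|x - y| by rewrite /d /y opprB addrA addrAC.
have d0 : 0 <= d by rewrite dE normr_ge0.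
have t0 : 0 <= tau by exact: normr_ge0.
have p1 : tau `^ al <= (tau + d) `^ al by apply: ge0_ler_powR; rewrite ?nnegrE ?addr_ge0 ?lerDl ?(ltW al0).
have p2 : d `^ al <= (tau + d) `^ al by apply: ge0_ler_powR; rewrite ?nnegrE ?addr_ge0 ?lerDr ?(ltW al0).
apply: (@cabs_csumB_le _ _ _ K2 K2); [exact: c2|exact: c2|].
have hB := bsumD (h1 t t' tT tT') (bsumZ (_ : 0 <= 2 * (tau `^ al + d `^ al)) (h2 t' tT')).
have q0 : 0 <= 2 * (tau `^ al + d `^ al) by rewrite mulr_ge0 ?addr_ge0 ?powR_ge0.
move=> S uS; apply: le_trans (le_trans (hB q0 S uS) _); last first.
  rewrite -/tau /C [leRHS]mulrDl; apply: lerD; first by rewrite ler_wpM2l.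
  rewrite (_ : 4 * K2 * _ = 2 * ((tau + d) `^ al + (tau + d) `^ al) * K2); last by ring.
  by rewrite ler_wpM2r// ler_pM2l// lerD.
apply: ler_sum => n _; rewrite /smooth_coeff.
set b := profile u n t - _; set b' := profile u n t' - _.
have -> : profile u n t - profile u n t' = b - b' by rewrite /b /b' opprB addrA subrK.
have := free_wave_holder t t' x y n al01; rewrite -/tau -dE.
move=> hE; apply: (le_trans (cabs_wave_diff _ _ _ _ _ _)); rewrite ?cabs_conj ?cabs_expi ?cabs_ep//.
rewrite lerD2l; apply: (le_trans (ler_wpM2r (cabs_ge0 _) hE)).
by rewrite le_eqVlt; apply/orP; left; apply/eqP; move: (cabs b') (brk n `^ _) => *; ring.
Qed.

(** The partial sums of the series are those of u minus those of the free evolution. Both converge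
    in L^2 and the series converges uniformly, so the difference D has norm 0 on the circle, and
    periodicity extends this to the line. *)
Lemma smooth_part_ae v t : is_free_evolution g v -> {ae mu, forall x, u t x - v t x = smooth_part t x}.
Proof.
move=> /(_ t) [vL2 vcvg]; have P0 := @twopi_gt0 R.
have uc := sol_L2 hu t; have vc := inL2_cL2 vL2.
have wc : cL2 (smooth_part t).
  have [K hK] := smooth_coeff_bsum t; apply: (@cL2_bounded _ _ K).
    by apply: ccont_cmeasurable; exact: ccont_smooth_part.
  move=> x; apply: cabs_csum_le; apply: bsum_le hK => n; by rewrite cabs_smooth_coeff.
pose D x := u t x - v t x - smooth_part t x.
have Dc : cL2 D by apply: cL2B => //; exact: cL2B.
have nN (f : R -> R[i]) : nrm2 (fun x => - f x) = nrm2 f.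
  by congr fine; apply: eq_integral => x _; rewrite cabsN.
have nB (f h : R -> R[i]) : cL2 f -> cL2 h -> nrm2 (fun x => f x - h x) <= 2 * nrm2 f + 2 * nrm2 h.
  by move=> hf hh; rewrite -(nN h); apply: nrm2D => //; exact: cL2N.
have nD e : 0 < e -> nrm2 D <= e.
  (* The squared norm of X - Y - Z is at most 4 |X|^2 + 4 |Y|^2 + 2 |Z|^2; with e/12, e/12 and e/6
     this adds up to e. *)
  move=> e0; have e12 : 0 < e / 12 by rewrite divr_gt0.
  pose dl := Num.sqrt (e / 6 / (pi *+ 2)).
  have dl0 : 0 < dl by rewrite sqrtr_gt0 !divr_gt0.
  have [N1 h1] := fourier_complete uc e12.
  have [N2 h2] := smooth_part_tail t dl0.
  have [N3 _ h3] : \forall N \near \oo,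
      (L2norm_sq (fun x => (v t x - free_partial_sum g N t x)%R) < (e / 12)%:E)%E.
    by move: vcvg => /(_ [set y | (y < (e / 12)%:E)%E]); apply; apply: lt_nbhsl.
  pose N := maxn N1 (maxn N2 N3).
  have {}h1 := h1 N (leq_maxl _ _).
  have {}h2 x := h2 N x (leq_trans (leq_maxl _ _) (leq_maxr _ _)).
  have {}h3 := h3 N (leq_trans (leq_maxr _ _) (leq_maxr _ _)).
  pose X x := u t x - tp (zr N) (fourier (u t)) x.
  pose Y x := v t x - free_partial_sum g N t x.
  pose Z x := smooth_part t x - (tp (zr N) (fourier (u t)) x - free_partial_sum g N t x).
  have Fc : cL2 (free_partial_sum g N t).
    by rewrite (_ : free_partial_sum g N t = tp (zr N) (fun n => (expi (t * n%:~R ^+ 2))^cj * fourier g n));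
      [exact: cL2_tp|apply/funext => x; exact: free_partial_sum_tp].
  have Tc := cL2_tp (zr N) (fourier (u t)).
  have Xc : cL2 X by exact: cL2B.
  have Yc : cL2 Y by exact: cL2B.
  have Zc : cL2 Z by apply: cL2B => //; exact: cL2B.
  have Y3 : nrm2 Y <= e / 12 by rewrite -lee_fin -nrm2E//; exact: ltW.
  have Z3 : nrm2 Z <= e / 6.
    have dE : dl ^+ 2 * (pi *+ 2) = e / 6.
      by rewrite sqr_sqrtr ?divfK ?gt_eqF// ltW// !divr_gt0.
    rewrite -lee_fin -nrm2E// -dE -circle_integral_cst /L2norm_sq.
    apply: (@nnint_le _ MR R mu circle mC) => //.
    - by apply: measurable_cabsX; exact: Zc.1.
    - by move=> x _; rewrite exprn_ge0 ?cabs_ge0.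
    - by move=> x _; apply: lerXn2r; rewrite ?nnegrE ?cabs_ge0 ?sqrtr_ge0//; exact: h2.
  have -> : D = fun x => X x - Y x - Z x.
    by apply/funext => x; rewrite /D /X /Y /Z; ring.
  have k1 := nB _ _ (cL2B Xc Yc) Zc; have k2 := nB _ _ Xc Yc.
  apply: (le_trans k1); have : nrm2 X <= e / 12 := h1; lra.
have Dp : periodic D (pi *+ 2).
  move=> x; rewrite /D (sol_periodic hu) smooth_part_periodic.
  by case: vL2 => -> _ _.
have := periodic_ae Dc.1 Dp (nrm2_small_ae Dc nD).
apply: negligibleS => x /= h1 h2; apply: h1; move: h2 => /eqP.
by rewrite /D subr_eq0 => /eqP.
Qed.

End Smoothing.

Unset Implicit Arguments.

Theorem mainTheorem13 (R : realType) (sgn : R) (hsgn : sgn = 1 \/ sgn = -1)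
    (g : R -> R[i]) (hg : inHhalf_minus g)
    (u : R -> R -> R[i]) (hu : is_wick_NLS_solution sgn g u)
    (v : R -> R -> R[i]) (hv : is_free_evolution g v) :
  exists w : R -> R -> R[i],
    [/\ forall t : R, periodic (w t) (pi *+ 2),
        forall t : R, {ae (@lebesgue_measure R), forall x, u t x - v t x = w t x} &
        forall alpha : R, 0 < alpha -> alpha < 2^-1 ->
        forall K : set (R * R), compact K -> finite_holder_norm alpha K w].
Proof.
exists (smooth_part g u); split.
- exact: smooth_part_periodic.
- by move=> t; exact: (smooth_part_ae hsgn hg hu).
- by move=> alpha a0 a1 K cK; exact: (smooth_part_holder hsgn hg hu).
Qed.
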